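(* Let $d\ge 2$, $p\in(d,\infty]$, $\frac1p+\frac1{p'}=1$, $C\in\mathcal C$, and let $w\colon(0,\infty)\to[0,\infty)$. Suppose that either $K\in\mathbb K$ is a polytope and $w\in\mathcal W_{p'}(0,1)\cap\mathcal L_1(1,\infty)$, or $K\in\mathbb K$ is arbitrary and $w\in\mathcal W^*_{p'}(0,1)\cap\mathcal L_1(1,\infty)$. Let $N\in(0,\infty)$ if $D_{K,w}$ is unbounded, and $N\in(0,\|D_{K,w}\|)$ otherwise, and let $h_N>0$ be such that $$2d\cdot\mathrm{meas}(K\cap C)\int_{h_N}^\infty w(\rho)\rho^{d-1}\,d\rho=N.$$ Then $$E_N(D_{K,w},W^K_{\infty,p}(C))=\bigl(d\cdot\mathrm{meas}(K\cap C)\bigr)^{1/p'}\,\|g_{w,h_N}\|_{\mathcal L_{p'}(0,h_N)}.$$ Moreover, the extremal operator (a bounded linear operator on $L_\infty(C)$ of norm at most $N$ attaining the infimum that defines $E_N$) is $$(D_{K,w,h_N}f)(x)=\int_{C\setminus h_NK}w(|t|_K)\,(f(x)-f(x+t))\,dt,\quad x\in C.$$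
   Context: Sets. $\theta$ is the origin of $\mathbb R^d$, $(x,y)$ the dot product, meas the Lebesgue measure. $\mathbb K$ is the family of all open bounded convex sets $K\subset\mathbb R^d$ symmetric with respect to $\theta$ with $\theta\in\mathrm{int}\,K$. Such a $K$ is called a polytope if it is (up to its boundary) the convex hull of a finite set of points. $|x|_K=\inf\{\lambda>0: x\in\lambda K\}$ is the norm generated by $K$, $K^\circ=\{y:\sup_{x\in K}(x,y)\le1\}$ is the polar set, and $|z|_{K^\circ}=\sup\{(x,z):|x|_K\le1\}$ is the dual norm. $\mathcal C$ is the family of all non-empty sets of the form $\mathrm{int}\{\sum_{k=1}^n c_kx_k: c_k\ge0\}$ with $n\in\mathbb N$, $x_1,\dots,x_n\in\mathbb R^d$ (open convex finitely generated cones, including $\mathbb R^d$). Weights. For $0\le a<b\le\infty$ and $q\in[1,\infty)$, $\mathcal L_q(a,b)$ is the space of measurable $w\colon(a,b)\to[0,\infty)$ with $\|w\|_{\mathcal L_q(a,b)}=\left(\int_a^bt^{d-1}w^q(t)\,dt\right)^{1/q}<\infty$. For $h>0$, $$g_{w,h}(u)=\frac1{u^{d-1}}\int_u^hw(t)t^{d-1}\,dt,\quad 0<u\le h.$$ $\mathcal W_q(0,h)$ is the set of non-negative $w$ on $(0,h]$ such that $w\in\mathcal L_1(u,h)$ for all $u\in(0,h)$ and $g_{w,h}\in\mathcal L_q(0,h)$. $\mathcal W_q^*(0,h)$ is the set of non-negative $w$ on $(0,h]$ such that $w\in\mathcal L_q(u,h)$ for all $u\in(0,h)$; for all $\nu<1$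 close enough to $1$ the function $w_\nu(u)=\sup_{t\in[\nu u,u]}|w(t)-w(u)|$ belongs to $\mathcal W_q(0,h)$; and $\lim_{\nu\to1-0}\|g_{w_\nu,h}\|_{\mathcal L_q(0,h)}=0$. Membership of a function on $(0,\infty)$ in these classes refers to its restriction. Function classes and operators. $L^1_{\infty,p}(C)$ is the space of $f\in L_\infty(C)$ whose distributional first-order partial derivatives belong to $L_p(C)$ (for $p>d$ such $f$ are identified with their continuous representatives). $W^K_{\infty,p}(C)=\{f\in L^1_{\infty,p}(C):\||\nabla f|_{K^\circ}\|_{L_p(C)}\le1\}$. The operator $D_{K,w}\colon L^1_{\infty,p}(C)\to L_\infty(C)$ is $$(D_{K,w}f)(x)=\int_Cw(|t|_K)(f(x)-f(x+t))\,dt,\quad x\in C.$$ It is regarded as an operator from $L_\infty(C)$ to $L_\infty(C)$ with domain $L^1_{\infty,p}(C)$, and boundedness and $\|D_{K,w}\|$ are with respect to the $L_\infty(C)$ norms. It is unbounded if $\int_0^\infty w(\rho)\rho^{d-1}d\rho=\infty$, and otherwise it is bounded with norm $2d\cdot\mathrm{meas}(K\cap C)\int_0^\infty w(\rho)\rho^{d-1}d\rho$. Stechkin's quantity. For $N>0$, $$E_N(D_{K,w},W^K_{\infty,p}(C))=\inf_S\ \sup_{f\in W^K_{\infty,p}(C)}\|D_{K,w}f-Sf\|_{L_\infty(C)},$$ the infimum being over all bounded linear operators $S\colon L_\infty(C)\to L_\infty(C)$ with $\|S\|\le N$. *)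

(* Defs.v *)
From HB Require Import structures.
From mathcomp Require Import all_boot all_order all_algebra.
From mathcomp Require Import all_classical all_reals all_analysis.

Set Implicit Arguments.
Unset Strict Implicit.
Unset Printing Implicit Defensive.

Import Order.TTheory GRing.Theory Num.Theory.
Import numFieldNormedType.Exports.

Local Open Scope classical_set_scope.
Local Open Scope ring_scope.

Section CoverOuterMeasure.
Local Open Scope ereal_scope.
Context {R : realType} {T : Type} {I : Type}.
Variables (c : I -> set T) (v : I -> \bar R).

Definition cover_outer (A : set T) : \bar R :=
  ereal_inf [set \sum_(k <oo) v (s k) | s in
    [set s : nat -> I | A `<=` \bigcup_k c (s k)]].

Hypothesis v0 : forall i, 0 <= v i.

Lemma cover_outer_ge0 A : 0 <= cover_outer A.
Proof. by apply: le_ereal_inf_tmp => _ [s _ <-]; apply: nneseries_ge0. Qed.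

Lemma cover_outer_le : {homo cover_outer : A B / A `<=` B >-> A <= B}.
Proof.
move=> A B AB; apply: ereal_inf_le_tmp => _ [s Bs <-]; exists s => //.
exact: subset_trans Bs.
Qed.

Lemma cover_outer_set0 (i0 : I) : v i0 = 0 -> cover_outer set0 = 0.
Proof.
move=> vi0; apply/eqP; rewrite eq_le cover_outer_ge0 andbT.
apply: ereal_inf_lbound; exists (fun=> i0) => //=.
by rewrite eseries0// => k _ _; rewrite vi0.
Qed.

Lemma cover_outer_sigma_subadditive : sigma_subadditive cover_outer.
Proof.
move=> A; have [[i ioo]|] := pselect (exists i, cover_outer (A i) = +oo).
  rewrite (eseries_pinfty _ _ ioo) ?leey// => n _.
  by rewrite -ltNye (lt_le_trans _ (cover_outer_ge0 _)).
rewrite -forallNE => Aoo.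
suff add2e (e : {posnum R}) : cover_outer (\bigcup_n A n) <=
    \sum_(i <oo) cover_outer (A i) + e%:num%:E.
  by apply/lee_addgt0Pr => _/posnumP[].
rewrite (le_trans _ (epsilon_trick _ _ _))//; last first.
  by move=> n; exact: cover_outer_ge0.
pose P n (s : nat -> I) := A n `<=` \bigcup_k c (s k) /\
  \sum_(k <oo) v (s k) <= cover_outer (A n) + (e%:num / (2 ^ n.+1)%:R)%:E.
have [G PG] : {G : nat -> nat -> I & forall n, P n (G n)}.
  apply: (@choice _ _ P) => n; rewrite /P /cover_outer.
  set S := (X in ereal_inf X); move infS : (ereal_inf S) => iS.
  case: iS infS => [r Sr|Soo|Soo].
  - have en1 : (0 < e%:num / (2 ^ n.+1)%:R)%R by [].
    have /(lb_ereal_inf_adherent en1) : ereal_inf S \is a fin_num by rewrite Sr.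
    move=> [x [s As vx] xS].
    by exists s; split => //; rewrite vx -Sr; exact/ltW.
  - by have := Aoo n; rewrite /cover_outer Soo.
  - suff : 0 <= ereal_inf S by rewrite Soo.
    exact: cover_outer_ge0.
have /card_esym/ppcard_eqP[f] := card_nat2.
apply: (@le_trans _ _ (\esum_(i in setT) (v \o uncurry G) i)).
  apply: ereal_inf_lbound => /=.
  exists (uncurry G \o f).
    move=> t [i _ At]; have [j _ ?] := (PG i).1 t At.
    by exists (f^-1%FUN (i, j)) => //=; rewrite invK ?inE.
  rewrite -(esum_pred_image (v \o uncurry G) _ xpredT) ?[fun=> _]set_true//;
    last by move=> ? _; exact: v0.
  by rewrite image_eq.
rewrite (_ : esum _ _ = \sum_(i <oo) \sum_(j <oo ) v (G i j)); last first.
  pose J : nat -> set (nat * nat) := fun i => [set (i, j) | j in setT].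
  rewrite (_ : setT = \bigcup_k J k); last first.
    by rewrite predeqE => -[a b]; split => // _; exists a => //; exists b.
  rewrite esum_bigcupT /=; last 2 first.
    - apply/trivIsetP => i j _ _ ij.
      rewrite predeqE => -[n m] /=; split => //= -[] [_] _ [<-{n} _].
      by move=> [m' _] [] /esym/eqP; rewrite (negbTE ij).
    - by move=> ?; exact: v0.
  rewrite -(image_id [set: nat]) -fun_true esum_pred_image//; last first.
    by move=> n _; exact: esum_ge0.
  apply: eq_eseriesr => /= j _.
  rewrite -(esum_pred_image (v \o uncurry G) (pair j) predT)//=; last first.
    by move=> ? ? _ _; exact: (@can_inj _ _ _ snd).
  by congr esum; rewrite predeqE => -[a b]; split; move=> [i _ <-]; exists i.
apply: lee_nneseries; last by move=> n _; exact: (PG n).2.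
by move=> n _ _; apply: nneseries_ge0 => *; exact: v0.
Qed.

End CoverOuterMeasure.
Arguments cover_outer_ge0 {R T I c v}.
Arguments cover_outer_set0 {R T I c v} v0 {i0}.
Arguments cover_outer_sigma_subadditive {R T I c v}.


Section LebesgueMeasure.
Context {R : realType} (d : nat).

(* A half-open box is coded by its two corners; [None] codes the empty box,
   which is of this shape only when 0 < d. *)
Definition box (ab : option ('rV[R]_d * 'rV[R]_d)) : set 'rV[R]_d :=
  if ab is Some (a, b) then [set x | forall i, a 0 i < x 0 i <= b 0 i]
  else set0.

Definition box_volume (ab : option ('rV[R]_d * 'rV[R]_d)) : \bar R :=
  if ab is Some (a, b) then (\prod_i Num.max 0 (b 0 i - a 0 i))%:E else 0%E.

Lemma box_volume_ge0 ab : (0 <= box_volume ab)%E.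
Proof.
case: ab => [[a b]|//]; rewrite lee_fin; apply: prodr_ge0 => i _.
by rewrite le_max lexx.
Qed.

Definition lebesgue_outer : set 'rV[R]_d -> \bar R :=
  cover_outer box box_volume.

HB.instance Definition _ := isOuterMeasure.Build R 'rV[R]_d lebesgue_outer
  (cover_outer_set0 box_volume_ge0 (i0 := None) erefl)
  (cover_outer_ge0 box_volume_ge0)
  (@cover_outer_le _ _ _ box box_volume)
  (cover_outer_sigma_subadditive box_volume_ge0).

(* 'rV[R]_d with the sigma-algebra of Lebesgue measurable sets. *)
Definition Leb : Type := caratheodory_type lebesgue_outer.
HB.instance Definition _ :=
  Measurable.copy Leb (caratheodory_type lebesgue_outer).

Definition leb (A : set Leb) : \bar R := lebesgue_outer A.

Let leb0 : leb set0 = 0%E.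
Proof. exact: outer_measure0. Qed.

Let leb_ge0 A : (0 <= leb A)%E.
Proof. exact: outer_measure_ge0. Qed.

Let leb_sigma_additive : semi_sigma_additive leb.
Proof. exact: caratheodory_measure_sigma_additive. Qed.

HB.instance Definition _ :=
  isMeasure.Build _ Leb R leb leb0 leb_ge0 leb_sigma_additive.

End LebesgueMeasure.
Arguments Leb : clear implicits.

Section Weights.
Context {R : realType} (d : nat).
Implicit Types (q h : R) (w : R -> R) (I : set R).

(* R with the sigma-algebra of Lebesgue measurable sets, on which
   completed_lebesgue_measure is defined. *)
Definition Leb1 : Type := caratheodory_type ((wlength (@idfun R))^*)%mu.
HB.instance Definition _ :=
  Measurable.copy Leb1 (caratheodory_type ((wlength (@idfun R))^*)%mu).

Local Notation mu1 := (@completed_lebesgue_measure R).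

Definition weight_norm q I w : \bar R :=
  ((\int[mu1]_(t in I) (t ^+ d.-1 * w t `^ q)%:E) `^ q^-1)%E.

Definition weight_space q I w : Prop :=
  [/\ {in I, forall t, 0 <= w t},
      measurable_fun (I : set Leb1) (w : Leb1 -> R) &
      (weight_norm q I w < +oo)%E].

Definition g_wh w h (u : R) : R :=
  (u ^+ d.-1)^-1 * \int[mu1]_(t in `]u, h[) (w t * t ^+ d.-1).

Definition Wq q h w : Prop :=
  [/\ {in `]0, h], forall t, 0 <= w t},
      {in `]0, h[, forall u, weight_space 1 `]u, h[ w} &
      weight_space q `]0, h[ (g_wh w h)].

Definition osc w (nu u : R) : \bar R :=
  ereal_sup [set `|w t - w u|%:E | t in `[nu * u, u]].

(* The members of [Wq q h] are real-valued, so that the membership of the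
   oscillation function in it includes the finiteness of the suprema. *)
Definition Wq_star q h w : Prop :=
  [/\ {in `]0, h], forall t, 0 <= w t},
      {in `]0, h[, forall u, weight_space q `]u, h[ w},
      (\forall nu \near 1^'-,
        {in `]0, h], forall u, osc w nu u \is a fin_num} /\
        Wq q h (fine \o osc w nu)) &
      weight_norm q `]0, h[ (g_wh (fine \o osc w nu) h)
        @[nu --> 1^'-] --> 0%E].

End Weights.

Section Geometry.
Context {R : realType} {d : nat}.
Implicit Types (K C : set 'rV[R]_d) (x y z : 'rV[R]_d).

Definition dotp x y : R := \sum_i x 0 i * y 0 i.

Definition convex_body K : Prop :=
  [/\ open K, bounded_set K, convex_set (K : set (convex_lmodType 'rV[R]_d)),
      (forall x, K x -> K (- x)) & interior K 0].

Definition conv_hull n (v : 'I_n -> 'rV[R]_d) : set 'rV[R]_d :=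
  [set x | exists c : 'I_n -> R,
    [/\ forall i, 0 <= c i, \sum_i c i = 1 & x = \sum_i c i *: v i]].

(* For an open convex K, being a convex hull up to the boundary means that the
   closure of K is that (compact) hull. *)
Definition polytope K : Prop :=
  exists n (v : 'I_n -> 'rV[R]_d), closure K = conv_hull v.

Definition cone_hull n (v : 'I_n -> 'rV[R]_d) : set 'rV[R]_d :=
  [set x | exists2 c : 'I_n -> R,
    forall i, 0 <= c i & x = \sum_i c i *: v i].

Definition open_fg_cone C : Prop :=
  C !=set0 /\ exists n (v : 'I_n -> 'rV[R]_d), C = interior (cone_hull v).

Definition dilate (h : R) K : set 'rV[R]_d := [set h *: y | y in K].

Definition gauge_norm K x : R := inf [set l : R | 0 < l /\ dilate l K x].

Definition dual_norm K z : R :=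
  sup [set dotp x z | x in [set x | gauge_norm K x <= 1]].

End Geometry.

Section FunctionClasses.
Context {R : realType} {d : nat}.
Implicit Types (K C : set 'rV[R]_d) (p : \bar R) (f phi : 'rV[R]_d -> R).

Local Notation mu := (@leb R d).

(* Functions are total; only their values on C matter. *)
Definition Lp_norm p C f : \bar R := 'N[mu]_p[(EFin \o f) \_ C]%E.

Definition Lp p C f : Prop :=
  measurable_fun (C : set (Leb R d)) (f : Leb R d -> R) /\
  (Lp_norm p C f < +oo)%E.

Definition Linfty := Lp +oo%E.

Definition partial (i : 'I_d) phi : 'rV[R]_d -> R :=
  fun x => 'D_(delta_mx 0 i) phi x.

Fixpoint Ck (k : nat) phi : Prop :=
  continuous phi /\
  (if k is l.+1 then
     forall i, (forall x, derivable phi x (delta_mx 0 i)) /\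
               Ck l (partial i phi)
   else True).

Definition test_function C phi : Prop :=
  [/\ forall k, Ck k phi,
      compact (closure [set x | phi x != 0]) &
      closure [set x | phi x != 0] `<=` C].

Definition weak_gradient C f (G : 'rV[R]_d -> 'rV[R]_d) : Prop :=
  forall (i : 'I_d) phi, test_function C phi ->
    \int[mu]_(x in C) (f x * partial i phi x) =
    - \int[mu]_(x in C) (G x 0 i * phi x).

(* The space is only used for p > d, where its elements are identified with
   their continuous representatives. *)
Definition Linfp p C f : Prop :=
  [/\ Linfty C f, {in C, continuous f} &
      exists2 G, weak_gradient C f G & forall i, Lp p C (fun x => G x 0 i)].

Definition WK K p C f : Prop :=
  Linfp p C f /\
  exists G, [/\ weak_gradient C f G,
    forall i, Lp p C (fun x => G x 0 i) &
    (Lp_norm p C (fun x => dual_norm K (G x)) <= 1)%E].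

End FunctionClasses.

Section Operators.
Context {R : realType} {d : nat}.
Implicit Types (K C : set 'rV[R]_d) (p : \bar R) (w : R -> R).

Local Notation mu := (@leb R d).
Local Notation fct := ('rV[R]_d -> R).
Implicit Types (f g : fct) (T S : fct -> fct).

Definition D_Kw K C w f : fct := fun x =>
  \int[mu]_(t in C) (w (gauge_norm K t) * (f x - f (x + t))).

Definition D_Kwh K C w (h : R) f : fct := fun x =>
  \int[mu]_(t in C `\` dilate h K) (w (gauge_norm K t) * (f x - f (x + t))).

(* The norm is +oo exactly when the operator is unbounded. *)
Definition op_norm C (dom : set fct) T : \bar R :=
  ereal_inf [set M%:E | M in [set M : R | 0 <= M /\
    forall f, dom f ->
      (Lp_norm +oo C (T f) <= M%:E * Lp_norm +oo C f)%E]].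

(* An operator on classes modulo equality a.e. on C is given by its action on
   representatives; linearity up to null sets together with boundedness makes
   that action compatible with equality a.e. *)
Definition bounded_linear C S : Prop :=
  [/\ forall f, Linfty C f -> Linfty C (S f),
      forall (a : R) f g, Linfty C f -> Linfty C g ->
        {ae mu, forall x, C x ->
          S (fun y => a * f y + g y) x = a * S f x + S g x} &
      (op_norm C (Linfty C) S < +oo)%E].

Definition approximants C (N : R) : set (fct -> fct) :=
  [set S | bounded_linear C S /\ (op_norm C (Linfty C) S <= N%:E)%E].

Definition deviation C T S (W : set fct) : \bar R :=
  ereal_sup [set Lp_norm +oo C (fun x => T f x - S f x) | f in W].

Definition E_N C (N : R) T (W : set fct) : \bar R :=
  ereal_inf [set deviation C T S W | S in approximants C N].

End Operators.

(* Main.v *)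
Require Import Defs.
From HB Require Import structures.
From mathcomp Require Import all_boot all_order all_algebra.
From mathcomp Require Import all_classical all_reals all_analysis.
From mathcomp Require Import measurable_realfun ess_sup_inf ring lra.

Import Order.TTheory GRing.Theory Num.Theory.
Import numFieldNormedType.Exports.

Local Open Scope classical_set_scope.
Local Open Scope ring_scope.

Set Implicit Arguments.
Unset Strict Implicit.
Unset Printing Implicit Defensive.

(** Write N(t) for the gauge of K, m for the measure of K cut by C, and T for
    the operator with weight w, T_h for its truncation to N(t) >= h. The value
    E of Stechkin's quantity is squeezed between the deviation of T_h and a
    lower bound for the deviation of every approximant.

    Upper bound. For f in the class, T f - T_h f at x is the integral of
    w(N(t)) (f(x) - f(x + t)) over the part N(t) < h of the cone. For smooth f
    the increment is the integral of the gradient of f along the segment from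
    x to x + t, so it is at most N(t) times the mean over that segment of the
    dual norm of the gradient. In polar coordinates Tonelli's theorem moves
    the mean from the gradient to the weight and produces the kernel g(N(t)),
    with g the averaged weight of the statement ([radial_kernel]); Hoelder's
    inequality bounds the result by the L_q norm of g(N(t)) over the cone,
    that is (d m)^(1/q) times the weighted norm of g ([ker_norm_mean]). A
    general f is mollified by smooth bumps, on which its weak gradient is
    tested ([mol_increment_le], [class_increment_le]). The norm of T_h is at
    most twice the mass of the truncated weight, which is N by the choice of
    h ([truncation_approximant]).

    Lower bound. Take f = c (P(h)/2 - P(N(x))), where P is the primitive of a
    nonnegative bounded profile k supported in ]0, h[. Its sup norm is
    c P(h)/2 and the dual norm of its gradient is c k(N(x)), so k can be
    normalized to put f in the class ([radial_fun_WK]). Near the vertex of the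
    cone T f is close to its value there, which polar coordinates evaluate as
    c d m times the integral of k against u^(d-1) g(u), plus N c P(h)/2, the
    contribution of the radii beyond h ([radial_value0]). An operator S of
    norm at most N satisfies |S f| <= N c P(h)/2 almost everywhere, which
    cancels exactly the second term ([deviation_gain]). With k a truncation of
    g^(q-1), the case of equality in Hoelder's inequality, what remains tends
    to (d m)^(1/q) times the norm of g ([deviation_lower_bound]).

    Only three properties of the weight are used: measurability, finite tails
    and a finite first moment at the origin, which makes the integral of T on
    Lipschitz functions converge. For the weights with small oscillation the
    first moment comes from a contraction inequality under the scaling
    u -> nu u ([weight_data]).

    Measurability in products requires Borel functions, whereas the statement
    is about Lebesgue measurable ones; every function is therefore replaced by
    a Borel version off a null set. The weak differentiability of f rests on
    that of the norm, which is obtained from the monotonicity of its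
    difference quotients and translation invariance
    ([weak_derivative_quotient], [dirder_symm_ae]). *)

(** * Lebesgue measure on row vectors *)

Section BoxCut.
Context {R : realType} (d : nat).
Local Notation V := 'rV[R]_d.

Definition cut_lo (i : 'I_d) (c : R) (ab : option (V * V)) : option (V * V) :=
  if ab is Some (a, b)
  then Some (a, \row_j if j == i then Num.min (b 0 j) c else b 0 j) else None.

Definition cut_hi (i : 'I_d) (c : R) (ab : option (V * V)) : option (V * V) :=
  if ab is Some (a, b)
  then Some (\row_j if j == i then Num.max (a 0 j) c else a 0 j, b) else None.

Lemma box_cut_lo i c ab : box (cut_lo i c ab) = box ab `&` [set x | x 0 i <= c].
Proof.
case: ab => [[a b]|] /=; last by rewrite set0I.
apply/seteqP; split => [x /= h|x /= [h hc] j].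
  split=> [j|]; have /andP[] := h i; rewrite !mxE ?eqxx le_min.
    move: (h j); rewrite !mxE; case: eqP => [->|//].
    by rewrite le_min => /and3P[-> -> _].
  by move=> _ /andP[].
by rewrite !mxE; case: eqP => [->|_]; rewrite ?le_min ?hc ?andbT; exact: h.
Qed.

Lemma box_cut_hi i c ab : box (cut_hi i c ab) = box ab `&` ~` [set x | x 0 i <= c].
Proof.
case: ab => [[a b]|] /=; last by rewrite set0I.
apply/seteqP; split => [x /= h|x /= [h /negP]]; last first.
  rewrite -ltNge => hc j.
  by rewrite !mxE; case: eqP => [->|_]; rewrite ?gt_max ?hc ?andbT; exact: h.
split=> [j|]; have /andP[] := h i; rewrite !mxE ?eqxx gt_max => /andP[_ hc] _.
  move: (h j); rewrite !mxE; case: eqP => [->|//].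
  by rewrite gt_max => /andP[/andP[-> _] ->].
by apply/negP; rewrite -ltNge.
Qed.

Lemma box_volume_cut i c ab :
  (box_volume (cut_lo i c ab) + box_volume (cut_hi i c ab) = box_volume ab)%E.
Proof.
case: ab => [[a b]|] /=; last by rewrite adde0.
rewrite -EFinD; congr (_%:E).
rewrite [X in X + _](bigD1 i)//= [X in _ + X](bigD1 i)//= [RHS](bigD1 i)//=.
rewrite (eq_bigr (fun j => Num.max 0 (b 0 j - a 0 j))); last first.
  by move=> j ji; rewrite !mxE (negbTE ji).
rewrite [X in _ + _ * X](eq_bigr (fun j => Num.max 0 (b 0 j - a 0 j))); last first.
  by move=> j ji; rewrite !mxE (negbTE ji).
rewrite -mulrDl !mxE eqxx; congr (_ * _).
rewrite /Num.max /Num.min; do ! case: ifPn; lra.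
Qed.

(** Caratheodory measurability of half-spaces: each box of a cover splits
    along the hyperplane into two boxes with the same total volume. Boxes,
    hence open sets, are then measurable. *)
Lemma measurable_halfspace i (c : R) :
  measurable ([set x | x 0 i <= c] : set (Leb R d)).
Proof.
apply: (@le_caratheodory_measurable R V (@lebesgue_outer R d)) => X.
apply: le_ereal_inf_tmp => _ [s Xs <-].
rewrite -(eq_eseriesr (fun k _ => box_volume_cut i c (s k))).
rewrite nneseriesD; [|by move=> *; exact: box_volume_ge0..].
apply: leeD; apply: ereal_inf_lbound.
  exists (cut_lo i c \o s) => // x [Xx xc]; have [k _ skx] := Xs _ Xx.
  by exists k => //=; rewrite box_cut_lo.
exists (cut_hi i c \o s) => // x [Xx xc]; have [k _ skx] := Xs _ Xx.
by exists k => //=; rewrite box_cut_hi.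
Qed.

Lemma measurable_box ab : measurable (box ab : set (Leb R d)).
Proof.
case: ab => [[a b]|]; last exact: measurable0.
rewrite (_ : box _ = \bigcap_(i in [set: 'I_d])
  ((~` [set x | x 0 i <= a 0 i]) `&` [set x | x 0 i <= b 0 i])).
  rewrite -[X in measurable X]setCK setC_bigcap; apply: measurableC.
  apply: fin_bigcup_measurable; first exact: finite_finset.
  move=> i _; apply: measurableC; apply: measurableI; last exact: measurable_halfspace.
  by apply: measurableC; exact: measurable_halfspace.
apply/seteqP; split => x /= h i.
  by move=> _; have /andP[ha hb] := h i; split => //; apply/negP; rewrite -ltNge.
by have [/negP + ->] := h i I; rewrite -ltNge andbT.
Qed.
End BoxCut.

Lemma eq_indic {R : nzRingType} {T T' : Type} (A : set T) (B : set T') x y :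
  (A x <-> B y) -> \1_A x = \1_B y :> R.
Proof.
move=> h; rewrite !indicE; suff -> : (x \in A) = (y \in B) by [].
by apply/idP/idP; rewrite !inE => /h.
Qed.

Lemma ge0_integral_image d1 d2 (X : measurableType d1) (Y : measurableType d2)
    (R : realType) (phi : X -> Y) (mphi : measurable_fun setT phi)
    (mu : {measure set X -> \bar R}) (nu : {measure set Y -> \bar R}) (k : R)
    (D : set Y) (f : Y -> \bar R) : 0 <= k -> measurable D ->
    (forall A, measurable A -> A `<=` D -> nu A = k%:E * mu (phi @^-1` A))%E ->
    measurable_fun D f -> (forall y, D y -> 0 <= f y)%E ->
  (\int[nu]_(y in D) f y = k%:E * \int[mu]_(x in phi @^-1` D) f (phi x))%E.
Proof.
move=> k0 mD nuE mf f0.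
have f0' : {in D, forall y : Y, (0 <= f y)%E} by move=> y /[!inE]; exact: f0.
have <- := ge0_integral_pushforward mphi mu mD mf f0'.
rewrite -[X in (X * _)%E]/((NngNum k0)%:num%:E) -ge0_integral_mscale//.
by apply: eq_measure_integral => A mA AD; exact: nuE.
Qed.

Section BorelType.
Context {R : realType} (d : nat).
Local Notation V := 'rV[R]_d.

(** The product measures below need a sigma-algebra generated by boxes;
    functions measurable for the larger sigma-algebra [Leb] are replaced by
    versions measurable for this one. *)
Definition Bor : Type := g_sigma_algebraType (range (@box R d)).
HB.instance Definition _ := Measurable.copy Bor
  (g_sigma_algebraType (range (@box R d))).

Lemma Bor_Leb (A : set V) :
  measurable (A : set Bor) -> measurable (A : set (Leb R d)).
Proof.
move: A; apply: smallest_sub; first exact: sigma_algebra_measurable.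
by move=> _ [ab _ <-]; exact: measurable_box.
Qed.

Lemma measurable_idLB : measurable_fun [set: Leb R d] (id : Leb R d -> Bor).
Proof. by move=> _ A mA; rewrite setTI; exact: Bor_Leb. Qed.

Definition vol : set Bor -> \bar R := pushforward (@leb R d) (id : Leb R d -> Bor).

Let vol0 : vol set0 = 0%E. Proof. exact: (@measure0 _ _ _ (@leb R d)). Qed.

Let vol_ge0 A : (0 <= vol A)%E. Proof. exact: (@measure_ge0 _ _ _ (@leb R d)). Qed.

Let vol_sigma_additive : semi_sigma_additive vol.
Proof.
move=> F mF tF mUF; apply: (@measure_semi_sigma_additive _ _ _ (@leb R d)) => //.
  by move=> n; exact: Bor_Leb (mF n).
exact: Bor_Leb mUF.
Qed.

HB.instance Definition _ :=
  isMeasure.Build _ Bor R vol vol0 vol_ge0 vol_sigma_additive.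

Lemma volE A : vol A = leb A. Proof. by []. Qed.

Lemma ge0_integral_vol (D : set V) (f : V -> \bar R) :
    measurable (D : set Bor) -> measurable_fun (D : set Bor) (f : Bor -> \bar R) ->
    (forall x, D x -> (0 <= f x)%E) ->
  (\int[vol]_(x in D) f x = \int[@leb R d]_(x in D) f x)%E.
Proof.
move=> mD mf f0.
rewrite (ge0_integral_image measurable_idLB (mu := @leb R d) ler01 mD)// ?mul1e//.
by move=> A mA AD; rewrite mul1e.
Qed.

Lemma measurable_Bor_box ab : measurable (box ab : set Bor).
Proof. by apply: sub_sigma_algebra; exists ab. Qed.

Lemma norm_coord (x : V) i : `|x 0 i| <= `|x|.
Proof.
rewrite [leRHS]mx_normrE.
by rewrite (le_trans _ (le_bigmax _ (fun ij => `|x ij.1 ij.2|) (0, i))).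
Qed.

Lemma norm_le_coord (x : V) (e : R) : 0 <= e -> (forall i, `|x 0 i| <= e) -> `|x| <= e.
Proof.
by move=> e0 h; rewrite [leLHS]mx_normrE; apply: bigmax_le => // -[i j] _ /=; rewrite (ord1 i).
Qed.

Lemma norm_lt_coord (x : V) (e : R) : 0 < e -> (forall i, `|x 0 i| < e) -> `|x| < e.
Proof.
by move=> e0 h; rewrite [ltLHS]mx_normrE; apply: bigmax_lt => // -[i j] _ /=; rewrite (ord1 i).
Qed.

Lemma open_normP (U : set V) x : open U -> U x ->
  exists2 e, 0 < e & forall y, `|y - x| < e -> U y.
Proof.
move=> oU Ux; have /nbhs_ballP[e /= e0 h] : nbhs x U by exact: open_nbhs_nbhs.
by exists e => // y yx; apply: h; rewrite -ball_normE /ball_/= distrC.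
Qed.

(** An open set is the union of the countably many boxes with rational corners
    that it contains. *)
Lemma open_Bor (U : set V) : open U -> measurable (U : set Bor).
Proof.
move=> oU.
pose rb (ab : 'rV[rat]_d * 'rV[rat]_d) : option (V * V) :=
  Some (map_mx ratr ab.1, map_mx ratr ab.2).
rewrite (_ : U = \bigcup_ab if `[< box (rb ab) `<=` U >] then box (rb ab) else set0).
  apply: countable_bigcupT_measurable; first exact: countableP.
  by move=> ab; case: ifP => _; [exact: measurable_Bor_box|exact: measurable0].
apply/seteqP; split => [x Ux|x [ab _]]; last by case: ifPn => // /asboolP; apply.
have [e e0 he] := open_normP oU Ux.
have ha i : exists q : rat, ratr q \in `]x 0 i - e, x 0 i[ by apply: rat_in_itvoo; lra.
have hb i : exists q : rat, ratr q \in `]x 0 i, x 0 i + e[ by apply: rat_in_itvoo; lra.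
have [a {}ha] := choice ha; have [b {}hb] := choice hb.
exists (\row_i a i, \row_i b i) => //.
have rx : box (rb (\row_i a i, \row_i b i)) x.
  move=> i; rewrite !mxE; have := ha i; have := hb i.
  by rewrite !in_itv/= => /andP[/ltW -> _] /andP[_ ->].
case: ifPn => // /asboolP; apply => y hy; apply: he.
apply: norm_lt_coord => // i; have := hy i; rewrite !mxE.
have := ha i; have := hb i; rewrite !in_itv/= => /andP[? ?] /andP[? ?] /andP[? ?].
rewrite ltr_norml; lra.
Qed.

Lemma measurable_fun_Bor (dS : measure_display) (S : measurableType dS)
    (T : S -> V) : (forall i, measurable_fun setT (fun x => T x 0 i)) ->
  measurable_fun setT (T : S -> Bor).
Proof.
move=> mT; apply: (@measurability _ _ S Bor setT T (range (@box R d))) => //.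
move=> _ [_ [ab _ <-] <-]; rewrite setTI; case: ab => [[a b]|]; last first.
  by rewrite preimage_set0; exact: measurable0.
rewrite (_ : T @^-1` _ = ~` \bigcup_(i in [set: 'I_d])
   ~` ((fun x => T x 0 i) @^-1` `]a 0 i, b 0 i])).
  apply: measurableC; apply: fin_bigcup_measurable; first exact: finite_finset.
  move=> i _; apply: measurableC; rewrite -[X in measurable X]setTI.
  exact: mT.
rewrite setC_bigcup; apply/seteqP; split => x /= h i.
  by move=> _; rewrite setCK/= in_itv/=; exact: h.
by have := h i I; rewrite setCK/= in_itv.
Qed.

Lemma continuous_Bor (f : V -> R) : continuous f ->
  measurable_fun setT (f : Bor -> R).
Proof.
move=> cf; apply: (measurability _ (RGenOInfty.measurableE R)).
move=> _ [_ [a ->] <-]; rewrite setTI; apply: open_Bor.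
by move/continuousP : cf; apply; exact: interval_open.
Qed.

Lemma open_continuous_Bor (D : set V) (f : V -> R) : open D -> {in D, continuous f} ->
  measurable_fun (D : set Bor) (f : Bor -> R).
Proof.
move=> oD cf; apply: (measurability _ (RGenOInfty.measurableE R)).
move=> _ [_ [a ->] <-]; apply: open_Bor; rewrite openE => x [Dx fx].
rewrite /interior; apply: filterI; first exact: open_nbhs_nbhs.
apply: (cf x); first by rewrite inE.
by apply: open_nbhs_nbhs; split => //; exact: interval_open.
Qed.

Lemma measurable_coord i : measurable_fun setT (fun x : Bor => (x : V) 0 i).
Proof.
apply: (@continuous_Bor (fun x : V => x 0 i)); exact: coord_continuous.
Qed.

End BorelType.
Arguments Bor : clear implicits.

Section Affine.
Context {R : realType} (d : nat).
Local Notation V := 'rV[R]_d.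

Definition scale_box (s : R) (v : V) (ab : option (V * V)) :=
  if ab is Some (a, b) then Some (s *: a + v, s *: b + v) else None.

Lemma box_scale s v ab x : 0 < s -> box (scale_box s v ab) (s *: x + v) <-> box ab x.
Proof.
case: ab => [[a b]|] s0 //=; split => h i; have := h i; rewrite !mxE.
  by rewrite ltrD2r lerD2r !ler_pM2l ?ltr_pM2l.
by rewrite ltrD2r lerD2r ler_pM2l ?ltr_pM2l.
Qed.

Lemma box_volume_scale s v ab : 0 < s ->
  box_volume (scale_box s v ab) = ((s ^+ d)%:E * box_volume ab)%E.
Proof.
case: ab => [[a b]|] s0 /=; last by rewrite mule0.
rewrite -EFinM; congr (_%:E); rewrite -[in s ^+ d](card_ord d) -prodr_const -big_split/=.
apply: eq_bigr => i _; rewrite !mxE maxr_pMr ?ltW// mulr0; congr (Num.max _ _); ring.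
Qed.

(** A homothety maps covers by boxes to covers by boxes. The reverse
    inequality in [leb_affine] is this one for the inverse map. *)
Lemma lebesgue_outer_affine_le (s : R) (v : V) (A : set V) : 0 < s ->
  (lebesgue_outer [set x | A (s^-1 *: (x - v))] <= (s ^+ d)%:E * lebesgue_outer A)%E.
Proof.
move=> s0; have sd0 : 0 < s ^+ d by exact: exprn_gt0.
rewrite -lee_pdivrMl//; apply: le_ereal_inf_tmp => _ [c Ac <-].
rewrite lee_pdivrMl// -nneseriesZl//; last by move=> *; exact: box_volume_ge0.
rewrite -(eq_eseriesr (fun k _ => box_volume_scale v (c k) s0)).
apply: ereal_inf_lbound; exists (scale_box s v \o c) => // x /= Ax.
have [k _ ck] := Ac _ Ax; exists k => //=.
have -> : x = s *: (s^-1 *: (x - v)) + v by rewrite scalerA mulfV ?gt_eqF// scale1r subrK.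
exact/box_scale.
Qed.

Lemma leb_affine (s : R) (v : V) (A : set V) : 0 < s ->
  (leb [set x | A (s^-1 *: (x - v))] = (s ^+ d)%:E * leb A)%E.
Proof.
move=> s0; apply/eqP; rewrite eq_le lebesgue_outer_affine_le//=.
have sd0 : 0 < s ^+ d by exact: exprn_gt0.
have s'0 : 0 < s^-1 by rewrite invr_gt0.
have := lebesgue_outer_affine_le (- (s^-1 *: v)) [set x | A (s^-1 *: (x - v))] s'0.
rewrite /leb -lee_pdivlMl ?exprn_gt0// exprVn invrK.
set B := [set x | A _]; set D := [set x | B _].
suff -> : D = A by [].
have xE x : s^-1 *: (s *: (x - - (s^-1 *: v)) - v) = x.
  by apply/rowP => i; rewrite !mxE; field; rewrite gt_eqF.
by apply/seteqP; split => x; rewrite /D /B /= xE.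
Qed.

Lemma measurable_affine (s : R) (v : V) :
  measurable_fun setT ((fun x : V => s *: x + v) : Bor R d -> Bor R d).
Proof.
apply: measurable_fun_Bor => i.
rewrite (_ : (fun _ => _) = (fun x : Bor R d => s * (x : V) 0 i + v 0 i)).
  by apply: measurable_funD => //; apply: measurable_funM => //; exact: measurable_coord.
by apply/funext => x; rewrite !mxE.
Qed.

Lemma ge0_integral_affine (s : R) (v : V) (f : V -> \bar R) : 0 < s ->
    measurable_fun setT (f : Bor R d -> \bar R) -> (forall x, 0 <= f x)%E ->
  (\int[@vol R d]_x f x = (s ^+ d)%:E * \int[@vol R d]_x f (s *: x + v)%R)%E.
Proof.
move=> s0 mf f0; have sd0 : 0 <= s ^+ d by exact/exprn_ge0/ltW.
rewrite (ge0_integral_image (measurable_affine s v) (mu := @vol R d) sd0)//.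
move=> A mA _; rewrite -[RHS](leb_affine v [set x | A (s *: x + v)] s0).
congr (@leb R d _); apply/seteqP; split => x /=; rewrite scalerA mulfV ?gt_eqF// scale1r subrK //.
Qed.
End Affine.

(** The sets where the function exceeds a rational number determine it, and
    there are countably many of them, so their exceptional null sets [Z n]
    unite to a null set. The version is 0 there, hence inherits the sign of
    the function. The map [j] is an identity between two sigma-algebras on the
    same carrier. *)
Lemma measurable_version d1 d2 (T1 : measurableType d1) (T2 : measurableType d2)
    (R : realType) (mu : {measure set T2 -> \bar R}) (j : T2 -> T1)
    (hyp : forall A : set T1, measurable A -> exists B Z : set T2,
      [/\ measurable B, measurable Z, mu Z = 0%E &
          forall y, ~ Z y -> A (j y) <-> B y])
    (D : set T1) (f0 : T1 -> R) : measurable D -> measurable_fun D f0 ->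
  exists (g : T2 -> R) (Z : set T2), [/\ measurable_fun setT g, measurable Z,
    mu Z = 0%E, forall y, D (j y) -> ~ Z y -> g y = f0 (j y) &
    forall y, ~ D (j y) \/ Z y -> g y = 0].
Proof.
move=> mD /(measurable_restrictT _ mD).1; set f := _ \_ _ => mf.
pose r n : rat := odflt 0 (unpickle n).
have /choice[B /choice[Z hBZ]] : forall n, exists B Z : set T2,
    [/\ measurable B, measurable Z, mu Z = 0%E &
        forall y, ~ Z y -> ratr (r n) < f (j y) <-> B y].
  move=> n; have /hyp[B [Z [mB mZ Z0 h]]] : measurable [set x | ratr (r n) < f x].
    rewrite (_ : [set x | _] = f @^-1` `]ratr (r n), +oo[); last first.
      by apply/seteqP; split => x /=; rewrite in_itv/= andbT.
    by rewrite -[X in measurable X]setTI; exact: mf.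
  by exists B, Z.
pose ZZ := \bigcup_n Z n.
have mZZ : measurable ZZ by apply: bigcupT_measurable => n; have [] := hBZ n.
have ZZ0 : mu ZZ = 0%E.
  apply/negligibleP => //; apply: negligible_bigcup => n.
  by have [_ mZ Z0 _] := hBZ n; apply/negligibleP.
pose g y := if `[< ZZ y >] then 0 else f (j y).
exists g, ZZ; split => //; last 2 first.
- by move=> y Dy ZZy; rewrite /g; case: asboolP => // _; rewrite /f patchE mem_set.
- move=> y [nD|ZZy]; rewrite /g; case: asboolP => // _.
  by rewrite /f patchE memNset.
apply: (measurability _ (RGenOInfty.measurableE R)).
move=> _ [_ [a ->] <-]; rewrite setTI.
pose E n : set T2 := if a < ratr (r n) then
  (B n `\` ZZ) `|` (if ratr (r n) < 0 :> R then ZZ else set0) else set0.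
rewrite (_ : g @^-1` _ = \bigcup_n E n).
  apply: bigcupT_measurable => n; rewrite /E; case: ifP => _ //.
  have [mB _ _ _] := hBZ n; apply: measurableU; last by case: ifP.
  exact: measurableD.
apply/seteqP; split => [y /=|y [n _]]; rewrite /E /= in_itv/= andbT /g.
  move=> ag; have [q] := rat_in_itvoo ag; rewrite in_itv/= => /andP[aq qg].
  have rq : r (pickle q) = q by rewrite /r pickleK.
  exists (pickle q) => //; rewrite rq aq; move: qg; case: asboolP => Zy qg.
    by right; rewrite qg.
  left; split => //; have [_ _ _ <-] := hBZ (pickle q); first by rewrite rq.
  by move=> Zq; apply: Zy; exists (pickle q).
case: ifP => // ar [[By nZ]|].
  case: asboolP => // _; apply: (lt_trans ar).
  by have [_ _ _ ->] := hBZ n => // Zn; apply: nZ; exists n.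
by case: ifP => // rn0 ZZy; case: asboolP => // _; exact: lt_trans ar rn0.
Qed.

Section LebVersion.
Context {R : realType} (d : nat).
Local Notation V := 'rV[R]_d.
Local Notation vol := (@vol R d).

Definition cube (r : R) : set V := [set x | forall i, - r < x 0 i <= r].

Lemma cube_box r : cube r = box (Some (\row__ - r, \row__ r)).
Proof. by apply/seteqP; split => x h i; have := h i; rewrite !mxE. Qed.

Lemma measurable_cube r : measurable (cube r : set (Bor R d)).
Proof. rewrite cube_box; exact: measurable_Bor_box. Qed.

Lemma lebesgue_outer_box_le ab : (@lebesgue_outer R d (box ab) <= box_volume ab)%E.
Proof.
apply: ereal_inf_lbound; exists (fun n : nat => if (n == 0)%N then ab else None).
  by move=> x abx; exists 0%N.
rewrite (nneseries_split 0 1); last by move=> [|n] _; exact: box_volume_ge0.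
rewrite add0n big_nat1/= eseries0 ?adde0//.
by move=> [|n].
Qed.

Lemma leb_cube_lty r : (@leb R d (cube r) < +oo)%E.
Proof.
by rewrite cube_box (le_lt_trans (lebesgue_outer_box_le _))//= ltry.
Qed.

Lemma cube_cover : \bigcup_n cube n%:R = setT.
Proof.
apply/seteqP; split => // x _; exists (Num.truncn `|x|).+1 => // i.
have := norm_coord x i; have := truncnS_gt `|x|.
rewrite ler_norml => h /andP[h1 h2]; apply/andP; split; lra.
Qed.

(** The intersection of countably many covers by boxes whose volumes tend to
    the outer measure. *)
Lemma borel_hull (A : set V) : (@leb R d A < +oo)%E ->
  exists B : set V, [/\ measurable (B : set (Bor R d)), A `<=` B & leb B = leb A].
Proof.
move=> Aoo; have Afin : lebesgue_outer A \is a fin_num.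
  by rewrite ge0_fin_numE//; exact: outer_measure_ge0.
have /choice[s hs] : forall n, exists s : nat -> _,
    A `<=` \bigcup_k box (s k) /\
    (\sum_(k <oo) box_volume (s k) < lebesgue_outer A + (n.+1%:R^-1)%:E)%E.
  move=> n; have n0 : 0 < n.+1%:R^-1 :> R by rewrite invr_gt0.
  by have [_ [s As <-] hs] := lb_ereal_inf_adherent n0 Afin; exists s.
pose B n := \bigcup_k box (s n k).
exists (\bigcap_n B n); split.
- apply: bigcapT_measurable => n; apply: bigcupT_measurable => k.
  exact: measurable_Bor_box.
- by move=> x Ax n _; exact: (hs n).1.
apply/eqP; rewrite eq_le; apply/andP; split; last first.
  by apply: (@le_outer_measure _ _ (@lebesgue_outer R d)) => x Ax n _; exact: (hs n).1.
apply/lee_addgt0Pr => e e0.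
near \oo => n.
have Bn : (lebesgue_outer (B n) <= lebesgue_outer A + (n.+1%:R^-1)%:E)%E.
  apply: le_trans (ltW (hs n).2); apply: ereal_inf_lbound.
  by exists (s n).
apply: (@le_trans _ _ (lebesgue_outer (B n))).
  by apply: (@le_outer_measure _ _ (@lebesgue_outer R d)) => x; exact.
apply: (le_trans Bn); rewrite leeD2l// lee_fin ltW//.
by near: n; exact: near_infty_natSinv_lt (PosNum e0).
Unshelve. all: by end_near. Qed.

(** Within a cube the measures are finite: the hull of the set differs from it
    by a null set, whose own hull is the exceptional set. *)
Lemma leb_borel_mod_null (A : set (Leb R d)) : measurable A ->
  exists B Z : set (Bor R d), [/\ measurable B, measurable Z, vol Z = 0%E &
    forall y, ~ Z y -> A y <-> B y].
Proof.
move=> mA.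
have mQ n : measurable (cube n%:R : set (Leb R d)).
  by apply: Bor_Leb; exact: measurable_cube.
have /choice[B /choice[Z h]] : forall n, exists B Z : set (Bor R d),
    [/\ measurable B, measurable Z, vol Z = 0%E &
    forall y, ~ Z y -> (A `&` cube n%:R) y <-> B y].
  move=> n; set An := A `&` cube n%:R.
  have mAn : measurable (An : set (Leb R d)) by exact: measurableI.
  have Anoo : (@leb R d An < +oo)%E.
    apply: le_lt_trans (leb_cube_lty n%:R).
    by apply: (@le_outer_measure _ _ (@lebesgue_outer R d)) => x [].
  have [B [mB AB BA]] := borel_hull Anoo.
  have mB' := Bor_Leb mB.
  have BA0 : @leb R d (B `\` An) = 0%E.
    have h : (@leb R d B < +oo)%E by rewrite BA.
    rewrite (@measureD _ (Leb R d) R (@leb R d) B An mB' mAn h) (setIidr AB).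
    by rewrite -[X in (X - _)%E]/(leb B) BA subee// ge0_fin_numE.
  have [|Z [mZ BZ Z0]] := @borel_hull (B `\` An); first by rewrite BA0.
  exists B, Z; split => //; first by rewrite -[LHS]/(leb Z) Z0.
  move=> y nZ; split => [/AB//|By]; apply: contrapT => nA; apply: nZ.
  by apply: BZ; split.
exists (\bigcup_n B n), (\bigcup_n Z n); split.
- by apply: bigcupT_measurable => n; have [] := h n.
- by apply: bigcupT_measurable => n; have [] := h n.
- apply/negligibleP; first by apply: bigcupT_measurable => n; have [] := h n.
  by apply: negligible_bigcup => n; have [_ mZ Z0 _] := h n; apply/negligibleP.
move=> y nZ; have nZn n : ~ Z n y by move=> Zn; apply: nZ; exists n.
split => [Ay|[n _ Bn]]; last by have [_ _ _ /(_ _ (nZn n))] := h n => -[_ /(_ Bn)[]].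
have [n _ yn] : (\bigcup_n cube n%:R) y by rewrite cube_cover.
by exists n => //; have [_ _ _ /(_ _ (nZn n))] := h n => -[+ _]; apply.
Qed.

Lemma vol_sigma_finite : sigma_finite setT vol.
Proof.
exists (fun n => cube n%:R); first by rewrite cube_cover.
by move=> n; split; [exact: measurable_cube|exact: leb_cube_lty].
Qed.
HB.instance Definition _ := @Measure_isSigmaFinite.Build _ _ _ vol vol_sigma_finite.

Lemma leb_borel_version (D : set V) (f : V -> R) :
    measurable (D : set (Bor R d)) ->
    measurable_fun (D : set (Leb R d)) (f : Leb R d -> R) ->
  exists (g : V -> R) (Z : set V), [/\ measurable_fun setT (g : Bor R d -> R),
    measurable (Z : set (Bor R d)), vol Z = 0%E,
    forall y, D y -> ~ Z y -> g y = f y & forall y, ~ D y \/ Z y -> g y = 0].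
Proof.
move=> mD mf; have mDL := Bor_Leb mD.
exact: (@measurable_version _ _ (Leb R d) (Bor R d) _ vol id leb_borel_mod_null D f mDL mf).
Qed.

End LebVersion.

Section Version1.
Context {R : realType}.
Local Notation mu1 := (@completed_lebesgue_measure R).
Local Notation mu := (@lebesgue_measure R).

Lemma measurable_Leb1 (A : set R) :
  measurable (A : set (measurableTypeR R)) -> measurable (A : set Leb1).
Proof. exact: sub_caratheodory. Qed.

Lemma measurable_id1 : measurable_fun [set: @Leb1 R] (id : @Leb1 R -> measurableTypeR R).
Proof. by move=> _ A mA; rewrite setTI; exact: measurable_Leb1. Qed.

Lemma leb1_borel_mod_null (A : set Leb1) : measurable A ->
  exists B Z : set (measurableTypeR R), [/\ measurable B, measurable Z, mu Z = 0%E &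
    forall y, ~ Z y -> A y <-> B y].
Proof.
move=> mA.
have : (completed_algebra_gen mu).-sigma.-measurable A.
  by rewrite completed_caratheodory_measurable.
rewrite g_sigma_completed_algebra_genE => -[B mB [N [Z [mZ Z0 NZ]] <-]].
exists B, Z; split => // y nZ; split; last by left.
by move=> [//|/NZ].
Qed.

Lemma leb1_borel_version (D : set R) (f : R -> R) :
    measurable (D : set (measurableTypeR R)) ->
    measurable_fun (D : set Leb1) (f : Leb1 -> R) ->
  exists (g : R -> R) (Z : set R), [/\ measurable_fun setT (g : measurableTypeR R -> R),
    measurable (Z : set (measurableTypeR R)), mu Z = 0%E,
    forall y, D y -> ~ Z y -> g y = f y & forall y, ~ D y \/ Z y -> g y = 0].
Proof.
move=> mD mf; have mDL := measurable_Leb1 mD.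
exact: (@measurable_version _ _ Leb1 (measurableTypeR R) _ mu id leb1_borel_mod_null D f mDL mf).
Qed.

Lemma ge0_integral_leb1 (D : set R) (f : R -> \bar R) :
    measurable (D : set (measurableTypeR R)) ->
    measurable_fun (D : set (measurableTypeR R)) (f : measurableTypeR R -> \bar R) ->
    (forall x, D x -> (0 <= f x)%E) ->
  (\int[mu1]_(x in D) f x = \int[mu]_(x in D) f x)%E.
Proof.
move=> mD mf f0.
rewrite [RHS](ge0_integral_image measurable_id1 (mu := mu1) ler01 mD)// ?mul1e//.
by move=> A mA AD; rewrite mul1e.
Qed.
End Version1.

(** * The norm generated by a convex body *)

Lemma lipschitz_continuous {R : realType} (d : nat) (f : 'rV[R]_d -> R) (c : R) :
  0 < c -> (forall x y, `|f x - f y| <= c * `|x - y|) -> continuous f.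
Proof.
move=> c0 hf x A /nbhs_ballP[e /= e0 hA]; apply/nbhs_ballP.
exists (e / c); first exact: divr_gt0.
move=> y; rewrite -ball_normE /= => xy; apply: hA; rewrite -ball_normE /=.
by apply: le_lt_trans (hf _ _) _; rewrite mulrC -ltr_pdivlMr.
Qed.

Section Gauge.
Context {R : realType} (d : nat) (K : set 'rV[R]_d) (hK : convex_body K).
Local Notation V := 'rV[R]_d.
Local Notation N := (gauge_norm K).
Implicit Types (x y z : V).

Lemma body_convex x y (a b : R) : K x -> K y -> 0 <= a -> 0 <= b -> a + b = 1 ->
  K (a *: x + b *: y).
Proof.
case: hK => _ _ cK _ _ Kx Ky a0 b0 ab.
have a1 : a <= 1 by lra.
have := cK x y (Itv01 a0 a1); rewrite !inE => /(_ Kx Ky).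
by have -> : b = 1 - a by lra.
Qed.

Lemma body_ball : exists2 r : R, 0 < r & forall x, `|x| < r -> K x.
Proof.
case: hK => oK _ _ _ /interior_subset K0; have [r r0 h] := open_normP oK K0.
by exists r => // x xr; apply: h; rewrite subr0.
Qed.

Lemma body_bound : exists2 M : R, 0 < M & forall x, K x -> `|x| <= M.
Proof.
case: hK => _ bK _ _ _; have /= [M [_ h]] := bK.
exists (`|M| + 1); first by rewrite ltr_pwDr.
by move=> x; apply: h; rewrite (le_lt_trans (ler_norm M))// ltrDl.
Qed.

Lemma dilateE l x : 0 < l -> dilate l K x <-> K (l^-1 *: x).
Proof.
move=> l0; split => [[y Ky <-]|Kx]; first by rewrite scalerA mulVf ?gt_eqF// scale1r.
by exists (l^-1 *: x) => //; rewrite scalerA mulfV ?gt_eqF// scale1r.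
Qed.

Lemma body_star x (a : R) : K x -> 0 <= a -> a <= 1 -> K (a *: x).
Proof.
move=> Kx a0 a1; have K0 : K 0 by have [r r0] := body_ball; apply; rewrite normr0.
have := body_convex Kx K0 a0 (_ : 0 <= 1 - a); rewrite scaler0 addr0; apply; lra.
Qed.

(** The gauge is an infimum, so that the strict inequality is the one that
    characterizes membership; openness of the body makes it an equivalence. *)
Lemma gauge_lt x l : 0 < l -> (N x < l <-> K (l^-1 *: x)).
Proof.
move=> l0.
have lb : has_lbound [set l | 0 < l /\ dilate l K x] by exists 0 => y [/ltW].
split => [/inf_lt|Kx].
  case.
    have [r r0 hr] := body_ball; exists (`|x| / r + 1).
    have p0 : 0 < `|x| / r + 1 by rewrite ltr_wpDl// divr_ge0// ltW.
    split => //; apply/dilateE => //; apply: hr; rewrite normrZ normfV gtr0_norm//.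
    rewrite mulrC ltr_pdivrMr// mulrDr mulr1 mulrCA mulfV ?gt_eqF// mulr1; lra.
  move=> l' [l'0 /dilateE -/(_ l'0) Kl'] l'l.
  have -> : l^-1 *: x = (l' / l) *: (l'^-1 *: x).
    by rewrite scalerA mulrAC mulfV ?gt_eqF// mul1r.
  apply: body_star => //; first by rewrite divr_ge0// ltW.
  by rewrite ler_pdivrMr// mul1r ltW.
have [oK _ _ _ _] := hK; have [e e0 he] := open_normP oK Kx.
(* A dilation of ratio 1 + t still maps the point into the body. *)
pose t := e / (2 * (`|l^-1 *: x| + 1)).
have p0 : 0 < `|l^-1 *: x| + 1 by rewrite ltr_wpDl.
have t0 : 0 < t by rewrite divr_gt0// mulr_gt0.
apply: (@le_lt_trans _ _ (l / (1 + t))); last first.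
  by rewrite ltr_pdivrMr ?addr_gt0// mulrDr mulr1 ltrDl mulr_gt0.
apply: ge_inf => //; have lt0 : 0 < l / (1 + t) by rewrite divr_gt0// addr_gt0.
split => //; apply/dilateE => //; apply: he.
have -> : (l / (1 + t))^-1 *: x - l^-1 *: x = t *: (l^-1 *: x).
  rewrite -scalerBl scalerA; congr (_ *: _); field.
  by rewrite !gt_eqF// addr_gt0.
rewrite normrZ gtr0_norm// /t mulrAC ltr_pdivrMr ?mulr_gt0//.
by rewrite ltr_pM2l// mulrDr mulr1; have := normr_ge0 (l^-1 *: x); lra.
Qed.

Lemma gauge_ge0 x : 0 <= N x.
Proof.
apply: lb_le_inf; last by move=> y [/ltW].
have [r r0 hr] := body_ball; exists (`|x| / r + 1).
have p0 : 0 < `|x| / r + 1 by rewrite ltr_wpDl// divr_ge0// ltW.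
split => //; apply/dilateE => //; apply: hr; rewrite normrZ normfV gtr0_norm//.
rewrite mulrC ltr_pdivrMr// mulrDr mulr1 mulrCA mulfV ?gt_eqF// mulr1; lra.
Qed.

Lemma dilate_gauge l x : 0 < l -> dilate l K x <-> N x < l.
Proof. by move=> l0; rewrite dilateE// gauge_lt. Qed.

(** Identities between gauges reduce, through [gauge_lt], to equivalences
    between memberships in the body. *)
Lemma eq_of_lt (a b : R) : 0 <= a -> 0 <= b ->
  (forall l, 0 < l -> a < l <-> b < l) -> a = b.
Proof.
move=> a0 b0 h; apply/eqP; rewrite eq_le !leNgt; apply/andP; split; apply/negP => ab.
  by have /h := le_lt_trans b0 ab; rewrite ab ltxx => -[_ /(_ isT)].
by have /h := le_lt_trans a0 ab; rewrite ab ltxx => -[/(_ isT)].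
Qed.

Lemma gaugeN x : N (- x) = N x.
Proof.
have [_ _ _ sK _] := hK.
apply: eq_of_lt; [exact: gauge_ge0..|move=> l l0; rewrite !gauge_lt// scalerN].
by split => /sK; rewrite ?opprK.
Qed.

Lemma gaugeZ_gt0 (a : R) x : 0 < a -> N (a *: x) = a * N x.
Proof.
move=> a0; apply: eq_of_lt; first exact: gauge_ge0.
  by rewrite mulr_ge0 ?gauge_ge0// ltW.
move=> l l0; rewrite mulrC -ltr_pdivlMr// !gauge_lt ?divr_gt0// scalerA.
by rewrite invfM invrK mulrC.
Qed.

Lemma gauge0 : N 0 = 0.
Proof.
have [r r0 hr] := body_ball.
apply: eq_of_lt => //; first exact: gauge_ge0.
by move=> l l0; rewrite gauge_lt// scaler0 l0; split => // _; apply: hr; rewrite normr0.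
Qed.

Lemma gaugeZ (a : R) x : N (a *: x) = `|a| * N x.
Proof.
have [a0|a0|->] := ltrgt0P a; last by rewrite scale0r gauge0 mul0r.
  exact: gaugeZ_gt0.
by rewrite -gaugeZ_gt0 ?oppr_gt0// scaleNr gaugeN.
Qed.

Lemma gaugeD x y : N (x + y) <= N x + N y.
Proof.
apply/ler_addgt0Pr => e e0; pose a := N x + e / 2; pose b := N y + e / 2.
have a0 : 0 < a by rewrite ltr_wpDl ?gauge_ge0// divr_gt0.
have b0 : 0 < b by rewrite ltr_wpDl ?gauge_ge0// divr_gt0.
have Kx : K (a^-1 *: x) by rewrite -gauge_lt// /a ltrDl divr_gt0.
have Ky : K (b^-1 *: y) by rewrite -gauge_lt// /b ltrDl divr_gt0.
have -> : N x + N y + e = a + b by rewrite /a /b; field.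
have l0 : 0 < a + b by exact: addr_gt0.
apply/ltW; rewrite gauge_lt//.
have := body_convex Kx Ky (_ : 0 <= a / (a + b)) (_ : 0 <= b / (a + b)).
rewrite !scalerA mulrAC mulfV ?gt_eqF// mulrAC mulfV ?gt_eqF// !mul1r -scalerDr; apply.
- by rewrite divr_ge0// ltW.
- by rewrite divr_ge0// ltW.
- by field; rewrite gt_eqF.
Qed.

Lemma gaugeB x y : `|N x - N y| <= N (x - y).
Proof.
rewrite ler_norml; apply/andP; split.
  by have := gaugeD (y - x) x; rewrite subrK -(opprB x) gaugeN; lra.
by have := gaugeD (x - y) y; rewrite subrK; lra.
Qed.

Lemma gauge_le_norm : exists2 c : R, 0 < c & forall x, N x <= c * `|x|.
Proof.
have [r r0 hr] := body_ball; exists r^-1; first by rewrite invr_gt0.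
move=> x; apply/ler_addgt0Pr => e e0.
have l0 : 0 < r^-1 * `|x| + e by rewrite ltr_wpDl// mulr_ge0// ltW// invr_gt0.
apply/ltW; rewrite gauge_lt//; apply: hr; rewrite normrZ normfV (gtr0_norm l0).
rewrite mulrC ltr_pdivrMr// mulrDr mulrA mulfV ?gt_eqF// mul1r ltrDl mulr_gt0//.
Qed.

Lemma norm_le_gauge : exists2 M : R, 0 < M & forall x, `|x| <= M * N x.
Proof.
have [M M0 hM] := body_bound; exists M => // x; apply/ler_addgt0Pr => e e0.
have l0 : 0 < N x + e / M by rewrite ltr_wpDl ?gauge_ge0// divr_gt0.
have /gauge_lt -/(_ l0)/hM : N x < N x + e / M by rewrite ltrDl divr_gt0.
rewrite normrZ normfV (gtr0_norm l0) mulrC ler_pdivrMr// mulrDr.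
by rewrite [_ * (e / M)]mulrC divfK// gt_eqF.
Qed.

Lemma gauge_gt0 x : x != 0 -> 0 < N x.
Proof.
move=> x0; rewrite lt_neqAle gauge_ge0 andbT eq_sym; apply/eqP => Nx.
have [M M0 /(_ x)] := norm_le_gauge; rewrite Nx mulr0 normr_le0.
exact/negP.
Qed.

Lemma gauge_continuous : continuous N.
Proof.
have [c c0 hc] := gauge_le_norm.
apply: (lipschitz_continuous c0) => x y.
exact: le_trans (gaugeB _ _) (hc _).
Qed.

Lemma measurable_gauge : measurable_fun setT (N : Bor R d -> R).
Proof. exact: continuous_Bor gauge_continuous. Qed.

Lemma bodyE x : K x <-> N x < 1.
Proof. by rewrite gauge_lt// invr1 scale1r. Qed.

(** ** The dual norm *)
Local Notation N' := (dual_norm K).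

Lemma dotpDr x y z : dotp z (x + y) = dotp z x + dotp z y.
Proof. by rewrite /dotp -big_split; apply: eq_bigr => i _; rewrite mxE mulrDr. Qed.

Lemma dotpZl (a : R) x z : dotp (a *: x) z = a * dotp x z.
Proof. by rewrite /dotp mulr_sumr; apply: eq_bigr => i _; rewrite mxE mulrA. Qed.

Lemma dotpZr (a : R) x z : dotp z (a *: x) = a * dotp z x.
Proof. by rewrite /dotp mulr_sumr; apply: eq_bigr => i _; rewrite mxE mulrCA. Qed.

Lemma dotp0l z : dotp 0 z = 0.
Proof. by rewrite -(scale0r 0) dotpZl mul0r. Qed.

Lemma dotp_le x z : `|dotp x z| <= d%:R * (`|x| * `|z|).
Proof.
rewrite (le_trans (ler_norm_sum _ _ _))//.
rewrite (le_trans (ler_sum _ (_ : forall i, true -> _ <= `|x| * `|z|)))//.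
  by move=> i _; rewrite normrM ler_pM// norm_coord.
by rewrite sumr_const card_ord mulr_natl.
Qed.

(** The dual norm is a supremum over a bounded set, since the body is bounded. *)
Lemma dual_has_sup z : has_sup [set dotp x z | x in [set x | N x <= 1]].
Proof.
split; first by exists (dotp 0 z), 0 => //=; rewrite gauge0.
have [M M0 hM] := norm_le_gauge.
exists (d%:R * (M * `|z|)) => _ [x /= Nx <-].
apply: le_trans (ler_norm _) _; apply: le_trans (dotp_le _ _) _.
rewrite ler_wpM2l// ler_wpM2r//; apply: le_trans (hM x) _.
by rewrite -[leRHS]mulr1 ler_wpM2l// ltW.
Qed.

Lemma dual_ge0 z : 0 <= N' z.
Proof.
apply: sup_upper_bound; first exact: dual_has_sup.
by exists 0; rewrite /= ?gauge0// dotp0l.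
Qed.

Lemma dual_le z (c : R) : (forall x, N x <= 1 -> dotp x z <= c) -> N' z <= c.
Proof.
move=> h; apply: ge_sup; first exact: (dual_has_sup z).1.
by move=> _ [x /= Nx <-]; exact: h.
Qed.

Lemma dotp_le_dual x z : dotp x z <= N x * N' z.
Proof.
have [->|x0] := eqVneq x 0; first by rewrite dotp0l gauge0 mul0r.
have Nx := gauge_gt0 x0.
rewrite mulrC -ler_pdivrMr// mulrC -dotpZl; apply: sup_upper_bound.
  exact: dual_has_sup.
exists ((N x)^-1 *: x) => //=.
by rewrite gaugeZ normfV (gtr0_norm Nx) mulVf// gt_eqF.
Qed.

Lemma dotp_norm_le_dual x z : `|dotp x z| <= N x * N' z.
Proof.
rewrite ler_norml dotp_le_dual andbT -[leRHS]opprK lerN2.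
by rewrite -gaugeN -mulN1r -dotpZl scaleN1r dotp_le_dual.
Qed.

Lemma dualD x y : N' (x + y) <= N' x + N' y.
Proof.
apply: dual_le => v Nv; rewrite dotpDr lerD//;
  by apply: le_trans (dotp_le_dual _ _) _; rewrite ler_piMl// dual_ge0.
Qed.

Lemma dualZ_ge0 (a : R) x : 0 <= a -> N' (a *: x) <= a * N' x.
Proof.
move=> a0; apply: dual_le => v Nv; rewrite dotpZr ler_wpM2l//.
by apply: le_trans (dotp_le_dual _ _) _; rewrite ler_piMl// dual_ge0.
Qed.

Lemma dual_le_norm : exists2 c : R, 0 < c & forall x, N' x <= c * `|x|.
Proof.
have [M M0 hM] := norm_le_gauge; exists (d%:R * M + 1).
  by rewrite ltr_wpDl// mulr_ge0// ltW.
move=> z; apply: dual_le => x Nx.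
apply: le_trans (ler_norm _) _; apply: le_trans (dotp_le _ _) _.
rewrite mulrA ler_wpM2r//; apply: (@le_trans _ _ (d%:R * M)); last by rewrite lerDl.
rewrite ler_wpM2l//; apply: le_trans (hM x) _.
by rewrite -[leRHS]mulr1 ler_wpM2l// ltW.
Qed.

Lemma dual_continuous : continuous N'.
Proof.
have [c c0 hc] := dual_le_norm.
have hB x y : N' x - N' y <= c * `|x - y|.
  by have := dualD (x - y) y; rewrite subrK; have := hc (x - y); lra.
apply: (lipschitz_continuous c0) => x y.
by rewrite ler_norml hB andbT; have := hB y x; rewrite distrC; lra.
Qed.

Lemma measurable_dual : measurable_fun setT (N' : Bor R d -> R).
Proof. exact: continuous_Bor dual_continuous. Qed.

End Gauge.

(** * Open cones *)
Section Cone.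
Context {R : realType} (d : nat) (C : set 'rV[R]_d) (hC : open_fg_cone C).
Local Notation V := 'rV[R]_d.
Implicit Types (x y z : V).

Lemma cone_open : open C.
Proof. by case: hC => _ [n [v ->]]; exact: open_interior. Qed.

(** Interior points: a small perturbation of [x + y] is absorbed by [x]. *)
Lemma cone_add x y : C x -> C y -> C (x + y).
Proof.
case: hC => _ [n [v CE]] Cx Cy; have oC := cone_open.
have [e e0 he] := open_normP oC Cx.
rewrite CE; apply/nbhs_ballP; exists e => // z; rewrite -ball_normE /= => zxy.
have : C (z - y) by apply: he; rewrite distrC; apply: le_lt_trans zxy; rewrite opprB addrA addrC addrA.
move: Cy; rewrite CE => /interior_subset[a a0 ->] /interior_subset[b b0 zE].
exists (fun i => a i + b i); first by move=> i; exact: addr_ge0.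
rewrite -[z](subrK (\sum_i a i *: v i)) zE -big_split/=.
by apply: eq_bigr => i _; rewrite scalerDl addrC.
Qed.

Lemma cone_scale x (s : R) : C x -> 0 < s -> C (s *: x).
Proof.
case: hC => _ [n [v CE]] Cx s0; have oC := cone_open.
have [e e0 he] := open_normP oC Cx.
rewrite CE; apply/nbhs_ballP; exists (s * e); first exact: mulr_gt0.
move=> z; rewrite -ball_normE /= => zx.
have : C (s^-1 *: z).
  apply: he; rewrite -[x in _ - x](scalerK (lt0r_neq0 s0)) -scalerBr normrZ normfV.
  by rewrite (gtr0_norm s0) mulrC ltr_pdivrMr// mulrC distrC.
rewrite CE => /interior_subset[a a0 zE].
exists (fun i => s * a i); first by move=> i; rewrite mulr_ge0// ltW.
rewrite -[z](scalerKV (lt0r_neq0 s0)) zE scaler_sumr.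
by apply: eq_bigr => i _; rewrite scalerA.
Qed.

Lemma cone_scaleE x (s : R) : 0 < s -> C (s *: x) <-> C x.
Proof.
move=> s0; split => Cx; last exact: cone_scale.
rewrite -(scale1r x) -(mulVf (lt0r_neq0 s0)) -scalerA.
by apply: cone_scale => //; rewrite invr_gt0.
Qed.

Lemma measurable_cone : measurable (C : set (Bor R d)).
Proof. exact: open_Bor cone_open. Qed.
End Cone.

(** * Polar coordinates *)

Section Scale1.
Context {R : realType}.
Local Notation mu := (@lebesgue_measure R).

Lemma measurable_scale1 (s : R) :
  measurable_fun setT ((fun x => s * x) : measurableTypeR R -> measurableTypeR R).
Proof. exact: measurable_funM. Qed.

Lemma lebesgue_scale (s : R) (A : set (measurableTypeR R)) : 0 < s -> measurable A ->
  mu A = (s%:E * mu ((fun x => (s * x)%R) @^-1` A))%E.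
Proof.
move=> s0 mA; have s0' := ltW s0.
have [pm pmE] : exists pm : {measure set (measurableTypeR R) -> \bar R},
    forall A, pm A = mu ((fun x => (s * x)%R) @^-1` A).
  by exists (measure_function_pushforward__canonical__measure_function_Measure mu (measurable_scale1 s)).
suff h : forall X, ocitv X -> mu X = mscale (NngNum s0') pm X.
  by rewrite (lebesgue_measure_unique h mA); congr (_ * _)%E; exact: pmE.
move=> _ [[a b] /= ab <-]; rewrite [RHS](_ : _ = s%:E * pm `]a, b]%classic)%E// pmE.
rewrite (_ : _ @^-1` _ = `]a / s, b / s]%classic); last first.
  by apply/seteqP; split => x /=; rewrite !in_itv/= ltr_pdivrMr// ler_pdivlMr// mulrC.
rewrite !lebesgue_measure_itv/= !lte_fin ltr_pM2r ?invr_gt0//.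
case: ifP => _; last by rewrite mule0.
by rewrite -!EFinB -EFinM; congr (_%:E); field; rewrite gt_eqF.
Qed.

Lemma ge0_integral_scale1 (s : R) (f : R -> \bar R) : 0 < s ->
    measurable_fun setT (f : measurableTypeR R -> \bar R) -> (forall x, 0 <= f x)%E ->
  (\int[mu]_(x in `]0%R, +oo[) f x = s%:E * \int[mu]_(x in `]0%R, +oo[) f (s * x)%R)%E.
Proof.
move=> s0 mf f0.
rewrite (ge0_integral_image (measurable_scale1 s) (mu := mu) (ltW s0))//; last 2 first.
- by move=> A mA _; exact: lebesgue_scale.
- exact: measurable_funS mf.
congr (_ * integral _ _ _)%E.
by apply/seteqP; split => x /=; rewrite !in_itv/= !andbT pmulr_rgt0.
Qed.
End Scale1.

Section Polar.
Context {R : realType} (d : nat) (hd : (0 < d)%N) (K C : set 'rV[R]_d).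
Context (hK : convex_body K) (hC : open_fg_cone C).
Local Notation V := 'rV[R]_d.
Local Notation N := (gauge_norm K).
Local Notation mu := (@lebesgue_measure R).
Local Notation vol := (@vol R d).
Local Notation Bor := (Bor R d).
Local Notation R1 := (measurableTypeR R).

Lemma measurable_scale_pair :
  measurable_fun setT ((fun z : R1 * Bor => z.1 *: (z.2 : V)) : R1 * Bor -> Bor).
Proof.
apply: measurable_fun_Bor => i.
rewrite (_ : (fun _ => _) = (fun z : R1 * Bor => z.1 * (z.2 : V) 0 i)); last first.
  by apply/funext => z; rewrite mxE.
apply: measurable_funM; first exact: measurable_fst.
exact: measurableT_comp (measurable_coord i) (measurable_snd).
Qed.

(** A homothety of ratio 2 about the origin fixes the set and multiplies its
    measure by 2^d. *)
Lemma leb_set1 : vol [set 0] = 0%E.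
Proof.
have fin : @leb R d [set 0] \is a fin_num.
  rewrite ge0_fin_numE; last exact: outer_measure_ge0.
  apply: le_lt_trans (leb_cube_lty d 1).
  apply: (@le_outer_measure _ _ (@lebesgue_outer R d)) => _ -> i; rewrite mxE.
  by rewrite oppr_lt0 ltr01 ler01.
have := @leb_affine R d 2 0 [set 0] (ltr0n _ 2).
rewrite (_ : [set x | _] = [set 0]); last first.
  apply/seteqP; split => x /=; last by move=> ->; rewrite subr0 scaler0.
  by rewrite subr0 => /eqP; rewrite scaler_eq0 invr_eq0 pnatr_eq0/= => /eqP.
rewrite volE -(fineK fin) -EFinM => -[].
have h2 : 1 < 2 ^+ d :> R by rewrite exprn_egt1 ?ltr1n// -lt0n.
move=> /eqP; rewrite -{1}[fine _]mul1r -subr_eq0 -mulrBl mulf_eq0.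
by rewrite subr_eq0 lt_eqF//= => /eqP ->.
Qed.

Lemma measurable_set10 : measurable ([set 0] : set Bor).
Proof.
rewrite (_ : [set 0] = N @^-1` [set 0]).
  by rewrite -[X in measurable X]setTI; apply: measurable_gauge.
apply/seteqP; split => x /=; first by move=> ->; rewrite gauge0.
by move=> Nx; apply/eqP; apply: contraT => /(gauge_gt0 hK); rewrite Nx ltxx.
Qed.

(** A shell meeting every open half-line of the cone in one segment [1, 2[ of
    the gauge: it carries the angular part of the polar decomposition. *)
Definition shell : set V := C `&` [set y | 1 <= N y < 2].

Lemma measurable_ge_gauge (r : R) : measurable ([set y | r <= N y] : set Bor).
Proof.
rewrite (_ : [set y | _] = N @^-1` `[r, +oo[).
  by rewrite -[X in measurable X]setTI; apply: measurable_gauge.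
by apply/seteqP; split => x /=; rewrite in_itv/= andbT.
Qed.

Lemma measurable_lt_gauge (r : R) : measurable ([set y | N y < r] : set Bor).
Proof.
rewrite (_ : [set y | _] = N @^-1` `]-oo, r[).
  by rewrite -[X in measurable X]setTI; apply: measurable_gauge.
by apply/seteqP; split => x /=; rewrite in_itv/=.
Qed.

Lemma measurable_shell : measurable (shell : set Bor).
Proof.
apply: measurableI; first exact: measurable_cone hC.
rewrite (_ : [set y | _] = [set y | 1 <= N y] `&` [set y | N y < 2]).
  by apply: measurableI; [exact: measurable_ge_gauge|exact: measurable_lt_gauge].
by apply/seteqP; split => x /= => [/andP[]|[-> ->]].
Qed.

Lemma measurable_inv_gauge : measurable_fun setT ((fun y => 2 / N y) : Bor -> R).
Proof.
rewrite (_ : (fun _ => _) = (fun y : Bor => 2 * N y `^ (- 1))).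
  apply: measurable_funM => //; apply: (measurableT_comp (measurable_powR _)).
  exact: measurable_gauge hK.
by apply/funext => y; rewrite powR_inv1// gauge_ge0.
Qed.

Lemma tonelli_RV (g : R1 * Bor -> \bar R) : measurable_fun setT g -> (forall z, 0 <= g z)%E ->
  (\int[mu]_s \int[vol]_y g (s, y) = \int[vol]_y \int[mu]_s g (s, y))%E.
Proof. by move=> mg g0; rewrite (@fubini_tonelli _ _ R1 Bor R mu vol g mg g0). Qed.

(** For fixed [t] in the cone, [1 = 2 / N t * mu ]N t / 2, N t]]. Exchanging
    the integrals over [s] in that interval and over [t], and substituting [t
    = s *: y] at fixed [s], turns the condition [N t / 2 < s <= N t] into [1
    <= N y < 2]: the variable [y] ranges over the shell and [s] over the
    half-line. This gives polar coordinates without a surface measure. *)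
Lemma polar_aux (f : V -> \bar R) :
    measurable_fun setT (f : Bor -> \bar R) -> (forall x, 0 <= f x)%E ->
  (\int[vol]_(t in C) f t =
   \int[vol]_(y in shell) ((2 / N y)%:E *
      \int[mu]_(s in `]0%R, +oo[) (f (s *: y)%R * (s ^+ d.-1)%:E)))%E.
Proof.
move=> mf f0.
pose E : set (R1 * Bor) := [set z | C z.2 /\ N z.2 / 2 < z.1 <= N z.2].
have mN2 : measurable_fun setT (fun z : R1 * Bor => N z.2).
  exact: measurableT_comp (measurable_gauge hK) measurable_snd.
have mE : measurable E.
  rewrite (_ : E = (snd @^-1` C) `&` ((fun z => z.1 - N z.2 / 2) @^-1` `]0, +oo[
      `&` (fun z => N z.2 - z.1) @^-1` `[0, +oo[)); last first.
    apply/seteqP; split => z; rewrite /E /= !in_itv/= !andbT subr_gt0 subr_ge0.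
      by move=> [? /andP[]].
    by move=> [? [-> ->]].
  apply: measurableI.
    by rewrite -[X in measurable X]setTI; apply: measurable_snd => //; exact: measurable_cone.
  apply: measurableI; rewrite -[X in measurable X]setTI.
    have : measurable_fun setT (fun z : R1 * Bor => z.1 - N z.2 / 2).
      by apply: measurable_funB; [exact: measurable_fst|exact: measurable_funM].
    by apply.
  have : measurable_fun setT (fun z : R1 * Bor => N z.2 - z.1).
    by apply: measurable_funB => //; exact: measurable_fst.
  by apply.
pose g (z : R1 * Bor) : \bar R := (f z.2 * (\1_E z * (2 / N z.2))%:E)%E.
have c0 y : 0 <= 2 / N y by rewrite divr_ge0// gauge_ge0.
have g0 z : (0 <= g z)%E by rewrite mule_ge0// lee_fin mulr_ge0.
have mg : measurable_fun setT g.
  apply: emeasurable_funM; first exact: measurableT_comp mf measurable_snd.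
  apply/measurable_EFinP; apply: measurable_funM; first exact: measurable_indic.
  exact: measurableT_comp measurable_inv_gauge measurable_snd.
pose g2 (z : R1 * Bor) : \bar R := (f (z.1 *: (z.2 : V)) *
   (\1_(`]0%R, +oo[ : set R1) z.1 * \1_shell z.2 * (2 / N z.2) * z.1 ^+ d.-1)%:E)%E.
have g20 z : (0 <= g2 z)%E.
  rewrite mule_ge0// lee_fin indicE/= mem_setE in_itv/= andbT.
  case: ltP => z10; last by rewrite !mul0r.
  apply: mulr_ge0; last exact/exprn_ge0/ltW.
  by apply: mulr_ge0 => //; rewrite mul1r indicE.
have mg2 : measurable_fun setT g2.
  apply: emeasurable_funM; first exact: measurableT_comp mf measurable_scale_pair.
  apply/measurable_EFinP; apply: measurable_funM; last first.
    by apply: measurable_funX; exact: measurable_fst.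
  apply: measurable_funM; last first.
    exact: measurableT_comp measurable_inv_gauge measurable_snd.
  apply: measurable_funM.
    by apply: measurableT_comp measurable_fst; exact: measurable_indic.
  by apply: measurableT_comp measurable_snd; apply: measurable_indic; exact: measurable_shell.
transitivity (\int[vol]_t \int[mu]_s g (s, t))%E.
  rewrite (ge0_negligible_integral measurable_set10)//; last 3 first.
  - exact: measurable_cone.
  - exact: measurable_funS mf.
  - exact: leb_set1.
  rewrite integral_mkcond; apply: eq_integral => t _; rewrite patchE.
  case: ifPn => [/set_mem[Ct /eqP t0]|/negP nt].
    have Nt := gauge_gt0 hK t0.
    transitivity (\int[mu]_s ((f t * (2 / N t)%:E) * (\1_(`]N t / 2, N t] : set R1) s)%:E))%E.
      rewrite ge0_integralZl//; last 2 first.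
      - by apply/measurable_EFinP; exact: measurable_indic.
      - by rewrite mule_ge0// lee_fin.
      transitivity (f t * (2 / N t)%:E *
          lebesgue_measure (`](N t / 2)%R, (N t)%R]%classic : set R))%E; last first.
        by rewrite integral_indic ?setIT.
      rewrite lebesgue_measure_itv/= lte_fin.
      rewrite ltr_pdivrMr// ltr_pMr// ltr1n -EFinB -muleA -EFinM.
      by rewrite (_ : _ * _ = 1) ?mule1//; field; rewrite gt_eqF.
    apply: eq_integral => s _; rewrite /g /= -muleA -EFinM; congr (_ * (_)%:E)%E.
    rewrite mulrC; congr (_ * _); rewrite !indicE; congr (_%:R : R); congr nat_of_bool.
    by apply/idP/idP; rewrite !inE /E /= in_itv/= => // -[].
  rewrite integral0_eq// => s _; rewrite /g /= indicE memNset ?mul0r ?mule0//.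
  move=> [/= Ct /andP[h1 h2]]; apply: nt; rewrite inE; split => //= t0.
  by move: h1 h2; rewrite t0 gauge0// mul0r => /lt_le_trans /[apply]; rewrite ltxx.
transitivity (\int[mu]_s \int[vol]_t g (s, t))%E.
  by rewrite tonelli_RV.
transitivity (\int[mu]_s \int[vol]_y g2 (s, y))%E; last first.
  rewrite tonelli_RV// [RHS]integral_mkcond; apply: eq_integral => y _.
  rewrite patchE; case: ifPn => sy; last first.
    by rewrite integral0_eq// => s _; rewrite /g2 /= indicE [\1_shell y]indicE (negbTE sy) mulr0 !mul0r mule0.
  rewrite -ge0_integralZl//; last 3 first.
  - apply: emeasurable_funM.
      apply: (measurable_funS measurableT (@subsetT _ _)).
      apply: (measurableT_comp mf).
      exact: measurableT_comp measurable_scale_pair (measurable_pair2 _).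
    apply/measurable_EFinP; apply: measurable_funX; exact: measurable_id.
  - move=> s; rewrite /= in_itv/= andbT => s0.
    by rewrite mule_ge0// lee_fin exprn_ge0// ltW.
  - by rewrite lee_fin.
  rewrite [RHS]integral_mkcond.
  apply: eq_integral => s _; rewrite /g2 /= patchE indicE.
  case: ifPn => _; last by rewrite !mul0r !mule0.
  by rewrite indicE sy !mul1r muleCA; congr (_ * _)%E; rewrite EFinM.
apply: eq_integral => s _.
have [s0|s0] := ltP 0 s; last first.
  rewrite !integral0_eq// => y _.
    by rewrite /g2/= indicE memNset ?mul0r ?mule0//= in_itv/= andbT ltNge s0.
  rewrite /g/= indicE memNset ?mul0r ?mule0// => -[/= _ /andP[h1 h2]].
  have := gauge_ge0 hK y; move: h1; rewrite ltr_pdivrMr//; lra.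
rewrite (@ge0_integral_affine _ _ s 0)//; last first.
  exact: measurable_fun_pair2.
rewrite -ge0_integralZl//; last 2 first.
- apply: (measurableT_comp mg); apply: measurable_fun_pair => //.
  exact: measurable_affine.
- by rewrite lee_fin exprn_ge0// ltW.
apply: eq_integral => y _; rewrite /g /g2 /= addr0 muleCA -EFinM; congr (_ * (_)%:E)%E.
have -> : \1_(`]0%R, +oo[%classic : set R1) s = 1 :> R.
  by rewrite indicE mem_set//= in_itv/= andbT.
rewrite mul1r.
rewrite !indicE gaugeZ_gt0// -[in X in s ^+ X](prednK hd) exprS.
have -> : ((s, s *: y) \in E) = (y \in shell).
  apply/idP/idP; rewrite !inE /E /shell /= gaugeZ_gt0// cone_scaleE//.
    move=> [Cy /andP[h1 h2]]; split => //; move: h1 h2.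
    by rewrite ltr_pdivrMr// ltr_pM2l// ler_pMr// => -> ->.
  move=> [Cy /andP[h1 h2]]; split => //.
  by rewrite ltr_pdivrMr// ltr_pM2l// ler_pMr// h1 h2.
case: (y \in shell) => //=; last by rewrite !mul0r mulr0.
have [y0|y0] := eqVneq (N y) 0; first by rewrite y0 mulr0 invr0 !mulr0 mul0r.
by rewrite !mul1r; field; rewrite y0 gt_eqF.
Qed.

Definition dir (y : V) : V := (N y)^-1 *: y.
(** The density, on the shell, of the measure of directions: the substitution
    [r = s * N y] in [polar_aux] contributes the powers of the gauge. *)
Definition kap (y : V) : R := 2 / N y ^+ d.+1.

Lemma kap_ge0 y : 0 <= kap y.
Proof. by rewrite divr_ge0// exprn_ge0// gauge_ge0. Qed.

Lemma measurable_kap : measurable_fun setT (kap : Bor -> R).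
Proof.
rewrite (_ : kap = (fun y : Bor => 2 * (N y ^+ d.+1) `^ (- 1))).
  apply: measurable_funM => //; apply: (measurableT_comp (measurable_powR _)).
  by apply: measurable_funX; exact: measurable_gauge.
by apply/funext => y; rewrite powR_inv1// exprn_ge0// gauge_ge0.
Qed.

Lemma shell_gauge y : shell y -> 0 < N y.
Proof. by move=> [_ /= /andP[+ _]]; exact: lt_le_trans. Qed.

Lemma gauge_dir y : shell y -> N (dir y) = 1.
Proof.
by move=> /shell_gauge Ny; rewrite /dir gaugeZ// normfV (gtr0_norm Ny) mulVf// gt_eqF.
Qed.

Lemma measurable_ray (f : V -> \bar R) (v : V) : measurable_fun setT (f : Bor -> \bar R) ->
  measurable_fun setT ((fun r : R => f (r *: v)) : R1 -> \bar R).
Proof.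
move=> mf; apply: (measurableT_comp mf).
apply: (@measurable_fun_pair1 _ _ _ R1 Bor Bor (fun z => z.1 *: (z.2 : V)) v).
exact: measurable_scale_pair.
Qed.

Lemma polar (f : V -> \bar R) :
    measurable_fun setT (f : Bor -> \bar R) -> (forall x, 0 <= f x)%E ->
  (\int[vol]_(t in C) f t =
   \int[vol]_(y in shell) ((kap y)%:E *
      \int[mu]_(r in `]0%R, +oo[) (f (r *: dir y)%R * (r ^+ d.-1)%:E)))%E.
Proof.
move=> mf f0; rewrite (polar_aux mf f0); apply: eq_integral => y /[!inE] sy.
have Ny := shell_gauge sy.
have mF v : measurable_fun (`]0, +oo[ : set R1) (fun s : R1 => (f (s *: v) * (s ^+ d.-1)%:E)%E).
  apply: (measurable_funS measurableT (@subsetT _ _)).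
  by apply: emeasurable_funM; [exact: measurable_ray|exact/measurable_EFinP/measurable_funX].
pose F (s : R) : \bar R := (f (s *: y) * (Num.max 0 s ^+ d.-1)%:E)%E.
have mFF : measurable_fun setT (F : R1 -> \bar R).
  apply: emeasurable_funM; first exact: measurable_ray.
  by apply/measurable_EFinP/measurable_funX; exact: measurable_maxr.
have FF0 s : (0 <= F s)%E by rewrite mule_ge0// lee_fin exprn_ge0// le_max lexx.
transitivity ((2 / N y)%:E * \int[mu]_(s in `]0%R, +oo[) F s)%E.
  congr (_ * _)%E; apply: eq_integral => s; rewrite inE/= in_itv/= andbT => s0.
  by rewrite /F max_r// ltW.
rewrite (@ge0_integral_scale1 _ (N y)^-1) ?invr_gt0// muleA.
transitivity ((kap y)%:E * ((N y ^+ d.-1)%:E * \int[mu]_(x in `]0%R, +oo[) F ((N y)^-1 * x)%R))%E.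
  rewrite muleA -!EFinM /kap; congr (_%:E * _)%E.
  have -> : N y ^+ d.+1 = N y * (N y * N y ^+ d.-1) by rewrite -!exprS prednK.
  by have p := exprn_gt0 d.-1 Ny; field; rewrite !gt_eqF.
congr (_ * _)%E; rewrite -ge0_integralZl//.
- apply: eq_integral => s; rewrite inE/= in_itv/= andbT => s0.
  rewrite /F /dir scalerA [in RHS]mulrC muleCA; congr (_ * _)%E.
  rewrite max_r; last by rewrite mulr_ge0 ?invr_ge0// ltW.
  rewrite -EFinM exprMn exprVn mulrA mulfV ?mul1r// expf_neq0// gt_eqF//.
- apply: (measurable_funS measurableT (@subsetT _ _)).
  exact: (measurableT_comp mFF (measurable_scale1 _)).
- by rewrite lee_fin exprn_ge0// ltW.
Qed.

(** Tonelli on the region [u < r]. *)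
Lemma hardy_tonelli (a psi : R -> \bar R) :
    measurable_fun setT (a : R1 -> \bar R) -> measurable_fun setT (psi : R1 -> \bar R) ->
    (forall r, 0 <= a r)%E -> (forall r, 0 <= psi r)%E ->
  (\int[mu]_(r in `]0%R, +oo[) (a r * \int[mu]_(u in `]0%R, r[) psi u) =
   \int[mu]_(u in `]0%R, +oo[) (psi u * \int[mu]_(r in `]u, +oo[) a r))%E.
Proof.
move=> ma mpsi a0 psi0.
pose E : set (R1 * R1) := [set z | 0 < z.2 < z.1].
have mE : measurable E.
  rewrite (_ : E = (snd @^-1` `]0, +oo[) `&` ((fun z => z.1 - z.2) @^-1` `]0, +oo[)); last first.
    by apply/seteqP; split => z; rewrite /E /= !in_itv/= !andbT subr_gt0 => /andP.
  apply: measurableI; rewrite -[X in measurable X]setTI.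
  - exact: measurable_snd.
  - have : measurable_fun setT (fun z : R1 * R1 => z.1 - z.2).
      by apply: measurable_funB; [exact: measurable_fst|exact: measurable_snd].
    by apply.
pose g (z : R1 * R1) : \bar R := (a z.1 * psi z.2 * (\1_E z)%:E)%E.
have mg : measurable_fun setT g.
  apply: emeasurable_funM; last by apply/measurable_EFinP; exact: measurable_indic.
  apply: emeasurable_funM; first exact: measurableT_comp ma measurable_fst.
  exact: measurableT_comp mpsi measurable_snd.
have g0 z : (0 <= g z)%E by rewrite !mule_ge0.
transitivity (\int[mu]_r \int[mu]_u g (r, u))%E.
  rewrite integral_mkcond; apply: eq_integral => r _; rewrite patchE.
  case: ifPn => [|/negP nr]; last first.
    rewrite integral0_eq// => u _; rewrite /g /= indicE memNset ?mule0// => /= /andP[u0 ur].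
    by apply: nr; rewrite inE/= in_itv/= (lt_trans u0).
  rewrite inE/= in_itv/= => /andP[r0 _].
  rewrite [X in (_ * X)%E]integral_mkcond -ge0_integralZl//; last 2 first.
  - by apply/(measurable_restrictT _ _).1 => //; exact: measurable_funS mpsi.
  - by move=> u _; rewrite patchE; case: ifP.
  apply: eq_integral => u _; rewrite patchE /g /= indicE -muleA; congr (_ * _)%E.
  have -> : ((r, u) \in E) = (u \in `]0, r[%classic).
    by apply/idP/idP; rewrite !inE /E/= ?in_itv/=.
  by case: ifP; rewrite ?mule1 ?mule0.
transitivity (\int[mu]_u \int[mu]_r g (r, u))%E.
  by rewrite (@fubini_tonelli _ _ R1 R1 R mu mu g mg g0).
rewrite [RHS]integral_mkcond; apply: eq_integral => u _; rewrite patchE.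
case: ifPn => [|/negP nu]; last first.
  rewrite integral0_eq// => r _; rewrite /g /= indicE memNset ?mule0// => /= /andP[u0 ur].
  by apply: nu; rewrite inE/= in_itv/= u0.
rewrite inE/= in_itv/= => /andP[u0 _].
rewrite [X in (_ * X)%E]integral_mkcond -ge0_integralZl//; last 2 first.
- by apply/(measurable_restrictT _ _).1 => //; exact: measurable_funS ma.
- by move=> r _; rewrite patchE; case: ifP.
apply: eq_integral => r _; rewrite patchE /g /= indicE [(a r * _)%E]muleC -muleA; congr (_ * _)%E.
have -> : ((r, u) \in E) = (r \in `]u, +oo[%classic).
  by apply/idP/idP; rewrite !inE /E/= ?in_itv/= u0 ?andbT.
by case: ifP; rewrite ?mule1 ?mule0.
Qed.

(** The total mass of the measure of directions. *)
Definition kap0 : \bar R := (\int[vol]_(y in shell) (kap y)%:E)%E.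

Lemma radial_kap0 (F : R -> \bar R) :
    measurable_fun setT (F : R1 -> \bar R) -> (forall x, 0 <= F x)%E ->
  (\int[vol]_(t in C) F (N t) =
   kap0 * \int[mu]_(r in `]0%R, +oo[) (F r * (r ^+ d.-1)%:E))%E.
Proof.
move=> mF F0; rewrite polar//; last first.
  exact: measurableT_comp mF (measurable_gauge hK).
have mk : measurable_fun (shell : set Bor) (EFin \o kap : Bor -> _).
  by apply/measurable_EFinP; exact: measurable_funS measurable_kap.
have k0 y : shell y -> (0 <= (EFin \o kap) y)%E by rewrite lee_fin kap_ge0.
rewrite /kap0 -(ge0_integralZr vol measurable_shell mk k0); last first.
  apply: integral_ge0 => r /=; rewrite in_itv/= andbT => r0.
  by rewrite mule_ge0// lee_fin exprn_ge0// ltW.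
apply: eq_integral => y /[!inE] sy; congr (_ * _)%E.
apply: eq_integral => r; rewrite inE/= in_itv/= andbT => r0; congr (F _ * _)%E.
by rewrite gaugeZ_gt0// gauge_dir// mulr1.
Qed.

Lemma integral_expn01 : (\int[mu]_(r in `]0%R, 1%R[) (r ^+ d.-1)%:E = (d%:R^-1)%:E)%E.
Proof.
have d0 : d%:R != 0 :> R by rewrite pnatr_eq0 -lt0n.
rewrite integral_itv_bndo_bndc; last by apply/measurable_EFinP; exact: measurable_funX.
rewrite integral_itv_obnd_cbnd; last by apply/measurable_EFinP; exact: measurable_funX.
rewrite (@continuous_FTC2 _ _ (fun x : R => x ^+ d * d%:R^-1))//.
- by rewrite expr1n mul1r expr0n eqn0Ngt hd/= mul0r sube0.
- by apply: continuous_subspaceT => x; exact: exprn_continuous.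
- split.
  + by move=> x _; apply: derivableM => //; exact: exprn_derivable.
  + apply: cvg_at_right_filter; apply: cvgM; last exact: cvg_cst.
    exact: exprn_continuous.
  + apply: cvg_at_left_filter; apply: cvgM; last exact: cvg_cst.
    exact: exprn_continuous.
- move=> x _; rewrite derive1E.
  rewrite deriveM ?derive_cst ?scaler0 ?add0r//; last exact: exprn_derivable.
  by rewrite exp_derive /GRing.scale/= mulr1 mulrA mulVf// mul1r.
Qed.

(** The case of the indicator of [0, 1[ in [radial_kap0]; it expresses the
    unknown mass [kap0] through the measure of the body. *)
Lemma leb_body_cone : vol (K `&` C) = (d%:R^-1%:E * kap0)%E.
Proof.
have mKC : measurable (K `&` C : set Bor).
  by apply: measurableI; [case: hK => oK _ _ _ _; exact: open_Bor|exact: measurable_cone].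
transitivity (\int[vol]_(t in C) (\1_(`]-oo, 1%R[ : set R1) (N t))%:E)%E.
  rewrite (_ : (fun t => _) = (fun t => (\1_[set y | N y < 1] t)%:E)); last first.
    by apply/funext => t; congr (_%:E); apply: eq_indic; rewrite /= in_itv.
  rewrite (integral_indic vol (measurable_cone hC) (measurable_lt_gauge 1)).
  by congr (vol (_ `&` _)); apply/seteqP; split => x; rewrite /= (bodyE hK).
rewrite (@radial_kap0 (fun r => (\1_(`]-oo, 1%R[ : set R1) r)%:E)); last 2 first.
- by apply/measurable_EFinP; exact: measurable_indic.
- by move=> x; rewrite lee_fin.
rewrite muleC; congr (_ * _)%E; rewrite -integral_expn01.
rewrite integral_mkcond [RHS]integral_mkcond; apply: eq_integral => r _.
rewrite !patchE /= indicE; have [r0|r0] := ltP 0 r; last first.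
  rewrite !memNset//= in_itv/= ?andbT; last by rewrite ltNge r0.
  by move=> /andP[]; rewrite ltNge r0.
rewrite (mem_set (_ : `]0%R, +oo[%classic r)); last by rewrite /= in_itv/= r0.
have [r1|r1] := ltP r 1.
  by rewrite !mem_set ?mul1e//= in_itv/= ?r0.
by rewrite !memNset ?mul0e//= in_itv/= ?r0/= ltNge r1.
Qed.

Lemma leb_body_cone_fin : vol (K `&` C) \is a fin_num.
Proof.
rewrite ge0_fin_numE; last exact: measure_ge0.
have [M M0 hM] := body_bound hK.
apply: le_lt_trans (leb_cube_lty d (M + 1)).
apply: (@le_outer_measure _ _ (@lebesgue_outer R d)) => x [Kx _] i.
by have := norm_coord x i; have := hM x Kx; rewrite ler_norml => ? /andP[? ?]; apply/andP; split; lra.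
Qed.

Lemma radial (F : R -> \bar R) :
    measurable_fun setT (F : R1 -> \bar R) -> (forall x, 0 <= F x)%E ->
  (\int[vol]_(t in C) F (N t) = d%:R%:E * vol (K `&` C) *
   \int[mu]_(r in `]0%R, +oo[) (F r * (r ^+ d.-1)%:E))%E.
Proof.
move=> mF F0; rewrite radial_kap0// leb_body_cone muleA -EFinM mulfV ?mul1e//.
by rewrite pnatr_eq0 -lt0n.
Qed.

(** Apply [radial] to the indicator of the null set. *)
Lemma radial_null (Z : set R) : measurable (Z : set R1) -> mu Z = 0%E ->
  vol (C `&` [set t | Z (N t)]) = 0%E.
Proof.
move=> mZ Z0.
have mNZ : measurable ([set t | Z (N t)] : set Bor).
  by rewrite -[X in measurable X]setTI; apply: (measurable_gauge hK).
rewrite setIC -(integral_indic vol (measurable_cone hC) mNZ).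
have -> : (fun t : V => (\1_[set t | Z (N t)] t : R)%:E) =
          (fun t => ((fun r => (\1_(Z : set R1) r : R)%:E) (N t))).
  by apply/funext => t; congr (_%:E); exact: eq_indic.
rewrite (@radial (fun r => (\1_(Z : set R1) r)%:E)); last 2 first.
- by apply/measurable_EFinP; exact: measurable_indic.
- by move=> x; rewrite lee_fin.
rewrite (_ : integral _ _ _ = 0%E) ?mule0//.
rewrite (ge0_negligible_integral mZ)//; last 2 first.
- apply: (measurable_funS measurableT (@subsetT _ _)).
  apply: emeasurable_funM; apply/measurable_EFinP; first exact: measurable_indic.
  exact: measurable_funX.
- move=> r; rewrite /= in_itv/= andbT => r0.
  by rewrite mule_ge0// lee_fin// exprn_ge0// ltW.
by rewrite integral0_eq// => r [_ nZ]; rewrite indicE memNset ?mul0e.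
Qed.

(** Tonelli on the region [u < r]: the tail is a section integral. *)
Lemma measurable_tail (a : R -> \bar R) :
    measurable_fun setT (a : R1 -> \bar R) -> (forall r, 0 <= a r)%E ->
  measurable_fun setT ((fun u => \int[mu]_(r in `]u, +oo[) a r)%E : R1 -> \bar R).
Proof.
move=> ma a0.
pose E : set (R1 * R1) := [set z | z.1 < z.2].
have mE : measurable E.
  rewrite (_ : E = ((fun z => z.2 - z.1) @^-1` `]0, +oo[)); last first.
    by apply/seteqP; split => z; rewrite /E /= !in_itv/= !andbT subr_gt0.
  rewrite -[X in measurable X]setTI.
  have : measurable_fun setT (fun z : R1 * R1 => z.2 - z.1).
    by apply: measurable_funB; [exact: measurable_snd|exact: measurable_fst].
  by apply.
pose g (z : R1 * R1) : \bar R := (a z.2 * (\1_E z)%:E)%E.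
have mg : measurable_fun setT g.
  apply: emeasurable_funM; last by apply/measurable_EFinP; exact: measurable_indic.
  exact: measurableT_comp ma measurable_snd.
have g0 z : (0 <= g z)%E by rewrite !mule_ge0.
have := @measurable_fun_fubini_tonelli_F _ _ R1 R1 R mu g mg g0.
congr (measurable_fun _ _); apply/funext => u; rewrite /fubini_F.
rewrite [RHS]integral_mkcond; apply: eq_integral => r _.
rewrite patchE /g /= indicE.
have -> : ((u, r) \in E) = (r \in `]u, +oo[%classic).
  by apply/idP/idP; rewrite !inE /E/= ?in_itv/= ?andbT.
by case: ifP; rewrite ?mule1 ?mule0.
Qed.

Lemma ge0_integral_scale01 (r : R) (psi : R -> \bar R) : 0 < r ->
    measurable_fun setT (psi : R1 -> \bar R) -> (forall x, 0 <= psi x)%E ->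
  (\int[mu]_(u in `]0%R, r[) psi u = r%:E * \int[mu]_(s in `]0%R, 1%R[) psi (s * r)%R)%E.
Proof.
move=> r0 mpsi psi0.
rewrite (ge0_integral_image (measurable_scale1 r) (mu := mu) (ltW r0))//; last 2 first.
- by move=> A mA _; exact: lebesgue_scale.
- exact: measurable_funS mpsi.
congr (_ * _)%E; under [RHS]eq_integral do rewrite mulrC.
congr (integral _ _ _).
by apply/seteqP; split => x /=; rewrite !in_itv/= pmulr_rgt0// gtr_pMr.
Qed.

Lemma measurable_radial_mean (phi : V -> \bar R) :
    measurable_fun setT (phi : Bor -> \bar R) -> (forall x, 0 <= phi x)%E ->
  measurable_fun setT ((fun t => \int[mu]_(s in `]0%R, 1%R[) phi (s *: t)%R)%E : Bor -> \bar R).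
Proof.
move=> mphi phi0.
pose g (z : R1 * Bor) : \bar R := (phi (z.1 *: (z.2 : V)) * (\1_(`]0%R, 1%R[ : set R1) z.1)%:E)%E.
have mg : measurable_fun setT g.
  apply: emeasurable_funM; first exact: measurableT_comp mphi measurable_scale_pair.
  apply/measurable_EFinP; apply: measurableT_comp measurable_fst.
  exact: measurable_indic.
have g0 z : (0 <= g z)%E by rewrite !mule_ge0.
have := @measurable_fun_fubini_tonelli_G _ _ R1 Bor R mu g mg g0.
congr (measurable_fun _ _); apply/funext => t; rewrite /fubini_G.
rewrite [RHS]integral_mkcond; apply: eq_integral => s _.
by rewrite patchE /g /= indicE; case: ifP; rewrite ?mule1 ?mule0.
Qed.

(** In polar coordinates the mean of [phi] over the segment from the vertex to
    [t] becomes an average over [u < r], and [hardy_tonelli] moves the average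
    onto the weight: this is how the averaged weight arises in the upper
    bound. *)
Lemma radial_kernel (w : R -> R) (phi : V -> \bar R) :
    measurable_fun setT (w : R1 -> R) -> (forall r, 0 <= w r) ->
    measurable_fun setT (phi : Bor -> \bar R) -> (forall x, 0 <= phi x)%E ->
  (\int[vol]_(t in C) ((w (N t) * N t)%:E * \int[mu]_(s in `]0%R, 1%R[) phi (s *: t)%R) =
   \int[vol]_(t in C) (((N t ^+ d.-1)^-1)%:E *
      (\int[mu]_(r in `]N t, +oo[) (w r * Num.max 0 r ^+ d.-1)%:E) * phi t))%E.
Proof.
move=> mw w0 mphi phi0.
pose a r : \bar R := (w r * Num.max 0 r ^+ d.-1)%:E.
have ma : measurable_fun setT (a : R1 -> \bar R).
  by apply/measurable_EFinP; apply: measurable_funM => //; apply: measurable_funX; exact: measurable_maxr.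
have a0 r : (0 <= a r)%E by rewrite lee_fin mulr_ge0// exprn_ge0// le_max lexx.
have mN := measurable_gauge hK.
have tail0 u : (0 <= \int[mu]_(r in `]u, +oo[) a r)%E by apply: integral_ge0 => r _.
have mean0 t : (0 <= \int[mu]_(s in `]0%R, 1%R[) phi (s *: t)%R)%E by apply: integral_ge0.
rewrite polar; last 2 first.
- apply: emeasurable_funM; last exact: measurable_radial_mean.
  apply/measurable_EFinP; apply: measurable_funM => //.
  exact: (measurableT_comp mw mN).
- by move=> t; rewrite mule_ge0// lee_fin mulr_ge0// gauge_ge0.
rewrite polar; last 2 first.
- apply: emeasurable_funM => //; apply: emeasurable_funM; last first.
    exact: (measurableT_comp (measurable_tail ma a0) mN).
  rewrite (_ : (fun _ => _) = (fun y : Bor => ((N y ^+ d.-1) `^ (- 1))%:E)).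
    apply/measurable_EFinP; apply: (measurableT_comp (measurable_powR _)).
    exact: measurable_funX.
  by apply/funext => y; rewrite powR_inv1// exprn_ge0// gauge_ge0.
- by move=> t; rewrite !mule_ge0// lee_fin invr_ge0 exprn_ge0// gauge_ge0.
apply: eq_integral => y /[!inE] sy; congr (_ * _)%E.
pose psi u := phi (u *: dir y).
have mpsi : measurable_fun setT (psi : R1 -> \bar R) by exact: measurable_ray.
have psi0 u : (0 <= psi u)%E by exact: phi0.
have Nd r : 0 < r -> N (r *: dir y) = r by move=> r0; rewrite gaugeZ_gt0// gauge_dir// mulr1.
transitivity (\int[mu]_(r in `]0%R, +oo[) (a r * \int[mu]_(u in `]0%R, r[) psi u))%E.
  apply: eq_integral => r; rewrite inE/= in_itv/= andbT => r0.
  have -> : a r = (w r * r ^+ d.-1)%:E by rewrite /a max_r// ltW.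
  cbv beta; rewrite Nd// (ge0_integral_scale01 r0 mpsi psi0).
  set I1 := (X in (_%:E * X * _)%E); have -> : I1 = (\int[mu]_(s in `]0%R, 1%R[) psi (s * r)%R)%E.
    by apply: eq_integral => s _; rewrite /psi scalerA.
  rewrite muleAC [in RHS]muleA -!EFinM.
  by congr (_%:E * _)%E; rewrite mulrAC.
rewrite hardy_tonelli//; apply: eq_integral => u; rewrite inE/= in_itv/= andbT => u0.
cbv beta; rewrite Nd// [RHS]muleC !muleA -EFinM mulfV ?mul1e; first exact: muleC.
by rewrite expf_neq0// gt_eqF.
Qed.

End Polar.

(** * Smooth bumps *)

Section Flat.
Context {R : realType}.
Implicit Types (P : {poly R}) (x : R).

(** The class of the functions P(1/x) exp(-1/x), extended by 0, is closed
    under differentiation, so that smoothness of all orders follows by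
    induction. *)
Definition flat P x : R := if 0 < x then P.[x^-1] * expR (- x^-1) else 0.
Definition flat_deriv P : {poly R} := 'X^2 * (P - P^`()).

Lemma exp_ge_expn (y : R) n : 0 <= y -> y ^+ n <= n`!%:R * expR y.
Proof.
case: n => [|n] y0; first by rewrite expr0 mul1r -expR0 ler_expR.
have := expR_ge1Dxn n y0; have f0 : 0 < n.+1`!%:R :> R by rewrite ltr0n fact_gt0.
move=> h; rewrite mulrC -ler_pdivrMr//; lra.
Qed.

Lemma poly_le_exp P : exists2 c : R, 0 <= c & forall y, 0 <= y -> `|P.[y]| <= c * expR y.
Proof.
exists (\sum_(i < size P) `|P`_i| * i`!%:R).
  by apply: sumr_ge0 => i _; rewrite mulr_ge0.
move=> y y0; rewrite horner_coef; apply: le_trans (ler_norm_sum _ _ _) _.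
rewrite mulr_suml; apply: ler_sum => i _.
rewrite normrM -mulrA ler_wpM2l// ger0_norm ?exprn_ge0//.
exact: exp_ge_expn.
Qed.

(** The exponential beats every power of 1/x; order 2 is what makes the
    derivative at the origin vanish. *)
Lemma flat_small P : exists2 c : R, 0 <= c & forall x, `|flat P x| <= c * x ^+ 2.
Proof.
have [c c0 hc] := poly_le_exp ('X^2 * P); exists c => // x.
rewrite /flat; case: ltP => x0; last by rewrite normr0 mulr_ge0// sqr_ge0.
have x'0 : 0 < x^-1 by rewrite invr_gt0.
have h : x^-1 ^+ 2 * `|P.[x^-1]| <= c * expR x^-1.
  have := hc _ (ltW x'0); rewrite hornerM hornerXn normrM.
  by rewrite [`|_ ^+ _|]ger0_norm// exprn_ge0// ltW.
rewrite normrM.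
rewrite (ger0_norm (expR_ge0 _)) expRN ler_pdivrMr ?expR_gt0//.
rewrite -(ler_pM2l (_ : 0 < x^-1 ^+ 2)); last by rewrite exprn_gt0// invr_gt0.
apply: le_trans h _; rewrite [leRHS]mulrA [_ * (c * _)]mulrCA -exprMn mulVf ?gt_eqF//.
by rewrite expr1n mulr1.
Qed.

Lemma is_derive_flat P x : is_derive x (1 : R) (flat P) (flat (flat_deriv P) x).
Proof.
have [x0|x0|->] := ltrgtP x 0.
- have -> : flat (flat_deriv P) x = 0 by rewrite /flat ltNge (ltW x0).
  apply: (@near_eq_is_derive _ _ _ (cst (0:R)) _ x).
  near=> y; rewrite /flat /= ltNge (_ : y <= 0)//; apply: ltW.
  by near: y; exact: lt_nbhsl.
- apply: (@near_eq_is_derive _ _ _ ((horner P \o GRing.inv) * (expR \o (fun y => - y^-1)))).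
    near=> y; rewrite /flat (_ : 0 < y)//.
    by near: y; exact: lt_nbhsr.
  have D1 : is_derive x (1:R) (GRing.inv : R -> R) (- x ^- 2).
    have := @is_deriveV R id x 1 1 _ _; rewrite /GRing.scale/= mulr1; apply.
    by rewrite gt_eqF.
  have D2 : is_derive x (1:R) (fun y : R => - y^-1) (x ^- 2).
    by have := is_deriveN D1; rewrite opprK.
  have D3 : is_derive x^-1 (1:R) (horner P) (P^`().[x^-1]).
    have := derivableP (@derivable_horner R P x^-1); rewrite -derive1E derivE; exact.
  have D4 := is_derive1_comp D3 D1.
  have D5 := @is_derive1_comp R expR (fun y : R => - y^-1) x _ _ (is_derive_expR (- x^-1)) D2.
  apply: (is_derive_eq (is_deriveM D4 D5)); rewrite /flat x0 /flat_deriv /GRing.scale/=.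
  rewrite hornerM hornerXn hornerD hornerN; field.
  by rewrite gt_eqF.
- have -> : flat (flat_deriv P) 0 = 0 by rewrite /flat ltxx.
  have [c c0 hc] := flat_small P.
  have L : (fun h : R => h^-1 *: (flat P (h *: (1:R) + 0) - flat P 0)) @ 0^' --> (0:R).
    have c1 : 0 < c + 1 by rewrite ltr_wpDl.
    apply/cvgrPdist_le => e e0; near=> h.
    have h0 : h != 0 by near: h; exact: nbhs_dnbhs_neq.
    rewrite addr0 /flat ltxx subr0 sub0r normrN /GRing.scale/= mulr1 normrM normfV.
    rewrite ler_pdivrMl ?normr_gt0//; apply: le_trans (hc h) _.
    have -> : h ^+ 2 = `|h| * `|h| by rewrite -expr2 real_normK// num_real.
    rewrite mulrCA ler_wpM2l//.
    have he : `|h| <= e / (c + 1) by near: h; apply: dnbhs0_le; rewrite divr_gt0.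
    apply: (@le_trans _ _ ((c + 1) * `|h|)); first by rewrite ler_wpM2r// lerDl.
    by rewrite mulrC -ler_pdivlMr.
  apply: DeriveDef; first by apply/cvg_ex; exists 0; exact: L.
  by apply: cvg_lim => //; exact: L.
Unshelve. all: by end_near. Qed.
End Flat.

Lemma continuous_big_sum {R : realType} (T : topologicalType) (I : Type) (s : seq I)
    (F : I -> T -> R) : (forall i, continuous (F i)) ->
  continuous (fun x => \sum_(i <- s) F i x).
Proof.
move=> cF; elim: s => [|i s IH].
  by under eq_fun do rewrite big_nil; exact: cst_continuous.
by under eq_fun do rewrite big_cons; move=> x; exact: cvgD (cF i x) (IH x).
Qed.

Section CkClosure.
Context {R : realType} (d : nat).
Local Notation V := 'rV[R]_d.
Implicit Types (f g : V -> R).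

Lemma Ck_continuous k f : Ck k f -> continuous f.
Proof. by case: k => [|k] []. Qed.

Lemma Ck_derivable k f i x : Ck k.+1 f -> derivable f x (delta_mx 0 i).
Proof. by move=> [_ /(_ i)[]]. Qed.

Lemma Ck_partial k f i : Ck k.+1 f -> Ck k (partial i f).
Proof. by move=> [_ /(_ i)[]]. Qed.

Lemma CkW k f : Ck k.+1 f -> Ck k f.
Proof.
elim: k f => [|k IH] f [cf hf]; first by split.
by split => // i; have [h1 h2] := hf i; split => //; exact: IH.
Qed.

Lemma Ck_cst k (c : R) : Ck k (cst c : V -> R).
Proof.
elim: k c => [|k IH] c; (split; first exact: cst_continuous) => // i; split.
  by move=> x; exact: derivable_cst.
rewrite (_ : partial i _ = cst 0)//; apply/funext => x.
by rewrite /partial derive_cst.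
Qed.

Lemma Ck_add k f g : Ck k f -> Ck k g -> Ck k (f + g).
Proof.
elim: k f g => [|k IH] f g [cf hf] [cg hg];
  (split; first by move=> x; exact: cvgD (cf x) (cg x)) => // i.
have [df hf'] := hf i; have [dg hg'] := hg i; split.
  by move=> x; exact: derivableD.
rewrite (_ : partial i _ = partial i f + partial i g); first exact: IH.
by apply/funext => x; rewrite /partial deriveD.
Qed.

Lemma partialM i f g x : derivable f x (delta_mx 0 i) -> derivable g x (delta_mx 0 i) ->
  partial i (f * g) x = (partial i f * g + f * partial i g) x.
Proof.
move=> df dg; rewrite /partial (deriveM df dg) addrC.
by rewrite [g x *: _]mulrC.
Qed.

Lemma Ck_mul k f g : Ck k f -> Ck k g -> Ck k (f * g).
Proof.
elim: k f g => [|k IH] f g Cf Cg;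
  have cf := Ck_continuous Cf; have cg := Ck_continuous Cg;
  (split; first by move=> x; exact: cvgM (cf x) (cg x)) => // i.
split; first by move=> x; apply: derivableM; exact: (@Ck_derivable k).
rewrite (_ : partial i _ = partial i f * g + f * partial i g).
  by apply: Ck_add; apply: IH; [exact: Ck_partial|exact: CkW|exact: CkW|exact: Ck_partial].
by apply/funext => x; rewrite partialM//; exact: (@Ck_derivable k).
Qed.

Lemma Ck_prod k (I : Type) (s : seq I) (F : I -> V -> R) :
  (forall i, Ck k (F i)) -> Ck k (\prod_(i <- s) F i).
Proof.
move=> hF; elim: s => [|i s IH]; first by rewrite big_nil; exact: Ck_cst.
by rewrite big_cons; apply: Ck_mul.
Qed.

(** The derivatives available for test functions are partial derivatives; the
    chain rule along a segment needs all directions. *)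
Definition has_gradient f :=
  forall x v : V, is_derive x v f (\sum_i v 0 i * partial i f x).

Lemma has_gradient_mul f g : Ck 1 f -> Ck 1 g ->
  has_gradient f -> has_gradient g -> has_gradient (f * g).
Proof.
move=> Cf Cg hf hg x v.
apply: is_derive_eq (is_deriveM (hf x v) (hg x v)) _.
rewrite /GRing.scale/= !mulr_sumr -big_split; apply: eq_bigr => i _ /=.
rewrite partialM; [|exact: (@Ck_derivable 0)..].
rewrite [RHS](_ : _ = v 0 i * (partial i f x * g x + f x * partial i g x))//; ring.
Qed.

Lemma has_gradient_cst c : has_gradient (cst c).
Proof.
move=> x v; rewrite big1 => [|i _]; last by rewrite /partial derive_cst mulr0.
by apply: DeriveDef; [exact: derivable_cst|exact: derive_cst].
Qed.

Lemma has_gradient_prod (I : Type) (s : seq I) (F : I -> V -> R) :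
  (forall i, Ck 1 (F i)) -> (forall i, has_gradient (F i)) ->
  has_gradient (\prod_(i <- s) F i).
Proof.
move=> hF hG; elim: s => [|i s IH]; first by rewrite big_nil; exact: has_gradient_cst.
by rewrite big_cons; apply: has_gradient_mul => //; exact: Ck_prod.
Qed.

Lemma is_derive_scale (F : R -> R) (y v D : R) :
  is_derive y (1 : R) F D -> is_derive y v F (v * D).
Proof.
move=> hD; have dF : differentiable F y by apply/derivable1_diffP.
apply: DeriveDef; first exact: diff_derivable.
rewrite deriveE// -[v]mulr1 -[v * 1]/(v *: (1:R)) linearZ /= -deriveE//.
by rewrite derive_val -[v%:A]/(v * 1) mulr1.
Qed.

Lemma is_derive_flat_coord (P : {poly R}) (a c : R) (i : 'I_d) (x v : V) :
  is_derive x v (fun x : V => flat P (a * x 0 i + c))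
    (a * v 0 i * flat (flat_deriv P) (a * x 0 i + c)).
Proof.
have := is_derive_scale (a * v 0 i) (is_derive_flat P (a * x 0 i + c)).
have E : (fun h : R => h^-1 *: (flat P (h *: (a * v 0 i) + (a * x 0 i + c)) - flat P (a * x 0 i + c)))
   = (fun h : R => h^-1 *: (flat P (a * (h *: v + x) 0 i + c) - flat P (a * x 0 i + c))).
  apply/funext => h; congr (_ *: (flat P _ - _)).
  by rewrite !mxE /GRing.scale/=; ring.
move=> [D1 D2]; move: D1 D2; rewrite /derivable /derive /= => D1 D2.
by apply: DeriveDef; rewrite /derivable /derive /= -E.
Qed.

Lemma partial_flat_coord (P : {poly R}) (a c : R) (i j : 'I_d) :
  partial j (fun x : V => flat P (a * x 0 i + c)) =
  cst (a * (j == i)%:R) * (fun x : V => flat (flat_deriv P) (a * x 0 i + c)).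
Proof.
apply/funext => x; have h := is_derive_flat_coord P a c i x (delta_mx 0 j).
by rewrite /partial derive_val mxE eqxx eq_sym.
Qed.

Lemma continuous_flat (P : {poly R}) : continuous (flat P).
Proof.
move=> x; have [h _] := is_derive_flat P x.
by apply: differentiable_continuous; apply/derivable1_diffP.
Qed.

Lemma Ck_flat_coord k (P : {poly R}) (a c : R) (i : 'I_d) :
  Ck k (fun x : V => flat P (a * x 0 i + c)).
Proof.
have cont Q : continuous (fun x : V => flat Q (a * x 0 i + c)).
  move=> x; apply: (@continuous_comp _ _ _ (fun x : V => a * x 0 i + c) (flat Q)).
    apply: (@lipschitz_continuous R d _ (`|a| + 1)); first by rewrite ltr_wpDl.
    move=> u v; rewrite (_ : _ - _ = a * (u - v) 0 i); last by rewrite !mxE; ring.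
    by rewrite normrM ler_pM// ?lerDl// norm_coord.
  exact: continuous_flat.
elim: k P => [|k IH] P; (split; first exact: cont) => // j; split.
  by move=> x; have [] := is_derive_flat_coord P a c i x (delta_mx 0 j).
by rewrite partial_flat_coord; apply: Ck_mul; [exact: Ck_cst|exact: IH].
Qed.

Lemma has_gradient_flat_coord (P : {poly R}) (a c : R) (i : 'I_d) :
  has_gradient (fun x : V => flat P (a * x 0 i + c)).
Proof.
move=> x v; apply: is_derive_eq (is_derive_flat_coord P a c i x v) _.
rewrite (bigD1 i)//= big1 ?addr0 => [|j ji]; rewrite partial_flat_coord.
  rewrite [RHS](_ : _ = v 0 i * (a * (i == i)%:R * flat (flat_deriv P) (a * x 0 i + c)))//.
  by rewrite eqxx /= mulr1; ring.
rewrite [LHS](_ : _ = v 0 j * (a * (j == i)%:R * flat (flat_deriv P) (a * x 0 i + c)))//.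
by rewrite (negbTE ji) /= mulr0 mul0r mulr0.
Qed.

(** Each factor is positive exactly for |x_i - z_i| < r, so that the support
    is a cube, i.e. a ball of the maximum norm. The affine maps are written in
    the form covered by [Ck_flat_coord]. *)
Definition bump (z : V) (r : R) : V -> R :=
  \prod_(i : 'I_d) ((fun x : V => flat 1 (1 * x 0 i + (r - z 0 i))) *
                    (fun x : V => flat 1 (-1 * x 0 i + (r + z 0 i)))).

Lemma bumpE z r x : bump z r x =
  \prod_(i : 'I_d) (flat 1 (r + (x 0 i - z 0 i)) * flat 1 (r - (x 0 i - z 0 i))).
Proof.
rewrite /bump fct_prodE; apply: eq_bigr => i _.
by rewrite [LHS]/GRing.mul/=; congr (flat _ _ * flat _ _); ring.
Qed.

Lemma Ck_bump k z r : Ck k (bump z r).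
Proof. by apply: Ck_prod => i; apply: Ck_mul; exact: Ck_flat_coord. Qed.

Lemma has_gradient_bump z r : has_gradient (bump z r).
Proof.
apply: has_gradient_prod => i; first by apply: Ck_mul; exact: Ck_flat_coord.
by apply: has_gradient_mul; solve [exact: Ck_flat_coord|exact: has_gradient_flat_coord].
Qed.

Lemma flat1_ge0 (x : R) : 0 <= flat 1 x.
Proof. by rewrite /flat; case: ltP => // x0; rewrite hornerC mul1r expR_ge0. Qed.

Lemma flat1_gt0 (x : R) : (0 < flat 1 x) = (0 < x).
Proof.
by rewrite /flat; case: (ltP 0 x) => _; rewrite ?ltxx// hornerC mul1r expR_gt0.
Qed.

Lemma flat1_neq0 (x : R) : (flat 1 x != 0) = (0 < x).
Proof. by rewrite -flat1_gt0 lt0r flat1_ge0 andbT. Qed.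

Lemma bump_ge0 z r x : 0 <= bump z r x.
Proof. by rewrite bumpE; apply: prodr_ge0 => i _; rewrite mulr_ge0// flat1_ge0. Qed.

Lemma bump_gt0 z r x : 0 < r -> `|x - z| < r -> 0 < bump z r x.
Proof.
move=> r0 xz; rewrite bumpE; apply: prodr_gt0 => i _.
have := le_lt_trans (norm_coord (x - z) i) xz; rewrite !mxE ltr_norml => /andP[h1 h2].
by rewrite mulr_gt0// flat1_gt0; lra.
Qed.

Lemma bump_supp z r x : bump z r x != 0 -> 0 <= r -> `|x - z| <= r.
Proof.
rewrite bumpE => /prodf_neq0 h r0; apply: norm_le_coord => // i.
have := h i isT; rewrite mulf_eq0 negb_or !flat1_neq0 !mxE => /andP[h1 h2].
by rewrite ler_norml; apply/andP; split; lra.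
Qed.

Lemma bump_shift z r x v : bump (z + v) r x = bump z r (x - v).
Proof.
rewrite !bumpE; apply: eq_bigr => i _; rewrite !mxE.
by congr (flat _ _ * flat _ _); ring.
Qed.

Lemma test_function_bump (C : set V) z r : 0 <= r ->
  (forall x, `|x - z| <= r -> C x) -> test_function C (bump z r).
Proof.
move=> r0 hC.
have cB : closed [set x : V | `|x - z| <= r].
  apply: (@closed_comp _ _ (fun x : V => `|x - z|) [set y : R | y <= r]).
    move=> x _; apply: (@lipschitz_continuous R d _ 1) => // u v; rewrite mul1r.
    by apply: le_trans (ler_dist_dist _ _) _; rewrite opprB addrA subrK.
  exact: closed_le.
have sub : closure [set x | bump z r x != 0] `<=` [set x : V | `|x - z| <= r].
  have E := (closure_id _).1 cB; rewrite [X in _ `<=` X]E; apply: closure_subset => x /=.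
  by move=> hx; exact: bump_supp hx r0.
split; first by move=> k; exact: Ck_bump.
  apply: bounded_closed_compact; last exact: closed_closure.
  exists (`|z| + r); split; first exact: num_real.
  move=> M hM x /sub /= xz; apply: le_trans (ltW hM).
  by rewrite -[x](subrK z) (le_trans (ler_normD _ _))// addrC lerD.
by move=> x /sub; exact: hC.
Qed.

Lemma partial_shift i (f : V -> R) (z y : V) :
  partial i (fun x => f (x - z)) y = partial i f (y - z).
Proof.
rewrite /partial /derive; set A := (X in lim (X @ _)); set B := (X in _ = lim (X @ _)).
by suff -> : A = B by []; apply/funext => h; rewrite /A /B /= addrA.
Qed.

Lemma partial_bump_shift i (z : V) r y : partial i (bump z r) y = partial i (bump 0 r) (y - z).
Proof.
rewrite -partial_shift; congr (partial i _ y); apply/funext => x.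
by rewrite -bump_shift add0r.
Qed.

Lemma bump0E (z : V) r y : bump z r y = bump 0 r (y - z).
Proof. by rewrite -bump_shift add0r. Qed.

Lemma compact_ball r : 0 <= r -> compact [set x : V | `|x| <= r].
Proof.
move=> r0; apply: bounded_closed_compact.
  by exists r; split; [exact: num_real|move=> M hM x /= /le_trans; apply; exact: ltW].
apply: (@closed_comp _ _ (fun x : V => `|x|) [set y : R | y <= r]).
  move=> x _; apply: (@lipschitz_continuous R d _ 1) => // u v; rewrite mul1r.
  exact: ler_dist_dist.
exact: closed_le.
Qed.

Lemma continuous_supp_bounded (f : V -> R) r : 0 <= r -> continuous f ->
  (forall x, r < `|x| -> f x = 0) -> exists2 M, 0 <= M & forall x, `|f x| <= M.
Proof.
move=> r0 cf f0.
have [M [_ hM]] := compact_bounded (continuous_compact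
  (continuous_subspaceT cf) (compact_ball r0)).
exists (`|M| + 1); first by rewrite addr_ge0.
move=> x; have [xr|xr] := leP `|x| r; last by rewrite f0// normr0 addr_ge0.
by apply: hM; [rewrite (le_lt_trans (ler_norm M))// ltrDl|exists x].
Qed.

Lemma bump_supp0 r x : 0 <= r -> r < `|x| -> bump 0 r x = 0.
Proof.
move=> r0 xr; apply/eqP; apply: contraTT xr => /bump_supp /(_ r0).
by rewrite subr0 -leNgt.
Qed.

Lemma partial_bump_supp i r x : 0 <= r -> r < `|x| -> partial i (bump 0 r) x = 0.
Proof.
move=> r0 xr; rewrite /partial (@near_eq_derive _ _ _ _ (cst 0)) ?derive_cst//.
apply/nbhs_ballP; exists (`|x| - r); first by rewrite /= subr_gt0.
move=> y; rewrite -ball_normE /= => xy; apply: bump_supp0 => //.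
by have := ler_dist_dist x y; rewrite ler_norml => /andP[_]; lra.
Qed.

Lemma continuous_bump z r : continuous (bump z r).
Proof. exact: Ck_continuous (Ck_bump 0 z r). Qed.

Lemma continuous_partial_bump i z r : continuous (partial i (bump z r)).
Proof. exact: Ck_continuous (Ck_partial i (Ck_bump 1 z r)). Qed.

Lemma bump_bounded r : 0 <= r -> exists2 M : R, 0 <= M & forall x, `|bump 0 r x| <= M.
Proof.
move=> r0; apply: (continuous_supp_bounded r0 (@continuous_bump 0 r)) => x.
exact: bump_supp0.
Qed.

Lemma partial_bump_bounded r : 0 <= r ->
  exists2 M : R, 0 <= M & forall i x, `|partial i (bump 0 r) x| <= M.
Proof.
move=> r0.
have /choice[M hM] : forall i, exists M : R, 0 <= M /\ forall x, `|partial i (bump 0 r) x| <= M.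
  move=> i; have [|M M0 hM] := @continuous_supp_bounded (partial i (bump 0 r)) r r0 (@continuous_partial_bump i 0 r).
    by move=> x; exact: partial_bump_supp.
  by exists M.
exists (\sum_i M i); first by apply: sumr_ge0 => i _; have [] := hM i.
move=> i x; rewrite (bigD1 i)//=; apply: le_trans ((hM i).2 x) _.
by rewrite lerDl; apply: sumr_ge0 => j _; have [] := hM j.
Qed.

(** The fundamental theorem of calculus along the segment. *)
Lemma bump_increment r (v t : V) :
  (\int[lebesgue_measure]_(s in `]0%R, 1%R[)
     (\sum_i t 0 i * partial i (bump 0 r) (v + s *: t))%:E =
   (bump 0 r (v + t) - bump 0 r v)%:E)%E.
Proof.
pose F s := bump 0 r (v + s *: t).
pose f s := \sum_i t 0 i * partial i (bump 0 r) (v + s *: t).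
have cl : continuous (fun s : R => v + s *: t).
  by move=> s; apply: cvgD; [exact: cvg_cst|apply: cvgZl; exact: cvg_id].
have cf : continuous f.
  apply: continuous_big_sum => i s; apply: cvgM; first exact: cvg_cst.
  apply: (@continuous_comp _ _ _ (fun s : R => v + s *: t)); first exact: cl.
  exact: continuous_partial_bump.
have cF : continuous F.
  move=> s; apply: (@continuous_comp _ _ _ (fun s : R => v + s *: t)); first exact: cl.
  exact: continuous_bump.
have dF s : is_derive s (1:R) F (f s).
  have [D1 D2] := has_gradient_bump 0 r (v + s *: t) t.
  have E : (fun h : R => h^-1 *: (bump 0 r (h *: t + (v + s *: t)) - bump 0 r (v + s *: t)))
      = (fun h : R => h^-1 *: (F (h *: (1:R) + s) - F s)).
    apply/funext => h; congr (_ *: (bump 0 r _ - _)).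
    by rewrite /F [h *: 1]mulr1 scalerDl addrCA.
  by move: D1 D2; rewrite /derivable /derive /= E => D1 D2; apply: DeriveDef.
have mf : measurable_fun setT f by exact: continuous_measurable_fun.
rewrite integral_itv_bndo_bndc; last by apply/measurable_EFinP; exact: measurable_funS mf.
rewrite integral_itv_obnd_cbnd; last by apply/measurable_EFinP; exact: measurable_funS mf.
rewrite (@continuous_FTC2 _ f F)//.
- by rewrite /F scale1r scale0r addr0.
- exact: continuous_subspaceT.
- split; first by move=> s _; have [] := dF s.
    by apply: cvg_at_right_filter; exact: cF.
  by apply: cvg_at_left_filter; exact: cF.
- by move=> s _; rewrite derive1E; exact: derive_val.
Qed.

End CkClosure.

(** * Mollification *)

Lemma lebesgue01 {R : realType} : @lebesgue_measure R `]0%R, 1%R[%classic = 1%E.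
Proof. by rewrite lebesgue_measure_itv/= lte_fin ltr01 sube0. Qed.

Section Mollify.
Context {R : realType} (d : nat).
Local Notation V := 'rV[R]_d.
Local Notation mu := (@lebesgue_measure R).
Local Notation vol := (@vol R d).
Local Notation Bor := (Bor R d).
Local Notation R1 := (measurableTypeR R).

Lemma leb_ball_lty (rho : R) : (vol [set y : V | (`|y| <= rho)%R] < +oo)%E.
Proof.
apply: le_lt_trans (leb_cube_lty d (rho + 1)).
apply: (@le_outer_measure _ _ (@lebesgue_outer R d)) => x /= xr i.
have := le_trans (norm_coord x i) xr; rewrite ler_norml => /andP[h1 h2].
by apply/andP; split; lra.
Qed.

Lemma measurable_norm : measurable_fun setT ((fun x => `|x|) : Bor -> R).
Proof.
apply: continuous_Bor; apply: (@lipschitz_continuous R d _ 1) => // u v.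
by rewrite mul1r; exact: ler_dist_dist.
Qed.

Lemma measurable_ball (rho : R) : measurable ([set y : V | `|y| <= rho] : set Bor).
Proof.
rewrite (_ : [set y : V | _] = (fun x : V => `|x|) @^-1` `]-oo, rho]).
  by rewrite -[X in measurable X]setTI; apply: measurable_norm.
by apply/seteqP; split => x /=; rewrite in_itv.
Qed.

Lemma ge0_bounded_supp_lty (F : V -> R) (B rho : R) :
    measurable_fun setT (F : Bor -> R) -> (forall y, `|F y| <= B) ->
    (forall y, rho < `|y| -> F y = 0) ->
  (\int[vol]_y (`|F y|%R)%:E <= B%:E * vol [set y : V | (`|y| <= rho)%R])%E.
Proof.
move=> mF FB F0; have B0 : 0 <= B by exact: le_trans (normr_ge0 _) (FB 0).
have mQ := measurable_ball rho.
rewrite -(setIT [set y | _]) -(integral_indic vol measurableT mQ).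
rewrite -ge0_integralZl//; last by apply/measurable_EFinP; exact: measurable_indic.
apply: ge0_le_integral => //.
- by apply/measurable_EFinP; exact: measurableT_comp.
- apply/measurable_EFinP; apply: measurable_funM => //; exact: measurable_indic.
move=> y _; rewrite -EFinM lee_fin indicE; case: (boolP (y \in _)) => [_|/negP ny].
  by rewrite mulr1.
rewrite F0 ?normr0 ?mulr0//; rewrite ltNge; apply/negP => yr; apply: ny.
by rewrite inE.
Qed.

Lemma bounded_supp_integrable (F : V -> R) (B rho : R) :
    measurable_fun setT (F : Bor -> R) -> (forall y, `|F y| <= B) ->
    (forall y, rho < `|y| -> F y = 0) ->
  vol.-integrable setT (EFin \o F).
Proof.
move=> mF FB F0; apply/integrableP; split; first exact/measurable_EFinP.
apply: le_lt_trans (ge0_bounded_supp_lty mF FB F0) _.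
have B0 : 0 <= B by exact: le_trans (normr_ge0 _) (FB 0).
by rewrite lte_mul_pinfty ?lee_fin// leb_ball_lty.
Qed.

Lemma measurable_bump z r : measurable_fun setT (bump z r : Bor -> R).
Proof. by apply: continuous_Bor; exact: continuous_bump. Qed.

(** The convolution with a bump, not normalized: its mass [bump_mass] is
    divided out only at the end. *)
Definition mol (f : V -> R) (r : R) (z : V) : R := \int[vol]_y (f y * bump z r y).

Context (f1 : V -> R) (c r : R) (mf1 : measurable_fun setT (f1 : Bor -> R)).
Context (f1c : forall y, `|f1 y| <= c) (r0 : 0 <= r).

Lemma mol_integrable z : vol.-integrable setT (fun y => (f1 y * bump z r y)%:E).
Proof.
have [M M0 hM] := @bump_bounded R d r r0.
apply: (@bounded_supp_integrable _ (c * M) (`|z| + r)).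
- by apply: measurable_funM => //; exact: measurable_bump.
- by move=> y; rewrite normrM ler_pM// bump0E.
move=> y hy; rewrite bump0E bump_supp0 ?mulr0//.
by have := lerB_normD y (- z); rewrite normrN; lra.
Qed.

Lemma mol_EFin z : (mol f1 r z)%:E = (\int[vol]_y (f1 y * bump z r y)%:E)%E.
Proof. by rewrite /mol /Rintegral fineK// (integrable_fin_num measurableT (mol_integrable z)). Qed.

Section Increment.
Context (x t : V).

Let D (s : R) (y : V) := \sum_i (- t 0 i) * partial i (bump (x + s *: t) r) y.

Let DE s y : D s y = \sum_i (- t 0 i) * partial i (bump 0 r) ((y - x) + s *: (- t)).
Proof.
apply: eq_bigr => i _; rewrite partial_bump_shift scalerN; congr (_ * partial i _ _).
by rewrite opprD addrA.
Qed.

Lemma measurable_D : measurable_fun setT ((fun z => D z.1 z.2) : R1 * Bor -> R).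
Proof.
rewrite (_ : (fun z => _) = (fun z : R1 * Bor => \sum_i (- t 0 i) *
    (partial i (bump 0 r) \o (fun z : R1 * Bor => ((z.2 : V) - x) + z.1 *: (- t))) z)); last first.
  by apply/funext => z; rewrite DE.
apply: measurable_sum => i; apply: measurable_funM => //.
apply: (@measurableT_comp _ _ _ _ Bor).
  by apply: continuous_Bor; exact: continuous_partial_bump.
apply: measurable_fun_Bor => j.
rewrite (_ : (fun _ => _) = (fun z : R1 * Bor => ((z.2 : V) 0 j - x 0 j) + z.1 * (- t 0 j))); last first.
  by apply/funext => z; rewrite !mxE.
apply: measurable_funD.
  apply: measurable_funB => //.
  exact: measurableT_comp (measurable_coord j) (measurable_snd).
apply: measurable_funM => //; exact: measurable_fst.
Qed.

Let g (z : R1 * Bor) : \bar R := (\1_(`]0%R, 1%R[ : set R1) z.1 * (f1 z.2 * D z.1 z.2))%:E.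

Let mg : measurable_fun setT g.
Proof.
apply/measurable_EFinP; apply: measurable_funM.
  by apply: measurableT_comp measurable_fst; exact: measurable_indic.
apply: measurable_funM; last exact: measurable_D.
exact: measurableT_comp mf1 measurable_snd.
Qed.

Let D_bound : exists2 B : R, 0 <= B & forall s y, `|D s y| <= B.
Proof.
have [M M0 hM] := @partial_bump_bounded R d r r0.
exists (\sum_i `|t 0 i| * M); first by apply: sumr_ge0 => i _; rewrite mulr_ge0.
move=> s y; rewrite DE; apply: le_trans (ler_norm_sum _ _ _) _; apply: ler_sum => i _.
by rewrite normrM normrN ler_wpM2l.
Qed.

Let D_supp s y : 0 <= s <= 1 -> `|x| + `|t| + r < `|y| -> D s y = 0.
Proof.
move=> /andP[s0 s1] hy; rewrite DE big1// => i _; rewrite partial_bump_supp ?mulr0//.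
have := lerB_normD y (- x + s *: (- t)); rewrite -addrA.
have := ler_normD (- x) (s *: (- t)); rewrite normrN normrZ normrN (ger0_norm s0).
have : s * `|t| <= `|t| by rewrite ler_piMl.
rewrite [y + _]addrA; lra.
Qed.

Let ig : (mu \x vol)%E.-integrable setT g.
Proof.
have [B B0 hB] := D_bound; have c0 : 0 <= c by exact: le_trans (normr_ge0 _) (f1c 0).
apply/(@integrable12ltyP _ _ R1 Bor R mu vol g mg).
pose Q := [set y : V | `|y| <= `|x| + `|t| + r].
have vQ : vol Q \is a fin_num by rewrite ge0_fin_numE ?leb_ball_lty.
apply: (@le_lt_trans _ _ (\int[mu]_s ((c * B)%:E * vol Q * (\1_(`]0%R, 1%R[ : set R1) s)%:E))%E).
  apply: ge0_le_integral; first exact: measurableT.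
  - by move=> s _; apply: integral_ge0.
  - have := @measurable_fun_fubini_tonelli_F _ _ R1 Bor R vol (fun z => `|g z|)%E.
    by apply => //; exact: measurableT_comp.
  - by apply: emeasurable_funM => //; apply/measurable_EFinP; exact: measurable_indic.
  move=> s _; rewrite /g /= indicE; case: (boolP (s \in _)) => [|_]; last first.
    by rewrite mule0 integral0_eq// => y _; rewrite mul0r normr0.
  rewrite inE/= in_itv/= => /andP[s0 s1]; rewrite mule1.
  under eq_integral do rewrite mul1r.
  apply: ge0_bounded_supp_lty => [|y|y hy].
  - apply: measurable_funM => //.
    exact: (@measurable_fun_pair2 _ _ _ R1 Bor _ (fun z => D z.1 z.2) s measurable_D).
  - by rewrite normrM ler_pM.
  - by rewrite D_supp ?mulr0// !ltW.
rewrite ge0_integralZl//; last 2 first.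
- by apply/measurable_EFinP; exact: measurable_indic.
- by rewrite mule_ge0// lee_fin mulr_ge0.
rewrite integral_indic// setIT lte_mul_pinfty//.
- by rewrite mule_ge0// lee_fin mulr_ge0.
- by rewrite fin_numM.
- by rewrite [X in (X < _)%E]lebesgue01 ltry.
Qed.

(** The increment of the mollified function is an integral of increments of
    the bump along the segment; Fubini exchanges the two integrals. The inner
    integral then has the form to which the definition of the weak gradient
    applies. *)
Lemma mol_increment :
  (\int[mu]_(s in `]0%R, 1%R[) \int[vol]_y (f1 y * D s y)%:E =
   (mol f1 r (x + t) - mol f1 r x)%:E)%E.
Proof.
transitivity (\int[mu]_s \int[vol]_y g (s, y))%E.
  rewrite integral_mkcond; apply: eq_integral => s _; rewrite patchE /g /= indicE.
  case: ifP => _; first by apply: eq_integral => y _; rewrite mul1r.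
  by rewrite integral0_eq// => y _; rewrite mul0r.
rewrite (@Fubini _ _ R1 Bor R mu vol g ig).
have ix := mol_integrable x; have ixt := mol_integrable (x + t).
transitivity (\int[vol]_y (f1 y * bump (x + t) r y)%:E -
              \int[vol]_y (f1 y * bump x r y)%:E)%E; last by rewrite -!mol_EFin.
apply: etrans (integralB_EFin measurableT ixt ix).
apply: eq_integral => y _; rewrite /g /=.
rewrite -EFinB -mulrBr.
transitivity (\int[mu]_(s in `]0%R, 1%R[) ((f1 y)%:E * (D s y)%:E))%E.
  rewrite [RHS]integral_mkcond; apply: eq_integral => s _; rewrite patchE indicE.
  by case: ifP => _; [rewrite mul1r EFinM|rewrite mul0r].
have := @bump_increment R d r (y - x) (- t).
rewrite (_ : (fun s => _) = (fun s => (D s y)%:E)); last first.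
  apply/funext => s; rewrite DE; congr (_%:E); apply: eq_bigr => i _.
  by rewrite mxE.
rewrite -addrA -opprD -!bump0E => E.
rewrite integralZl ?E//; apply/integrableP; split.
  apply/measurable_EFinP; apply: (measurable_funS measurableT (@subsetT _ _)).
  exact: (@measurable_fun_pair1 _ _ _ R1 Bor _ (fun z => D z.1 z.2) y measurable_D).
have [B B0 hB] := D_bound.
apply: (@le_lt_trans _ _ (\int[mu]_(s in `]0%R, 1%R[) B%:E)%E).
  apply: ge0_le_integral => //; last by move=> s _; rewrite lee_fin.
  apply/measurable_EFinP; apply: measurableT_comp => //.
  apply: (measurable_funS measurableT (@subsetT _ _)).
  exact: (@measurable_fun_pair1 _ _ _ R1 Bor _ (fun z => D z.1 z.2) y measurable_D).
rewrite (_ : (fun _ => B%:E) = cst B%:E)// integral_cst// lte_mul_pinfty//.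
by rewrite [X in (X < _)%E]lebesgue01 ltry.
Qed.

Lemma measurable_mol_increment :
  measurable_fun setT ((fun s => \int[vol]_y (f1 y * D s y)%:E)%E : R1 -> \bar R).
Proof.
pose g' (z : R1 * Bor) : \bar R := (f1 z.2 * D z.1 z.2)%:E.
have mg' : measurable_fun setT g'.
  apply/measurable_EFinP; apply: measurable_funM; last exact: measurable_D.
  exact: measurableT_comp mf1 measurable_snd.
rewrite (_ : (fun s => _) = (fun s => (\int[vol]_y (g'^\+ (s, y)) - \int[vol]_y (g'^\- (s, y)))%E)).
  apply: emeasurable_funB.
    apply: (@measurable_fun_fubini_tonelli_F _ _ R1 Bor R vol (g'^\+)%E) => //.
    exact: measurable_funepos.
  apply: (@measurable_fun_fubini_tonelli_F _ _ R1 Bor R vol (g'^\-)%E) => //.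
  exact: measurable_funeneg.
apply/funext => s; rewrite [LHS]integralE.
by congr (_ - _)%E; apply: eq_integral => y _; rewrite ?funeposE ?funenegE.
Qed.

Context (G : 'I_d -> V -> R) (mG : forall i, measurable_fun setT (G i : Bor -> R)).
Context (Gam : V -> R) (mGam : measurable_fun setT (Gam : Bor -> R)).
Context (nt : R) (nt0 : 0 <= nt) (Gam0 : forall y, 0 <= Gam y).
Context (tG : forall y, `|\sum_i t 0 i * G i y| <= nt * Gam y).
Context (iG : forall i z, vol.-integrable setT (fun y => (G i y * bump z r y)%:E)).
Context (wG : forall i s, 0 < s < 1 ->
  \int[vol]_y (f1 y * partial i (bump (x + s *: t) r) y) =
  - \int[vol]_y (G i y * bump (x + s *: t) r y)).

Lemma measurable_Gam_bump :
  measurable_fun setT ((fun z => \int[vol]_y (Gam y * bump z r y)%:E)%E : Bor -> \bar R).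
Proof.
pose h (z : Bor * Bor) : \bar R := (Gam z.2 * bump z.1 r z.2)%:E.
apply: (@measurable_fun_fubini_tonelli_F _ _ Bor Bor R vol h) => [|z].
  apply/measurable_EFinP; apply: measurable_funM.
    exact: measurableT_comp mGam measurable_snd.
  rewrite (_ : (fun z => _) = (fun z : Bor * Bor => bump 0 r ((z.2 : V) - (z.1 : V)))); last first.
    by apply/funext => z; rewrite bump0E.
  apply: (@measurableT_comp _ _ _ _ Bor); first exact: measurable_bump.
  apply: measurable_fun_Bor => j.
  rewrite (_ : (fun _ => _) = (fun z : Bor * Bor => (z.2 : V) 0 j - (z.1 : V) 0 j)); last first.
    by apply/funext => z; rewrite !mxE.
  apply: measurable_funB.
    exact: measurableT_comp (measurable_coord j) (measurable_snd).
  exact: measurableT_comp (measurable_coord j) (measurable_fst).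
by rewrite lee_fin mulr_ge0// bump_ge0.
Qed.

(** The weak gradient, tested on the bump centred at a point of the segment,
    replaces the derivative of the bump; [tG] then bounds its pairing with [t]
    by the dual norm [Gam] of the gradient. *)
Lemma mol_increment_le :
  (`|mol f1 r (x + t) - mol f1 r x|%:E <=
   nt%:E * \int[mu]_(s in `]0%R, 1%R[) \int[vol]_y (Gam y * bump (x + s *: t) r y)%:E)%E.
Proof.
have mH : measurable_fun setT
    ((fun s => \int[vol]_y (Gam y * bump (x + s *: t) r y)%:E)%E : R1 -> \bar R).
  have ml : measurable_fun setT ((fun s : R1 => x + s *: t) : R1 -> Bor).
    apply: measurable_fun_Bor => j.
    rewrite (_ : (fun _ => _) = (fun s : R1 => x 0 j + s * t 0 j)); last first.
      by apply/funext => s; rewrite !mxE.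
    by apply: measurable_funD => //; exact: measurable_funM.
  exact: (measurableT_comp measurable_Gam_bump ml).
have H0 z : (0 <= \int[vol]_y (Gam y * bump z r y)%:E)%E.
  by apply: integral_ge0 => y _; rewrite lee_fin mulr_ge0// bump_ge0.
rewrite -abse_EFin -mol_increment.
apply: le_trans (le_abse_integral mu _ _) _ => //.
  exact: measurable_funS measurable_mol_increment.
rewrite -ge0_integralZl//; last exact: measurable_funS mH.
apply: ge0_le_integral; first exact: measurable_itv.
- by move=> s _; exact: abse_ge0.
- apply: measurableT_comp => //; exact: measurable_funS measurable_mol_increment.
- by apply: emeasurable_funM => //; exact: measurable_funS mH.
move=> s /=; rewrite in_itv/= => s01; set z := x + s *: t.
have ip i : vol.-integrable setT (fun y => (f1 y * partial i (bump z r) y)%:E).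
  have [M M0 hM] := @partial_bump_bounded R d r r0.
  apply: (@bounded_supp_integrable _ (c * M) (`|z| + r)).
  - apply: measurable_funM => //.
    by apply: continuous_Bor; exact: continuous_partial_bump.
  - by move=> y; rewrite normrM ler_pM// partial_bump_shift.
  move=> y hy; rewrite partial_bump_shift partial_bump_supp ?mulr0//.
  by have := lerB_normD y (- z); rewrite normrN; lra.
have -> : (\int[vol]_y (f1 y * D s y)%:E =
           \int[vol]_y (\sum_i t 0 i * G i y * bump z r y)%:E)%E.
  transitivity (\int[vol]_y \sum_i ((- t 0 i)%:E * (f1 y * partial i (bump z r) y)%:E))%E.
    apply: eq_integral => y _; rewrite /D mulr_sumr -sumEFin.
    by apply: eq_bigr => i _; rewrite -EFinM mulrCA.
  rewrite integral_sum//; last by move=> i; exact: integrableZl.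
  transitivity (\int[vol]_y \sum_i ((t 0 i)%:E * (G i y * bump z r y)%:E))%E; last first.
    apply: eq_integral => y _; rewrite -sumEFin.
    by apply: eq_bigr => i _; rewrite -EFinM mulrA.
  rewrite integral_sum//; last by move=> i; exact: integrableZl.
  apply: eq_bigr => i _; rewrite !integralZl//.
  have := wG i s01; rewrite /Rintegral -/z => E.
  rewrite -(fineK (integrable_fin_num measurableT (ip i))).
  rewrite -(fineK (integrable_fin_num measurableT (iG i z))) -!EFinM.
  by congr (_%:E); rewrite E mulrNN.
have mb := measurable_bump z r.
have mS : measurable_fun setT ((fun y => \sum_i t 0 i * G i y * bump z r y) : Bor -> R).
  by apply: measurable_sum => i; do 2 apply: measurable_funM => //.
apply: le_trans (le_abse_integral vol _ _) _ => //; first exact/measurable_EFinP.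
rewrite -ge0_integralZl//; last 2 first.
- by apply/measurable_EFinP; exact: measurable_funM.
- by move=> y _; rewrite lee_fin mulr_ge0// bump_ge0.
apply: ge0_le_integral => //.
- by apply: measurableT_comp => //; exact/measurable_EFinP.
- by apply/measurable_EFinP; do 2 apply: measurable_funM => //.
move=> y _; rewrite abse_EFin -EFinM lee_fin -mulr_suml normrM (ger0_norm (bump_ge0 _ _ _)).
by rewrite mulrA ler_wpM2r// bump_ge0.
Qed.

End Increment.
End Mollify.

(** * Hoelder duality on the cone *)

Definition conjugate {R : realType} (p : \bar R) (q : R) : Prop :=
  match p with
  | r%:E => [/\ 0 < r, 0 < q & r^-1 + q^-1 = 1]
  | +oo%E => q = 1
  | -oo%E => False
  end.

Lemma hoelder_restrict d (T : measurableType d) (R : realType)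
    (mu : {measure set T -> \bar R}) (p : \bar R) (q : R) (D : set T)
    (a F : T -> R) (c : R) :
    conjugate p q -> (0 < mu setT)%E -> measurable D -> 0 <= c ->
    measurable_fun setT a -> (forall y, 0 <= a y) ->
    measurable_fun D F -> (Lnorm mu p ((EFin \o F) \_ D) <= c%:E)%E ->
  (\int[mu]_(y in D) (a y * `|F y|)%:E <=
   c%:E * (\int[mu]_y (a y `^ q)%:E) `^ q^-1)%E.
Proof.
move=> pq mu0 mD c0 ma a0 mF.
have mFD : measurable_fun setT (F \_ D) by exact/(measurable_restrictT _ mD).1.
have mq r : measurable_fun setT (fun y => (a y `^ r)%:E).
  by apply/measurable_EFinP; exact: (measurableT_comp (measurable_powR _) ma).
have -> : (\int[mu]_(y in D) (a y * `|F y|)%:E = \int[mu]_y (a y * `|(F \_ D) y|)%:E)%E.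
  rewrite integral_mkcond; apply: eq_integral => y _; rewrite !patchE.
  by case: ifP => // _; rewrite normr0 mulr0.
rewrite restrict_EFin; case: p pq => [r [r0 q0 rq]| q1|//] hF.
  have := hoelder mu mFD ma r0 q0 rq.
  rewrite Lnorm1; under eq_integral do rewrite /= normrM mulrC (ger0_norm (a0 _)).
  move=> /le_trans; apply.
  rewrite [X in (_ * X)%E](_ : _ = (\int[mu]_y (a y `^ q)%:E) `^ q^-1)%E; last first.
    rewrite unlock; apply: (congr1 (fun z => z `^ q^-1)%E).
    by apply: eq_integral => y _ /=; rewrite (ger0_norm (a0 _)).
  by apply: lee_wpmul2r => //; exact: poweR_ge0.
move: hF; rewrite q1 invr1 poweRe1; last by apply: integral_ge0 => y _; rewrite lee_fin powR_ge0.
rewrite unlock mu0 => /ess_supP hF.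
rewrite -ge0_integralZl//; last by move=> y _; rewrite lee_fin powR_ge0.
apply: ae_ge0_le_integral => //.
- by move=> y _; rewrite lee_fin mulr_ge0.
- apply/measurable_EFinP; apply: measurable_funM => //.
  exact: measurableT_comp.
- by move=> y _; rewrite mule_ge0// lee_fin powR_ge0.
- exact: emeasurable_funM.
apply: filterS hF => y /= hF _; rewrite powRr1// mulrC -EFinM lee_fin.
by rewrite ler_wpM2r.
Qed.

Section Transfer.
Context {R : realType} (d : nat).
Local Notation V := 'rV[R]_d.
Local Notation leb := (@leb R d).
Local Notation vol := (@vol R d).
Local Notation Bor := (Bor R d).
Local Notation Leb := (Leb R d).

Lemma measurable_fun_Leb d' (T : measurableType d') (D : set V) (f : V -> T) :
  measurable_fun (D : set Bor) (f : Bor -> T) -> measurable (D : set Bor) ->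
  measurable_fun (D : set Leb) (f : Leb -> T).
Proof. by move=> mf mD _ A mA; apply: Bor_Leb; exact: mf. Qed.

Lemma integral_vol (f : V -> \bar R) : measurable_fun setT (f : Bor -> \bar R) ->
  (\int[vol]_x f x = \int[leb]_x f x)%E.
Proof.
move=> mf; rewrite [LHS]integralE [RHS]integralE.
rewrite (@ge0_integral_vol _ _ setT) ?(@ge0_integral_vol _ _ setT)//.
- exact: measurable_funeneg.
- exact: measurable_funepos.
Qed.

Lemma leb_null (Z : set V) : measurable (Z : set Bor) -> vol Z = 0%E ->
  leb.-negligible Z.
Proof. by move=> mZ Z0; exists Z; split => //; exact: Bor_Leb. Qed.

(** The bridge between the two sigma-algebras: a Borel version that vanishes
    off the domain has the same integral. *)
Lemma integral_leb_vol (D Z : set V) (F G : V -> \bar R) :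
    measurable (D : set Bor) -> measurable (Z : set Bor) -> vol Z = 0%E ->
    measurable_fun (D : set Leb) (F : Leb -> \bar R) ->
    measurable_fun setT (G : Bor -> \bar R) ->
    (forall y, D y -> ~ Z y -> G y = F y) -> (forall y, ~ D y -> G y = 0%E) ->
  (\int[leb]_(x in D) F x = \int[vol]_x G x)%E.
Proof.
move=> mD mZ Z0 mF mG GF G0; have mDL := Bor_Leb mD.
rewrite (integral_vol mG).
transitivity (\int[leb]_(x in D) G x)%E.
  apply: ae_eq_integral => //.
    by apply: (measurable_funS measurableT (@subsetT _ _)); exact: measurable_fun_Leb.
  have [N [mN N0 ZN]] := leb_null mZ Z0.
  exists N; split => // y /= hy; apply: ZN; apply: contrapT => nZ; apply: hy => Dy.
  by rewrite GF.
rewrite integral_mkcond; apply: eq_integral => y _; rewrite patchE.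
by case: ifPn => // /negP nD; rewrite G0// => Dy; apply: nD; rewrite inE.
Qed.

Lemma hoelder_cone (p : \bar R) (q : R) (D : set V) (a F : V -> R) (c : R) :
    conjugate p q -> (0 < leb setT)%E -> measurable (D : set Bor) -> 0 <= c ->
    measurable_fun setT (a : Bor -> R) -> (forall y, 0 <= a y) ->
    measurable_fun (D : set Leb) (F : Leb -> R) -> (Lp_norm p D F <= c%:E)%E ->
  (\int[leb]_(y in D) (a y * `|F y|)%:E <=
   c%:E * (\int[vol]_y (a y `^ q)%:E) `^ q^-1)%E.
Proof.
move=> pq leb0 mD c0 ma a0 mF hF; have mDL := Bor_Leb mD.
have maL : measurable_fun setT (a : Leb -> R) by exact: measurable_fun_Leb.
rewrite integral_vol; first exact: (hoelder_restrict pq leb0 mDL c0 maL a0 mF hF).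
by apply/measurable_EFinP; exact: (measurableT_comp (measurable_powR _) ma).
Qed.

End Transfer.

(** * Convergence of the mollified functions *)

Section Upper.
Context {R : realType} (d : nat) (hd : (0 < d)%N) (K C : set 'rV[R]_d).
Context (hK : convex_body K) (hC : open_fg_cone C).
Local Notation V := 'rV[R]_d.
Local Notation N := (gauge_norm K).
Local Notation N' := (dual_norm K).
Local Notation mu := (@lebesgue_measure R).
Local Notation leb := (@leb R d).
Local Notation vol := (@vol R d).
Local Notation Bor := (Bor R d).
Local Notation Leb := (Leb R d).
Local Notation R1 := (measurableTypeR R).

Lemma ge0_integral_shift (f : V -> \bar R) (v : V) :
  measurable_fun setT (f : Bor -> \bar R) -> (forall x, 0 <= f x)%E ->
  (\int[vol]_x f (x + v)%R = \int[vol]_x f x)%E.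
Proof.
move=> mf f0; rewrite [RHS](@ge0_integral_affine _ _ 1 v)// expr1n mul1e.
by apply: eq_integral => x _; rewrite scale1r.
Qed.

Lemma measurable_shift (v : V) : measurable_fun setT ((fun x => x + v) : Bor -> Bor).
Proof.
rewrite (_ : (fun x => _) = (fun x : Bor => 1 *: (x : V) + v)).
  exact: measurable_affine.
by apply/funext => x; rewrite scale1r.
Qed.

Definition bump_mass (r : R) : \bar R := (\int[vol]_y (bump 0 r y)%:E)%E.

Lemma bump_mass_shift r z : (\int[vol]_y (bump z r y)%:E = bump_mass r)%E.
Proof.
rewrite -(@ge0_integral_shift _ z).
- by apply: eq_integral => y _; rewrite bump0E addrK.
- by apply/measurable_EFinP; exact: measurable_bump.
- by move=> y; rewrite lee_fin bump_ge0.
Qed.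

Lemma bump_integrable z r : 0 <= r -> vol.-integrable setT (fun y => (bump z r y)%:E).
Proof.
move=> r0; have [M M0 hM] := @bump_bounded R d r r0.
apply: (@bounded_supp_integrable _ _ _ M (`|z| + r)).
- exact: measurable_bump.
- by move=> y; rewrite bump0E.
move=> y hy; rewrite bump0E bump_supp0//.
by have := lerB_normD y (- z); rewrite normrN; lra.
Qed.

Lemma bump_mass_fin r : 0 <= r -> bump_mass r \is a fin_num.
Proof. by move=> /(bump_integrable 0) /(integrable_fin_num measurableT). Qed.

(** A ball contains a homothetic copy of the part of the body in the cone. *)
Lemma leb_ball_gt0 r : (0 < vol (K `&` C))%E -> 0 < r ->
  (0 < vol [set y : V | (`|y| < r)%R])%E.
Proof.
move=> m0 r0; rewrite lt0e measure_ge0 andbT; apply/eqP => B0.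
have [M M0 hM] := body_bound hK.
have s0 : 0 < (M + 1) / r by rewrite divr_gt0// ltr_wpDr// ltW.
have := leb_affine 0 [set y : V | `|y| < r] s0; rewrite -[X in (_ * X)%E]volE B0 mule0.
set A := [set x | _] => A0; move: m0; rewrite lt0e => /andP[/eqP + _]; apply.
apply/eqP; rewrite eq_le measure_ge0 andbT -[leRHS]A0.
apply: (@le_outer_measure _ _ (@lebesgue_outer R d)) => x [Kx _].
rewrite /A /= subr0 normrZ normfV (gtr0_norm s0) mulrC ltr_pdivrMr//.
by rewrite mulrCA mulfV ?gt_eqF// mulr1; have := hM x Kx; lra.
Qed.

(** The bump is positive on a ball, which is not negligible. *)
Lemma bump_mass_gt0 r : (0 < vol (K `&` C))%E -> 0 < r -> (0 < bump_mass r)%E.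
Proof.
move=> m0 r0; rewrite lt0e; apply/andP; split; last first.
  by apply: integral_ge0 => y _; rewrite lee_fin bump_ge0.
have mB : measurable ([set y : V | `|y| < r] : set Bor).
  rewrite (_ : [set y : V | _] = (fun x : V => `|x|) @^-1` `]-oo, r[).
    by rewrite -[X in measurable X]setTI; apply: measurable_norm.
  by apply/seteqP; split => x /=; rewrite in_itv.
apply/eqP => I0; have := leb_ball_gt0 m0 r0; rewrite lt0e => /andP[/eqP + _]; apply.
have : (\int[vol]_y `|(bump 0 r y)%:E| = 0)%E.
  by rewrite -[RHS]I0; apply: eq_integral => y _; rewrite abse_EFin ger0_norm// bump_ge0.
move/(ae_eq_integral_abs vol measurableT _).1 => /(_ _)[].
  by apply/measurable_EFinP; exact: measurable_bump.
move=> Z [mZ Z0 hZ]; apply/eqP; rewrite eq_le measure_ge0 andbT -[leRHS]Z0.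
apply: le_measure; rewrite ?inE// => y /= yr; apply: hZ => /= /(_ I)[].
by apply/eqP; rewrite gt_eqF// bump_gt0// subr0.
Qed.

(** The bump is supported in the region where [f] is close to [f z], and
    inside the cone, where [f1] represents [f]. *)
Lemma mol_cvg (f f1 : V -> R) (c : R) (z : V) :
    (0 < vol (K `&` C))%E ->
    measurable_fun setT (f1 : Bor -> R) -> (forall y, `|f1 y| <= c) ->
    {ae vol, forall y, C y -> f1 y = f y} -> C z -> {for z, continuous f} ->
  forall e, 0 < e -> exists2 r0 : R, 0 < r0 & forall r, 0 < r -> r <= r0 ->
    `|mol f1 r z / fine (bump_mass r) - f z| <= e.
Proof.
move=> m0 mf1 f1c f1f Cz cf e e0.
have oC := cone_open hC; have [r1 r10 h1] := open_normP oC Cz.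
have /nbhs_ballP[r2 /= r20 h2] : nbhs z [set y | `|f y - f z| < e].
  have : nbhs (f z) [set u | `|u - f z| < e].
    by apply/nbhs_ballP; exists e => // u; rewrite -ball_normE /= distrC.
  exact: cf.
exists (Num.min r1 r2 / 2); first by rewrite divr_gt0// lt_min r10.
move=> r r0 rr; have Ifin := bump_mass_fin (ltW r0); have I0 := bump_mass_gt0 m0 r0.
have I0' : 0 < fine (bump_mass r) by rewrite fine_gt0// I0 ltey_eq Ifin.
have rr1 : r < r1 by apply: le_lt_trans rr _; rewrite ltr_pdivrMr// gt_min; apply/orP; left; lra.
have rr2 : r < r2 by apply: le_lt_trans rr _; rewrite ltr_pdivrMr// gt_min; apply/orP; right; lra.
have r0' := ltW r0.
have ib : vol.-integrable setT (fun y => (bump z r y)%:E).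
  exact: bump_integrable.
have im := mol_integrable mf1 f1c r0' z.
rewrite -(ler_pM2r I0') -[X in _ * X <= _](gtr0_norm I0') -normrM mulrBl divfK ?gt_eqF//.
have iz : vol.-integrable setT (fun y => ((f z)%:E * (bump z r y)%:E)%E) by exact: integrableZl.
have E : ((mol f1 r z - f z * fine (bump_mass r))%:E =
    \int[vol]_y (f1 y * bump z r y - f z * bump z r y)%:E)%E.
  rewrite EFinB (mol_EFin mf1 f1c r0') EFinM fineK// -(bump_mass_shift r z).
  by rewrite -(integralZl measurableT ib) -(integralB measurableT im iz).
rewrite -lee_fin -abse_EFin E.
apply: le_trans (le_abse_integral vol _ _) _ => //.
  apply/measurable_EFinP; apply: measurable_funB; apply: measurable_funM => //;
  exact: measurable_bump.
rewrite EFinM fineK// -(bump_mass_shift r z) -ge0_integralZl//; last 3 first.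
- by apply/measurable_EFinP; exact: measurable_bump.
- by move=> y _; rewrite lee_fin bump_ge0.
- by rewrite lee_fin ltW.
apply: ae_ge0_le_integral => //.
- apply: measurableT_comp => //; apply/measurable_EFinP; apply: measurable_funB;
  apply: measurable_funM => //; exact: measurable_bump.
- by move=> y _; rewrite -EFinM lee_fin mulr_ge0 ?bump_ge0// ltW.
- by apply/measurable_EFinP; apply: measurable_funM => //; exact: measurable_bump.
apply: (@filterS _ _ (ae_filter_ringOfSetsType vol)) f1f => y hy _.
rewrite /= -EFinM lee_fin -mulrBl normrM (ger0_norm (bump_ge0 _ _ _)).
have [->|b0] := eqVneq (bump z r y) 0; first by rewrite !mulr0.
have yz := bump_supp b0 r0'.
rewrite ler_wpM2r ?bump_ge0// hy; last by apply: h1; exact: le_lt_trans yz rr1.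
apply: ltW; apply: h2; rewrite -ball_normE /= distrC; exact: le_lt_trans yz rr2.
Qed.

End Upper.

(** The form in which Fatou's lemma passes uniform bounds to the limit. *)
Lemma fatou_le d (T : measurableType d) (R : realType) (mu : {measure set T -> \bar R})
    (D : set T) (u : nat -> T -> \bar R) (F : T -> \bar R) (S : \bar R) :
    measurable D -> (forall n, measurable_fun D (u n)) ->
    (forall n x, D x -> (0 <= u n x)%E) ->
    (forall x, D x -> u ^~ x @ \oo --> F x) ->
    (forall n, (\int[mu]_(x in D) u n x <= S)%E) ->
  (\int[mu]_(x in D) F x <= S)%E.
Proof.
move=> mD mu_ u0 uF uS.
rewrite (_ : (\int[mu]_(x in D) F x = \int[mu]_(x in D) limn_einf (u ^~ x))%E); last first.
  by apply: eq_integral => x /[!inE] Dx; rewrite (cvg_limn_einf_sup (uF x Dx)).1.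
apply: le_trans (fatou mu mD mu_ u0) _.
apply: le_trans (limn_einf_sup _) _; rewrite limn_esup_lim.
apply: lime_le; first exact: is_cvg_esups.
by apply: nearW => n; apply: ge_ereal_sup => _ [k _ <-]; exact: uS.
Qed.

(** Adding a constant makes the integrand nonnegative, where Tonelli's theorem
    gives measurability. *)
Lemma measurable_mol (R : realType) (d : nat) (f1 : 'rV[R]_d -> R) (c r : R) :
    measurable_fun setT (f1 : Bor R d -> R) -> (forall y, `|f1 y| <= c) -> 0 <= r ->
  measurable_fun setT (mol f1 r : Bor R d -> R).
Proof.
move=> mf1 f1c r0.
have c0 y : 0 <= f1 y + c by have := f1c y; rewrite ler_norml => /andP[+ _]; lra.
have mfc : measurable_fun setT ((fun y => f1 y + c) : Bor R d -> R) by exact: measurable_funD.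
rewrite (_ : mol f1 r = fun z => fine (\int[@vol R d]_y ((f1 y + c) * bump z r y)%:E)%E -
                                c * fine (bump_mass d r)).
  apply: measurable_funB; last exact: measurable_cst.
  by apply: measurableT_comp => //; exact: measurable_Gam_bump.
apply/funext => z; apply/EFin_inj.
have ib := bump_integrable z r0; have im := mol_integrable mf1 f1c r0 z.
have icb : (@vol R d).-integrable setT (fun y => (c%:E * (bump z r y)%:E)%E) by exact: integrableZl.
have E : (\int[@vol R d]_y ((f1 y + c) * bump z r y)%:E = (mol f1 r z)%:E + c%:E * bump_mass d r)%E.
  rewrite (mol_EFin mf1 f1c r0) -(bump_mass_shift r z) -(integralZl measurableT ib).
  rewrite -(integralD measurableT im icb); apply: eq_integral => y _.
  by rewrite mulrDl EFinD !EFinM.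
rewrite E -(fineK (bump_mass_fin _ r0)) -EFinM -EFinD /=; congr (_%:E); lra.
Qed.

(** * Increments and the averaged weight *)

Section Increments.
Context {R : realType} (d : nat) (hd : (1 < d)%N) (K C : set 'rV[R]_d).
Context (hK : convex_body K) (hC : open_fg_cone C).
Local Notation V := 'rV[R]_d.
Local Notation N := (gauge_norm K).
Local Notation mu := (@lebesgue_measure R).
Local Notation vol := (@vol R d).
Local Notation Bor := (Bor R d).
Local Notation R1 := (measurableTypeR R).
Context (m0 : (0 < vol (K `&` C))%E).

Context (f1 : V -> R) (c : R) (mf1 : measurable_fun setT (f1 : Bor -> R)).
Context (f1c : forall y, `|f1 y| <= c).
Context (G : 'I_d -> V -> R) (mG : forall i, measurable_fun setT (G i : Bor -> R)).
Context (Gam : V -> R) (mGam : measurable_fun setT (Gam : Bor -> R)).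
Context (Gam0 : forall y, 0 <= Gam y).
Context (tG : forall t y : V, `|\sum_i t 0 i * G i y| <= N t * Gam y).
Context (iG : forall i z r, 0 <= r -> vol.-integrable setT (fun y => (G i y * bump z r y)%:E)).
Context (wG : forall i z r, 0 <= r -> (forall x, `|x - z| <= r -> C x) ->
  \int[vol]_y (f1 y * partial i (bump z r) y) = - \int[vol]_y (G i y * bump z r y)).
Context (q : R) (q0 : 0 < q) (hold : forall a : V -> R, measurable_fun setT (a : Bor -> R) ->
  (forall y, 0 <= a y) ->
  (\int[vol]_y (a y * Gam y)%:E <= (\int[vol]_y (a y `^ q)%:E) `^ q^-1)%E).
Context (w : R -> R) (mw : measurable_fun setT (w : R1 -> R)) (w0 : forall r, 0 <= w r).

(** The maximum only serves to have a Borel nonnegative integrand on the whole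
    line. *)
Definition tail (u : R) : \bar R := (\int[mu]_(r in `]u, +oo[) (w r * Num.max 0 r ^+ d.-1)%:E)%E.

Context (tfin : forall u, 0 < u -> tail u \is a fin_num).

Lemma tail_ge0 u : (0 <= tail u)%E.
Proof. by apply: integral_ge0 => r _; rewrite lee_fin mulr_ge0// exprn_ge0// le_max lexx. Qed.

(** The mean weight [g_wh], composed with the gauge. *)
Definition ker (t : V) : R := (N t ^+ d.-1)^-1 * fine (tail (N t)).

Lemma ker_ge0 t : 0 <= ker t.
Proof. by rewrite mulr_ge0 ?invr_ge0 ?exprn_ge0 ?gauge_ge0// fine_ge0// tail_ge0. Qed.

Lemma kerE t : (((N t ^+ d.-1)^-1)%:E * tail (N t) = (ker t)%:E)%E.
Proof.
have := gauge_ge0 hK t; rewrite le_eqVlt => /orP[/eqP N0|N0].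
  by rewrite /ker -N0 expr0n gtn_eqF ?invr0 ?mul0r ?mul0e// -ltnS prednK// ltnW.
by rewrite /ker EFinM fineK// tfin.
Qed.

Lemma measurable_ker : measurable_fun setT (ker : Bor -> R).
Proof.
apply: measurable_funM.
  rewrite (_ : (fun _ => _) = (fun t : Bor => (N t ^+ d.-1) `^ (- 1))).
    apply: (measurableT_comp (measurable_powR _)).
    by apply: measurable_funX; exact: measurable_gauge.
  by apply/funext => t; rewrite powR_inv1// exprn_ge0// gauge_ge0.
apply: measurableT_comp => //; apply: (measurableT_comp _ (measurable_gauge hK)).
apply: measurable_tail => [|r]; last by rewrite lee_fin mulr_ge0// exprn_ge0// le_max lexx.
apply/measurable_EFinP; apply: measurable_funM => //; apply: measurable_funX.
exact: measurable_maxr.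
Qed.

Definition ker_norm : \bar R := ((\int[vol]_(t in C) (ker t `^ q)%:E) `^ q^-1)%E.

(** Hoelder's inequality on the translated cone, on which [hold] is available
    because the kernel is extended by 0. *)
Lemma ker_translate_le (v : V) :
  (\int[vol]_(t in C) (ker t * Gam (t + v)%R)%:E <= ker_norm)%E.
Proof.
have mC := measurable_cone hC.
pose a (y : V) := ker y * \1_C y.
have ma : measurable_fun setT (a : Bor -> R).
  by apply: measurable_funM; [exact: measurable_ker|exact: measurable_indic].
have a0 y : 0 <= a y by rewrite mulr_ge0// ker_ge0.
pose b (y : V) := a (y - v).
have mb : measurable_fun setT (b : Bor -> R).
  exact: measurableT_comp ma (measurable_shift (- v)).
have := hold mb (fun y => a0 _).
rewrite -(@ge0_integral_shift _ _ _ v); last 2 first.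
- by apply/measurable_EFinP; exact: measurable_funM.
- by move=> y; rewrite lee_fin mulr_ge0// /b a0.
have mq : measurable_fun setT (fun y : Bor => (b y `^ q)%:E).
  by apply/measurable_EFinP; exact: (measurableT_comp (measurable_powR _) mb).
rewrite -(@ge0_integral_shift _ _ _ v mq); last by move=> y; rewrite lee_fin powR_ge0.
rewrite /b; under eq_integral do rewrite addrK.
under [X in (_ <= X `^ _)%E]eq_integral do rewrite addrK.
have -> : (\int[vol]_t (a t * Gam (t + v)%R)%:E = \int[vol]_(t in C) (ker t * Gam (t + v)%R)%:E)%E.
  rewrite [RHS]integral_mkcond; apply: eq_integral => t _; rewrite patchE /a indicE.
  by case: ifP; rewrite ?mulr1// mulr0 mul0r.
have E : (\int[vol]_(t in C) (ker t `^ q)%:E = \int[vol]_t (a t `^ q)%:E)%E; last first.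
  by rewrite /ker_norm E.
rewrite [LHS]integral_mkcond; apply: eq_integral => t _; rewrite patchE /a indicE.
by case: ifP; rewrite ?mulr1// mulr0 powR0// gt_eqF.
Qed.

Lemma measurable_kernel_pair (x : V) (r : R) : measurable_fun setT
  ((fun z => (\1_C (z.1 : V) * (ker z.1 * (Gam ((z.2 : V) + (x + z.1)) * bump 0 r z.2)))%:E) :
   Bor * Bor -> \bar R).
Proof.
apply/measurable_EFinP; apply: measurable_funM.
  apply: measurableT_comp measurable_fst; apply: measurable_indic.
  exact: measurable_cone hC.
apply: measurable_funM; first exact: measurableT_comp measurable_ker measurable_fst.
apply: measurable_funM; last exact: measurableT_comp (measurable_bump 0 r) measurable_snd.
apply: (measurableT_comp mGam); apply: measurable_fun_Bor => j.
rewrite (_ : (fun _ => _) = (fun z : Bor * Bor => (z.2 : V) 0 j + (x 0 j + (z.1 : V) 0 j))); last first.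
  by apply/funext => z; rewrite !mxE.
apply: measurable_funD; first exact: measurableT_comp (measurable_coord j) measurable_snd.
apply: measurable_funD => //.
exact: measurableT_comp (measurable_coord j) measurable_fst.
Qed.

(** By [mol_increment_le] the increment is at most [N t] times the mean of
    [phi = Gam * bump] over the segment from [x] to [x + t]; [radial_kernel]
    replaces the mean by the averaged weight, and Hoelder's inequality is
    applied for each shift [u] of the bump. *)
Lemma mol_kernel_le (x : V) (r r1 : R) : C x -> 0 < r -> r < r1 ->
    (forall y, `|y - x| < r1 -> C y) ->
  (\int[vol]_(t in C) (w (N t) * `|mol f1 r (x + t) - mol f1 r x|)%:E <=
   bump_mass d r * ker_norm)%E.
Proof.
move=> Cx r0 rr1 hr1; have mC := measurable_cone hC; have r0' := ltW r0.
pose H (z : V) : \bar R := (\int[vol]_y (Gam y * bump z r y)%:E)%E.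
have mH : measurable_fun setT (H : Bor -> \bar R) by exact: measurable_Gam_bump.
have H0 z : (0 <= H z)%E.
  by apply: integral_ge0 => y _; rewrite lee_fin mulr_ge0// bump_ge0.
pose phi (t : V) := H (x + t).
have mphi : measurable_fun setT (phi : Bor -> \bar R).
  rewrite /phi (_ : (fun t => _) = (fun t : Bor => H ((t : V) + x))).
    exact: measurableT_comp mH (measurable_shift x).
  by apply/funext => t; rewrite addrC.
have phi0 t : (0 <= phi t)%E by exact: H0.
have mwN : measurable_fun setT ((w \o N) : Bor -> R).
  exact: measurableT_comp mw (measurable_gauge hK).
apply: (@le_trans _ _ (\int[vol]_(t in C) ((w (N t) * N t)%:E *
    \int[mu]_(s in `]0%R, 1%R[) phi (s *: t)%R))%E).
  apply: ge0_le_integral => //.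
  - by move=> t _; rewrite lee_fin mulr_ge0.
  - apply/measurable_EFinP; apply: measurable_funM; first exact: measurable_funS mwN.
    apply: (measurableT_comp (@normr_measurable R setT)).
    apply: measurable_funB; last exact: measurable_cst.
    apply: (measurable_funS measurableT (@subsetT _ _)).
    rewrite (_ : (fun t => _) = (fun t : Bor => mol f1 r ((t : V) + x))).
      exact: measurableT_comp (measurable_mol mf1 f1c r0') (measurable_shift x).
    by apply/funext => t; rewrite addrC.
  - apply: emeasurable_funM.
      apply/measurable_EFinP; apply: measurable_funM; first exact: measurable_funS mwN.
      exact: measurable_funS (measurable_gauge hK).
    exact: measurable_funS (measurable_radial_mean mphi phi0).
  move=> t Ct; rewrite EFinM EFinM -muleA; apply: lee_wpmul2l; first by rewrite lee_fin.
  apply: (@mol_increment_le R d f1 c r mf1 f1c r0' x t G mG Gam mGam (N t) (gauge_ge0 hK t) Gam0).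
  - by move=> y; exact: tG.
  - by move=> i z; exact: iG.
  move=> i s /andP[s0 s1]; apply: wG => // y hy.
  rewrite -(subrK (s *: t) y); apply: (cone_add hC); last exact: cone_scale.
  by apply: hr1; apply: le_lt_trans rr1; rewrite -addrA -opprD [s *: t + x]addrC.
rewrite (radial_kernel (ltnW hd) hK hC)//.
pose g (z : Bor * Bor) : \bar R :=
  (\1_C (z.1 : V) * (ker z.1 * (Gam ((z.2 : V) + (x + z.1)) * bump 0 r z.2)))%:E.
have mg : measurable_fun setT g := measurable_kernel_pair x r.
have g0 z : (0 <= g z)%E 
  by rewrite /g lee_fin mulr_ge0 ?indicE ?ler0n// mulr_ge0 ?ker_ge0// mulr_ge0 ?bump_ge0.
have -> : (\int[vol]_(t in C) (((N t ^+ d.-1)^-1)%:E *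
      (\int[mu]_(r0 in `]N t, +oo[) (w r0 * Num.max 0 r0 ^+ d.-1)%:E) * phi t) =
    \int[vol]_t \int[vol]_u g (t, u))%E.
  rewrite integral_mkcond; apply: eq_integral => t _; rewrite patchE.
  case: ifP => tC; last first.
    by rewrite integral0_eq// => u _; rewrite /g indicE tC mul0r.
  rewrite kerE /phi /H -(@ge0_integral_shift _ _ _ (x + t)); last 2 first.
  - by apply/measurable_EFinP; apply: measurable_funM => //; exact: measurable_bump.
  - by move=> y; rewrite lee_fin mulr_ge0// bump_ge0.
  rewrite -ge0_integralZl//; last 3 first.
  - apply/measurable_EFinP; apply: measurable_funM.
      exact: measurableT_comp mGam (measurable_shift _).
    exact: measurableT_comp (measurable_bump _ _) (measurable_shift _).
  - by move=> y _; rewrite lee_fin mulr_ge0// bump_ge0.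
  - by rewrite lee_fin ker_ge0.
  by apply: eq_integral => u _; rewrite /g /= indicE tC mul1r (bump0E (x + t)) addrK EFinM.
rewrite (@fubini_tonelli _ _ Bor Bor R vol vol g mg g0) /bump_mass.
have mb : measurable_fun setT ((fun u => (bump 0 r u)%:E) : Bor -> \bar R).
  by apply/measurable_EFinP; exact: measurable_bump.
have n0 : (0 <= ker_norm)%E by exact: poweR_ge0.
rewrite -(ge0_integralZr vol measurableT mb _ n0); last by move=> u _; rewrite lee_fin bump_ge0.
apply: ge0_le_integral; first exact: measurableT.
- by move=> u _; apply: integral_ge0 => t _.
- exact: (@measurable_fun_fubini_tonelli_G _ _ Bor Bor R vol g mg g0).
- exact: emeasurable_funM.
move=> u _.
have mk : measurable_fun (C : set Bor) ((fun t : V => (ker t * Gam (t + (x + u)))%:E) : Bor -> \bar R).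
  apply/measurable_EFinP; apply: measurable_funM.
    exact: measurable_funS measurable_ker.
  apply: (measurable_funS measurableT (@subsetT _ _)).
  exact: measurableT_comp mGam (measurable_shift (x + u)).
have -> : (\int[vol]_t g (t, u) =
    (bump 0 r u)%:E * \int[vol]_(t in C) (ker t * Gam (t + (x + u))%R)%:E)%E.
  rewrite -(ge0_integralZl vol mC mk); last 2 first.
  - by move=> t _; rewrite lee_fin mulr_ge0// ker_ge0.
  - by rewrite lee_fin bump_ge0.
  rewrite [RHS]integral_mkcond; apply: eq_integral => t _; rewrite patchE /g /= indicE.
  case: ifP => _; last by rewrite mul0r.
  rewrite mul1r -EFinM; congr (_%:E); rewrite (_ : u + (x + t) = t + (x + u)).
    by rewrite mulrA mulrC.
  by rewrite addrCA [RHS]addrCA [u + t]addrC.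
by apply: lee_wpmul2l; [rewrite lee_fin bump_ge0|exact: ker_translate_le].
Qed.

(** Fatou's lemma as the mollification scale tends to 0; the masses of the
    bumps cancel. *)
Lemma increment_le (f : V -> R) (x : V) : C x ->
    {in C, continuous f} -> {ae vol, forall y, C y -> f1 y = f y} ->
  (\int[vol]_(t in C) (w (N t) * `|f x - f (x + t)|)%:E <= ker_norm)%E.
Proof.
move=> Cx cf f1f; have mC := measurable_cone hC.
have [r1 r10 hr1] := open_normP (cone_open hC) Cx.
pose rn (n : nat) := r1 / n.+2%:R.
have rn0 n : 0 < rn n by rewrite divr_gt0.
have rn1 n : rn n < r1 by rewrite ltr_pdivrMr// ltr_pMr// ltr1n.
have I0 n : 0 < fine (bump_mass d (rn n)).
  by rewrite fine_gt0// (bump_mass_gt0 hK m0)//= ltey_eq bump_mass_fin// ltW.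
pose u n (t : V) : \bar R := (w (N t) *
  `|mol f1 (rn n) (x + t) / fine (bump_mass d (rn n)) - mol f1 (rn n) x / fine (bump_mass d (rn n))|)%:E.
have muu n : measurable_fun (C : set Bor)
    ((fun t : V => (w (N t) * `|mol f1 (rn n) (x + t) - mol f1 (rn n) x|)%:E) : Bor -> \bar R).
  apply/measurable_EFinP; apply: measurable_funM.
    apply: (measurable_funS measurableT (@subsetT _ _)).
    exact: measurableT_comp mw (measurable_gauge hK).
  apply: (measurableT_comp (@normr_measurable R setT)).
  apply: measurable_funB; last exact: measurable_cst.
  apply: (measurable_funS measurableT (@subsetT _ _)).
  rewrite (_ : (fun t => _) = (fun t : Bor => mol f1 (rn n) ((t : V) + x))).
    exact: measurableT_comp (measurable_mol mf1 f1c (ltW (rn0 n))) (measurable_shift x).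
  by apply/funext => t; rewrite addrC.
have uE n t : u n t = ((fine (bump_mass d (rn n)))^-1%:E *
    (w (N t) * `|mol f1 (rn n) (x + t) - mol f1 (rn n) x|)%:E)%E.
  rewrite /u -mulrBl normrM normfV (gtr0_norm (I0 n)) -EFinM; congr (_%:E).
  by rewrite mulrA mulrC.
apply: (@fatou_le _ _ _ vol C u) => //.
- move=> n; rewrite (funext (uE n)); apply: emeasurable_funM => //.
- by move=> n t _; rewrite lee_fin mulr_ge0.
- move=> t Ct; apply: cvg_EFin; first exact: nearW.
  rewrite /u/=; apply: cvgM; first exact: cvg_cst.
  have mc z : C z -> (fun n => mol f1 (rn n) z / fine (bump_mass d (rn n))) @ \oo --> f z.
    move=> Cz; apply/cvgrPdist_le => e e0.
    have [r2 r20 hr2] := mol_cvg hK hC m0 mf1 f1c f1f Cz (cf z (mem_set Cz)) e0.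
    near=> n; rewrite distrC; apply: hr2 => //.
    rewrite /rn ler_pdivrMr// -ler_pdivrMl//.
    apply: le_trans (_ : n%:R <= _); last by rewrite ler_nat leqW.
    near: n; exact: nbhs_infty_ger.
  rewrite distrC; apply: cvg_norm; apply: cvgB; apply: mc => //.
  exact: (cone_add hC).
move=> n; under eq_integral do rewrite uE.
rewrite ge0_integralZl//; last 2 first.
- by move=> t _; rewrite lee_fin mulr_ge0.
- by rewrite lee_fin invr_ge0 ltW.
rewrite lee_pdivrMl// fineK ?bump_mass_fin ?(ltW (rn0 n))//.
exact: mol_kernel_le Cx (rn0 n) (rn1 n) hr1.
Unshelve. all: by end_near. Qed.

End Increments.

Lemma measurable_clamp d (T : measurableType d) (R : realType) (D : set T) (f : T -> R) (c : R) :
  measurable_fun D f -> measurable_fun D (fun y => Num.max (- c) (Num.min c (f y))).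
Proof.
move=> mf; have m1 := measurable_minr (measurable_cst c) mf.
exact: (measurable_maxr (measurable_cst (- c)) m1).
Qed.

Section Class.
Context {R : realType} (d : nat) (hd : (1 < d)%N) (K C : set 'rV[R]_d).
Context (hK : convex_body K) (hC : open_fg_cone C).
Local Notation V := 'rV[R]_d.
Local Notation N := (gauge_norm K).
Local Notation mu := (@lebesgue_measure R).
Local Notation leb := (@leb R d).
Local Notation vol := (@vol R d).
Local Notation Bor := (Bor R d).
Local Notation Leb := (Leb R d).
Local Notation R1 := (measurableTypeR R).
Context (m0 : (0 < vol (K `&` C))%E).

Lemma leb_gt0 : (0 < leb setT)%E.
Proof.
apply: lt_le_trans m0 _; rewrite [leLHS]volE.
by apply: (@le_outer_measure _ _ (@lebesgue_outer R d)).
Qed.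

Lemma measurable_comp_coord (D : set V) (F : V -> V) (phi : V -> R) :
    measurable (D : set Leb) -> measurable_fun setT (phi : Bor -> R) ->
    (forall i, measurable_fun (D : set Leb) ((fun y => F y 0 i) : Leb -> R)) ->
  measurable_fun (D : set Leb) ((fun y => phi (F y)) : Leb -> R).
Proof.
move=> mD mphi mF.
pose F' (y : V) : V := \row_i ((fun y => F y 0 i) \_ D) y.
have mF' : measurable_fun setT (F' : Leb -> Bor).
  apply: measurable_fun_Bor => i.
  rewrite (_ : (fun y => _) = (fun y => F y 0 i) \_ D); last by apply/funext => y; rewrite mxE.
  exact/(measurable_restrictT _ mD).1.
have mpF : measurable_fun (D : set Leb) ((phi \o F') : Leb -> R).
  exact: measurable_funS (measurableT_comp mphi mF').
apply: eq_measurable_fun mpF => y yD; rewrite /= /F'; congr phi; apply/rowP => i.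
by rewrite mxE patchE yD.
Qed.

Lemma essentially_bounded (f : V -> R) : Linfty C f ->
  exists2 c : R, 0 <= c & {ae leb, forall y, C y -> `|f y| <= c}.
Proof.
move=> [mf]; have := Lnorm_ge0 leb +oo%E ((EFin \o f) \_ C); rewrite /Lp_norm unlock leb_gt0.
set s := ess_sup _ _ => s0 s1.
have sf : s \is a fin_num by rewrite ge0_fin_numE.
exists (fine s); first exact: fine_ge0.
have : (s <= (fine s)%:E)%E by rewrite fineK.
move/ess_supP; apply: filterS => y /= + Cy; rewrite patchE mem_set//=.
Qed.

Lemma ae_leb_Borel (D : set V) (A : set V) : measurable (D : set Bor) ->
    measurable (D `&` A : set Bor) -> {ae leb, forall y, D y -> A y} ->
  vol (D `\` A) = 0%E.
Proof.
move=> mD mA [Z [mZ Z0 hZ]]; apply/eqP; rewrite eq_le measure_ge0 andbT -[leRHS]Z0 [leLHS]volE.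
apply: (@le_outer_measure _ _ (@lebesgue_outer R d)) => y [Dy nA].
by apply: hZ => /= /(_ Dy).
Qed.

(** The upper bound on the class: apply [increment_le] to Borel versions of
    the function and of its weak gradient, with [Gam] the dual norm of the
    gradient, which has L_p norm at most 1. *)
Lemma class_increment_le (p : \bar R) (q : R) (f : V -> R) (w : R -> R) (x : V) :
    conjugate p q -> 0 < q -> WK K p C f -> C x ->
    measurable_fun setT (w : R1 -> R) -> (forall r, 0 <= w r) ->
    (forall u, 0 < u -> tail d w u \is a fin_num) ->
  (\int[vol]_(t in C) (w (N t) * `|f x - f (x + t)|)%:E <= ker_norm K C q w)%E.
Proof.
move=> pq q0 [[fL cf _] [G [wG LG nG]]] Cx mw w0 tfin.
have mC := measurable_cone hC; have mCL := Bor_Leb mC; have oC := cone_open hC.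
have [mfL _] := fL.
have [c c0 fc] := essentially_bounded fL.
have mfB : measurable_fun (C : set Bor) (f : Bor -> R) by exact: open_continuous_Bor.
pose Z0 := C `\` [set y | `|f y| <= c].
have mI : measurable (C `&` [set y | `|f y| <= c] : set Bor).
  rewrite (_ : [set y | _] = (fun y => `|f y|) @^-1` `]-oo, c]); last first.
    by apply/seteqP; split => y /=; rewrite in_itv.
  by apply: (measurableT_comp (@normr_measurable R setT) mfB).
have vZ0 : vol Z0 = 0%E by exact: ae_leb_Borel fc.
have mZ0 : measurable (Z0 : set Bor).
  rewrite (_ : Z0 = C `\` (C `&` [set y | `|f y| <= c])); first exact: measurableD.
  by apply/seteqP; split => y /= [Cy h]; split => // h'; apply: h; [case: h'|split].
pose f1 := ((fun y => Num.max (- c) (Num.min c (f y))) \_ C) : V -> R.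
have mf1 : measurable_fun setT (f1 : Bor -> R).
  have mt : measurable_fun (C : set Bor) ((fun y => Num.max (- c) (Num.min c (f y))) : Bor -> R).
    exact: (@measurable_clamp _ Bor).
  exact: (measurable_restrictT _ mC).1 mt.
have f1c y : `|f1 y| <= c.
  rewrite /f1 patchE; case: ifP => _; last by rewrite normr0.
  by rewrite ler_norml le_max lexx/= ge_max ge_min lexx andbT; lra.
have f1E y : C y -> ~ Z0 y -> f1 y = f y.
  move=> Cy nZ; rewrite /f1 patchE mem_set//.
  have : `|f y| <= c by apply: contrapT => h; apply: nZ.
  by rewrite ler_norml => /andP[h1 h2]; rewrite min_r// max_r.
have f10 y : ~ C y -> f1 y = 0 by move=> nC; rewrite /f1 patchE memNset.
have /choice[g /choice[Z hZ]] : forall i, exists (g : V -> R) (Z : set V),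
    [/\ measurable_fun setT (g : Bor -> R), measurable (Z : set Bor), vol Z = 0%E,
    forall y, C y -> ~ Z y -> g y = G y 0 i & forall y, ~ C y \/ Z y -> g y = 0].
  by move=> i; exact: leb_borel_version mC (LG i).1.
have mg i : measurable_fun setT (g i : Bor -> R) by have [] := hZ i.
pose Gr (y : V) : V := \row_i g i y.
pose ZG := \big[setU/set0]_i Z i.
have [mZG vZG] : measurable (ZG : set Bor) /\ vol ZG = 0%E.
  apply: (big_ind (fun A => measurable (A : set Bor) /\ vol A = 0%E)).
  - by rewrite measure0.
  - by move=> A B [mA A0] [mB B0]; split; [exact: measurableU|rewrite measureU0].
  - by move=> i _; have [] := hZ i.
have GrE y : C y -> ~ ZG y -> Gr y = G y.
  move=> Cy nZ; apply/rowP => i; rewrite mxE; have [_ _ _ -> //] := hZ i.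
  by move=> Zi; apply: nZ; rewrite /ZG (bigD1 i)//=; left.
have Gr0 y : ~ C y -> Gr y = 0.
  by move=> nC; apply/rowP => i; rewrite !mxE; have [_ _ _ _ -> //] := hZ i; left.
have mGr : measurable_fun setT (Gr : Bor -> Bor).
  apply: measurable_fun_Bor => i.
  by rewrite (_ : (fun y => _) = g i)//; apply/funext => y; rewrite mxE.
pose Gam (y : V) := dual_norm K (Gr y).
have mGam : measurable_fun setT (Gam : Bor -> R) by exact: measurableT_comp (measurable_dual hK) mGr.
have Gam0 y : 0 <= Gam y by exact: dual_ge0.
have tG (t y : V) : `|\sum_i t 0 i * g i y| <= N t * Gam y.
  rewrite (_ : \sum_i _ = dotp t (Gr y)); first exact: dotp_norm_le_dual.
  by apply: eq_bigr => i _; rewrite mxE.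
have hold (a : V -> R) : measurable_fun setT (a : Bor -> R) -> (forall y, 0 <= a y) ->
    (\int[vol]_y (a y * Gam y)%:E <= (\int[vol]_y (a y `^ q)%:E) `^ q^-1)%E.
  move=> ma a0.
  have mF : measurable_fun (C : set Leb) ((fun y => dual_norm K (G y)) : Leb -> R).
    exact: (measurable_comp_coord mCL (measurable_dual hK) (fun i => (LG i).1)).
  have := hoelder_cone pq leb_gt0 mC ler01 ma a0 mF nG; rewrite mul1e.
  apply: le_trans; rewrite le_eqVlt; apply/orP; left; apply/eqP; apply/esym.
  apply: (integral_leb_vol mC mZG vZG).
  - apply/measurable_EFinP; apply: measurable_funM.
      apply: (measurable_funS measurableT (@subsetT _ _)).
      exact: measurable_fun_Leb.
    exact: measurableT_comp.
  - by apply/measurable_EFinP; exact: measurable_funM.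
  - by move=> y Cy nZ; rewrite /Gam GrE// ger0_norm// dual_ge0.
  - move=> y nC; rewrite /Gam Gr0// (_ : dual_norm K 0 = 0) ?mulr0//.
    by have := dualZ_ge0 hK 0 (lexx 0); rewrite scale0r mul0r => h; apply/eqP; rewrite eq_le h dual_ge0.
have iG i z r : 0 <= r -> vol.-integrable setT (fun y => (g i y * bump z r y)%:E).
  move=> r0; apply/integrableP; split.
    by apply/measurable_EFinP; apply: measurable_funM => //; exact: measurable_bump.
  have mb := measurable_bump z r.
  apply: (@le_lt_trans _ _ ((N (delta_mx 0 i))%:E * \int[vol]_y (bump z r y * Gam y)%:E)%E).
    rewrite -ge0_integralZl//; last 3 first.
    - by apply/measurable_EFinP; exact: measurable_funM.
    - by move=> y _; rewrite lee_fin mulr_ge0// bump_ge0.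
    - by rewrite lee_fin gauge_ge0.
    apply: ge0_le_integral => //.
    - apply: measurableT_comp => //; apply/measurable_EFinP; exact: measurable_funM.
    - apply: emeasurable_funM => //; apply/measurable_EFinP; exact: measurable_funM.
    move=> y _; rewrite abse_EFin -EFinM lee_fin normrM (ger0_norm (bump_ge0 _ _ _)).
    rewrite mulrCA mulrC ler_wpM2l ?bump_ge0//.
    have := tG (delta_mx 0 i) y; rewrite (bigD1 i)//= mxE !eqxx mul1r big1 ?addr0//.
    by move=> j ji; rewrite mxE (negbTE ji) andbF mul0r.
  apply: lte_mul_pinfty; rewrite ?lee_fin ?gauge_ge0//.
  apply: le_lt_trans (hold _ mb (fun y => bump_ge0 _ _ _)) _.
  apply: poweR_lty.
  have [M M0 hM] := @bump_bounded R d r r0.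
  have := @ge0_bounded_supp_lty R d (fun y => bump z r y `^ q) (M `^ q) (`|z| + r).
  under eq_integral do rewrite (ger0_norm (powR_ge0 _ _)).
  move=> B; apply: le_lt_trans (B _ _ _) _.
  - exact: (measurableT_comp (measurable_powR _) mb).
  - move=> y; rewrite (ger0_norm (powR_ge0 _ _)); apply: ge0_ler_powR => //.
    + exact: ltW.
    + by rewrite nnegrE bump_ge0.
    + by apply: le_trans (ler_norm _) _; rewrite bump0E; exact: hM.
  - move=> y hy; rewrite bump0E bump_supp0 ?powR0 ?gt_eqF//.
    by have := lerB_normD y (- z); rewrite normrN; lra.
  by rewrite lte_mul_pinfty ?lee_fin ?powR_ge0// leb_ball_lty.
have wGB i z r : 0 <= r -> (forall x, `|x - z| <= r -> C x) ->
    \int[vol]_y (f1 y * partial i (bump z r) y) = - \int[vol]_y (g i y * bump z r y).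
  move=> r0 hz.
  have mb := measurable_bump z r.
  have mp : measurable_fun setT (partial i (bump z r) : Bor -> R).
    by apply: continuous_Bor; exact: continuous_partial_bump.
  have := wG i _ (test_function_bump r0 hz); rewrite /Rintegral.
  have [_ mZi vZi gE g0] := hZ i.
  rewrite (integral_leb_vol (G := fun y => (f1 y * partial i (bump z r) y)%:E) mC mZ0 vZ0); last 4 first.
  - apply/measurable_EFinP; apply: measurable_funM => //.
    apply: (measurable_funS measurableT (@subsetT _ _)).
    exact: measurable_fun_Leb.
  - by apply/measurable_EFinP; exact: measurable_funM.
  - by move=> y Cy nZ; rewrite f1E.
  - by move=> y nC; rewrite f10// mul0r.
  rewrite (integral_leb_vol (G := fun y => (g i y * bump z r y)%:E) mC mZi vZi) => [//| | | |].
  - apply/measurable_EFinP; apply: measurable_funM; first by have [] := LG i.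
    apply: (measurable_funS measurableT (@subsetT _ _)).
    exact: measurable_fun_Leb.
  - by apply/measurable_EFinP; exact: measurable_funM.
  - by move=> y Cy nZ; rewrite gE.
  - by move=> y nC; rewrite g0 ?mul0r//; left.
apply: (increment_le hd hK hC m0 mf1 f1c mg mGam Gam0 tG iG wGB q0 hold mw w0 tfin Cx cf).
exists Z0; split => // y /= h; apply: contrapT => nZ; apply: h => Cy; exact: f1E.
Qed.

End Class.

(** * Borel versions of the operators *)

(** A complete measure does not see null sets. *)
Lemma measurable_fun_mod d (T : measurableType d) (R : realType)
    (mu : {measure set T -> \bar R}) d' (T' : measurableType d') (D Z : set T) (F G : T -> T') :
    measure_is_complete mu -> measurable D -> measurable Z -> mu Z = 0%E ->
    measurable_fun D G -> (forall y, D y -> ~ Z y -> G y = F y) ->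
  measurable_fun D F.
Proof.
move=> cmu mD mZ Z0 mG GF _ A mA.
rewrite (_ : D `&` F @^-1` A = ((D `&` G @^-1` A) `\` Z) `|` (D `&` F @^-1` A `&` Z)).
  apply: measurableU; first by apply: measurableD => //; exact: mG.
  by apply: cmu; exists Z; split => // y [].
apply/seteqP; split => y /= => [[Dy Fy]|[[[Dy Gy] nZ]|[]//]].
  have [Zy|nZ] := pselect (Z y); first by right.
  by left; split => //; split => //; rewrite GF.
by split => //; rewrite -GF.
Qed.

Section Versions.
Context {R : realType} (d : nat) (hd : (1 < d)%N) (K C : set 'rV[R]_d).
Context (hK : convex_body K) (hC : open_fg_cone C).
Local Notation V := 'rV[R]_d.
Local Notation N := (gauge_norm K).
Local Notation mu := (@lebesgue_measure R).
Local Notation leb := (@leb R d).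
Local Notation vol := (@vol R d).
Local Notation Bor := (Bor R d).
Local Notation Leb := (Leb R d).
Local Notation R1 := (measurableTypeR R).
Context (m0 : (0 < vol (K `&` C))%E).

Lemma measurable_Leb_mod (D Z : set V) (F G : V -> R) :
    measurable (D : set Bor) -> measurable (Z : set Bor) -> vol Z = 0%E ->
    measurable_fun (D : set Bor) (G : Bor -> R) ->
    (forall y, D y -> ~ Z y -> G y = F y) ->
  measurable_fun (D : set Leb) (F : Leb -> R).
Proof.
move=> mD mZ Z0 mG GF.
have mGL : measurable_fun (D : set Leb) (G : Leb -> R) by exact: measurable_fun_Leb.
exact: (@measurable_fun_mod _ Leb R leb _ _ D Z F G
  (@measure_is_complete_caratheodory _ _ (@lebesgue_outer R d)) (Bor_Leb mD) (Bor_Leb mZ) Z0 mGL GF).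
Qed.

Lemma vol_translate (x : V) (Z : set V) : vol Z = 0%E -> vol [set t | Z (t + x)] = 0%E.
Proof.
move=> Z0; have := leb_affine (- x) Z (@ltr01 R).
rewrite expr1n mul1e -[RHS]volE Z0 => <-; rewrite volE; congr (leb _).
by apply/seteqP; split => t /=; rewrite invr1 scale1r opprK.
Qed.

Lemma measurable_translate (x : V) (Z : set V) : measurable (Z : set Bor) ->
  measurable ([set t | Z (t + x)] : set Bor).
Proof. by move=> mZ; rewrite -[X in measurable X]setTI; apply: (measurable_shift x). Qed.

Lemma Linfty_norm_ge0 (f : V -> R) : (0 <= Lp_norm +oo C f)%E.
Proof. exact: Lnorm_ge0. Qed.

Lemma Linfty_norm_fin (f : V -> R) : Linfty C f -> Lp_norm +oo C f \is a fin_num.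
Proof. by move=> [_ h]; rewrite ge0_fin_numE// Linfty_norm_ge0. Qed.

Lemma Linfty_normP (f : V -> R) (c : R) : 0 <= c ->
  (Lp_norm +oo C f <= c%:E)%E <-> {ae leb, forall y, C y -> `|f y| <= c}.
Proof.
move=> c0; rewrite /Lp_norm unlock (leb_gt0 m0); split.
  by move/ess_supP; apply: filterS => y /= + Cy; rewrite patchE mem_set//=.
move=> h; apply/ess_supP; apply: (@filterS _ _ (ae_filter_ringOfSetsType leb)) h => y /= h; rewrite patchE.
by case: ifPn => [/set_mem/h//|_]; rewrite /= normr0.
Qed.

(** Clamping a Borel version makes it bounded everywhere by the norm. *)
Lemma Linfty_version (f : V -> R) : Linfty C f ->
  exists (f1 : V -> R) (Z : set V), [/\ measurable_fun setT (f1 : Bor -> R),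
    forall y, `|f1 y| <= fine (Lp_norm +oo C f), measurable (Z : set Bor), vol Z = 0%E &
    forall y, C y -> ~ Z y -> f1 y = f y].
Proof.
move=> fL; set c := fine _; have mC := measurable_cone hC.
have c0 : 0 <= c by exact/fine_ge0/Linfty_norm_ge0.
have fc : {ae leb, forall y, C y -> `|f y| <= c}.
  by apply/Linfty_normP => //; rewrite fineK// Linfty_norm_fin.
have [g [Z [mg mZ Z0 gf _]]] := leb_borel_version mC fL.1.
pose Z1 := (C `\` Z) `\` [set y | `|g y| <= c].
have mA : measurable ([set y | `|g y| <= c] : set Bor).
  rewrite (_ : [set y | _] = (fun y => `|g y|) @^-1` `]-oo, c]); last first.
    by apply/seteqP; split => y /=; rewrite in_itv.
  by rewrite -[X in measurable X]setTI; apply: (measurableT_comp (@normr_measurable R setT) mg).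
have mCZ : measurable (C `\` Z : set Bor) by exact: measurableD.
have mZ1 : measurable (Z1 : set Bor) by exact: measurableD.
have Z10 : vol Z1 = 0%E.
  apply: ae_leb_Borel => //; first exact: measurableI.
  by apply: (@filterS _ _ (ae_filter_ringOfSetsType leb)) fc => y /= h [Cy nZ]; rewrite gf//; exact: h.
exists (fun y => Num.max (- c) (Num.min c (g y))), (Z `|` Z1); split.
- exact: (@measurable_clamp _ Bor).
- by move=> y; rewrite ler_norml le_max lexx/= ge_max ge_min lexx andbT; lra.
- exact: measurableU.
- by rewrite measureU0.
move=> y Cy nZ; have nZy : ~ Z y by move=> h; apply: nZ; left.
have : `|g y| <= c by apply: contrapT => h; apply: nZ; right.
by rewrite -gf// ler_norml => /andP[h1 h2]; rewrite min_r// max_r.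
Qed.

Context (w wB : R -> R) (Zw : set R) (mwB : measurable_fun setT (wB : R1 -> R)).
Context (mZw : measurable (Zw : set R1)) (Zw0 : mu Zw = 0%E).
Context (wBE : forall r, 0 < r -> ~ Zw r -> wB r = w r).

(** [radial_null]: a null set of radii gives a null set in the cone. The
    vertex is put apart because [wBE] says nothing at 0. *)
Lemma weight_version : exists Z : set V, [/\ measurable (Z : set Bor), vol Z = 0%E &
  forall t, C t -> ~ Z t -> wB (N t) = w (N t)].
Proof.
have hd0 := ltnW hd.
have mN : measurable ([set t | Zw (N t)] : set Bor).
  by rewrite -[X in measurable X]setTI; apply: (measurable_gauge hK).
have mS := measurable_set10 hK; have mC := measurable_cone hC.
exists ((C `&` [set t | Zw (N t)]) `|` [set 0]); split.
- by apply: measurableU => //; exact: measurableI.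
- by rewrite measureU0//; [exact: radial_null|exact: measurableI|exact: leb_set1].
move=> t Ct h; apply: wBE => [|Zt]; last by apply: h; left.
by apply: gauge_gt0 => //; apply/eqP => t0; apply: h; right.
Qed.

Context (E : set V) (mE : measurable (E : set Bor)) (EC : E `<=` C).

(** The integrals that define the operators, in terms of Borel functions; the
    truncated operator and the operator itself are the cases [E] = C minus a
    dilate of K, and [E] = C. *)
Lemma operator_version (f f1 : V -> R) (Zf : set V) (x : V) :
    measurable_fun setT (f1 : Bor -> R) -> measurable (Zf : set Bor) -> vol Zf = 0%E ->
    (forall y, C y -> ~ Zf y -> f1 y = f y) -> C x ->
  [/\ measurable_fun (E : set Leb) ((fun t => w (N t) * (f x - f (x + t))) : Leb -> R),
      measurable_fun setT ((fun t => \1_E t * (wB (N t) * (f x - f1 (x + t)))) : Bor -> R) &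
  (\int[leb]_(t in E) (w (N t) * (f x - f (x + t)))%:E =
   \int[vol]_t (\1_E t * (wB (N t) * (f x - f1 (x + t))))%:E)%E].
Proof.
move=> mf1 mZf Zf0 f1E Cx.
have [Z [mZ Z0 hZ]] := weight_version.
pose Z' := Z `|` [set t | Zf (t + x)].
have mT := measurable_translate x mZf.
have mZ' : measurable (Z' : set Bor) by exact: measurableU.
have Z'0 : vol Z' = 0%E by rewrite measureU0//; exact: vol_translate.
pose g (t : V) := wB (N t) * (f x - f1 (x + t)).
have mg : measurable_fun setT (g : Bor -> R).
  apply: measurable_funM; first exact: measurableT_comp mwB (measurable_gauge hK).
  apply: measurable_funB => //.
  rewrite (_ : (fun t => _) = (fun t : Bor => f1 ((t : V) + x))).
    exact: measurableT_comp mf1 (measurable_shift x).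
  by apply/funext => t; rewrite addrC.
have gE t : E t -> ~ Z' t -> g t = w (N t) * (f x - f (x + t)).
  move=> Et nZ; have Ct := EC Et; rewrite /g hZ//; last by move=> h; apply: nZ; left.
  rewrite f1E//; first exact: (cone_add hC).
  by move=> h; apply: nZ; right; rewrite /= addrC.
have mF : measurable_fun (E : set Leb) ((fun t => w (N t) * (f x - f (x + t))) : Leb -> R).
  exact: measurable_Leb_mod mE mZ' Z'0 (measurable_funS measurableT (@subsetT _ _) mg) gE.
have mG : measurable_fun setT ((fun t => \1_E t * g t) : Bor -> R).
  by apply: measurable_funM => //; exact: measurable_indic.
split => //; apply: (integral_leb_vol mE mZ' Z'0).
- exact/measurable_EFinP.
- exact/measurable_EFinP.
- by move=> t Et nZ; rewrite indicE mem_set// mul1r -gE.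
- by move=> t nE; rewrite indicE memNset// mul0r.
Qed.

End Versions.

(** * One-dimensional weights *)

Section Weight1.
Context {R : realType}.
Local Notation mu := (@lebesgue_measure R).
Local Notation mu1 := (@completed_lebesgue_measure R).
Local Notation R1 := (measurableTypeR R).

Lemma measurable_fun_Leb1 (D : set R) (f : R -> R) :
  measurable_fun (D : set R1) (f : R1 -> R) -> measurable (D : set R1) ->
  measurable_fun (D : set Leb1) (f : Leb1 -> R).
Proof. by move=> mf mD _ A mA; apply: measurable_Leb1; exact: mf. Qed.

Lemma measurable_Leb1_mod (D Z : set R) (F G : R -> R) :
    measurable (D : set R1) -> measurable (Z : set R1) -> mu Z = 0%E ->
    measurable_fun (D : set R1) (G : R1 -> R) ->
    (forall y, D y -> ~ Z y -> G y = F y) ->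
  measurable_fun (D : set Leb1) (F : Leb1 -> R).
Proof.
move=> mD mZ Z0 mG GF.
have mGL : measurable_fun (D : set Leb1) (G : Leb1 -> R).
  exact: measurable_fun_Leb1.
exact: (@measurable_fun_mod _ Leb1 R mu1 _ _ D Z F G
  completed_lebesgue_measure_is_complete (measurable_Leb1 mD) (measurable_Leb1 mZ) Z0 mGL GF).
Qed.

(** The one-dimensional counterpart of [integral_leb_vol]. *)
Lemma ge0_integral_leb1_mod (D Z : set R) (F G : R -> R) :
    measurable (D : set R1) -> measurable (Z : set R1) -> mu Z = 0%E ->
    measurable_fun (D : set R1) (G : R1 -> R) ->
    (forall y, D y -> ~ Z y -> G y = F y) -> (forall y, D y -> 0 <= F y) ->
    (forall y, D y -> 0 <= G y) ->
  (\int[mu1]_(y in D) (F y)%:E = \int[mu]_(y in D) (G y)%:E)%E.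
Proof.
move=> mD mZ Z0 mG GF F0 G0; have mDL := measurable_Leb1 mD.
rewrite -(ge0_integral_leb1 mD); last 2 first.
- exact/measurable_EFinP.
- by move=> y Dy; rewrite lee_fin G0.
have mGL : measurable_fun (D : set Leb1) ((fun y => (G y)%:E) : Leb1 -> \bar R).
  by apply/measurable_EFinP; exact: measurable_fun_Leb1.
have mFL : measurable_fun (D : set Leb1) ((fun y => (F y)%:E) : Leb1 -> \bar R).
  by apply/measurable_EFinP; exact: measurable_Leb1_mod GF.
apply: (@ae_eq_integral _ Leb1 R mu1 D _ _ mDL mFL mGL).
exists Z; split; [exact: measurable_Leb1|exact: Z0|move=> y /= hy].
by apply: contrapT => nZ; apply: hy => Dy; rewrite GF.
Qed.

Lemma le1_powR (x q : R) : 0 <= x -> 1 <= q -> x <= 1 + x `^ q.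
Proof.
move=> x0 q1; have [x1|/ltW x1] := leP x 1.
  by apply: le_trans x1 _; rewrite lerDl powR_ge0.
by apply: le_trans (_ : x `^ q <= _); [rewrite -{1}(powRr1 x0) ler_powR|rewrite lerDr].
Qed.

Lemma weight_norm_lty (d : nat) (q : R) (I : set R) (w : R -> R) : 0 < q ->
  (weight_norm d q I w < +oo)%E -> (\int[mu1]_(t in I) (t ^+ d.-1 * w t `^ q)%:E < +oo)%E.
Proof. by move=> q0; apply: lty_poweRy; rewrite gt_eqF// invr_gt0. Qed.

Context (d : nat) (hd : (0 < d)%N).

(** Tonelli on the region [u < r]. *)
Lemma moment_tails (a : R -> R) : measurable_fun setT (a : R1 -> R) -> (forall r, 0 <= a r) ->
  (\int[mu]_(r in `]0%R, +oo[) (a r * r)%:E =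
   \int[mu]_(u in `]0%R, +oo[) \int[mu]_(r in `]u, +oo[) (a r)%:E)%E.
Proof.
move=> ma a0.
have maE : measurable_fun setT ((fun r => (a r)%:E) : R1 -> \bar R) by exact/measurable_EFinP.
have a0E r : (0 <= (a r)%:E)%E by rewrite lee_fin.
have := hardy_tonelli maE (measurable_cst 1%E) a0E (fun r => lee01).
under [in X in _ = X -> _]eq_integral do rewrite mul1e.
move=> <-; apply: eq_integral => r; rewrite inE/= in_itv/= andbT => r0.
rewrite integral_cst// mul1e [X in (_ * X)%E](lebesgue_measure_itv `]0, r[)/= lte_fin r0.
by rewrite sube0 EFinM.
Qed.

Definition cut (h : R) (w : R -> R) (r : R) : R := w r * \1_(`]-oo, h[ : set R1) r.

Section Cut.
Context (w : R -> R) (mw : measurable_fun setT (w : R1 -> R)) (w0 : forall r, 0 <= w r) (h : R).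

Lemma measurable_cut : measurable_fun setT (cut h w : R1 -> R).
Proof. by apply: measurable_funM => //; exact: measurable_indic. Qed.

Lemma cut_ge0 r : 0 <= cut h w r.
Proof. by rewrite mulr_ge0// indicE. Qed.

Lemma cut_lt r : r < h -> cut h w r = w r.
Proof. by move=> rh; rewrite /cut indicE mem_set ?mulr1//= in_itv. Qed.

Lemma cut_ge r : h <= r -> cut h w r = 0.
Proof. by move=> hr; rewrite /cut indicE memNset ?mulr0//= in_itv/= ltNge hr. Qed.

Lemma measurable_maxX (n : nat) : measurable_fun setT ((fun r => Num.max 0 r ^+ n) : R1 -> R).
Proof. by apply: measurable_funX; exact: measurable_maxr. Qed.

Lemma maxX_ge0 (n : nat) (r : R) : 0 <= Num.max 0 r ^+ n.
Proof. by rewrite exprn_ge0// le_max lexx. Qed.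

Lemma tail_cutE u : 0 <= u ->
  (tail d (cut h w) u = \int[mu]_(r in `]u, h[) (w r * r ^+ d.-1)%:E)%E.
Proof.
move=> u0; rewrite /tail integral_mkcond [RHS]integral_mkcond.
apply: eq_integral => r _; rewrite !patchE; case: ifPn => [/set_mem|/negP rn].
  rewrite /= in_itv/= andbT => ur; have r0 := ltW (le_lt_trans u0 ur).
  case: ifPn => [/set_mem|/negP hr].
    by rewrite /= in_itv/= => /andP[_ rh]; rewrite cut_lt// max_r.
  rewrite cut_ge ?mul0r// leNgt; apply/negP => rh; apply: hr.
  by rewrite inE/= in_itv/= ur.
rewrite memNset// /= in_itv/= => /andP[ur _]; apply: rn.
by rewrite inE/= in_itv/= ur.
Qed.

Lemma tail_cut_ge u : h <= u -> tail d (cut h w) u = 0%E.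
Proof.
move=> hu; apply: integral0_eq => r; rewrite /= in_itv/= andbT => ur.
by rewrite cut_ge ?mul0r// (le_trans hu)// ltW.
Qed.

(** The averaged weight [g_wh], as a function of a Borel version of the
    weight. *)
Definition mean (u : R) : R := (u ^+ d.-1)^-1 * fine (tail d (cut h w) u).

Lemma mean_ge0 u : 0 <= u -> 0 <= mean u.
Proof.
by move=> u0; rewrite mulr_ge0 ?invr_ge0 ?exprn_ge0// fine_ge0// tail_ge0// => r; exact: cut_ge0.
Qed.

Lemma measurable_tail_cut : measurable_fun setT (tail d (cut h w) : R1 -> \bar R).
Proof.
apply: measurable_tail => [|r]; last by rewrite lee_fin mulr_ge0 ?maxX_ge0// cut_ge0.
by apply/measurable_EFinP; apply: measurable_funM; [exact: measurable_cut|exact: measurable_maxX].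
Qed.

Lemma measurable_mean (D : set R) : D `<=` `]0, +oo[ -> measurable (D : set R1) ->
  measurable_fun (D : set R1) (mean : R1 -> R).
Proof.
move=> D0 mD; apply: measurable_funM; last first.
  by apply: (measurable_funS measurableT (@subsetT _ _)); apply: measurableT_comp => //;
  exact: measurable_tail_cut.
have mp : measurable_fun (D : set R1) (fun u : R1 => (u ^+ d.-1) `^ (- 1)).
  apply: (measurableT_comp (measurable_powR _)); exact: measurable_funX.
apply: eq_measurable_fun mp => u; rewrite inE => /D0; rewrite /= in_itv/= andbT => u0.
by rewrite powR_inv1// exprn_ge0// ltW.
Qed.

Context (tfin : forall u, 0 < u -> tail d (cut h w) u \is a fin_num).

(** The first moment is the integral of [u ^+ d.-1 * mean u], and [x <= 1 +
    x^q]. *)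
Lemma moment_lty (q : R) : 1 <= q -> 0 < h ->
  (\int[mu]_(u in `]0%R, h[) (u ^+ d.-1 * mean u `^ q)%:E < +oo)%E ->
  (\int[mu]_(r in `]0%R, h[) (w r * r ^+ d)%:E < +oo)%E.
Proof.
move=> q1 h0 hq.
pose a r := cut h w r * Num.max 0 r ^+ d.-1.
have ma : measurable_fun setT (a : R1 -> R).
  by apply: measurable_funM; [exact: measurable_cut|exact: measurable_maxX].
have a0 r : 0 <= a r by rewrite mulr_ge0 ?maxX_ge0// cut_ge0.
have -> : (\int[mu]_(r in `]0%R, h[) (w r * r ^+ d)%:E =
          \int[mu]_(r in `]0%R, +oo[) (a r * r)%:E)%E.
  rewrite integral_mkcond [RHS]integral_mkcond; apply: eq_integral => r _; rewrite !patchE.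
  case: ifPn => [/set_mem|/negP rn].
    rewrite /= in_itv/= => /andP[r0 rh]; rewrite mem_set/= ?in_itv/= ?r0//.
    by rewrite /a cut_lt// max_r ?(ltW r0)// -mulrA -exprSr prednK.
  case: ifPn => // /set_mem; rewrite /= in_itv/= andbT => r0.
  rewrite /a cut_ge ?mul0r// leNgt; apply/negP => rh; apply: rn.
  by rewrite inE/= in_itv/= r0.
rewrite (moment_tails ma a0).
have -> : (\int[mu]_(u in `]0%R, +oo[) \int[mu]_(r in `]u, +oo[) (a r)%:E =
          \int[mu]_(u in `]0%R, h[) tail d (cut h w) u)%E.
  rewrite integral_mkcond [RHS]integral_mkcond; apply: eq_integral => u _; rewrite !patchE.
  case: ifPn => [/set_mem|/negP un].
    rewrite /= in_itv/= andbT => u0; case: ifPn => // /negP hu; rewrite -/(tail d (cut h w) u).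
    apply: tail_cut_ge; rewrite leNgt; apply/negP => uh; apply: hu.
    by rewrite inE/= in_itv/= u0.
  rewrite memNset// /= in_itv/= => /andP[u0 _]; apply: un.
  by rewrite inE/= in_itv/= u0.
have mI : measurable (`]0, h[%classic : set R1) by exact: measurable_itv.
have mm : measurable_fun (`]0, h[%classic : set R1) (mean : R1 -> R).
  by apply: measurable_mean => // u; rewrite /= !in_itv/= andbT => /andP[].
have mX : measurable_fun (`]0, h[%classic : set R1) ((fun u => u ^+ d.-1) : R1 -> R).
  exact: measurable_funX.
have mq : measurable_fun (`]0, h[%classic : set R1) ((fun u => u ^+ d.-1 * mean u `^ q) : R1 -> R).
  by apply: measurable_funM => //; exact: (measurableT_comp (measurable_powR _) mm).
have X0 u : `]0, h[%classic u -> 0 <= u ^+ d.-1.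
  by rewrite /= in_itv/= => /andP[u0 _]; rewrite exprn_ge0// ltW.
apply: (@le_lt_trans _ _ (\int[mu]_(u in `]0%R, h[) ((u ^+ d.-1)%:E + (u ^+ d.-1 * mean u `^ q)%:E))%E).
  apply: ge0_le_integral => //.
  - by move=> u _; apply: tail_ge0 => r; exact: cut_ge0.
  - exact: measurable_funS measurable_tail_cut.
  - by apply: emeasurable_funD; exact/measurable_EFinP.
  move=> u uI; move: (uI); rewrite /= in_itv/= => /andP[u0 uh].
  rewrite -(fineK (tfin u0)) -EFinD lee_fin.
  have -> : fine (tail d (cut h w) u) = u ^+ d.-1 * mean u.
    by rewrite /mean mulrA mulfV ?mul1r// expf_neq0// gt_eqF.
  by rewrite -{2}(mulr1 (u ^+ _)) -mulrDr ler_wpM2l ?X0// le1_powR// mean_ge0// ltW.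
rewrite (ge0_integralD mu mI); last 4 first.
- by move=> u uI; rewrite lee_fin X0.
- exact/measurable_EFinP.
- by move=> u uI; rewrite lee_fin mulr_ge0 ?powR_ge0// X0.
- exact/measurable_EFinP.
apply: lte_add_pinfty => //.
apply: (@le_lt_trans _ _ (\int[mu]_(t in `]0%R, h[) (cst (h ^+ d.-1)%:E t))%E).
  apply: ge0_le_integral => //.
  - exact/measurable_EFinP.
  - move=> t; rewrite /= in_itv/= => /andP[t0 th].
    by rewrite lee_fin lerXn2r ?nnegrE ?ltW// (lt_trans t0).
rewrite integral_cst// [X in (_ * X)%E](lebesgue_measure_itv `]0, h[)/= lte_fin h0 sube0.
by rewrite -EFinM ltry.
Qed.

End Cut.

End Weight1.

(** * Boundedness of the truncated operator *)

Section Truncated.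
Context {R : realType} (d : nat) (hd : (1 < d)%N) (K C : set 'rV[R]_d).
Context (hK : convex_body K) (hC : open_fg_cone C).
Local Notation V := 'rV[R]_d.
Local Notation N := (gauge_norm K).
Local Notation mu := (@lebesgue_measure R).
Local Notation leb := (@leb R d).
Local Notation vol := (@vol R d).
Local Notation Bor := (Bor R d).
Local Notation Leb := (Leb R d).
Local Notation R1 := (measurableTypeR R).
Context (m0 : (0 < vol (K `&` C))%E).

Section Average.
Context (k : V -> R) (mk : measurable_fun setT (k : Bor -> R)) (k0 : forall t, 0 <= k t).
Context (B : R) (kB : (\int[vol]_t (k t)%:E = B%:E)%E).

(** The part of the truncated operator that acts through integration; the rest
    is a multiple of the identity. *)
Definition average (g : V -> R) (x : V) : R := \int[vol]_t (k t * g (x + t)).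

Lemma average_measurable (g : V -> R) (x : V) : measurable_fun setT (g : Bor -> R) ->
  measurable_fun setT ((fun t => k t * g (x + t)) : Bor -> R).
Proof.
move=> mg; apply: measurable_funM => //.
rewrite (_ : (fun t => _) = (fun t : Bor => g ((t : V) + x))).
  exact: measurableT_comp mg (measurable_shift x).
by apply/funext => t; rewrite addrC.
Qed.

Lemma average_integral_le (g : V -> R) (x : V) (c : R) :
    measurable_fun setT (g : Bor -> R) -> (forall y, `|g y| <= c) ->
  (\int[vol]_t `|(k t * g (x + t))%:E| <= (c * B)%:E)%E.
Proof.
move=> mg gc; have c0 : 0 <= c by exact: le_trans (normr_ge0 _) (gc 0).
rewrite EFinM -kB -ge0_integralZl//; last 2 first.
- exact/measurable_EFinP.
- by move=> t _; rewrite lee_fin.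
apply: ge0_le_integral => //.
- by apply: measurableT_comp => //; apply/measurable_EFinP; exact: average_measurable.
- by apply: emeasurable_funM => //; exact/measurable_EFinP.
by move=> t _; rewrite abse_EFin -EFinM lee_fin normrM (ger0_norm (k0 _)) mulrC ler_wpM2r.
Qed.

Lemma average_integrable (g : V -> R) (x : V) (c : R) :
    measurable_fun setT (g : Bor -> R) -> (forall y, `|g y| <= c) ->
  vol.-integrable setT (fun t => (k t * g (x + t))%:E).
Proof.
move=> mg gc; apply/integrableP; split.
  by apply/measurable_EFinP; exact: average_measurable.
by apply: le_lt_trans (average_integral_le x mg gc) _; rewrite ltry.
Qed.

Lemma kernel_integrable : vol.-integrable setT (fun t => (k t)%:E).
Proof.
apply/integrableP; split; first exact/measurable_EFinP.
under eq_integral do rewrite abse_EFin (ger0_norm (k0 _)).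
by rewrite kB ltry.
Qed.

Lemma average_le (g : V -> R) (x : V) (c : R) :
    measurable_fun setT (g : Bor -> R) -> (forall y, `|g y| <= c) ->
  `|average g x| <= c * B.
Proof.
move=> mg gc; have ig := average_integrable x mg gc.
rewrite -lee_fin -abse_EFin /average /Rintegral fineK ?(integrable_fin_num measurableT)//.
apply: le_trans (le_abse_integral vol measurableT _) (average_integral_le x mg gc).
by apply/measurable_EFinP; exact: average_measurable.
Qed.

Lemma average_linear (g1 g2 : V -> R) (a x c1 c2 : _) :
    measurable_fun setT (g1 : Bor -> R) -> (forall y, `|g1 y| <= c1) ->
    measurable_fun setT (g2 : Bor -> R) -> (forall y, `|g2 y| <= c2) ->
  average (fun y => a * g1 y + g2 y) x = a * average g1 x + average g2 x.
Proof.
move=> mg1 gc1 mg2 gc2.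
have i1 := average_integrable x mg1 gc1; have i2 := average_integrable x mg2 gc2.
have i3 : vol.-integrable setT (fun t => (a%:E * (k t * g1 (x + t)%R)%:E)%E) by exact: integrableZl.
apply: EFin_inj; rewrite EFinD EFinM /average /Rintegral !fineK ?(integrable_fin_num measurableT)//.
  rewrite -(integralZl measurableT i1) -(integralD measurableT i3 i2).
  by apply: eq_integral => t _; rewrite -EFinM -EFinD mulrDr mulrCA.
rewrite (_ : (fun t => _) = (fun t => ((a%:E * (k t * g1 (x + t)%R)%:E) + (k t * g2 (x + t)%R)%:E)%E)).
  exact: integrableD.
by apply/funext => t; rewrite -EFinM -EFinD mulrDr mulrCA.
Qed.

(** As for [measurable_mol], adding a constant reduces to nonnegative
    functions. *)
Lemma measurable_average (g : V -> R) (c : R) :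
    measurable_fun setT (g : Bor -> R) -> (forall y, `|g y| <= c) ->
  measurable_fun setT (average g : Bor -> R).
Proof.
move=> mg gc.
have c0 y : 0 <= g y + c by have := gc y; rewrite ler_norml => /andP[+ _]; lra.
have mgc : measurable_fun setT ((fun y => g y + c) : Bor -> R) by exact: measurable_funD.
pose G (z : Bor * Bor) : \bar R := (k z.2 * (g ((z.1 : V) + z.2) + c))%:E.
have mG : measurable_fun setT G.
  apply/measurable_EFinP; apply: measurable_funM; first exact: measurableT_comp mk measurable_snd.
  apply: (measurableT_comp mgc); apply: measurable_fun_Bor => j.
  rewrite (_ : (fun _ => _) = (fun z : Bor * Bor => (z.1 : V) 0 j + (z.2 : V) 0 j)); last first.
    by apply/funext => z; rewrite !mxE.
  apply: measurable_funD; first exact: measurableT_comp (measurable_coord j) measurable_fst.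
  exact: measurableT_comp (measurable_coord j) measurable_snd.
have G0 z : (0 <= G z)%E by rewrite /G lee_fin mulr_ge0.
have mI := @measurable_fun_fubini_tonelli_F _ _ Bor Bor R vol G mG G0.
rewrite (_ : average g = fun x => fine (\int[vol]_t G (x, t))%E - c * B).
  by apply: measurable_funB => //; exact: measurableT_comp.
apply/funext => x.
have i1 := average_integrable x mg gc.
have i3 : vol.-integrable setT (fun t => (c%:E * (k t)%:E)%E) by apply: integrableZl => //; exact: kernel_integrable.
have -> : (\int[vol]_t G (x, t) = (average g x)%:E + (c * B)%:E)%E.
  rewrite /average /Rintegral fineK ?(integrable_fin_num measurableT)//.
  rewrite EFinM -kB -(integralZl measurableT kernel_integrable) -(integralD measurableT i1 i3).
  by apply: eq_integral => t _; rewrite /G/= -EFinM -EFinD mulrDr [c * _]mulrC.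
by rewrite -EFinD/= addrK.
Qed.

End Average.

Context (w wB : R -> R) (Zw : set R) (mwB : measurable_fun setT (wB : R1 -> R)).
Context (wB0 : forall r, 0 <= wB r).
Context (mZw : measurable (Zw : set R1)) (Zw0 : mu Zw = 0%E).
Context (wBE : forall r, 0 < r -> ~ Zw r -> wB r = w r).
Context (E : set V) (mE : measurable (E : set Bor)) (EC : E `<=` C).
Context (B : R) (EB : (\int[vol]_t (\1_E t * wB (N t))%:E = B%:E)%E).

Definition trunc (t : V) : R := \1_E t * wB (N t).

Lemma measurable_trunc : measurable_fun setT (trunc : Bor -> R).
Proof.
apply: measurable_funM; first exact: measurable_indic.
exact: measurableT_comp mwB (measurable_gauge hK).
Qed.

Lemma trunc_ge0 t : 0 <= trunc t.
Proof. by rewrite mulr_ge0// indicE. Qed.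

Definition trunc_op (f : V -> R) (x : V) : R :=
  \int[leb]_(t in E) (w (N t) * (f x - f (x + t))).

Lemma B_ge0 : 0 <= B.
Proof. by rewrite -lee_fin -EB; apply: integral_ge0 => t _; rewrite lee_fin trunc_ge0. Qed.

Lemma trunc_opE (f f1 : V -> R) (Zf : set V) (c : R) (x : V) :
    measurable_fun setT (f1 : Bor -> R) -> (forall y, `|f1 y| <= c) ->
    measurable (Zf : set Bor) -> vol Zf = 0%E ->
    (forall y, C y -> ~ Zf y -> f1 y = f y) -> C x ->
  trunc_op f x = f x * B - average trunc f1 x.
Proof.
move=> mf1 f1c mZf Zf0 f1E Cx.
have [mF mG e] := operator_version hd hK hC mwB mZw Zw0 wBE mE EC mf1 mZf Zf0 f1E Cx.
have i1 := average_integrable measurable_trunc trunc_ge0 EB x mf1 f1c.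
have ik := kernel_integrable measurable_trunc trunc_ge0 EB.
have i3 : vol.-integrable setT (fun t => ((f x)%:E * (trunc t)%:E)%E) by exact: integrableZl.
have eG : (fun t => (\1_E t * (wB (N t) * (f x - f1 (x + t))))%:E) =
    (fun t => ((f x)%:E * (trunc t)%:E - (trunc t * f1 (x + t)%R)%:E)%E).
  by apply/funext => t; rewrite -EFinM -EFinB /trunc; congr (_%:E); ring.
rewrite /trunc_op /Rintegral e eG (integralB measurableT i3 i1) (integralZl measurableT ik) EB.
by rewrite -EFinM /average /Rintegral -[X in (_ - X)%E]fineK// (integrable_fin_num measurableT).
Qed.

(** The two terms of [trunc_opE] contribute one [B] each. *)
Lemma trunc_op_le (f : V -> R) : Linfty C f ->
  (Lp_norm +oo C (trunc_op f) <= (2 * B)%:E * Lp_norm +oo C f)%E.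
Proof.
move=> fL; have [f1 [Zf [mf1 f1c mZf Zf0 f1E]]] := Linfty_version hC m0 fL.
rewrite -[X in (_ * X)%E](fineK (Linfty_norm_fin fL)) -EFinM.
set c := fine _ in f1c *; have B0 := B_ge0.
have c0 : 0 <= c by exact/fine_ge0/Linfty_norm_ge0.
apply/(Linfty_normP m0); first by rewrite mulr_ge0// mulr_ge0.
have [Z [mZ Z0 hZ]] := leb_null mZf Zf0.
exists Z; split => // y /= hy; apply: hZ; apply: contrapT => nZ; apply: hy => Cy.
rewrite (trunc_opE mf1 f1c mZf Zf0 f1E Cy).
have h1 := average_le measurable_trunc trunc_ge0 EB y mf1 f1c.
have h2 : `|f y| <= c by rewrite -f1E.
apply: le_trans (ler_normB _ _) _; rewrite normrM (ger0_norm B0).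
have : `|f y| * B <= c * B by rewrite ler_wpM2r.
lra.
Qed.

Lemma trunc_op_Linfty (f : V -> R) : Linfty C f -> Linfty C (trunc_op f).
Proof.
move=> fL; split; last first.
  apply: le_lt_trans (trunc_op_le fL) _; apply: lte_mul_pinfty => //.
  - by rewrite lee_fin mulr_ge0// B_ge0.
  - by have [] := fL.
have [f1 [Zf [mf1 f1c mZf Zf0 f1E]]] := Linfty_version hC m0 fL.
have mC := measurable_cone hC.
pose F (x : V) := f1 x * B - average trunc f1 x.
have mF : measurable_fun setT (F : Bor -> R).
  apply: measurable_funB; first exact: measurable_funM.
  exact: (measurable_average measurable_trunc trunc_ge0 EB mf1 f1c).
apply: (measurable_Leb_mod mC mZf Zf0 (measurable_funS measurableT (@subsetT _ _) mF)).
by move=> y Cy nZ; rewrite (trunc_opE mf1 f1c mZf Zf0 f1E Cy) /F f1E.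
Qed.

Lemma trunc_op_linear (a : R) (f g : V -> R) (x : V) :
    Linfty C f -> Linfty C g -> C x ->
  trunc_op (fun y => a * f y + g y) x = a * trunc_op f x + trunc_op g x.
Proof.
move=> fL gL Cx.
have [f1 [Zf [mf1 f1c mZf Zf0 f1E]]] := Linfty_version hC m0 fL.
have [g1 [Zg [mg1 g1c mZg Zg0 g1E]]] := Linfty_version hC m0 gL.
set c1 := fine _ in f1c; set c2 := fine _ in g1c.
have mfg : measurable_fun setT ((fun y => a * f1 y + g1 y) : Bor -> R).
  by apply: measurable_funD => //; exact: measurable_funM.
have fgc y : `|a * f1 y + g1 y| <= `|a| * c1 + c2.
  apply: le_trans (ler_normD _ _) _; rewrite normrM lerD//.
  by rewrite ler_wpM2l.
have mZ : measurable (Zf `|` Zg : set Bor) by exact: measurableU.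
have Z0 : vol (Zf `|` Zg) = 0%E by rewrite measureU0.
rewrite (trunc_opE mf1 f1c mZf Zf0 f1E Cx) (trunc_opE mg1 g1c mZg Zg0 g1E Cx).
rewrite (trunc_opE mfg fgc mZ Z0 _ Cx); last first.
  move=> y Cy nZ; rewrite f1E// ?g1E// => h; apply: nZ; [by right|by left].
rewrite (average_linear measurable_trunc trunc_ge0 EB a x mf1 f1c mg1 g1c); ring.
Qed.

Lemma trunc_op_approximant : approximants C (2 * B) trunc_op.
Proof.
have B2 : 0 <= 2 * B by rewrite mulr_ge0// B_ge0.
have h : (op_norm C (Linfty C) trunc_op <= (2 * B)%:E)%E.
  apply: ereal_inf_lbound; exists (2 * B) => //; split => // f fL.
  exact: trunc_op_le.
split => //; split.
- exact: trunc_op_Linfty.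
- move=> a f g fL gL; apply: nearW => x Cx; exact: trunc_op_linear.
- by apply: le_lt_trans h _; rewrite ltry.
Qed.

End Truncated.

(** * The first moment of the weight *)

Section Contraction.
Context {R : realType} (d : nat) (hd : (0 < d)%N).
Local Notation mu := (@lebesgue_measure R).
Local Notation mu1 := (@completed_lebesgue_measure R).
Local Notation R1 := (measurableTypeR R).

(** The interval ]e, 1[ lies in the union of ]nu e, nu[ and [nu, 1[. Scaling
    by [nu] bounds the moment over the first one by nu^(d+1) (I(e) + O), where
    I(e) is the moment over ]e, 1[ and O that of [o]; the moment over the
    second one does not depend on [e]. As I(e) is finite and nu^(d+1) < 1, it
    is bounded independently of [e]. *)
Lemma contraction_moment (w o : R -> R) (nu : R) (Z : set R) :
    measurable_fun setT (w : R1 -> R) -> (forall r, 0 <= w r) ->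
    measurable_fun setT (o : R1 -> R) -> (forall r, 0 <= o r) -> 0 < nu -> nu < 1 ->
    (forall e, 0 < e -> (\int[mu]_(r in `]e, 1%R[) (w r * r ^+ d)%:E < +oo)%E) ->
    (\int[mu]_(r in `]0%R, 1%R[) (o r * r ^+ d)%:E < +oo)%E ->
    measurable (Z : set R1) -> mu Z = 0%E ->
    (forall u, 0 < u < 1 -> ~ Z u -> w (nu * u) <= w u + o u) ->
  (\int[mu]_(r in `]0%R, 1%R[) (w r * r ^+ d)%:E < +oo)%E.
Proof.
move=> mw w0 mo o0 nu0 nu1 hw ho mZ Z0 hwo.
have mX : measurable_fun setT ((fun r => r ^+ d) : R1 -> R) by exact: measurable_funX.
have mW : measurable_fun setT ((fun r => (w r * r ^+ d)%:E) : R1 -> \bar R).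
  by apply/measurable_EFinP; exact: measurable_funM.
have mO : measurable_fun setT ((fun r => (o r * r ^+ d)%:E) : R1 -> \bar R).
  by apply/measurable_EFinP; exact: measurable_funM.
pose I e := (\int[mu]_(r in `]e, 1%R[) (w r * r ^+ d)%:E)%E.
pose O := (\int[mu]_(r in `]0%R, 1%R[) (o r * r ^+ d)%:E)%E.
have X0 r : 0 < r -> 0 <= r ^+ d by move=> r0; rewrite exprn_ge0// ltW.
have O0 : (0 <= O)%E.
  apply: integral_ge0 => r; rewrite /= in_itv/= => /andP[r0 _].
  by rewrite lee_fin mulr_ge0// X0.
have I0 e : 0 < e -> (0 <= I e)%E.
  move=> e0; apply: integral_ge0 => r; rewrite /= in_itv/= => /andP[r0 _].
  by rewrite lee_fin mulr_ge0// X0// (lt_trans e0).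
have Ofin : O \is a fin_num by rewrite ge0_fin_numE.
have Ifin e : 0 < e -> I e \is a fin_num by move=> e0; rewrite ge0_fin_numE ?I0//; exact: hw.
have nu20 : 0 < nu / 2 by rewrite divr_gt0.
pose c := fine (I (nu / 2)).
have step e : 0 < e -> (I e <= (nu ^+ d.+1)%:E * (I e + O) + c%:E)%E.
  move=> e0; have ne0 : 0 < nu * e by rewrite mulr_gt0.
  pose f r := (w r * r ^+ d * \1_(`]nu * e, nu[ : set R1) r)%:E.
  have mf : measurable_fun setT (f : R1 -> \bar R).
    apply/measurable_EFinP; apply: measurable_funM; last exact: measurable_indic.
    exact: measurable_funM.
  have f0 r : (0 <= f r)%E.
    rewrite lee_fin indicE; case: (boolP (r \in _)); last by rewrite mulr0.
    by rewrite inE/= in_itv/= mulr1 => /andP[r0 _]; rewrite mulr_ge0// X0// (lt_trans ne0).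
  have h1 : (\int[mu]_(r in `](nu * e)%R, nu[) (w r * r ^+ d)%:E <= (nu ^+ d.+1)%:E * (I e + O))%E.
    have -> : (\int[mu]_(r in `](nu * e)%R, nu[) (w r * r ^+ d)%:E = \int[mu]_(r in `]0%R, +oo[) f r)%E.
      rewrite integral_mkcond [RHS]integral_mkcond; apply: eq_integral => r _; rewrite !patchE /f indicE.
      case: ifPn => [/set_mem rI|nI].
        rewrite mulr1 mem_set//= in_itv/= andbT; move: rI; rewrite /= in_itv/= => /andP[r0 _].
        exact: lt_trans r0.
      by rewrite mulr0; case: ifP.
    rewrite (ge0_integral_scale1 nu0 mf f0).
    rewrite exprS EFinM -muleA; apply: lee_wpmul2l; first by rewrite lee_fin ltW.
    have -> : (\int[mu]_(x in `]0%R, +oo[) f (nu * x)%R =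
        \int[mu]_(u in `]e, 1%R[) ((nu ^+ d)%:E * (w (nu * u) * u ^+ d)%:E))%E.
      rewrite integral_mkcond [RHS]integral_mkcond; apply: eq_integral => u _; rewrite !patchE /f indicE.
      have uE : (nu * u \in (`]nu * e, nu[%classic : set R)) = (u \in (`]e, 1[%classic : set R)).
        by apply/idP/idP; rewrite !inE/= !in_itv/= ltr_pM2l// gtr_pMr.
      rewrite uE; case: (boolP (u \in (`]e, 1[%classic : set R))) => [/set_mem uI|_].
        rewrite mem_set/=; last first.
          by move: uI; rewrite /= !in_itv/= => /andP[eu _]; rewrite (lt_trans e0).
        by rewrite mulr1 -EFinM; congr (_%:E); rewrite exprMn; ring.
      by rewrite mulr0; case: ifP.
    rewrite ge0_integralZl//; last 3 first.
    - apply: (measurable_funS measurableT (@subsetT _ _)); apply/measurable_EFinP.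
      apply: measurable_funM => //; exact: (measurableT_comp mw (measurable_scale1 nu)).
    - move=> u; rewrite /= in_itv/= => /andP[eu _].
      by rewrite lee_fin mulr_ge0// X0// (lt_trans e0).
    - by rewrite lee_fin X0.
    apply: lee_wpmul2l; first by rewrite lee_fin X0.
    apply: (@le_trans _ _ (\int[mu]_(u in `]e, 1%R[) ((w u * u ^+ d)%:E + (o u * u ^+ d)%:E))%E).
      apply: ae_ge0_le_integral => //.
      - move=> u; rewrite /= in_itv/= => /andP[eu _].
        by rewrite lee_fin mulr_ge0// X0// (lt_trans e0).
      - apply: (measurable_funS measurableT (@subsetT _ _)); apply/measurable_EFinP.
        apply: measurable_funM => //; exact: (measurableT_comp mw (measurable_scale1 nu)).
      - move=> u; rewrite /= in_itv/= => /andP[eu _].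
        by rewrite -EFinD lee_fin addr_ge0// mulr_ge0// X0// (lt_trans e0).
      - by apply: measurable_funS (emeasurable_funD mW mO).
      exists Z; split => // u /= hu; apply: contrapT => nZ; apply: hu.
      rewrite in_itv/= => /andP[eu u1]; have u0 := lt_trans e0 eu.
      by rewrite -EFinD lee_fin -mulrDl ler_wpM2r ?X0// hwo// u0.
    rewrite ge0_integralD//; last 4 first.
    - move=> u; rewrite /= in_itv/= => /andP[eu _].
      by rewrite lee_fin mulr_ge0// X0// (lt_trans e0).
    - exact: measurable_funS mW.
    - move=> u; rewrite /= in_itv/= => /andP[eu _].
      by rewrite lee_fin mulr_ge0// X0// (lt_trans e0).
    - exact: measurable_funS mO.
    apply: leeD => //; apply: ge0_subset_integral => //.
    - exact: measurable_funS mO.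
    - move=> u; rewrite /= in_itv/= => /andP[u0 _].
      by rewrite lee_fin mulr_ge0// X0.
    - by move=> u; rewrite /= !in_itv/= => /andP[eu ->]; rewrite (lt_trans e0).
  have h2 : (I (nu / 2)%R <= c%:E)%E by rewrite /c fineK// Ifin.
  apply: (le_trans _ (leeD h1 h2)).
  pose A : set R := `]nu * e, nu[%classic; pose B : set R := `[nu, 1[%classic.
  apply: (@le_trans _ _ (\int[mu]_(r in A `|` B) (w r * r ^+ d)%:E)%E).
    have mAB : measurable (A `|` B : set R1) by apply: measurableU; exact: measurable_itv.
    rewrite /I; apply: ge0_subset_integral => //.
    - exact: measurable_funS mW.
    - move=> r [|]; rewrite /A /B /= in_itv/= => /andP[h _]; rewrite lee_fin mulr_ge0// X0//.
        exact: lt_trans h.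
      exact: lt_le_trans h.
    - move=> r; rewrite /A /B /= !in_itv/= => /andP[er r1].
      have [nr|rn] := leP nu r; [by right|left].
      by rewrite andbT (le_lt_trans _ er)// ler_piMl// ltW.
  have mA : measurable (A : set R1) by exact: measurable_itv.
  have mB : measurable (B : set R1) by exact: measurable_itv.
  rewrite (ge0_integral_setU _ mA mB); last 3 first.
  - exact: measurable_funS mW.
  - move=> r [|]; rewrite /A /B /= in_itv/= => /andP[h _]; rewrite lee_fin mulr_ge0// X0//.
      exact: lt_trans h.
    exact: lt_le_trans h.
  - rewrite disj_set2E; apply/eqP/seteqP; split => r //= []; rewrite /A /B /= !in_itv/= => /andP[_ r1] /andP[r2 _].
    by move: r1; rewrite ltNge r2.
  apply: leeD; first by [].
  rewrite /I; apply: ge0_subset_integral => //.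
  - exact: measurable_funS mW.
  - move=> r; rewrite /= in_itv/= => /andP[h _]; rewrite lee_fin mulr_ge0// X0//.
    exact: lt_trans h.
  - move=> r; rewrite /B /= !in_itv/= => /andP[h ->]; rewrite andbT.
    by apply: lt_le_trans h; rewrite ltr_pdivrMr// ltr_pMr// ltr1n.
(* The fixed point of the contraction, with nu^(d+1) weakened to nu. *)
pose M := (fine O + c) / (1 - nu).
have IM e : 0 < e -> (I e <= M%:E)%E.
  move=> e0; have := step e e0; have := I0 e e0.
  rewrite /M; case: (I e) (Ifin e e0) => [x _|//|//].
  have [y yE] : exists y, O = y%:E by exists (fine O); rewrite fineK.
  have y0 : 0 <= y by rewrite -lee_fin -yE.
  rewrite yE -(EFinD x y) -(EFinM _ (x + y)) -(EFinD _ c) !lee_fin /= => x0 hs.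
  rewrite ler_pdivlMr ?subr_gt0//.
  have pn : nu ^+ d.+1 <= nu by rewrite -[leRHS]expr1 ler_wiXn2l// ltW.
  have : nu ^+ d.+1 * (x + y) <= nu * (x + y) by rewrite ler_wpM2r// addr_ge0.
  have : nu * y <= y by rewrite ler_piMl// ltW.
  lra.
apply: (@le_lt_trans _ _ M%:E); last by rewrite ltry.
pose u n r : \bar R := (w r * r ^+ d * \1_(`]n.+2%:R^-1, 1%R[ : set R1) r)%:E.
apply: (@fatou_le _ R1 R mu _ u) => //.
- move=> n; apply: (measurable_funS measurableT (@subsetT _ _)).
  apply/measurable_EFinP; apply: measurable_funM; last exact: measurable_indic.
  exact: measurable_funM.
- move=> n r; rewrite /= in_itv/= => /andP[r0 _].
  by rewrite lee_fin mulr_ge0 ?mulr_ge0 ?X0// indicE.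
- move=> r; rewrite /= in_itv/= => /andP[r0 r1].
  apply: cvg_near_cst; near=> n; rewrite /u indicE mem_set ?mulr1//= in_itv/= r1 andbT.
  rewrite invf_plt ?posrE//; apply: lt_le_trans (_ : n%:R <= _); last by rewrite ler_nat leqW.
  by near: n; exact: nbhs_infty_gtr.
move=> n; rewrite (_ : (\int[mu]_(r in _) u n r = I (n.+2%:R^-1)%R)%E); first exact: IM.
rewrite integral_mkcond [RHS]integral_mkcond; apply: eq_integral => r _; rewrite !patchE /u indicE.
case: (boolP (r \in (`]n.+2%:R^-1, 1%R[%classic : set R))) => [/set_mem rI|_]; last first.
  by rewrite mulr0; case: ifP.
rewrite mem_set ?mulr1//; move: rI; rewrite /= !in_itv/= => /andP[h ->]; rewrite andbT.
by apply: lt_trans h; rewrite invr_gt0.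
Unshelve. all: by end_near. Qed.

End Contraction.

(** The membership conditions only concern the intervals ]u, 1[. *)
Lemma measurable_pos (R : realType) (w : R -> R) :
    (forall u, 0 < u < 1 -> measurable_fun (`]u, 1[%classic : set (@Leb1 R)) (w : @Leb1 R -> R)) ->
  measurable_fun (`]0, 1[%classic : set (@Leb1 R)) (w : @Leb1 R -> R).
Proof.
move=> mw; rewrite (_ : `]0, 1[%classic = \bigcup_n `]n.+2%:R^-1, 1[%classic).
  have mJ (n : nat) : measurable (`](n.+2%:R^-1 : R), 1[%classic : set (@Leb1 R)).
    by apply: measurable_Leb1; exact: measurable_itv.
  apply: ((measurable_fun_bigcup (w : @Leb1 R -> R) mJ).2 _) => n.
  by apply: mw; rewrite invr_gt0 ltr0n/= invf_lt1// ltr1n.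
apply/seteqP; split => r /=.
  rewrite in_itv/= => /andP[r0 r1].
  have [n _ hn] : \forall n \near \oo, r^-1 < n%:R by exact: nbhs_infty_gtr.
  exists n => //=; rewrite in_itv/= r1 andbT invf_plt ?posrE//.
  by apply: lt_le_trans (hn n (leqnn n)) _; rewrite ler_nat leqW.
move=> [n _]; rewrite /= !in_itv/= => /andP[h ->]; rewrite andbT.
by apply: lt_trans h; rewrite invr_gt0.
Qed.

Section WeightVersion.
Context {R : realType} (d : nat) (hd : (0 < d)%N).
Local Notation mu := (@lebesgue_measure R).
Local Notation mu1 := (@completed_lebesgue_measure R).
Local Notation R1 := (measurableTypeR R).

(** The data that replace the weight: its values matter only almost everywhere
    on [D]. *)
Definition borel_weight (D : set R) (w wB : R -> R) (Z : set R) : Prop :=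
  [/\ measurable_fun setT (wB : R1 -> R), forall r, 0 <= wB r,
      measurable (Z : set R1), mu Z = 0%E & forall r, D r -> ~ Z r -> wB r = w r].

Lemma borel_weight_exists (D : set R) (w : R -> R) :
    measurable (D : set R1) -> measurable_fun (D : set Leb1) (w : Leb1 -> R) ->
    (forall r, D r -> 0 <= w r) ->
  exists wB Z, borel_weight D w wB Z /\ forall r, D r -> wB r <= w r.
Proof.
move=> mD mw w0.
have [wB [Z [mwB mZ Z0 wE wZ]]] := leb1_borel_version mD mw.
have wP r : (D r /\ ~ Z r) \/ (~ D r \/ Z r).
  have [Dr|nD] := pselect (D r); last by right; left.
  by have [Zr|nZ] := pselect (Z r); [right; right|left].
exists wB, Z; split; last first.
  by move=> r Dr; have [[_ nZ]|h] := wP r; [rewrite wE|rewrite wZ// w0].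
by split => // r; have [[Dr nZ]|h] := wP r; [rewrite wE// w0|rewrite wZ].
Qed.

Lemma borel_weightS (D D' : set R) (w wB : R -> R) (Z : set R) :
  D' `<=` D -> borel_weight D w wB Z -> borel_weight D' w wB Z.
Proof. by move=> DD [? ? ? ? h]; split => // r /DD; exact: h. Qed.

Section Transfer.
Context (w wB : R -> R) (Z : set R) (h : R).
Context (bw : borel_weight `]0, h[ w wB Z) (w0 : forall r, 0 < r < h -> 0 <= w r).

Lemma g_whE u : 0 < u < h -> g_wh d w h u = mean d wB h u.
Proof.
move=> /andP[u0 uh]; have [mwB wB0 mZ Z0 wE] := bw.
rewrite /g_wh /mean; congr (_ * _); rewrite /Rintegral tail_cutE//; last exact: ltW.
congr (fine _); apply: (ge0_integral_leb1_mod (measurable_itv _) mZ Z0).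
- by apply: measurable_funM; [exact: measurable_funS mwB|exact: measurable_funX].
- move=> y; rewrite /= in_itv/= => /andP[uy yh] nZ; rewrite wE//=.
  by rewrite in_itv/= yh (lt_trans u0).
- move=> y; rewrite /= in_itv/= => /andP[uy yh]; have y0 := lt_trans u0 uy.
  by rewrite mulr_ge0 ?w0 ?y0 ?exprn_ge0// ltW.
- move=> y; rewrite /= in_itv/= => /andP[uy yh]; have y0 := lt_trans u0 uy.
  by rewrite mulr_ge0// exprn_ge0// ltW.
Qed.

Lemma weight_norm_meanE q : weight_norm d q `]0, h[ (g_wh d w h) =
  ((\int[mu]_(u in `]0%R, h[) (u ^+ d.-1 * mean d wB h u `^ q)%:E) `^ q^-1)%E.
Proof.
have [mwB wB0 mZ Z0 wE] := bw; rewrite /weight_norm; congr (_ `^ _)%E.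
have mm : measurable_fun (`]0, h[%classic : set R1) (mean d wB h : R1 -> R).
  by apply: measurable_mean => //; move=> u; rewrite /= !in_itv/= andbT => /andP[].
have hge u : `]0, h[%classic u -> 0 <= u ^+ d.-1.
  by rewrite /= in_itv/= => /andP[u0 _]; rewrite exprn_ge0// ltW.
apply: (ge0_integral_leb1_mod (measurable_itv _) measurable0 (measure0 _)).
- apply: measurable_funM; first exact: measurable_funX.
  exact: (measurableT_comp (measurable_powR _) mm).
- by move=> u; rewrite /= in_itv/= => uh _; rewrite g_whE.
- by move=> u uh; rewrite mulr_ge0 ?powR_ge0// hge.
- by move=> u uh; rewrite mulr_ge0 ?powR_ge0// hge.
Qed.

(** Since [x <= 1 + x^q] and the interval is bounded. *)
Lemma weight_space_lty q u v : 1 <= q -> 0 <= u -> v <= h -> weight_space d q `]u, v[ w ->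
  (\int[mu]_(r in `]u, v[) (wB r * r ^+ d.-1)%:E < +oo)%E.
Proof.
move=> q1 u0 vh [_ _ /weight_norm_lty hq]; have [mwB wB0 mZ Z0 wE] := bw.
have {}hq := hq (lt_le_trans ltr01 q1).
have mI : measurable (`]u, v[%classic : set R1) by exact: measurable_itv.
have X0 r : `]u, v[%classic r -> 0 <= r ^+ d.-1.
  by rewrite /= in_itv/= => /andP[r0 _]; rewrite exprn_ge0// ltW// (le_lt_trans u0).
have mX : measurable_fun (`]u, v[%classic : set R1) ((fun r => r ^+ d.-1) : R1 -> R).
  exact: measurable_funX.
have mwI : measurable_fun (`]u, v[%classic : set R1) (wB : R1 -> R) by exact: measurable_funS mwB.
have mq : measurable_fun (`]u, v[%classic : set R1) ((fun r => r ^+ d.-1 * wB r `^ q) : R1 -> R).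
  by apply: measurable_funM => //; exact: (measurableT_comp (measurable_powR _) mwI).
have hqB : (\int[mu]_(r in `]u, v[) (r ^+ d.-1 * wB r `^ q)%:E < +oo)%E.
  rewrite -(@ge0_integral_leb1_mod _ _ Z (fun r => r ^+ d.-1 * w r `^ q) _ mI mZ Z0 mq)//.
  - move=> r rI nZ; rewrite wE//; move: rI; rewrite /= !in_itv/= => /andP[ur rv].
    by rewrite (le_lt_trans u0 ur) (lt_le_trans rv).
  - by move=> r rI; rewrite mulr_ge0 ?powR_ge0// X0.
  - by move=> r rI; rewrite mulr_ge0 ?powR_ge0// X0.
apply: (@le_lt_trans _ _ (\int[mu]_(r in `]u, v[) ((r ^+ d.-1)%:E + (r ^+ d.-1 * wB r `^ q)%:E))%E).
  apply: ge0_le_integral => //.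
  - by move=> r rI; rewrite lee_fin mulr_ge0// X0.
  - by apply/measurable_EFinP; exact: measurable_funM.
  - by apply: emeasurable_funD; exact/measurable_EFinP.
  move=> r rI; rewrite -EFinD lee_fin -{2}(mulr1 (r ^+ _)) -mulrDr mulrC.
  by rewrite ler_wpM2l ?X0// le1_powR.
rewrite (ge0_integralD mu mI); last 4 first.
- by move=> r rI; rewrite lee_fin X0.
- exact/measurable_EFinP.
- by move=> r rI; rewrite lee_fin mulr_ge0 ?powR_ge0// X0.
- exact/measurable_EFinP.
apply: lte_add_pinfty => //.
have [uv|vu] := ltP u v; last first.
  by rewrite set_itv_ge ?integral_set0// -leNgt bnd_simp.
apply: (@le_lt_trans _ _ (\int[mu]_(t in `]u, v[) (cst (v ^+ d.-1)%:E t))%E).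
  apply: ge0_le_integral => //.
  - exact/measurable_EFinP.
  - move=> t; rewrite /= in_itv/= => /andP[ut tv]; have t0 := le_lt_trans u0 ut.
    by rewrite lee_fin lerXn2r ?nnegrE ?ltW// (lt_trans t0).
rewrite integral_cst// [X in (_ * X)%E](lebesgue_measure_itv `]u, v[)/= lte_fin uv.
by rewrite -EFinB -EFinM ltry.
Qed.

End Transfer.

(** The q-th power of the averaged weight is integrable; see [moment_lty]. *)
Lemma Wq_moment (q : R) (w wB : R -> R) (Z : set R) : 1 <= q -> Wq d q 1 w ->
    borel_weight `]0, 1[ w wB Z ->
  (\int[mu]_(r in `]0%R, 1%R[) (wB r * r ^+ d)%:E < +oo)%E.
Proof.
move=> q1 [w0 wu [_ _ gq]] bw; have [mwB wB0 mZ Z0 wE] := bw.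
have w0' r : 0 < r < 1 -> 0 <= w r.
  by move=> /andP[r0 r1]; apply: w0; rewrite in_itv/= r0 ltW.
have tf u : 0 < u -> tail d (cut 1 wB) u \is a fin_num.
  move=> u0; have [u1|u1] := ltP u 1; last by rewrite tail_cut_ge.
  rewrite ge0_fin_numE; last by apply: tail_ge0 => r; exact: cut_ge0.
  rewrite tail_cutE ?(ltW u0)//.
  apply: (weight_space_lty bw (lexx 1) (ltW u0) (lexx 1)).
  by apply: wu; rewrite in_itv/= u0.
apply: (moment_lty hd mwB wB0 tf q1 ltr01).
apply: (@lty_poweRy _ _ q^-1); first by rewrite gt_eqF// invr_gt0 (lt_le_trans ltr01).
by rewrite -(weight_norm_meanE bw).
Qed.

(** The oscillation [o] is in [Wq], hence has a first moment by [Wq_moment],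
    and w(nu u) <= w(u) + o(u): this is the situation of [contraction_moment]. *)
Lemma Wq_star_moment (q : R) (w wB : R -> R) (Z : set R) : 1 <= q -> Wq_star d q 1 w ->
    borel_weight `]0, 1[ w wB Z -> (forall r, 0 < r < 1 -> wB r <= w r) ->
  (\int[mu]_(r in `]0%R, 1%R[) (wB r * r ^+ d)%:E < +oo)%E.
Proof.
move=> q1 [w0 wu wosc _] bw wBw; have [mwB wB0 mZ Z0 wE] := bw.
have nn : \forall nu \near (1 : R)^'-, 0 < nu < 1.
  near=> nu; apply/andP; split; near: nu; first by exact: nbhs_left_gt.
  exact: nbhs_left_lt.
have [nu [[oscf Wo] /andP[nu0 nu1]]] : exists nu,
    ({in `]0, 1], forall u, osc w nu u \is a fin_num} /\ Wq d q 1 (fine \o osc w nu)) /\ 0 < nu < 1.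
  by apply: (@filter_ex _ (1 : R)^'-); exact: filterI.
set o := fine \o osc w nu in Wo.
have [op0 opu _] := Wo.
have mo : measurable_fun (`]0, 1[%classic : set Leb1) (o : Leb1 -> R).
  by apply: (measurable_pos) => u u01; have [] := opu u (u01 : u \in `]0, 1[).
have mI : measurable (`]0, 1[%classic : set R1) by exact: measurable_itv.
have o0' r : `]0, 1[%classic r -> 0 <= o r.
  by rewrite /= in_itv/= => /andP[r0 r1]; apply: op0; rewrite in_itv/= r0 ltW.
have [oB [Zo [bo _]]] := borel_weight_exists mI mo o0'.
have ho := Wq_moment q1 Wo bo; have [moB oB0 mZo Zo0 oE] := bo.
apply: (contraction_moment mwB wB0 moB oB0 nu0 nu1 _ ho (measurableU _ _ mZ mZo)).
- move=> e e0; have [e1|e1] := ltP e 1; last by rewrite set_itv_ge ?integral_set0// -leNgt bnd_simp.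
  apply: le_lt_trans (_ : (\int[mu]_(r in `]e, 1%R[) (wB r * r ^+ d.-1)%:E < +oo)%E).
    apply: ge0_le_integral => //.
    + move=> r; rewrite /= in_itv/= => /andP[er r1].
      by rewrite lee_fin mulr_ge0// exprn_ge0// ltW// (lt_trans e0).
    + apply/measurable_EFinP; apply: measurable_funM; first exact: measurable_funS mwB.
      exact: measurable_funX.
    + apply/measurable_EFinP; apply: measurable_funM; first exact: measurable_funS mwB.
      exact: measurable_funX.
    move=> r; rewrite /= in_itv/= => /andP[er r1]; have r0 := lt_trans e0 er.
    by rewrite lee_fin ler_wpM2l// ler_wiXn2l// ?ltW// leq_pred.
  apply: (weight_space_lty bw q1 (ltW e0) (lexx 1)).
  by apply: wu; rewrite in_itv/= e0.
- by rewrite measureU0.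
move=> u /andP[u0 u1] nZ.
have nu0' : 0 < nu * u < 1 by rewrite mulr_gt0//= (lt_trans _ u1)// gtr_pMl.
apply: le_trans (wBw _ nu0') _.
have uI : `]0, 1[%classic u by rewrite /= in_itv/= u0.
rewrite wE//; last by move=> h; apply: nZ; left.
rewrite oE//; last by move=> h; apply: nZ; right.
have uI1 : u \in `]0, 1] by rewrite in_itv/= u0 ltW.
have : (`|w (nu * u) - w u|%:E <= osc w nu u)%E.
  by apply: ereal_sup_ubound; exists (nu * u) => //; rewrite /= in_itv/= lexx ler_piMl// ltW.
rewrite -(fineK (oscf u uI1)) lee_fin => h.
by have := ler_norm (w (nu * u) - w u); rewrite /o /=; lra.
Unshelve. all: by end_near. Qed.

End WeightVersion.

(** Both classes of weights enter the proof only through these three facts. *)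
Lemma weight_data (R : realType) (d : nat) (q : R) (w : R -> R) :
    (0 < d)%N -> 1 <= q -> (forall t, 0 < t -> 0 <= w t) ->
    Wq d q 1 w \/ Wq_star d q 1 w -> weight_space d 1 `]1, +oo[ w ->
  exists wB Z, [/\ borel_weight `]0, +oo[ w wB Z,
    forall u, 0 < u -> tail d wB u \is a fin_num &
    (\int[lebesgue_measure]_(r in `]0%R, 1%R[) (wB r * r ^+ d)%:E < +oo)%E].
Proof.
move=> hd q1 w0 hW [_ mw1 /weight_norm_lty hw1].
have {}hw1 := hw1 ltr01.
pose D : set R := `]0, +oo[%classic.
have mw01 : measurable_fun (`]0, 1[%classic : set (@Leb1 R)) (w : Leb1 -> R).
  apply: (measurable_pos) => u u01.
  by case: hW => [[_ /(_ u (u01 : u \in `]0, 1[))[]]|[_ /(_ u (u01 : u \in `]0, 1[))[]]].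
have mw : measurable_fun (D : set (@Leb1 R)) (w : Leb1 -> R).
  have mm (I : interval R) : measurable ([set` I] : set (@Leb1 R)).
    by apply: measurable_Leb1; exact: measurable_itv.
  rewrite (_ : D = (`]0, 1[ `|` [set 1]) `|` `]1, +oo[)%classic; last first.
    apply/seteqP; split => r; rewrite /D /= !in_itv/= ?andbT.
      move=> r0; have [r1|r1|->] := ltgtP r 1; [left; left|right|left; right] => //=.
      by rewrite r0.
    by move=> [[/andP[]//|->//]|]; exact: lt_trans.
  have m1 : measurable ([set 1] : set (@Leb1 R)).
    by apply: measurable_Leb1; exact: measurable_set1.
  apply/(measurable_funU _ _ _).2; [exact: measurableU|exact: mm|split=> //].
  apply/(measurable_funU _ _ _).2; [exact: mm|exact: m1|split=> //].
  exact: measurable_fun_set1.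
have mD : measurable (D : set (measurableTypeR R)) by exact: measurable_itv.
have w0D r : D r -> 0 <= w r by rewrite /D /= in_itv/= andbT => r0; exact: w0.
have [wB [Z [bw wBw]]] := borel_weight_exists mD mw w0D.
have s01 : `]0, 1[%classic `<=` D by move=> r; rewrite /D /= !in_itv/= andbT => /andP[].
have bw01 := borel_weightS s01 bw.
have [mwB wB0 mZ Z0 wE] := bw.
exists wB, Z; split => //; last first.
  case: hW => hW; first exact: (Wq_moment hd q1 hW bw01).
  apply: (Wq_star_moment hd q1 hW bw01) => r r01; apply: wBw; exact: s01.
move=> u u0; rewrite ge0_fin_numE; last exact: tail_ge0.
pose f r : \bar R := (wB r * Num.max 0 r ^+ d.-1)%:E.
have mf : measurable_fun setT (f : measurableTypeR R -> \bar R).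
  by apply/measurable_EFinP; apply: measurable_funM => //; exact: measurable_maxX.
have f0 r : (0 <= f r)%E by rewrite lee_fin mulr_ge0// maxX_ge0.
have fE r : 0 < r -> f r = (wB r * r ^+ d.-1)%:E by move=> r0; rewrite /f max_r// ltW.
have mI : measurable (`]u, 1[%classic : set (measurableTypeR R)) by exact: measurable_itv.
have mJ : measurable (`[1, +oo[%classic : set (measurableTypeR R)) by exact: measurable_itv.
apply: (@le_lt_trans _ _ (\int[lebesgue_measure]_(r in `]u, 1%R[ `|` `[1%R, +oo[) f r)%E).
  apply: ge0_subset_integral => //; first exact: measurableU.
  - exact: measurable_funS mf.
  - by move=> r _; exact: f0.
  move=> r; rewrite /= !in_itv/= !andbT => ur; have [r1|r1] := ltP r 1; last by right.
  by left; rewrite ur.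
rewrite (ge0_integral_setU _ mI mJ); last 3 first.
- exact: measurable_funS mf.
- by move=> r _; exact: f0.
- rewrite disj_set2E; apply/eqP/seteqP; split => r //= [].
  by rewrite /= !in_itv/= andbT => /andP[_ r1] r2; move: r1; rewrite ltNge r2.
apply: lte_add_pinfty.
  have [u1|u1] := ltP u 1; last by rewrite set_itv_ge ?integral_set0// -leNgt bnd_simp.
  under eq_integral => r.
    rewrite inE/= in_itv/= => /andP[ur _]; rewrite fE; last exact: lt_trans ur.
    over.
  have u01 : u \in `]0, 1[ by rewrite in_itv/= u0.
  case: hW => [[_ /(_ u u01) h _]|[_ /(_ u u01) h _ _]].
    exact: (weight_space_lty bw01 (lexx 1) (ltW u0) (lexx 1) h).
  exact: (weight_space_lty bw01 q1 (ltW u0) (lexx 1) h).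
rewrite -(integral_itv_obnd_cbnd (measurable_funS measurableT (@subsetT _ _) mf)).
rewrite (_ : (\int[_]_(r in _) _)%E = (\int[completed_lebesgue_measure]_(t in `]1%R, +oo[) (t ^+ d.-1 * w t `^ 1)%:E)%E)//.
have s1 : `]1, +oo[%classic `<=` D.
  by move=> r; rewrite /D /= !in_itv/= !andbT; exact: lt_trans.
apply/esym/(ge0_integral_leb1_mod (measurable_itv _) mZ Z0).
- apply: measurable_funM; first exact: measurable_funS mwB.
  by apply: measurable_funS (measurable_maxX _).
- move=> r r1 nZ; have := s1 _ r1; rewrite /D /= in_itv/= andbT => r0.
  by rewrite (wE r (s1 _ r1) nZ) max_r ?(ltW r0)// powRr1 ?w0// mulrC.
- move=> r r1; have := s1 _ r1; rewrite /D /= in_itv/= andbT => r0.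
  by rewrite mulr_ge0 ?powR_ge0// exprn_ge0// ltW.
- by move=> r r1; rewrite mulr_ge0// maxX_ge0.
Qed.

(** * Weak derivatives as limits of difference quotients *)

Lemma dominated_cvgT d (T : measurableType d) (R : realType) (mu : {measure set T -> \bar R})
    (u : nat -> T -> \bar R) (f g : T -> \bar R) :
    (forall n, measurable_fun setT (u n)) -> measurable_fun setT f ->
    {ae mu, forall x, u ^~ x @ \oo --> f x} -> mu.-integrable setT g ->
    (forall n x, (`|u n x| <= g x)%E) ->
  (fun n => \int[mu]_x u n x)%E @ \oo --> (\int[mu]_x f x)%E.
Proof.
move=> mu_ mf uf ig ug.
have h1 : {ae mu, forall x, setT x -> u ^~ x @ \oo --> f x}.
  by apply: (@filterS _ _ (ae_filter_ringOfSetsType mu)) uf => x h _.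
have h2 : {ae mu, forall x n, setT x -> (`|u n x| <= g x)%E}.
  by apply: aeW => x n _; exact: ug.
by have [_ _] := dominated_convergence measurableT mu_ mf h1 ig h2.
Qed.

Section Quotient.
Context {R : realType} (d : nat).
Local Notation V := 'rV[R]_d.
Local Notation vol := (@vol R d).
Local Notation Bor := (Bor R d).
Context (i : 'I_d).
Local Notation e := (delta_mx 0 i : V).

Lemma is_derive_line (psi : V -> R) (x : V) (s : R) :
    (forall y, derivable psi y e) ->
  is_derive s (1 : R) (fun s : R => psi (x + s *: e)) (partial i psi (x + s *: e)).
Proof.
move=> dpsi; pose F (s : R) := psi (x + s *: e).
have D1 := dpsi (x + s *: e).
have D2 : 'D_e psi (x + s *: e) = partial i psi (x + s *: e) by [].
have E : (fun h : R => h^-1 *: (psi (h *: e + (x + s *: e)) - psi (x + s *: e)))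
    = (fun h : R => h^-1 *: (F (h *: (1:R) + s) - F s)).
  apply/funext => h; congr (_ *: (psi _ - _)).
  by rewrite [h *: 1]mulr1 scalerDl addrCA.
by move: D1 D2; rewrite /derivable /derive /= E => D1 D2; apply: DeriveDef.
Qed.

Lemma line_increment_le (psi : V -> R) (B : R) (x : V) (t : R) :
    (forall y, derivable psi y e) -> (forall y, `|partial i psi y| <= B) ->
  `|psi (x + t *: e) - psi x| <= B * `|t|.
Proof.
move=> dpsi hB.
pose F s := psi (x + s *: e).
have dF s : is_derive s (1 : R) F (partial i psi (x + s *: e)) by exact: is_derive_line.
have cF : continuous F.
  move=> s; apply: differentiable_continuous; apply/derivable1_diffP.
  by have [] := dF s.
have F0 : psi x = F 0 by rewrite /F scale0r addr0.
rewrite F0 -/(F t).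
have main a b : a < b -> `|F b - F a| <= B * `|b - a|.
  move=> ab; have [c _ ->] := @MVT R F (fun s => partial i psi (x + s *: e)) a b ab
    (fun s _ => dF s) (continuous_subspaceT cF).
  by rewrite normrM ler_wpM2r.
have [t0|t0|->] := ltgtP t 0.
- by rewrite distrC -[X in _ * X]normrN -[- t]sub0r main.
- by rewrite -[X in _ * `|X|]subr0 main.
- by rewrite subrr !normr0 mulr0.
Qed.

Lemma partial_supp (psi : V -> R) (rho : R) (x : V) :
  (forall x, rho < `|x| -> psi x = 0) -> rho < `|x| -> partial i psi x = 0.
Proof.
move=> psi0 xr; rewrite /partial (@near_eq_derive _ _ _ _ (cst 0)) ?derive_cst//.
apply/nbhs_ballP; exists (`|x| - rho); first by rewrite /= subr_gt0.
move=> y; rewrite -ball_normE /= => xy; apply: psi0 => //.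
by have := ler_dist_dist x y; rewrite ler_norml => /andP[_]; lra.
Qed.

Lemma test_function_supp (C : set V) (psi : V -> R) : test_function C psi ->
  exists2 rho : R, 0 <= rho & forall x, rho < `|x| -> psi x = 0.
Proof.
move=> [_ cpt _]; have [M [_ hM]] := compact_bounded cpt.
exists (Num.max 0 M + 1); first by rewrite addr_ge0// le_max lexx.
move=> x hx; apply/eqP; apply: contraTT hx => px; rewrite -leNgt.
apply: (hM (Num.max 0 M + 1)); last exact: subset_closure.
by rewrite ltr_pwDr// le_max lexx orbT.
Qed.

(** Both parts of the function are handled by the nonnegative case. *)
Lemma integral_shift (f : V -> R) (v : V) : measurable_fun setT (f : Bor -> R) ->
  (\int[vol]_x (f (x + v)%R)%:E = \int[vol]_x (f x)%:E)%E.
Proof.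
move=> mf; have mfE : measurable_fun setT ((fun x => (f x)%:E) : Bor -> \bar R).
  exact/measurable_EFinP.
rewrite [LHS]integralE [RHS]integralE.
congr (_ - _)%E.
  transitivity (\int[vol]_x ((fun x => (f x)%:E)^\+ (x + v)%R))%E.
    by apply: eq_integral => x _; rewrite !funeposE.
  exact: (@ge0_integral_shift _ _ _ v (measurable_funepos mfE) (fun x => funepos_ge0 _ x)).
transitivity (\int[vol]_x ((fun x => (f x)%:E)^\- (x + v)%R))%E.
  by apply: eq_integral => x _; rewrite !funenegE.
exact: (@ge0_integral_shift _ _ _ v (measurable_funeneg mfE) (fun x => funeneg_ge0 _ x)).
Qed.

(** A derivative is the limit along any sequence of nonzero steps. *)
Lemma quotient_cvg (psi : V -> R) (tn : nat -> R) (x : V) :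
    derivable psi x e -> (forall n, tn n != 0) -> tn @ \oo --> 0 ->
  (fun n => (tn n)^-1 * (psi (x + tn n *: e) - psi x)) @ \oo --> partial i psi x.
Proof.
move=> dp tn0 tnc.
have h : tn @ \oo --> 0^'.
  move=> A hA; have hB : \forall n \near \oo, (tn n != 0 -> A (tn n)) := tnc _ hA.
  by apply: (@filterS _ \oo _ _ _ _ hB) => n; exact.
have := cvg_comp _ _ h dp.
rewrite (_ : _ \o tn = fun n => (tn n)^-1 * (psi (x + tn n *: e) - psi x))//.
by apply/funext => n; congr (_ * (psi _ - _)); exact: addrC.
Qed.

(** Translation invariance moves the difference quotient from [F] to the test
    function; both sides then converge by dominated convergence, with the
    Lipschitz bound of [F] on one side and that of the test function on the
    other. *)
Lemma weak_derivative_quotient (F D : V -> R) (tn : nat -> R) (L : R) (Z : set V) (C : set V) psi :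
    measurable_fun setT (F : Bor -> R) ->
    (forall rho, exists A, forall x, `|x| <= rho -> `|F x| <= A) ->
    (forall x s, `|F (x + s *: e) - F x| <= L * `|s|) ->
    measurable_fun setT (D : Bor -> R) ->
    (forall n, tn n != 0) -> (forall n, `|tn n| <= 1) -> tn @ \oo --> 0 ->
    measurable (Z : set Bor) -> vol Z = 0%E ->
    (forall x, C x -> ~ Z x ->
      (fun n => (tn n)^-1 * (F (x + tn n *: e) - F x)) @ \oo --> D x) ->
    test_function C psi ->
  (\int[vol]_x (F x * partial i psi x)%:E = - \int[vol]_x (D x * psi x)%:E)%E.
Proof.
move=> mF bF LF mD tn0 tn1 tnc mZ Z0 FD tf.
have [Ckpsi _ suppC] := tf.
have psiC x : ~ C x -> psi x = 0.
  by move=> nC; apply/eqP; apply: contrapT => /negP px; apply/nC/suppC; exact: subset_closure.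
have [rho rho0 supp] := test_function_supp tf.
have cpsi := Ck_continuous (Ckpsi 0%N).
have dpsi y : derivable psi y e by exact: (@Ck_derivable _ _ 0) (Ckpsi 1%N).
have cp : continuous (partial i psi) by exact: Ck_continuous (Ck_partial i (Ckpsi 1%N)).
have supp' x : rho < `|x| -> partial i psi x = 0 by exact: partial_supp.
have [M M0 hM] := continuous_supp_bounded rho0 cpsi supp.
have [B B0 hB] := continuous_supp_bounded rho0 cp supp'.
have mpsi : measurable_fun setT (psi : Bor -> R) by exact: continuous_Bor.
have mp : measurable_fun setT (partial i psi : Bor -> R) by exact: continuous_Bor.
have [A hA] := bF (rho + 1).
have A0 : 0 <= A by apply: le_trans (normr_ge0 _) (hA 0 _); rewrite normr0 addr_ge0.
have L0 : 0 <= L by have := le_trans (normr_ge0 _) (LF 0 1); rewrite normr1 mulr1.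
have ne : `|e| <= 1 by apply: norm_le_coord => // j; rewrite mxE eqxx/=; case: eqP => _; rewrite ?normr1 ?normr0.
have mFs t : measurable_fun setT ((fun x => F (x + t *: e)) : Bor -> R).
  exact: measurableT_comp mF (measurable_shift (t *: e)).
have mps t : measurable_fun setT ((fun x => psi (x + t *: e)) : Bor -> R).
  exact: measurableT_comp mpsi (measurable_shift (t *: e)).
pose a n (x : V) : \bar R := (((tn n)^-1 * (F (x + tn n *: e) - F x)) * psi x)%:E.
pose b n (x : V) : \bar R := (F x * ((tn n)^-1 * (psi (x - tn n *: e) - psi x)))%:E.
have ia (G : V -> R) (K : R) : measurable_fun setT (G : Bor -> R) ->
    (forall x, `|G x| <= K) -> (forall x, rho + 1 < `|x| -> G x = 0) ->
    vol.-integrable setT (EFin \o G).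
  by move=> mG GK G0; exact: bounded_supp_integrable mG GK G0.
have shiftn t x : `|t| <= 1 -> rho + 1 < `|x| -> rho < `|x - t *: e|.
  move=> t1 hx; have := lerB_normD x (- (t *: e)); rewrite normrN normrZ.
  by have := ler_pM (normr_ge0 t) (normr_ge0 e) t1 ne; rewrite mulr1; lra.
have iP t : `|t| <= 1 -> vol.-integrable setT (fun x => (F x * psi (x - t *: e))%:E).
  move=> t1; apply: (ia _ (A * M)).
  - by apply: measurable_funM => //; rewrite -scaleNr; exact: mps.
  - move=> x; rewrite normrM; have [xr|xr] := leP `|x| (rho + 1); last first.
      by rewrite (supp (x - _)) ?normr0 ?mulr0 ?mulr_ge0//; exact: shiftn.
    by rewrite ler_pM// hA.
  - by move=> x xr; rewrite (supp (x - _)) ?mulr0//; exact: shiftn.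
have iQ : vol.-integrable setT (fun x => (F x * psi x)%:E).
  rewrite (_ : (fun x => _) = (fun x => (F x * psi (x - 0 *: e))%:E)).
    by apply: iP; rewrite normr0.
  by apply/funext => x; rewrite scale0r subr0.
have iP' t : `|t| <= 1 -> vol.-integrable setT (fun x => (F (x + t *: e) * psi x)%:E).
  move=> t1; apply: (ia _ (A * M)).
  - exact: measurable_funM.
  - move=> x; rewrite normrM; have [xr|xr] := leP `|x| rho; last first.
      by rewrite (supp x) ?normr0 ?mulr0 ?mulr_ge0.
    rewrite ler_pM// hA// (le_trans (ler_normD _ _))// lerD// normrZ.
    by rewrite -[leRHS]mulr1 ler_pM.
  - by move=> x xr; rewrite supp ?mulr0//; lra.
have ab n : (\int[vol]_x a n x = \int[vol]_x b n x)%E.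
  have t1 := tn1 n; set t := tn n in t1 *.
  have E1 : (fun x => a n x) = (fun x => (t^-1%:E * ((F (x + t *: e) * psi x)%:E - (F x * psi x)%:E))%E).
    by apply/funext => x; rewrite -EFinB -EFinM /a -/t; congr (_%:E); ring.
  have E2 : (fun x => b n x) = (fun x => (t^-1%:E * ((F x * psi (x - t *: e))%:E - (F x * psi x)%:E))%E).
    by apply/funext => x; rewrite -EFinB -EFinM /b -/t; congr (_%:E); ring.
  have iB1 := integrableB measurableT (iP' t t1) iQ.
  have iB2 := integrableB measurableT (iP t t1) iQ.
  rewrite E1 E2 (integralZl measurableT iB1) (integralZl measurableT iB2).
  rewrite (integralB measurableT (iP' t t1) iQ) (integralB measurableT (iP t t1) iQ).
  congr (_ * (_ - _))%E.
  have mP : measurable_fun setT ((fun x => F x * psi (x - t *: e)) : Bor -> R).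
    by apply: measurable_funM => //; rewrite -scaleNr; exact: mps.
  by rewrite -(integral_shift (t *: e) mP); apply: eq_integral => x _; rewrite addrK.
have ma n : measurable_fun setT (a n : Bor -> \bar R).
  apply/measurable_EFinP; apply: measurable_funM => //; apply: measurable_funM => //.
  by apply: measurable_funB => //; exact: mFs.
have mb n : measurable_fun setT (b n : Bor -> \bar R).
  apply/measurable_EFinP; apply: measurable_funM => //; apply: measurable_funM => //.
  by apply: measurable_funB => //; rewrite -scaleNr; exact: mps.
have ca : (fun n => \int[vol]_x a n x)%E @ \oo --> (\int[vol]_x (D x * psi x)%:E)%E.
  have ig : vol.-integrable setT (fun x => (L * `|psi x|)%:E).
    apply: (ia _ (L * M)).
    - by apply: measurable_funM => //; exact: measurableT_comp.
    - by move=> x; rewrite normrM normr_id (ger0_norm L0) ler_wpM2l.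
    - by move=> x xr; rewrite supp ?normr0 ?mulr0//; lra.
  apply: (dominated_cvgT ma _ _ ig).
  - by apply/measurable_EFinP; exact: measurable_funM.
  - exists Z; split => // x /= hx; apply: contrapT => nZ; apply: hx.
    have [Cx|nC] := pselect (C x); last first.
      by rewrite /a psiC// mulr0; under eq_fun do rewrite mulr0; exact: cvg_cst.
    apply: cvg_EFin; first exact: nearW.
    by apply: cvgM; [exact: FD|exact: cvg_cst].
  - move=> n x; rewrite /a abse_EFin lee_fin !normrM ler_wpM2r// normfV.
    by rewrite mulrC ler_pdivrMr ?normr_gt0.
have cb : (fun n => \int[vol]_x b n x)%E @ \oo --> (\int[vol]_x (F x * - partial i psi x)%:E)%E.
  pose g (x : V) := (A * B * \1_[set x : V | `|x| <= rho + 1] x)%:E.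
  have ig : vol.-integrable setT g.
    apply: (ia _ (A * B)).
    - apply: measurable_funM => //; apply: measurable_indic; exact: measurable_ball.
    - move=> x; rewrite normrM ger0_norm ?mulr_ge0// ler_piMr ?mulr_ge0// indicE.
      by case: (_ \in _); rewrite ?normr1 ?normr0.
    - move=> x xr; rewrite indicE memNset ?mulr0//= => h.
      by move: xr; rewrite ltNge h.
  apply: (dominated_cvgT mb _ _ ig).
  - by apply/measurable_EFinP; apply: measurable_funM => //; exact: measurable_funN.
  - apply: aeW => x; apply: cvg_EFin; first exact: nearW.
    rewrite /b/=; apply: cvgM; first exact: cvg_cst.
    have Nc : (fun n => - tn n) @ \oo --> 0 by rewrite -oppr0; exact: cvgN.
    have N0 n : - tn n != 0 by rewrite oppr_eq0.
    rewrite (_ : (fun n => (tn n)^-1 * _) =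
        (fun n => - ((- tn n)^-1 * (psi (x + - tn n *: e) - psi x)))).
      by apply: cvgN; exact: quotient_cvg.
    by apply/funext => n; rewrite invrN mulNr opprK scaleNr.
  - move=> n x; rewrite /b /g abse_EFin lee_fin indicE.
    have [xr|xr] := leP `|x| (rho + 1); last first.
      rewrite (supp x) ?(supp (x - _)) ?subrr ?mulr0 ?normr0//.
      + by rewrite memNset ?mulr0//= => h; move: xr; rewrite ltNge h.
      + by apply: shiftn => //; exact: tn1.
      + by lra.
    rewrite mem_set// mulr1 normrM ler_pM// ?hA// normrM normfV mulrC ler_pdivrMr ?normr_gt0//.
    have := @line_increment_le psi B x (- tn n) dpsi hB.
    by rewrite scaleNr normrN.
have E : (\int[vol]_x (D x * psi x)%:E = \int[vol]_x (F x * - partial i psi x)%:E)%E.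
  apply: cvg_unique ca _ => //.
  by rewrite (_ : (fun n => _) = (fun n => \int[vol]_x b n x)%E)//; apply/funext.
have iFp : vol.-integrable setT (fun x => (F x * partial i psi x)%:E).
  apply: (ia _ (A * B)).
  - exact: measurable_funM.
  - move=> x; rewrite normrM; have [xr|xr] := leP `|x| rho; last first.
      by rewrite (supp' x) ?normr0 ?mulr0 ?mulr_ge0.
    by rewrite ler_pM// hA//; lra.
  - by move=> x xr; rewrite supp' ?mulr0//; lra.
have E2 : (\int[vol]_x (F x * - partial i psi x)%:E = - \int[vol]_x (F x * partial i psi x)%:E)%E.
  transitivity (\int[vol]_x ((-1)%:E * (F x * partial i psi x)%:E))%E.
    by apply: eq_integral => x _; rewrite -EFinM; congr (_%:E); ring.
  by rewrite (integralZl measurableT iFp) EFinN mulN1e.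
by rewrite E E2 oppeK.
Qed.

End Quotient.

(** * Directional derivatives of the norm *)

Section NormDerivative.
Context {R : realType} (d : nat) (hd : (0 < d)%N) (K : set 'rV[R]_d).
Context (hK : convex_body K).
Local Notation V := 'rV[R]_d.
Local Notation N := (gauge_norm K).
Local Notation vol := (@vol R d).
Local Notation Bor := (Bor R d).
Local Notation R1 := (measurableTypeR R).

(** Difference quotients of a convex function increase with the step, so that
    the one-sided derivative [dirder] is an infimum. *)
Definition slope (h : R) (v x : V) : R := h^-1 * (N (x + h *: v) - N x).

Lemma slope_le (h k : R) (v x : V) : 0 < h -> h <= k -> slope h v x <= slope k v x.
Proof.
move=> h0 hk; have k0 := lt_le_trans h0 hk.
have s0 : 0 <= h / k by rewrite divr_ge0// ltW.
have s1 : 0 <= 1 - h / k by rewrite subr_ge0 ler_pdivrMr// mul1r.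
have E : x + h *: v = (1 - h / k) *: x + (h / k) *: (x + k *: v).
  rewrite scalerDr scalerA divfK ?gt_eqF// addrA -scalerDl subrK scale1r.
  by [].
have := gaugeD hK ((1 - h / k) *: x) ((h / k) *: (x + k *: v)); rewrite -E.
rewrite !(gaugeZ hK) (ger0_norm s0) (ger0_norm s1) => H.
rewrite /slope ler_pdivrMl// mulrA; lra.
Qed.

(** Convexity at the midpoint of [x + 2 h u] and [x + 2 h v]. *)
Lemma slopeD (h : R) (u v x : V) : 0 < h ->
  slope h (u + v) x <= slope (2 * h) u x + slope (2 * h) v x.
Proof.
move=> h0; have E : x + h *: (u + v) = 2^-1 *: (x + (2 * h) *: u) + 2^-1 *: (x + (2 * h) *: v).
  by apply/rowP => j; rewrite !mxE; field.
have := gaugeD hK (2^-1 *: (x + (2 * h) *: u)) (2^-1 *: (x + (2 * h) *: v)); rewrite -E.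
rewrite !(gaugeZ hK) (ger0_norm (_ : 0 <= 2^-1))// => H.
rewrite /slope -mulrDr ler_pdivrMl// mulrA invfM mulrCA mulfV ?gt_eqF// mulr1; lra.
Qed.

Lemma slopeZ (h c : R) (v x : V) : 0 < h -> 0 < c -> slope h (c *: v) x = c * slope (h * c) v x.
Proof.
move=> h0 c0; rewrite /slope scalerA mulrA; congr (_ * _).
by rewrite invfM mulrCA mulfV ?gt_eqF// mulr1.
Qed.

Lemma slope_norm_le (h : R) (v x : V) : 0 < h -> `|slope h v x| <= N v.
Proof.
move=> h0; rewrite /slope normrM normfV (gtr0_norm h0) ler_pdivrMl//.
have := gaugeB hK (x + h *: v) x; rewrite [x + _ - x]addrC addKr.
by rewrite (gaugeZ hK) (gtr0_norm h0).
Qed.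

Definition dirder (v x : V) : R := inf [set slope h v x | h in [set h : R | 0 < h]].

Lemma dirder_has_inf v x : has_inf [set slope h v x | h in [set h : R | 0 < h]].
Proof.
split; first by exists (slope 1 v x), 1 => /=.
exists (- N v) => _ [h /= h0 <-].
by have := slope_norm_le v x h0; rewrite ler_norml => /andP[].
Qed.

Lemma dirder_le (h : R) v x : 0 < h -> dirder v x <= slope h v x.
Proof. by move=> h0; apply: inf_lbound; [exact: (dirder_has_inf v x).2|exists h]. Qed.

Lemma dirder_ge (c : R) v x : (forall h, 0 < h -> c <= slope h v x) -> c <= dirder v x.
Proof.
move=> hc; apply: lb_le_inf; first exact: (dirder_has_inf v x).1.
by move=> _ [h h0 <-]; exact: hc.
Qed.

Lemma dirder_cvg (hn : nat -> R) v x : (forall n, 0 < hn n) -> hn @ \oo --> 0 ->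
  (fun n => slope (hn n) v x) @ \oo --> dirder v x.
Proof.
move=> h0 hc; apply/cvgrPdist_le => e e0.
have [_ [k /= k0 <-] hk] := inf_adherent e0 (dirder_has_inf v x).
have : \forall n \near \oo, hn n < k.
  move/cvgrPdist_lt : hc => /(_ k k0); apply: filterS => n.
  by rewrite sub0r normrN; exact: le_lt_trans (ler_norm _).
apply: filterS => n hnk.
have h1 := dirder_le v x (h0 n); have h2 := slope_le v x (h0 n) (ltW hnk).
move: hk; rewrite -/(dirder v x) => hk.
by rewrite ler_norml; apply/andP; split; lra.
Qed.

Lemma dirder_norm_le v x : `|dirder v x| <= N v.
Proof.
rewrite ler_norml; apply/andP; split.
  by apply: dirder_ge => h h0; have := slope_norm_le v x h0; rewrite ler_norml => /andP[].
apply: le_trans (dirder_le v x ltr01) _.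
by have := slope_norm_le v x ltr01; rewrite ler_norml => /andP[].
Qed.

Lemma dirder0 x : dirder 0 x = 0.
Proof.
by have := dirder_norm_le 0 x; rewrite gauge0// normr_le0 => /eqP.
Qed.

Lemma dirderD u v x : dirder (u + v) x <= dirder u x + dirder v x.
Proof.
rewrite -lerBlDr; apply: dirder_ge => h h0.
rewrite lerBlDr [X in _ <= X]addrC -lerBlDr; apply: dirder_ge => k k0; rewrite lerBlDr.
pose m := Num.min h k / 2.
have m0 : 0 < m by rewrite divr_gt0// lt_min h0.
apply: le_trans (dirder_le _ _ m0) _; apply: le_trans (slopeD u v x m0) _.
have E : 2 * m = Num.min h k by rewrite /m mulrC divfK.
have mm : 0 < Num.min h k by rewrite lt_min h0.
have h1 : slope (Num.min h k) u x <= slope h u x.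
  by apply: slope_le => //; rewrite ge_min lexx.
have h2 : slope (Num.min h k) v x <= slope k v x.
  by apply: slope_le => //; rewrite ge_min lexx orbT.
by rewrite E; lra.
Qed.

Lemma dirderZ (c : R) v x : 0 <= c -> dirder (c *: v) x = c * dirder v x.
Proof.
rewrite le_eqVlt => /orP[/eqP <-|c0]; first by rewrite scale0r mul0r dirder0.
apply/eqP; rewrite eq_le; apply/andP; split.
  rewrite -ler_pdivrMl//; apply: dirder_ge => h h0; rewrite ler_pdivrMl//.
  have hc0 : 0 < h / c by rewrite divr_gt0.
  apply: le_trans (dirder_le _ _ hc0) _.
  by rewrite (slopeZ _ _ hc0 c0) divfK// gt_eqF.
apply: dirder_ge => h h0; rewrite (slopeZ _ _ h0 c0) ler_pM2l//.
by apply: dirder_le; rewrite mulr_gt0.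
Qed.

Lemma dirder_sum (I : Type) (s : seq I) (F : I -> V) x :
  dirder (\sum_(i <- s) F i) x <= \sum_(i <- s) dirder (F i) x.
Proof.
elim: s => [|i s IH]; first by rewrite !big_nil dirder0.
by rewrite !big_cons; apply: le_trans (dirderD _ _ _) _; rewrite lerD2l.
Qed.

Definition step (n : nat) : R := n.+1%:R^-1.

Lemma step_gt0 n : 0 < step n. Proof. by rewrite invr_gt0. Qed.

Lemma step_le1 n : step n <= 1. Proof. by rewrite invf_le1// ler1n. Qed.

Lemma step_cvg : step @ \oo --> 0. Proof. exact: cvg_harmonic. Qed.

Lemma measurable_slope h v : measurable_fun setT (slope h v : Bor -> R).
Proof.
apply: measurable_funM => //; apply: measurable_funB; last exact: measurable_gauge.
exact: measurableT_comp (measurable_gauge hK) (measurable_shift (h *: v)).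
Qed.

Lemma measurable_dirder v : measurable_fun setT (dirder v : Bor -> R).
Proof.
apply: (@measurable_fun_cvg _ Bor R setT (fun n => slope (step n) v)).
  by move=> n; exact: measurable_slope.
by move=> x _; apply: dirder_cvg; [exact: step_gt0|exact: step_cvg].
Qed.

Lemma gauge_quotient (v x : V) (s : R) : `|N (x + s *: v) - N x| <= N v * `|s|.
Proof.
have := gaugeB hK (x + s *: v) x; rewrite [x + _ - x]addrC addKr.
by rewrite (gaugeZ hK) mulrC.
Qed.

Lemma gauge_bounded (rho : R) : exists A, forall x, `|x| <= rho -> `|N x| <= A.
Proof.
have [M M0 hM] := gauge_le_norm hK; exists (M * rho) => x xr.
rewrite ger0_norm ?gauge_ge0//; apply: le_trans (hM x) _.
by rewrite ler_wpM2l// ltW.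
Qed.

(** [N] has the right derivative along the axis as a weak derivative, and also
    the left one (take negative steps). Hence the integral of their
    nonnegative difference against every bump vanishes. This replaces
    Rademacher's theorem. *)
Lemma dirder_symm_ae (i : 'I_d) :
  vol [set x | dirder (delta_mx 0 i) x + dirder (- delta_mx 0 i) x != 0] = 0%E.
Proof.
set e : V := delta_mx 0 i.
pose S (x : V) := dirder e x + dirder (- e) x.
have S0 x : 0 <= S x by have := dirderD e (- e) x; rewrite subrr dirder0.
have mS : measurable_fun setT (S : Bor -> R).
  by apply: measurable_funD; exact: measurable_dirder.
have mN : measurable_fun setT (N : Bor -> R) by exact: measurable_gauge.
have wk (m : nat) : (\int[vol]_x (S x * bump 0 m%:R x)%:E = 0)%E.
  have tf : test_function setT (bump (0 : V) m%:R) by exact: test_function_bump.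
  have m0 : (0 : R) <= m%:R by [].
  have h1 := @weak_derivative_quotient R d i N (dirder e) step (N e) set0 setT _ mN
    gauge_bounded (gauge_quotient e) (measurable_dirder e) (fun n => lt0r_neq0 (step_gt0 n)).
  have h2 := @weak_derivative_quotient R d i N (fun x => - dirder (- e) x) (fun n => - step n) (N e) set0 setT _ mN
    gauge_bounded (gauge_quotient e).
  have [M M0 hM] := @bump_bounded R d m%:R m0.
  have iD v : vol.-integrable setT (fun x => (dirder v x * bump 0 m%:R x)%:E).
    apply: (@bounded_supp_integrable _ _ _ (N v * M) m%:R).
    - by apply: measurable_funM; [exact: measurable_dirder|exact: measurable_bump].
    - by move=> x; rewrite normrM ler_pM// dirder_norm_le.
    - by move=> x hx; rewrite bump_supp0 ?mulr0.
  have e1 : (\int[vol]_x (N x * partial i (bump 0 m%:R) x)%:E = - \int[vol]_x (dirder e x * bump 0 m%:R x)%:E)%E.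
    apply: h1 => //.
    - by move=> n; rewrite ger0_norm ?step_le1// ltW// step_gt0.
    - exact: step_cvg.
    - by move=> x _ _; apply: dirder_cvg; [exact: step_gt0|exact: step_cvg].
  have e2 : (\int[vol]_x (N x * partial i (bump 0 m%:R) x)%:E = - \int[vol]_x (- dirder (- e) x * bump 0 m%:R x)%:E)%E.
    apply: h2 => //.
    - by apply: measurableT_comp => //; exact: measurable_dirder.
    - by move=> n; rewrite oppr_eq0 lt0r_neq0// step_gt0.
    - by move=> n; rewrite normrN ger0_norm ?step_le1// ltW// step_gt0.
    - by rewrite -oppr0; apply: cvgN; exact: step_cvg.
    - move=> x _ _; rewrite (_ : (fun n => _) = (fun n => - slope (step n) (- e) x)).
        by apply: cvgN; apply: dirder_cvg; [exact: step_gt0|exact: step_cvg].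
      by apply/funext => n; rewrite /slope invrN mulNr scaleNr scalerN.
  have i1 := iD e; have i2 := iD (- e).
  transitivity (\int[vol]_x ((dirder e x * bump 0 m%:R x)%:E + (dirder (- e) x * bump 0 m%:R x)%:E))%E.
    by apply: eq_integral => x _; rewrite -EFinD /S mulrDl.
  rewrite (integralD measurableT i1 i2).
  have : (\int[vol]_x (- dirder (- e) x * bump 0 m%:R x)%:E = - \int[vol]_x (dirder (- e) x * bump 0 m%:R x)%:E)%E.
    transitivity (\int[vol]_x ((-1)%:E * (dirder (- e) x * bump 0 m%:R x)%:E))%E.
      by apply: eq_integral => x _; rewrite -EFinM; congr (_%:E); ring.
    rewrite (integralZl measurableT i2).
    rewrite EFinN.
    by rewrite mulN1e; congr (- _)%E; apply: eq_integral.
  move=> e3; move: e2; rewrite e1 e3 => /eqP; rewrite eqe_opp => /eqP ->.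
  by rewrite addeC subee// (integrable_fin_num measurableT i2).
have mSset : measurable ([set x | S x != 0] : set Bor).
  rewrite (_ : [set x | _] = ~` (S @^-1` [set 0])); last first.
    by apply/seteqP; split => x /= /eqP.
  by apply: measurableC; rewrite -[X in measurable X]setTI; exact: mS.
have : vol.-negligible [set x | S x != 0].
  have hneg : vol.-negligible (\bigcup_m [set x | S x * bump 0 m%:R x != 0]).
    apply: negligible_bigcup => m.
    have mSb : measurable_fun setT ((fun x => (S x * bump 0 m%:R x)%:E) : Bor -> \bar R).
      by apply/measurable_EFinP; apply: measurable_funM => //; exact: measurable_bump.
    have I0 : (\int[vol]_x `|(S x * bump 0 m%:R x)%:E| = 0)%E.
      rewrite -[RHS](wk m); apply: eq_integral => x _.
      by rewrite abse_EFin ger0_norm// mulr_ge0// bump_ge0.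
    have := (ae_eq_integral_abs vol measurableT mSb).1 I0.
    apply: negligibleS => x /= hx /(_ I); apply/eqP; rewrite /=.
    by apply: contra hx => /eqP[->].
  apply: (negligibleS _ hneg).
  move=> x /= Sx.
  have [m _ hm] : \forall m \near \oo, `|x| < m%:R by exact: nbhs_infty_gtr.
  exists m => //=; have xm := hm m (leqnn m).
  by rewrite mulf_neq0// gt_eqF// bump_gt0 ?subr0// (le_lt_trans (normr_ge0 x)).
move=> h; apply/eqP; rewrite eq_le measure_ge0 andbT.
have [Z [mZ Z0 SZ]] := h; rewrite -[leRHS]Z0.
by apply: le_measure; rewrite ?inE.
Qed.

(** Where the one-sided derivatives along the axes are opposite, the sublinear
    function [v |-> dirder v x] is at most the linear form with these
    coefficients, hence equal to it; and it is at most [N v]. *)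
Lemma dirder_dual_le (x : V) :
    (forall i : 'I_d, dirder (delta_mx 0 i) x + dirder (- delta_mx 0 i) x = 0) ->
  dual_norm K (\row_i dirder (delta_mx 0 i) x) <= 1.
Proof.
move=> hx; apply: (dual_le hK) => v Nv.
have le1 (u : V) : dirder u x <= dotp u (\row_i dirder (delta_mx 0 i) x).
  rewrite {1}(row_sum_delta u); apply: le_trans (dirder_sum _ _ _) _.
  apply: ler_sum => i _; rewrite mxE.
  have [u0|u0] := leP 0 (u 0 i); first by rewrite dirderZ.
  rewrite -(opprK (u 0 i)) scaleNr -scalerN dirderZ ?oppr_ge0 ?(ltW u0)//.
  have -> : dirder (- delta_mx 0 i) x = - dirder (delta_mx 0 i) x.
    by apply/eqP; rewrite -addr_eq0 addrC hx.
  by rewrite mulrN -mulNr.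
have := le1 (- v); rewrite -[- v]scaleN1r dotpZl mulN1r scaleN1r.
have := dirderD v (- v) x; rewrite subrr dirder0.
have := dirder_norm_le v x; rewrite ler_norml => /andP[_]; lra.
Qed.

End NormDerivative.

(** * Radial functions of the class *)

Section Primitive.
Context {R : realType}.
Local Notation mu := (@lebesgue_measure R).
Local Notation R1 := (measurableTypeR R).
Context (k : R -> R) (M h : R) (mk : measurable_fun setT (k : R1 -> R)).
Context (k0 : forall r, 0 <= k r) (kM : forall r, k r <= M) (h0 : 0 < h).
Context (kh : forall r, ~ (0 < r < h) -> k r = 0).

Let M0 : 0 <= M. Proof. exact: le_trans (k0 0) (kM 0). Qed.

Let mkE : measurable_fun setT ((fun r => (k r)%:E) : R1 -> \bar R).
Proof. exact/measurable_EFinP. Qed.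

Lemma integral_itv_le (a b : R) : a <= b ->
  (\int[mu]_(r in `]a, b]) (k r)%:E <= (M * (b - a))%:E)%E.
Proof.
move=> ab; apply: (@le_trans _ _ (\int[mu]_(r in `]a, b]) (cst M%:E r))%E).
  apply: ge0_le_integral => //.
  - by move=> r _; rewrite lee_fin.
  - exact: measurable_funS mkE.
  - by move=> r _; rewrite lee_fin.
rewrite integral_cst// [X in (_ * X)%E](lebesgue_measure_itv `]a, b])/= lte_fin.
have [_|ba] := ltP a b; first by rewrite -EFinB -EFinM.
by rewrite mule0 lee_fin mulr_ge0// subr_ge0.
Qed.

(** The profile [k] lives on ]0, h[, so this is a primitive that is constant
    outside of it. *)
Definition prim (x : R) : R := \int[mu]_(r in `]-oo, x]) k r.

Lemma prim_fin x : (\int[mu]_(r in `]-oo, x]) (k r)%:E)%E \is a fin_num.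
Proof.
rewrite ge0_fin_numE; last by apply: integral_ge0 => r _; rewrite lee_fin.
apply: (@le_lt_trans _ _ (\int[mu]_(r in `]0%R, h]) (k r)%:E)%E); last first.
  by apply: le_lt_trans (integral_itv_le (ltW h0)) _; rewrite ltry.
rewrite integral_mkcond [leRHS]integral_mkcond; apply: ge0_le_integral => //.
- by move=> r _; rewrite patchE; case: ifP => // _; rewrite lee_fin.
- by apply/(measurable_restrictT _ _).1 => //; exact: measurable_funS mkE.
- by apply/(measurable_restrictT _ _).1 => //; exact: measurable_funS mkE.
move=> r _; rewrite !patchE; have [rh|nr] := pselect (0 < r < h).
  have -> : r \in (`]0, h]%classic : set R).
    by move: rh => /andP[r0 rh]; rewrite inE/= in_itv/= r0 ltW.
  by case: ifP => // _; rewrite lee_fin.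
by rewrite kh//; case: ifP; case: ifP.
Qed.

Lemma prim_integrable : mu.-integrable setT (EFin \o k).
Proof.
apply/integrableP; split => //.
apply: (@le_lt_trans _ _ (\int[mu]_(r in `]0%R, h]) (k r)%:E)%E); last first.
  by apply: le_lt_trans (integral_itv_le (ltW h0)) _; rewrite ltry.
rewrite [leRHS]integral_mkcond; apply: ge0_le_integral => //.
- exact: measurableT_comp.
- by apply/(measurable_restrictT _ _).1 => //; exact: measurable_funS mkE.
move=> r _; rewrite patchE /= ger0_norm//; have [rh|nr] := pselect (0 < r < h).
  rewrite mem_set//; by move: rh => /andP[r0 rh]; rewrite /= in_itv/= r0 ltW.
by rewrite kh//; case: ifP.
Qed.

Lemma primE a b : a <= b -> ((prim b - prim a)%:E = \int[mu]_(r in `]a, b]) (k r)%:E)%E.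
Proof.
move=> ab; rewrite EFinB /prim /Rintegral !fineK ?prim_fin//.
have mA : measurable (`]-oo, a]%classic : set R1) by exact: measurable_itv.
have mB : measurable (`]a, b]%classic : set R1) by exact: measurable_itv.
rewrite (_ : `]-oo, b]%classic = `]-oo, a] `|` `]a, b]); last first.
  apply/seteqP; split => r /=; rewrite !in_itv/=.
    by move=> rb; have [ra|ar] := leP r a; [left|right].
  by case=> [ra|/andP[]//]; exact: le_trans ab.
rewrite (ge0_integral_setU mu mA mB); last 3 first.
- exact: measurable_funS mkE.
- by move=> r _; rewrite lee_fin.
- rewrite disj_set2E; apply/eqP/seteqP; split => r //= []; rewrite !in_itv/= => ra /andP[ar _].
  by move: ar; rewrite ltNge ra.
by rewrite addeAC subee ?add0e// prim_fin.
Qed.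

Lemma prim_mono a b : a <= b -> prim a <= prim b.
Proof.
move=> ab; rewrite -subr_ge0 -lee_fin primE//.
by apply: integral_ge0 => r _; rewrite lee_fin.
Qed.

Lemma prim_lip a b : `|prim a - prim b| <= M * `|a - b|.
Proof.
have main x y : x <= y -> `|prim x - prim y| <= M * `|x - y|.
  move=> xy; rewrite distrC [`|x - y|]distrC !ger0_norm ?subr_ge0 ?prim_mono//.
  by rewrite -lee_fin primE//; exact: integral_itv_le.
have [ab|/ltW ba] := leP a b; first exact: main.
by rewrite distrC [`|a - b|]distrC main.
Qed.

Lemma prim_le0 x : x <= 0 -> prim x = 0.
Proof.
move=> x0; rewrite /prim /Rintegral integral0_eq// => r; rewrite /= in_itv/= => rx.
by rewrite kh// => /andP[r0 _]; move: r0; rewrite ltNge (le_trans rx).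
Qed.

Lemma prim_ge x : h <= x -> prim x = prim h.
Proof.
move=> hx; apply/eqP; rewrite -subr_eq0; apply/eqP/EFin_inj; rewrite primE//.
rewrite integral0_eq// => r; rewrite /= in_itv/= => /andP[hr _].
by rewrite kh// => /andP[_ rh]; move: hr; rewrite ltNge ltW.
Qed.

Lemma prim_bounds x : 0 <= prim x <= prim h.
Proof.
apply/andP; split.
  have [/prim_le0->//|/ltW x0] := leP x 0.
  by rewrite -(prim_le0 (lexx 0)) prim_mono.
by have [/prim_mono//|/ltW/prim_ge->] := leP x h.
Qed.

(** Lebesgue's differentiation theorem; [k] is only measurable. *)
Lemma prim_derive : exists Z : set R, [/\ measurable (Z : set R1), mu Z = 0%E &
  forall x, ~ Z x -> derivable prim x 1 /\ derive1 prim x = k x].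
Proof.
have locf : locally_integrable setT k.
  by apply: open_integrable_locally; [exact: openT|exact: prim_integrable].
have intf y : mu.-integrable `]-oo, y] (EFin \o k).
  by apply: integrableS prim_integrable.
have [Z [mZ Z0 hZ]] := FTC1Ny intf locf.
by exists Z; split => // x nZ; apply: contrapT => h'; apply: nZ; apply: hZ.
Qed.

End Primitive.

Section Chain.
Context {R : realType}.

(** The chain rule along a sequence. The increments [sn n] of the inner
    function may vanish, which is why the difference quotient is extended by
    [k] at 0. *)
Lemma quotient_comp (F : R -> R) (rho k delta : R) (sn hn : nat -> R) :
    derivable F rho 1 -> derive1 F rho = k -> sn @ \oo --> 0 ->
    (fun n => hn n * sn n) @ \oo --> delta ->
  (fun n => hn n * (F (rho + sn n) - F rho)) @ \oo --> k * delta.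
Proof.
move=> dF Fk s0 hs.
pose phi s := if s == 0 then k else s^-1 * (F (rho + s) - F rho).
have cphi : phi @ (nbhs (0 : R)) --> k.
  move=> A kA; move: dF; rewrite /derivable => /cvg_ex[l hl].
  have lk : l = k by rewrite -Fk derive1E; apply/esym/cvg_lim.
  have : \forall s \near 0^', A (s^-1 *: (F (s *: 1 + rho) - F rho)) by apply: hl; rewrite lk.
  rewrite /at_right/= => h.
  have h' : \forall s \near (0 : R), s != 0 -> A (s^-1 *: (F (s *: 1 + rho) - F rho)) := h.
  apply: (@filterS _ (nbhs (0 : R)) _ _ _ _ h') => s /=; rewrite /phi.
  have [_ _|s0' hs'] := eqVneq s 0; first exact: nbhs_singleton.
  by have := hs' isT; rewrite [s *: 1]mulr1 [rho + s]addrC.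
rewrite (_ : (fun n => _) = (fun n => phi (sn n) * (hn n * sn n))).
  by apply: cvgM hs; exact: (cvg_comp _ _ s0 cphi).
apply/funext => n; rewrite /phi; have [->|s0'] := eqVneq (sn n) 0.
  by rewrite addr0 subrr !mulr0.
by field.
Qed.

End Chain.

Section Radial.
Context {R : realType} (d : nat) (hd : (1 < d)%N) (K C : set 'rV[R]_d).
Context (hK : convex_body K) (hC : open_fg_cone C).
Local Notation V := 'rV[R]_d.
Local Notation N := (gauge_norm K).
Local Notation mu := (@lebesgue_measure R).
Local Notation leb := (@leb R d).
Local Notation vol := (@vol R d).
Local Notation Bor := (Bor R d).
Local Notation Leb := (Leb R d).
Local Notation R1 := (measurableTypeR R).
Context (m0 : (0 < vol (K `&` C))%E).
Context (k : R -> R) (M h : R) (mk : measurable_fun setT (k : R1 -> R)).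
Context (k0 : forall r, 0 <= k r) (kM : forall r, k r <= M) (h0 : 0 < h).
Context (kh : forall r, ~ (0 < r < h) -> k r = 0).
Context (c : R) (c0 : 0 <= c).

Let hd0 : (0 < d)%N. Proof. exact: ltnW. Qed.
Let M0 : 0 <= M. Proof. exact: le_trans (k0 0) (kM 0). Qed.

(** Decreasing in the gauge, with the constant chosen so that the supremum and
    the infimum are opposite: this halves the supremum norm, the only quantity
    through which the norm of an approximant enters. *)
Definition radial_fun (x : V) : R := c * (prim k h / 2 - prim k (N x)).

Definition radial_grad (x : V) : V := \row_i (- (c * k (N x)) * dirder K (delta_mx 0 i) x).

Lemma radial_fun_le x : `|radial_fun x| <= c * (prim k h / 2).
Proof.
rewrite /radial_fun normrM (ger0_norm c0) ler_wpM2l//.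
have /andP[p0 p1] := prim_bounds mk k0 kM h0 kh (N x).
by rewrite ler_norml; apply/andP; split; lra.
Qed.

Lemma radial_fun_lip x y : `|radial_fun x - radial_fun y| <= c * M * N (x - y).
Proof.
rewrite /radial_fun -mulrBr normrM (ger0_norm c0) -mulrA ler_wpM2l//.
rewrite (_ : _ - _ - _ = prim k (N y) - prim k (N x)); last by ring.
apply: le_trans (prim_lip mk k0 kM h0 kh _ _) _; rewrite ler_wpM2l// distrC.
exact: gaugeB.
Qed.

Lemma radial_fun_continuous : continuous radial_fun.
Proof.
have [A A0 hA] := gauge_le_norm hK.
apply: (@lipschitz_continuous R d _ (c * M * A + 1)).
  by rewrite ltr_pwDr// !mulr_ge0// ltW.
move=> x y; apply: le_trans (radial_fun_lip x y) _.
have := ler_wpM2l (mulr_ge0 c0 M0) (hA (x - y)); rewrite mulrDl mul1r mulrA.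
by have := normr_ge0 (x - y); lra.
Qed.

Lemma measurable_kN : measurable_fun setT ((fun x => k (N x)) : Bor -> R).
Proof. exact: measurableT_comp mk (measurable_gauge hK). Qed.

Lemma measurable_radial_grad i : measurable_fun setT ((fun x => radial_grad x 0 i) : Bor -> R).
Proof.
rewrite (_ : (fun x => _) = (fun x : Bor => (- (c * k (N x))) * dirder K (delta_mx 0 i) x)).
  apply: measurable_funM; last exact: measurable_dirder.
  by apply: measurable_funN; apply: measurable_funM => //; exact: measurable_kN.
by apply/funext => x; rewrite mxE.
Qed.

(** [weak_derivative_quotient] along the steps [step]: the quotients converge
    by the chain rule except where the gauge is in the null set of
    [prim_derive]. *)
Lemma radial_weak_derivative i (psi : V -> R) : test_function C psi ->
  (\int[vol]_x (radial_fun x * partial i psi x)%:E = - \int[vol]_x (radial_grad x 0 i * psi x)%:E)%E.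
Proof.
move=> tf; set e : V := delta_mx 0 i.
have [Zk [mZk Zk0 hZk]] := prim_derive mk k0 kM h0 kh.
have mZ : measurable (C `&` [set x | Zk (N x)] : set Bor).
  apply: measurableI; first exact: measurable_cone.
  by rewrite -[X in measurable X]setTI; apply: (measurable_gauge hK).
have Z0 : vol (C `&` [set x | Zk (N x)]) = 0%E by exact: radial_null.
apply: (@weak_derivative_quotient R d i radial_fun (fun x => radial_grad x 0 i) (@step R)
  (c * M * N e) (C `&` [set x | Zk (N x)]) C psi) => //.
- exact: continuous_Bor radial_fun_continuous.
- by move=> rho; exists (c * (prim k h / 2)) => x _; exact: radial_fun_le.
- move=> x s; apply: le_trans (radial_fun_lip _ _) _.
  have -> : x + s *: e - x = s *: e by rewrite addrAC subrr add0r.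
  have -> : N (s *: e) = N e * `|s| by rewrite (gaugeZ hK) mulrC.
  by rewrite (mulrA (c * M)).
- exact: measurable_radial_grad.
- by move=> n; rewrite lt0r_neq0// step_gt0.
- by move=> n; rewrite ger0_norm ?step_le1// ltW// step_gt0.
- exact: step_cvg.
move=> x Cx nZ; have [dp pk] := hZk (N x) (fun z => nZ (conj Cx z)).
pose sn n : R := N (x + step n *: e) - N x.
have s0 : sn @ \oo --> 0.
  apply/norm_cvg0P.
  apply: (@squeeze_cvgr _ _ _ _ (cst 0) (fun n => N e * step n)) => //.
  - apply: nearW => n; rewrite normr_ge0/=.
    have := gauge_quotient hK e x (step n); rewrite -/(sn n).
    by rewrite [`|step n|]ger0_norm// ltW// step_gt0.
  - exact: cvg_cst.
  - rewrite -(mulr0 (N e)); apply: cvgM; [exact: cvg_cst|exact: step_cvg].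
have hs : (fun n => (step n)^-1 * sn n) @ \oo --> dirder K e x.
  by apply: (dirder_cvg hK); [exact: step_gt0|exact: step_cvg].
have := quotient_comp dp pk s0 hs => Q.
rewrite (_ : (fun n => _) = (fun n => - c * ((step n)^-1 * (prim k (N x + sn n) - prim k (N x))))).
  rewrite /radial_grad mxE mulNr -mulrA -mulNr.
  by apply: cvgM => //; exact: cvg_cst.
by apply/funext => n; rewrite /radial_fun /sn [N x + _]addrC subrK; ring.
Qed.

Lemma partial_out (psi : V -> R) (i : 'I_d) (x : V) : test_function C psi -> ~ C x ->
  psi x = 0 /\ partial i psi x = 0.
Proof.
move=> [_ _ suppC] nC.
have nS : ~ closure [set x | psi x != 0] x by move=> h'; exact/nC/suppC.
have z0 y : ~ closure [set x | psi x != 0] y -> psi y = 0.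
  by move=> ny; apply/eqP; apply: contrapT => /negP py; apply: ny; exact: subset_closure.
split; first exact: z0.
rewrite /partial (@near_eq_derive _ _ _ _ (cst 0)) ?derive_cst//.
have : open (~` closure [set x | psi x != 0]) by apply: closed_openC; exact: closed_closure.
move=> oS; have nb : nbhs x (~` closure [set x | psi x != 0]) by exact: open_nbhs_nbhs.
by apply: filterS nb => y; exact: z0.
Qed.

Lemma radial_weak_gradient : weak_gradient C radial_fun radial_grad.
Proof.
move=> i psi tf; have mC := measurable_cone hC.
have [Ckpsi _ _] := tf.
have mpsi : measurable_fun setT (psi : Bor -> R).
  by apply: continuous_Bor; exact: Ck_continuous (Ckpsi 0%N).
have mp : measurable_fun setT (partial i psi : Bor -> R).
  by apply: continuous_Bor; exact: Ck_continuous (Ck_partial i (Ckpsi 1%N)).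
have mf : measurable_fun setT (radial_fun : Bor -> R) by exact: continuous_Bor radial_fun_continuous.
have T (F : V -> R) : measurable_fun setT (F : Bor -> R) -> (forall y, ~ C y -> F y = 0) ->
    (\int[leb]_(x in C) (F x)%:E = \int[vol]_x (F x)%:E)%E.
  move=> mF F0; apply: (integral_leb_vol mC measurable0 (measure0 _)).
  - apply/measurable_EFinP; apply: (measurable_funS measurableT (@subsetT _ _)).
    exact: measurable_fun_Leb.
  - exact/measurable_EFinP.
  - by [].
  - by move=> y nC; rewrite F0.
rewrite /Rintegral (T (fun x => radial_fun x * partial i psi x)); last 2 first.
- exact: measurable_funM.
- by move=> y nC; rewrite (partial_out i tf nC).2 mulr0.
rewrite (T (fun x => radial_grad x 0 i * psi x)); last 2 first.
- by apply: measurable_funM => //; exact: measurable_radial_grad.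
- by move=> y nC; rewrite (partial_out i tf nC).1 mulr0.
by rewrite radial_weak_derivative// fineN.
Qed.

(** The gradient of the norm has dual norm at most 1 where [dirder_symm_ae]
    holds for all axes. *)
Lemma radial_grad_dual_le : {ae leb, forall x, C x -> dual_norm K (radial_grad x) <= c * k (N x)}.
Proof.
pose S i : set V := [set x | dirder K (delta_mx 0 i) x + dirder K (- delta_mx 0 i) x != 0].
have mS i : measurable (S i : set Bor).
  rewrite (_ : S i = ~` ((fun x => dirder K (delta_mx 0 i) x + dirder K (- delta_mx 0 i) x) @^-1` [set 0])).
    apply: measurableC; rewrite -[X in measurable X]setTI.
    by apply: measurable_funD => //; exact: measurable_dirder.
  by apply/seteqP; split => x /= /eqP.
have [mZ Z0] : measurable (\big[setU/set0]_i S i : set Bor) /\ vol (\big[setU/set0]_i S i) = 0%E.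
  apply: (big_ind (fun A => measurable (A : set Bor) /\ vol A = 0%E)).
  - by rewrite measure0.
  - by move=> A B [mA A0] [mB B0]; split; [exact: measurableU|rewrite measureU0].
  - by move=> i _; split => //; exact: (dirder_symm_ae hK i).
apply: (negligibleS _ (leb_null mZ Z0)) => x /= hx; apply: contrapT => nZ; apply: hx => _.
have D1 : dual_norm K (\row_i dirder K (delta_mx 0 i) x) <= 1.
  apply: (dirder_dual_le hK) => i; apply/eqP; apply: contrapT => /negP Si; apply: nZ.
  by rewrite (bigD1 i)//=; left.
have ck0 : 0 <= c * k (N x) by rewrite mulr_ge0.
apply: (dual_le hK) => v Nv.
have -> : radial_grad x = (- (c * k (N x))) *: \row_i dirder K (delta_mx 0 i) x.
  by apply/rowP => i; rewrite !mxE.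
rewrite dotpZr mulNr -mulrN -[leRHS]mulr1 ler_wpM2l//.
rewrite -mulN1r -dotpZl scaleN1r; apply: le_trans (dotp_le_dual hK _ _) _.
by rewrite (gaugeN hK) -[leRHS]mulr1 ler_pM// ?gauge_ge0 ?dual_ge0.
Qed.

End Radial.

Lemma poweR_le (R : realType) (x y : \bar R) (r : R) :
  0 <= r -> (0 <= x)%E -> (x <= y)%E -> (x `^ r <= y `^ r)%E.
Proof.
move=> r0 x0 xy; apply: gt0_ler_poweR => //; rewrite in_itv/= leey andbT//.
exact: le_trans xy.
Qed.

Lemma measurable_fun_LebS (R : realType) (d : nat) (D : set 'rV[R]_d) (F : 'rV[R]_d -> R) :
  measurable_fun setT (F : Bor R d -> R) -> measurable_fun (D : set (Leb R d)) (F : Leb R d -> R).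
Proof.
move=> mF; exact: (measurable_funS measurableT (@subsetT _ _) (measurable_fun_Leb mF measurableT)).
Qed.

Section Membership.
Context {R : realType} (d : nat) (hd : (1 < d)%N) (K C : set 'rV[R]_d).
Context (hK : convex_body K) (hC : open_fg_cone C).
Local Notation V := 'rV[R]_d.
Local Notation N := (gauge_norm K).
Local Notation mu := (@lebesgue_measure R).
Local Notation leb := (@leb R d).
Local Notation vol := (@vol R d).
Local Notation Bor := (Bor R d).
Local Notation Leb := (Leb R d).
Local Notation R1 := (measurableTypeR R).
Context (m0 : (0 < vol (K `&` C))%E).

(** The unit ball of L_p(C), for nonnegative Borel functions. *)
Definition unit_bound (p : \bar R) (kap : V -> R) : Prop :=
  match p with
  | r%:E => (\int[vol]_(x in C) (kap x `^ r)%:E <= 1)%E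
  | +oo%E => forall x, kap x <= 1
  | -oo%E => False
  end.

Lemma Lp_norm_bound (p : \bar R) (q : R) (F kap : V -> R) (B : R) :
    conjugate p q -> 0 <= B -> measurable_fun (C : set Leb) (F : Leb -> R) ->
    measurable_fun setT (kap : Bor -> R) -> (forall x, 0 <= kap x) ->
    {ae leb, forall x, C x -> `|F x| <= B * kap x} -> unit_bound p kap ->
  (Lp_norm p C F <= B%:E)%E.
Proof.
move=> pq B0 mF mkap kap0 Fk; have mC := measurable_cone hC; have mCL := Bor_Leb mC.
case: p pq => [r [r0 _ _]|_|//] /= ub; last first.
  apply/(Linfty_normP m0 F B0).
  apply: (@filterS _ _ (ae_filter_ringOfSetsType leb)) Fk => x h Cx.
  by apply: le_trans (h Cx) _; rewrite ler_piMr.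
rewrite /Lp_norm restrict_EFin unlock.
have mkL : measurable_fun (C : set Leb) (kap : Leb -> R).
  exact: measurable_fun_LebS.
have mp (G : V -> R) : measurable_fun (C : set Leb) (G : Leb -> R) ->
    measurable_fun (C : set Leb) ((fun x => (`|G x| `^ r)%:E) : Leb -> \bar R).
  move=> mG; apply/measurable_EFinP; apply: (measurableT_comp (measurable_powR _)).
  exact: measurableT_comp.
have I1 : (\int[leb]_x (`|(EFin \o F \_ C) x| `^ r) = \int[leb]_(x in C) (`|F x| `^ r)%:E)%E.
  rewrite [RHS]integral_mkcond; apply: eq_integral => x _; rewrite /= !patchE.
  by case: ifP => // _; rewrite normr0 powR0// gt_eqF.
have I2 : (\int[leb]_(x in C) (`|F x| `^ r)%:E <= (B `^ r)%:E * \int[vol]_(x in C) (kap x `^ r)%:E)%E.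
  have mkB : measurable_fun (C : set Bor) ((fun x => (kap x `^ r)%:E) : Bor -> \bar R).
    apply/measurable_EFinP; apply: (measurable_funS measurableT (@subsetT _ _)).
    exact: (measurableT_comp (measurable_powR _) mkap).
  have k0 x : C x -> (0 <= (kap x `^ r)%:E)%E by rewrite lee_fin powR_ge0.
  rewrite (ge0_integral_vol mC mkB k0).
  have mkBL : measurable_fun (C : set Leb) ((fun x => (kap x `^ r)%:E) : Leb -> \bar R).
    apply/measurable_EFinP; exact: (measurableT_comp (measurable_powR _) mkL).
  rewrite -(ge0_integralZl leb mCL mkBL k0); last by rewrite lee_fin powR_ge0.
  apply: (@ae_ge0_le_integral _ Leb R leb C mCL).
  - by move=> x _; rewrite lee_fin powR_ge0.
  - exact: mp.
  - by move=> x Cx; rewrite -EFinM lee_fin; apply: mulr_ge0; exact: powR_ge0.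
  - exact: emeasurable_funM.
  apply: (@filterS _ _ (ae_filter_ringOfSetsType leb)) Fk => x h Cx.
  rewrite -EFinM lee_fin -(powRM _ B0 (kap0 x)); apply: ge0_ler_powR.
  - exact: ltW.
  - by rewrite nnegrE.
  - by rewrite nnegrE mulr_ge0.
  - exact: h.
have I3 : (\int[leb]_(x in C) (`|F x| `^ r)%:E <= (B `^ r)%:E)%E.
  apply: le_trans I2 _; rewrite -[leRHS]mule1; apply: lee_wpmul2l; last exact: ub.
  by rewrite lee_fin powR_ge0.
rewrite I1.
apply: (@le_trans _ _ ((B `^ r)%:E `^ r^-1)%E).
  apply: poweR_le; last exact: I3.
    by rewrite invr_ge0 ltW.
  by apply: integral_ge0 => x _; rewrite lee_fin powR_ge0.
by rewrite /= -powRrM mulfV ?gt_eqF// powRr1.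
Qed.

Context (k : R -> R) (M h : R) (mk : measurable_fun setT (k : R1 -> R)).
Context (k0 : forall r, 0 <= k r) (kM : forall r, k r <= M) (h0 : 0 < h).
Context (kh : forall r, ~ (0 < r < h) -> k r = 0).
Context (c : R) (c0 : 0 <= c).

Lemma radial_fun_norm : (Lp_norm +oo C (radial_fun K k h c) <= (c * (prim k h / 2))%:E)%E.
Proof.
apply/(Linfty_normP m0).
  exact: le_trans (normr_ge0 _) (radial_fun_le K mk k0 kM h0 kh c0 0).
by apply: aeW => x Cx; exact: (radial_fun_le K mk k0 kM h0 kh c0 x).
Qed.

Lemma radial_fun_Linfty : Linfty C (radial_fun K k h c).
Proof.
split; last by apply: le_lt_trans radial_fun_norm _; rewrite ltry.
apply: measurable_fun_LebS.
exact: continuous_Bor (radial_fun_continuous hK mk k0 kM h0 kh c0).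
Qed.

Lemma radial_fun_WK (p : \bar R) (q : R) : conjugate p q ->
  unit_bound p (fun x => c * k (N x)) -> WK K p C (radial_fun K k h c).
Proof.
move=> pq ub.
have wg := radial_weak_gradient hd hK hC mk k0 kM h0 kh c0.
have mkap : measurable_fun setT ((fun x => c * k (N x)) : Bor -> R).
  by apply: measurable_funM => //; exact: measurable_kN.
have kap0 x : 0 <= c * k (N x) by rewrite mulr_ge0.
have dl := radial_grad_dual_le C hK k0 c0.
have mGB i := measurable_radial_grad hK mk c i.
have mGL i : measurable_fun (C : set Leb) ((fun x => radial_grad K k c x 0 i) : Leb -> R).
  exact: measurable_fun_LebS.
have LG i : Lp p C (fun x => radial_grad K k c x 0 i).
  split => //; apply: (@le_lt_trans _ _ (N (delta_mx 0 i))%:E); last by rewrite ltry.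
  apply: (Lp_norm_bound pq _ _ mkap kap0 _ ub) => //; first exact: gauge_ge0.
  apply: (@filterS _ _ (ae_filter_ringOfSetsType leb)) dl => x hx Cx.
  have := dotp_norm_le_dual hK (delta_mx 0 i) (radial_grad K k c x).
  rewrite {1}/dotp (bigD1 i)//= mxE !eqxx mul1r big1 ?addr0; last first.
    by move=> j ji; rewrite mxE (negbTE ji) andbF mul0r.
  by move=> /le_trans; apply; rewrite ler_wpM2l ?gauge_ge0// hx.
split; [split|].
- exact: radial_fun_Linfty.
- by move=> x _; exact: (radial_fun_continuous hK mk k0 kM h0 kh c0).
- by exists (radial_grad K k c).
exists (radial_grad K k c); split => //.
apply: (Lp_norm_bound pq ler01 _ mkap kap0 _ ub).
  exact: (measurable_comp_coord (Bor_Leb (measurable_cone hC)) (measurable_dual hK) mGL).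
apply: (@filterS _ _ (ae_filter_ringOfSetsType leb)) dl => x hx Cx.
by rewrite mul1r ger0_norm ?dual_ge0// hx.
Qed.

End Membership.

Lemma subr4 (R : realType) (x y z t : R) : (x - y) - (z - t) = (x - z) - (y - t).
Proof. by ring. Qed.

Lemma mulrBB (R : realType) (i a x y z t : R) :
  i * (a * (x - y)) - i * (a * (z - t)) = i * (a * ((x - z) - (y - t))).
Proof. by ring. Qed.

Lemma lerD_double (R : realType) (u v c n s : R) : 0 <= c ->
  u <= c * n -> v <= c * n -> n <= s -> u + v <= 2 * c * s.
Proof. by move=> c0 un vn ns; have := ler_wpM2l c0 ns; lra. Qed.

Lemma lerD_halves (R : realType) (u v c p : R) :
  u <= c * (p / 2) -> v <= c * (p / 2) -> u + v <= c * p.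
Proof. by lra. Qed.

Lemma normr4_le (R : realType) (x y z t c p : R) :
    `|x| <= c * (p / 2) -> `|y| <= c * (p / 2) -> `|z| <= c * (p / 2) ->
    `|t| <= c * (p / 2) ->
  `|(x - z) - (y - t)| <= 2 * (c * p).
Proof.
move=> hx hy hz ht; apply: le_trans (ler_normB _ _) _.
apply: le_trans (lerD (ler_normB _ _) (ler_normB _ _)) _; lra.
Qed.

Lemma tail_split (R : realType) (d : nat) (w : R -> R) (h u : R) :
    measurable_fun setT (w : measurableTypeR R -> R) -> (forall r, 0 <= w r) ->
    0 < u -> u < h ->
  (tail d w u = tail d (cut h w) u + tail d w h)%E.
Proof.
move=> mw w0 u0 uh.
pose H (r : R) : \bar R := (w r * Num.max 0 r ^+ d.-1)%:E.
have mH : measurable_fun setT (H : measurableTypeR R -> \bar R).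
  by apply/measurable_EFinP; apply: measurable_funM => //; exact: measurable_maxX.
have H0 r : (0 <= H r)%E by rewrite lee_fin mulr_ge0// maxX_ge0.
have mI : measurable (`]u, h[%classic : set (measurableTypeR R)) by exact: measurable_itv.
have mJ : measurable (`[h, +oo[%classic : set (measurableTypeR R)) by exact: measurable_itv.
rewrite tail_cutE ?(ltW u0)// /tail -/H.
rewrite (_ : `]u, +oo[%classic = `]u, h[%classic `|` `[h, +oo[%classic); last first.
  apply/seteqP; split => r /=; rewrite !in_itv/= !andbT.
    by move=> ur; have [r1|r1] := ltP r h; [left; rewrite ur|right].
  by case=> [/andP[]//|]; exact: lt_le_trans.
rewrite (ge0_integral_setU lebesgue_measure mI mJ); last 3 first.
- exact: measurable_funS mH.
- by move=> r _; exact: H0.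
- rewrite disj_set2E; apply/eqP/seteqP; split => r //= [].
  by rewrite !in_itv/= andbT => /andP[_ r1] r2; move: r1; rewrite ltNge r2.
rewrite -(integral_itv_obnd_cbnd (measurable_funS measurableT (@subsetT _ _) mH)).
congr (_ + _)%E; apply: eq_integral => r; rewrite inE/= in_itv/= => /andP[ur _].
by rewrite /H max_r// ltW// (lt_trans u0).
Qed.

Lemma tail_cut_fin (R : realType) (d : nat) (w : R -> R) (h u : R) :
    measurable_fun setT (w : measurableTypeR R -> R) -> (forall r, 0 <= w r) ->
    (forall u, 0 < u -> tail d w u \is a fin_num) -> 0 < u ->
  tail d (cut h w) u \is a fin_num.
Proof.
move=> mw w0 tfin u0; have [uh|uh] := ltP u h; last by rewrite tail_cut_ge.
by have := tfin u u0; rewrite (tail_split d mw w0 u0 uh) fin_numD => /andP[].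
Qed.

(** * The operator on radial functions *)

Section RadialValue.
Context {R : realType} (d : nat) (hd : (1 < d)%N) (K C : set 'rV[R]_d).
Context (hK : convex_body K) (hC : open_fg_cone C).
Local Notation V := 'rV[R]_d.
Local Notation N := (gauge_norm K).
Local Notation mu := (@lebesgue_measure R).
Local Notation leb := (@leb R d).
Local Notation vol := (@vol R d).
Local Notation Bor := (Bor R d).
Local Notation Leb := (Leb R d).
Local Notation R1 := (measurableTypeR R).
Context (m0 : (0 < vol (K `&` C))%E).
Context (k : R -> R) (M h : R) (mk : measurable_fun setT (k : R1 -> R)).
Context (k0 : forall r, 0 <= k r) (kM : forall r, k r <= M) (h0 : 0 < h).
Context (kh : forall r, ~ (0 < r < h) -> k r = 0).
Context (c : R) (c0 : 0 <= c).
Context (w wB : R -> R) (Zw : set R) (mwB : measurable_fun setT (wB : R1 -> R)).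
Context (wB0 : forall r, 0 <= wB r).
Context (mZw : measurable (Zw : set R1)) (Zw0 : mu Zw = 0%E).
Context (wBE : forall r, 0 < r -> ~ Zw r -> wB r = w r).
Context (tfin : forall u, 0 < u -> tail d wB u \is a fin_num).
Context (moment : (\int[mu]_(r in `]0%R, 1%R[) (wB r * r ^+ d)%:E < +oo)%E).

Let hd0 : (0 < d)%N. Proof. exact: ltnW. Qed.
Let M0 : 0 <= M. Proof. exact: le_trans (k0 0) (kM 0). Qed.

(** Near the vertex the first moment of the weight controls the linear growth,
    and away from it the tails control the bound. *)
Lemma weight_min_lty (a b : R) : 0 <= a -> 0 <= b ->
  (\int[vol]_t (\1_C t * (wB (N t) * Num.min (a * N t) b))%:E < +oo)%E.
Proof.
move=> a0 b0; have mC := measurable_cone hC.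
pose F (r : R) := wB r * Num.min (a * Num.max 0 r) b.
have mm : measurable_fun setT ((fun r => Num.min (a * Num.max 0 r) b) : R1 -> R).
  have mx : measurable_fun setT ((fun r => a * Num.max 0 r) : R1 -> R).
    apply: measurable_funM => //.
    exact: (measurable_maxX 1).
  exact: (measurable_minr mx (measurable_cst b)).
have mF : measurable_fun setT (F : R1 -> R) by exact: measurable_funM.
have F0 r : 0 <= F r.
  by rewrite mulr_ge0// le_min b0 mulr_ge0// le_max lexx.
have -> : (\int[vol]_t (\1_C t * (wB (N t) * Num.min (a * N t) b))%:E =
    \int[vol]_(t in C) (F (N t))%:E)%E.
  rewrite [RHS]integral_mkcond; apply: eq_integral => t _; rewrite patchE indicE.
  by case: ifP => _; [rewrite mul1r /F max_r// gauge_ge0|rewrite mul0r].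
have mFE : measurable_fun setT ((fun r => (F r)%:E) : R1 -> \bar R) by exact/measurable_EFinP.
have F0E r : (0 <= (F r)%:E)%E by rewrite lee_fin.
rewrite (radial hd0 hK hC mFE F0E).
apply: lte_mul_pinfty.
- by rewrite mule_ge0// lee_fin.
- by rewrite fin_numM// leb_body_cone_fin.
pose G (r : R) : \bar R := ((F r)%:E * (r ^+ d.-1)%:E)%E.
have mG : measurable_fun setT (G : R1 -> \bar R).
  by apply: emeasurable_funM => //; apply/measurable_EFinP; exact: measurable_funX.
have mI : measurable (`]0, 1[%classic : set R1) by exact: measurable_itv.
have mJ : measurable (`[1, +oo[%classic : set R1) by exact: measurable_itv.
have IJ : `]0, +oo[%classic = `]0, 1[%classic `|` `[1, +oo[%classic :> set R.
  apply/seteqP; split => r /=; rewrite !in_itv/= !andbT.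
    by move=> r0; have [r1|r1] := ltP r 1; [left; rewrite r0|right].
  by case=> [/andP[]//|]; exact: lt_le_trans.
have G0 r : 0 < r -> (0 <= G r)%E by move=> r0; rewrite mule_ge0// lee_fin exprn_ge0// ltW.
rewrite -/G IJ (ge0_integral_setU mu mI mJ); last 3 first.
- exact: measurable_funS mG.
- by move=> r; rewrite -IJ /= in_itv/= andbT => /G0.
- rewrite disj_set2E; apply/eqP/seteqP; split => r //= [].
  by rewrite !in_itv/= andbT => /andP[_ r1] r2; move: r1; rewrite ltNge r2.
apply: lte_add_pinfty.
  apply: (@le_lt_trans _ _ (\int[mu]_(r in `]0%R, 1%R[) (a%:E * (wB r * r ^+ d)%:E))%E).
    apply: ge0_le_integral => //.
    - by move=> r; rewrite /= in_itv/= => /andP[/G0].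
    - exact: measurable_funS mG.
    - apply: emeasurable_funM => //; apply/measurable_EFinP; apply: measurable_funM.
        exact: measurable_funS mwB.
      exact: measurable_funX.
    move=> r; rewrite /= in_itv/= => /andP[r0 _].
    rewrite /G -!EFinM lee_fin /F max_r ?(ltW r0)//.
    rewrite -[X in _ <= _ * (_ * _ ^+ X)](prednK hd0) exprS.
    have X0 : 0 <= wB r * r ^+ d.-1 by rewrite mulr_ge0// exprn_ge0// ltW.
    have : Num.min (a * r) b <= a * r by rewrite ge_min lexx.
    move=> /(ler_wpM2l X0); rewrite -mulrA [X in X <= _ -> _]mulrCA; nra.
  rewrite ge0_integralZl//; last 2 first.
  - apply/measurable_EFinP; apply: measurable_funM; first exact: measurable_funS mwB.
    exact: measurable_funX.
  - move=> r; rewrite /= in_itv/= => /andP[r0 _].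
    by rewrite lee_fin mulr_ge0// exprn_ge0// ltW.
  by rewrite lte_mul_pinfty.
rewrite -(integral_itv_obnd_cbnd (measurable_funS measurableT (@subsetT _ _) mG)).
pose H (r : R) : \bar R := (wB r * Num.max 0 r ^+ d.-1)%:E.
have mH : measurable_fun setT (H : R1 -> \bar R).
  by apply/measurable_EFinP; apply: measurable_funM => //; exact: measurable_maxX.
apply: (@le_lt_trans _ _ (\int[mu]_(r in `]1%R, +oo[) (b%:E * H r))%E).
  apply: ge0_le_integral => //.
  - by move=> r; rewrite /= in_itv/= andbT => r1; apply: G0; exact: lt_trans r1.
  - exact: measurable_funS mG.
  - by apply: emeasurable_funM => //; exact: measurable_funS mH.
  move=> r; rewrite /= in_itv/= andbT => r1; have r0 := lt_trans ltr01 r1.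
  rewrite /G /H -!EFinM lee_fin /F max_r ?(ltW r0)//.
  rewrite mulrC mulrA [X in _ <= X]mulrC [r ^+ _ * _]mulrC ler_wpM2l//.
    by rewrite mulr_ge0// exprn_ge0// ltW.
  by rewrite ge_min lexx orbT.
rewrite ge0_integralZl//; last 2 first.
- exact: measurable_funS mH.
- by move=> r _; rewrite lee_fin mulr_ge0// maxX_ge0.
have tl : (tail d wB 1 < +oo)%E by rewrite ltey_eq tfin.
exact: lte_mul_pinfty.
Qed.

Local Notation f := (radial_fun K k h c).

Definition radial_integrand (x t : V) : R := \1_C t * (wB (N t) * (f x - f (x + t))).

(** The value of the operator on [radial_fun] written with the Borel weight;
    it makes sense at the vertex, which is not in the cone unless the cone is
    the whole space. *)
Definition radial_value (x : V) : R := \int[vol]_t radial_integrand x t.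

Let A : R := c * prim k h.

Let A0 : 0 <= A.
Proof. by rewrite mulr_ge0//; have /andP[] := prim_bounds mk k0 kM h0 kh 0; exact: le_trans. Qed.

Lemma radial_integrand_le x t :
  `|radial_integrand x t| <= \1_C t * (wB (N t) * Num.min (c * M * N t) A).
Proof.
rewrite /radial_integrand normrM ger0_norm ?indicE//; case: (t \in C); last by rewrite !mul0r.
rewrite !mul1r normrM (ger0_norm (wB0 _)) ler_wpM2l// le_min; apply/andP; split.
  have := radial_fun_lip hK mk k0 kM h0 kh c0 x (x + t).
  by rewrite opprD addNKr (gaugeN hK).
have h1 := radial_fun_le K mk k0 kM h0 kh c0 x.
have h2 := radial_fun_le K mk k0 kM h0 kh c0 (x + t).
by apply: le_trans (ler_normB _ _) _; exact: lerD_halves h1 h2.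
Qed.

Lemma measurable_radial_fun : measurable_fun setT (f : Bor -> R).
Proof. exact: continuous_Bor (radial_fun_continuous hK mk k0 kM h0 kh c0). Qed.

Lemma measurable_radial_integrand x : measurable_fun setT (radial_integrand x : Bor -> R).
Proof.
apply: measurable_funM; first by apply: measurable_indic; exact: measurable_cone.
apply: measurable_funM; first exact: measurableT_comp mwB (measurable_gauge hK).
apply: measurable_funB => //.
rewrite (_ : (fun t => _) = (fun t : Bor => f ((t : V) + x))).
  exact: measurableT_comp measurable_radial_fun (measurable_shift x).
by apply/funext => t; rewrite addrC.
Qed.

Definition weight_min (a b : R) (t : V) : R := \1_C t * (wB (N t) * Num.min (a * N t) b).

Lemma measurable_weight_min a b : measurable_fun setT (weight_min a b : Bor -> R).
Proof.
apply: measurable_funM; first by apply: measurable_indic; exact: measurable_cone.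
apply: measurable_funM; first exact: measurableT_comp mwB (measurable_gauge hK).
have ma : measurable_fun setT ((fun t => a * N t) : Bor -> R).
  by apply: measurable_funM => //; exact: measurable_gauge.
exact: (measurable_minr ma (measurable_cst b)).
Qed.

Lemma weight_min_ge0 a b t : 0 <= a -> 0 <= b -> 0 <= weight_min a b t.
Proof.
move=> a0 b0; rewrite mulr_ge0 ?indicE// mulr_ge0// le_min b0 andbT mulr_ge0//.
exact: gauge_ge0.
Qed.

Lemma weight_min_integrable a b : 0 <= a -> 0 <= b ->
  vol.-integrable setT (fun t => (weight_min a b t)%:E).
Proof.
move=> a0 b0; apply/integrableP; split.
  by apply/measurable_EFinP; exact: measurable_weight_min.
under eq_integral do rewrite abse_EFin (ger0_norm (weight_min_ge0 _ a0 b0)).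
exact: weight_min_lty.
Qed.

Lemma radial_integrable x : vol.-integrable setT (fun t => (radial_integrand x t)%:E).
Proof.
apply: (le_integrable measurableT _ _ (weight_min_integrable (mulr_ge0 c0 M0) A0)).
  by apply/measurable_EFinP; exact: measurable_radial_integrand.
move=> t _; rewrite !abse_EFin lee_fin [leRHS]ger0_norm; last first.
  by apply: weight_min_ge0 => //; exact: mulr_ge0.
exact: radial_integrand_le.
Qed.

Lemma radial_valueE x : ((radial_value x)%:E = \int[vol]_t (radial_integrand x t)%:E)%E.
Proof.
have fx := integrable_fin_num measurableT (radial_integrable x).
by rewrite /radial_value /Rintegral (fineK fx).
Qed.

Lemma D_Kw_radial x : C x -> D_Kw K C w f x = radial_value x.
Proof.
move=> Cx; have mC := measurable_cone hC.
have [_ _ e] := operator_version hd hK hC mwB mZw Zw0 wBE mC (@subset_refl _ C)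
  measurable_radial_fun measurable0 (measure0 _) (fun _ _ _ => erefl) Cx.
by rewrite /D_Kw /radial_value /Rintegral e.
Qed.

Lemma radial_valueB x y : ((radial_value x - radial_value y)%:E =
  \int[vol]_t ((radial_integrand x t)%:E - (radial_integrand y t)%:E))%E.
Proof.
have ix := radial_integrable x; have iy := radial_integrable y.
transitivity (\int[vol]_t (radial_integrand x t)%:E - \int[vol]_t (radial_integrand y t)%:E)%E.
  by rewrite EFinB; congr (_ - _)%E; exact: radial_valueE.
apply/esym; exact: (integralB measurableT ix iy).
Qed.

(** The points [x0] and [x] enter the two integrands through increments of a
    bounded Lipschitz function, so their difference is dominated by
    [weight_min] and tends to 0 with the distance. *)
Lemma radial_value_near (x0 : V) (e : R) : 0 < e ->
  exists2 rho, 0 < rho & forall x, N (x0 - x) <= rho -> radial_value x0 - e <= radial_value x.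
Proof.
move=> e0; pose a := 2 * (c * M); pose b := 2 * A.
have cM0 : 0 <= c * M by rewrite mulr_ge0.
have a0 : 0 <= a by rewrite mulr_ge0.
have b0 : 0 <= b by rewrite mulr_ge0.
pose u (n : nat) (t : V) : \bar R := (\1_C t * (wB (N t) * Num.min (a * step n) (Num.min (a * N t) b)))%:E.
have m0' n (t : V) : 0 <= Num.min (a * step n) (Num.min (a * N t) b).
  by rewrite !le_min b0 andbT !mulr_ge0 ?gauge_ge0// ltW// step_gt0.
have mu_ n : measurable_fun setT (u n : Bor -> \bar R).
  apply/measurable_EFinP.
  apply: measurable_funM; first by apply: measurable_indic; exact: measurable_cone.
  apply: measurable_funM; first exact: measurableT_comp mwB (measurable_gauge hK).
  have ma : measurable_fun setT ((fun t => a * N t) : Bor -> R).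
    by apply: measurable_funM => //; exact: measurable_gauge.
  exact: (measurable_minr (measurable_cst _) (measurable_minr ma (measurable_cst b))).
have cu : (fun n => \int[vol]_t u n t)%E @ \oo --> (\int[vol]_t (cst 0 t))%E.
  apply: (dominated_cvgT mu_ (measurable_cst _) _ (weight_min_integrable a0 b0)).
    apply: aeW => t; rewrite /cst; apply: cvg_EFin; first exact: nearW.
    rewrite /u/=; apply: (@squeeze_cvgr _ _ _ _ (cst 0) (fun n => \1_C t * (wB (N t) * (a * step n)))).
    - apply: nearW => n; rewrite /cst mulr_ge0 ?indicE ?mulr_ge0//= -indicE.
      rewrite ler_wpM2l ?indicE// ler_wpM2l// ge_min lexx//.
    - exact: cvg_cst.
    - rewrite -[X in _ --> X](mulr0 (\1_C t)); apply: cvgM; first exact: cvg_cst.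
      rewrite -[X in _ --> X](mulr0 (wB (N t))); apply: cvgM; first exact: cvg_cst.
      by rewrite -[X in _ --> X](mulr0 a); apply: cvgM; [exact: cvg_cst|exact: step_cvg].
  move=> n t; rewrite /u abse_EFin lee_fin ger0_norm ?mulr_ge0 ?indicE//.
  by rewrite -indicE ler_wpM2l ?indicE// ler_wpM2l// ge_min lexx orbT.
rewrite integral_cst// mul0e in cu.
have [n _ hn] : \forall n \near \oo, (\int[vol]_t u n t < e%:E)%E.
  have nb : nbhs 0%E [set y | (y < e%:E)%E].
    by apply: open_nbhs_nbhs; split; [exact: open_ereal_lt_ereal|rewrite /= lte_fin].
  exact: cu nb.
exists (step n); first exact: step_gt0.
move=> x Nx; rewrite lerBlDr addrC -lerBlDr.
rewrite -lee_fin radial_valueB.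
apply: le_trans (ltW (hn n (leqnn n))).
apply: le_trans (lee_abs _) _.
apply: le_trans (le_abse_integral vol measurableT _) _.
  apply: emeasurable_funB; apply/measurable_EFinP; exact: measurable_radial_integrand.
apply: ge0_le_integral => //.
- apply: measurableT_comp => //.
  by apply: emeasurable_funB; apply/measurable_EFinP; exact: measurable_radial_integrand.
move=> t _; rewrite -EFinB abse_EFin lee_fin.
have E : radial_integrand x0 t - radial_integrand x t =
    \1_C t * (wB (N t) * ((f x0 - f x) - (f (x0 + t) - f (x + t)))).
  exact: mulrBB.
rewrite {}E normrM ger0_norm ?indicE//; case tC : (t \in C); last by rewrite !mul0r.
rewrite !mul1r normrM (ger0_norm (wB0 _)) ler_wpM2l// !le_min; apply/and3P; split.
- have h1 := radial_fun_lip hK mk k0 kM h0 kh c0 x0 x.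
  have := radial_fun_lip hK mk k0 kM h0 kh c0 (x0 + t) (x + t).
  rewrite (_ : x0 + t - (x + t) = x0 - x); last by rewrite opprD addrACA subrr addr0.
  by move=> h2; apply: le_trans (ler_normB _ _) _; exact: lerD_double h1 h2 Nx.
- rewrite subr4.
  have h1 y : `|f y - f (y + t)| <= c * M * N t.
    have -> : N t = N (y - (y + t)) by rewrite opprD addNKr (gaugeN hK).
    exact: (radial_fun_lip hK mk k0 kM h0 kh c0).
  apply: le_trans (ler_normB _ _) _; exact: lerD_double cM0 (h1 x0) (h1 x) (lexx _).
- by apply: normr4_le; exact: radial_fun_le.
Qed.

(** At the vertex, f 0 - f t = c * prim (N t). In polar coordinates and by
    [hardy_tonelli] the integral becomes that of [k] against the tail of the
    weight, which splits at [h]; the part beyond [h] is constant on the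
    support of [k]. *)
Lemma radial_value0 : ((radial_value 0)%:E = c%:E * (d%:R%:E * vol (K `&` C)) *
  (\int[mu]_(u in `]0%R, h[) (k u * (u ^+ d.-1 * mean d wB h u))%:E +
   tail d wB h * (prim k h)%:E))%E.
Proof.
have mC := measurable_cone hC.
transitivity (\int[vol]_t (radial_integrand 0 t)%:E)%E; first exact: radial_valueE.
pose a r := wB r * Num.max 0 r ^+ d.-1.
have ma : measurable_fun setT ((fun r => (a r)%:E) : R1 -> \bar R).
  by apply/measurable_EFinP; apply: measurable_funM => //; exact: measurable_maxX.
have a0 r : (0 <= (a r)%:E)%E by rewrite lee_fin mulr_ge0// maxX_ge0.
have mkE : measurable_fun setT ((fun r => (k r)%:E) : R1 -> \bar R) by exact/measurable_EFinP.
have kE r : (0 <= (k r)%:E)%E by rewrite lee_fin.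
have p0 x : 0 <= prim k x by have /andP[] := prim_bounds mk k0 kM h0 kh x.
have mprim : measurable_fun setT (prim k : R1 -> R).
  apply: continuous_measurable_fun => x; apply/cvgrPdist_le => e e0.
  have M1 : 0 < M + 1 by rewrite ltr_wpDl.
  near=> y; apply: le_trans (prim_lip mk k0 kM h0 kh _ _) _.
  have xy : `|x - y| <= e / (M + 1).
    by near: y; apply: cvgr_dist_le; [exact: cvg_id|rewrite divr_gt0].
  move: xy; rewrite ler_pdivlMr// => xy; have := normr_ge0 (x - y); nra.
have -> : (\int[vol]_t (radial_integrand 0 t)%:E = \int[vol]_(t in C) (c * (wB (N t) * prim k (N t)))%:E)%E.
  rewrite [RHS]integral_mkcond; apply: eq_integral => t _; rewrite patchE /radial_integrand indicE.
  case: ifP => _; last by rewrite mul0r.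
  rewrite mul1r add0r /radial_fun gauge0// (prim_le0 kh (lexx 0)); congr (_%:E); ring.
have mF : measurable_fun setT ((fun r => (wB r * prim k r)%:E) : R1 -> \bar R).
  by apply/measurable_EFinP; exact: measurable_funM.
have F0 r : (0 <= (wB r * prim k r)%:E)%E by rewrite lee_fin mulr_ge0.
have -> : (\int[vol]_(t in C) (c * (wB (N t) * prim k (N t)))%:E =
    c%:E * \int[vol]_(t in C) (wB (N t) * prim k (N t))%:E)%E.
  rewrite -ge0_integralZl//.
  apply: (measurable_funS measurableT (@subsetT _ _)).
  exact: measurableT_comp mF (measurable_gauge hK).
rewrite (radial hd0 hK hC mF F0) -!muleA; congr (_ * (_ * (_ * _)))%E.
have prim0E r : 0 <= r -> ((prim k r)%:E = \int[mu]_(u in `]0%R, r[) (k u)%:E)%E.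
  move=> r0; rewrite integral_itv_bndo_bndc; last exact: measurable_funS mkE.
  by rewrite -(primE mk k0 kM h0 kh r0) (prim_le0 kh (lexx 0)) subr0.
transitivity (\int[mu]_(r in `]0%R, +oo[) ((a r)%:E * \int[mu]_(u in `]0%R, r[) (k u)%:E))%E.
  apply: eq_integral => r; rewrite inE/= in_itv/= andbT => r0.
  by rewrite -prim0E ?(ltW r0)// -!EFinM /a max_r ?(ltW r0)//; congr (_%:E); ring.
rewrite (hardy_tonelli ma mkE a0 kE).
transitivity (\int[mu]_(u in `]0%R, h[) ((k u * (u ^+ d.-1 * mean d wB h u))%:E + tail d wB h * (k u)%:E))%E.
  rewrite integral_mkcond [RHS]integral_mkcond; apply: eq_integral => u _; rewrite !patchE.
  have [uh|nu] := pselect (0 < u < h); last first.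
    rewrite kh// mul0e mul0r mule0 addr0; by case: ifP; case: ifP.
  move: (uh) => /andP[u0 u1]; rewrite !mem_set/=; last 2 first.
  - by rewrite in_itv/= u0.
  - by rewrite in_itv/= u0.
  rewrite -/(tail d wB u) (tail_split d mwB wB0 u0 u1) -(fineK (tail_cut_fin h mwB wB0 tfin u0)).
  rewrite -(fineK (tfin h0)) -EFinD -!EFinM -EFinD; congr (_%:E); rewrite /mean.
  have : u ^+ d.-1 != 0 by rewrite expf_neq0// gt_eqF.
  by move=> ?; field.
have T0 : (0 <= tail d wB h)%E by exact: tail_ge0.
have X0 u : `]0, h[%classic u -> 0 <= u ^+ d.-1.
  by rewrite /= in_itv/= => /andP[u0 _]; rewrite exprn_ge0// ltW.
rewrite ge0_integralD//; last 4 first.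
- move=> u uI; rewrite lee_fin mulr_ge0// mulr_ge0 ?X0// mean_ge0//.
  by move: uI; rewrite /= in_itv/= => /andP[/ltW].
- apply/measurable_EFinP; apply: measurable_funM; first exact: measurable_funS mk.
  apply: measurable_funM; first exact: measurable_funX.
  by apply: measurable_mean => // r; rewrite /= !in_itv/= andbT => /andP[].
- by move=> u _; rewrite mule_ge0.
- by apply: emeasurable_funM => //; exact: measurable_funS mkE.
congr (_ + _)%E; rewrite ge0_integralZl//; last exact: measurable_funS mkE.
by rewrite -prim0E// ltW.
Unshelve. all: by end_near. Qed.

End RadialValue.

(** * The lower bound *)

(** The operator norm is an infimum that need not be known to be attained. *)
Lemma op_norm_le (R : realType) (d : nat) (C : set 'rV[R]_d) (T : ('rV[R]_d -> R) -> 'rV[R]_d -> R)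
    (B A : R) (f : 'rV[R]_d -> R) : 0 <= B ->
    (op_norm C (Linfty C) T <= B%:E)%E -> Linfty C f -> (Lp_norm +oo C f <= A%:E)%E ->
  (Lp_norm +oo C (T f) <= (B * A)%:E)%E.
Proof.
move=> B0 hT fL fA.
have A0 : 0 <= A by rewrite -lee_fin; apply: le_trans fA; exact: Lnorm_ge0.
apply/lee_addgt0Pr => e e0.
pose e' := e / (A + 1).
have A1 : 0 < A + 1 by rewrite ltr_wpDl.
have e'0 : 0 < e' by rewrite divr_gt0.
have : (op_norm C (Linfty C) T < (B + e')%:E)%E by apply: le_lt_trans hT _; rewrite lte_fin ltrDl.
move=> /ereal_inf_lt[_ [M [M0 hM] <-]]; rewrite lte_fin => MB.
apply: le_trans (hM f fL) _.
apply: le_trans (lee_wpmul2l _ fA) _; first by rewrite lee_fin.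
rewrite -EFinM -EFinD lee_fin.
have : M * A <= (B + e') * A by rewrite ler_wpM2r// ltW.
have : e' * A <= e by rewrite /e' mulrAC ler_pdivrMr// ler_wpM2l ?ltW//; lra.
lra.
Qed.

(** The cancellation behind the lower bound: the part of the value at the
    vertex due to radii beyond [h] equals the most that an operator of norm N
    can reproduce. *)
Lemma gain_algebra (R : realType) (c b v g t r : R) :
  (c%:E * (b%:E * v%:E) * (g%:E + t%:E * r%:E) - (2 * b)%:E * v%:E * t%:E * (c * (r / 2))%:E =
   c%:E * (b%:E * v%:E) * g%:E)%E.
Proof.
transitivity (c * (b * v) * (g + t * r) - 2 * b * v * t * (c * (r / 2)))%:E; first by [].
by transitivity (c * (b * v) * g)%:E; [congr (_%:E); field|].
Qed.

Section Lower.
Context {R : realType} (d : nat) (hd : (1 < d)%N) (K C : set 'rV[R]_d).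
Context (hK : convex_body K) (hC : open_fg_cone C).
Local Notation V := 'rV[R]_d.
Local Notation N := (gauge_norm K).
Local Notation mu := (@lebesgue_measure R).
Local Notation leb := (@leb R d).
Local Notation vol := (@vol R d).
Local Notation Bor := (Bor R d).
Local Notation Leb := (Leb R d).
Local Notation R1 := (measurableTypeR R).
Context (m0 : (0 < vol (K `&` C))%E).
Context (w wB : R -> R) (Zw : set R) (mwB : measurable_fun setT (wB : R1 -> R)).
Context (wB0 : forall r, 0 <= wB r).
Context (mZw : measurable (Zw : set R1)) (Zw0 : mu Zw = 0%E).
Context (wBE : forall r, 0 < r -> ~ Zw r -> wB r = w r).
Context (tfin : forall u, 0 < u -> tail d wB u \is a fin_num).
Context (moment : (\int[mu]_(r in `]0%R, 1%R[) (wB r * r ^+ d)%:E < +oo)%E).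
Context (h : R) (h0 : 0 < h) (p : \bar R) (q : R) (pq : conjugate p q) (q1 : 1 <= q).
Context (Nn : R) (Nn0 : 0 <= Nn).
Context (hN : ((2 * d%:R)%:E * vol (K `&` C) * tail d wB h = Nn%:E)%E).

Let hd0 : (0 < d)%N. Proof. exact: ltnW. Qed.

(** An essential supremum over the cone sees the values near the vertex,
    because these neighbourhoods are homothetic to the part of the body in the
    cone. *)
Lemma vol_small_cone (rho : R) : 0 < rho -> (0 < vol (C `&` [set x | (N x < rho)%R]))%E.
Proof.
move=> r0; have := leb_affine 0 (K `&` C) r0.
rewrite -[X in (_ * X)%E]volE => E.
apply: (@lt_le_trans _ _ ((rho ^+ d)%:E * vol (K `&` C))%E).
  by rewrite mule_gt0// lte_fin exprn_gt0.
rewrite -E volE; apply: (@le_outer_measure _ _ (@lebesgue_outer R d)) => x /=.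
rewrite subr0 => -[Kx Cx]; have ri0 : 0 < rho^-1 by rewrite invr_gt0.
split; first by rewrite -(scale1r x) -(mulfV (lt0r_neq0 r0)) -scalerA; exact: (cone_scale hC).
by move: Kx => /(bodyE hK); rewrite (gaugeZ_gt0 hK)// mulrC ltr_pdivrMr// mul1r.
Qed.

Section Deviation.
Context (k : R -> R) (M : R) (mk : measurable_fun setT (k : R1 -> R)).
Context (k0 : forall r, 0 <= k r) (kM : forall r, k r <= M).
Context (kh : forall r, ~ (0 < r < h) -> k r = 0).
Context (c : R) (c0 : 0 <= c).
Context (S : (V -> R) -> V -> R) (hS : approximants C Nn S).
Local Notation f := (radial_fun K k h c).

(** Near the vertex [D_Kw f] is almost [radial_value 0], while [S f] is at
    most N times the norm of [f]. *)
Lemma deviation_ge : WK K p C f ->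
  ((radial_value K C k h c wB 0 - Nn * (c * (prim k h / 2)))%:E <=
   deviation C (D_Kw K C w) S (WK K p C))%E.
Proof.
move=> fW; have mC := measurable_cone hC.
have fL := radial_fun_Linfty hK m0 mk k0 kM h0 kh c0.
have Sn := op_norm_le Nn0 hS.2 fL (radial_fun_norm m0 mk k0 kM h0 kh c0).
set A := c * (prim k h / 2) in Sn *.
have A0 : 0 <= A.
  exact: le_trans (normr_ge0 _) (radial_fun_le K mk k0 kM h0 kh c0 0).
apply: (@le_trans _ _ (Lp_norm +oo%E C (fun x => D_Kw K C w f x - S f x))); last first.
  by apply: ereal_sup_ubound; exists f.
have := Linfty_norm_ge0 C (fun x => D_Kw K C w f x - S f x).
case E : (Lp_norm +oo%E C (fun x => D_Kw K C w f x - S f x)) => [s| |] //; last first.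
  by move=> _; rewrite leey.
rewrite lee_fin => s0.
have h1 : {ae leb, forall x, C x -> `|D_Kw K C w f x - S f x| <= s}.
  by apply/(Linfty_normP m0) => //; rewrite E.
have h2 : {ae leb, forall x, C x -> `|S f x| <= Nn * A}.
  by apply/(Linfty_normP m0) => //; rewrite mulr_ge0.
rewrite lee_fin; apply/ler_addgt0Pr => e e0.
have [rho rho0 hrho] := radial_value_near hd hK hC mk k0 kM h0 kh c0 mwB wB0 tfin moment 0 e0.
have [x [Cx Nx] [hx1 hx2]] : exists2 x, (C `&` [set x | N x < rho]) x &
    (C x -> `|D_Kw K C w f x - S f x| <= s) /\ (C x -> `|S f x| <= Nn * A).
  apply: contrapT => hn; have := vol_small_cone rho0; rewrite lt0e => /andP[/eqP + _]; apply.
  have [Z [mZ Z0 hZ]] := @filterI _ _ (ae_filter_ringOfSetsType leb) _ _ h1 h2.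
  apply/eqP; rewrite eq_le measure_ge0 andbT -[leRHS]Z0 [leLHS]volE.
  apply: (@le_outer_measure _ _ (@lebesgue_outer R d)) => x xB.
  by apply: hZ => /= hx; apply: hn; exists x.
have := hrho x; rewrite sub0r (gaugeN hK) => /(_ (ltW Nx)).
rewrite -(D_Kw_radial hd hK hC mk k0 kM h0 kh c0 mwB mZw Zw0 wBE Cx).
have := hx1 Cx; have := hx2 Cx; rewrite !ler_norml => /andP[_ a1] /andP[_ a2]; lra.
Qed.

(** What is left of [radial_value0] after the cancellation of [gain_algebra]. *)
Definition gain : \bar R := (\int[mu]_(u in `]0%R, h[) (k u * (u ^+ d.-1 * mean d wB h u))%:E)%E.

Lemma gain_ge0 : (0 <= gain)%E.
Proof.
apply: integral_ge0 => u; rewrite /= in_itv/= => /andP[u0 _].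
by rewrite lee_fin mulr_ge0// mulr_ge0 ?exprn_ge0 ?mean_ge0// ltW.
Qed.

Lemma radial_value0_gain : ((radial_value K C k h c wB 0)%:E =
  c%:E * (d%:R%:E * vol (K `&` C)) * (gain + tail d wB h * (prim k h)%:E))%E.
Proof. exact: (radial_value0 hd hK hC mk k0 kM h0 kh c0 mwB wB0 tfin moment). Qed.

Lemma deviation_gain : gain \is a fin_num -> WK K p C f ->
  (c%:E * (d%:R%:E * vol (K `&` C)) * gain <= deviation C (D_Kw K C w) S (WK K p C))%E.
Proof.
move=> gfin /deviation_ge; apply: le_trans.
rewrite EFinB radial_value0_gain EFinM -hN.
have vfin := leb_body_cone_fin C hK.
have [v vE] : exists v, vol (K `&` C) = v%:E by exists (fine (vol (K `&` C))); rewrite fineK.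
have [g gE] : exists g, gain = g%:E by exists (fine gain); rewrite fineK.
have [t tE] : exists t, tail d wB h = t%:E by exists (fine (tail d wB h)); rewrite fineK// tfin.
by rewrite vE gE tE gain_algebra.
Qed.

End Deviation.
End Lower.

(** The case of equality in Hoelder's inequality requires [mean ^ (q - 1)];
    the cut-off at [n.+1] makes it bounded. *)
Definition profile (R : realType) (d : nat) (wB : R -> R) (h q : R) (n : nat) (u : R) : R :=
  if u \in `]0, h[ then Num.min n.+1%:R (mean d wB h u `^ (q - 1)) else 0.

Lemma powR_mulr_ge0 (R : realType) (x a : R) : 0 <= x -> a + 1 != 0 ->
  x `^ a * x = x `^ (a + 1).
Proof.
rewrite le_eqVlt => /predU1P[<- a0|x0 _]; first by rewrite mulr0 powR0.
by rewrite powRD ?(gt_eqF x0) ?implybT// powRr1 ?ltW.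
Qed.

Section Profile.
Context {R : realType} (d : nat) (wB : R -> R) (wB0 : forall r, 0 <= wB r).
Context (mwB : measurable_fun setT (wB : measurableTypeR R -> R)).
Context (h q : R) (q1 : 1 <= q).
Local Notation k := (profile d wB h q).
Local Notation m := (mean d wB h).

Lemma profile_ge0 n u : 0 <= k n u.
Proof. by rewrite /profile; case: ifP => // _; rewrite le_min powR_ge0 andbT. Qed.

Lemma profile_le n u : k n u <= n.+1%:R.
Proof. by rewrite /profile; case: ifP => // _; rewrite ge_min lexx. Qed.

Lemma profile_out n r : ~ (0 < r < h) -> k n r = 0.
Proof. by move=> hr; rewrite /profile in_itv/=; case: ifP. Qed.

Lemma measurable_profile n : measurable_fun setT (k n : measurableTypeR R -> R).
Proof.
have mI : measurable (`]0, h[%classic : set (measurableTypeR R)) by exact: measurable_itv.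
have mm : measurable_fun (`]0, h[%classic : set (measurableTypeR R)) (m : measurableTypeR R -> R).
  by apply: measurable_mean => // u; rewrite /= !in_itv/= andbT => /andP[].
have mM : measurable_fun (`]0, h[%classic : set (measurableTypeR R))
    ((fun u => Num.min n.+1%:R (m u `^ (q - 1))) : measurableTypeR R -> R).
  exact: (measurable_minr (measurable_cst _) (measurableT_comp (measurable_powR _) mm)).
have := (measurable_restrictT _ mI).1 mM; congr (measurable_fun _ _).
apply/funext => u; rewrite patchE /profile; congr (if _ then _ else _).
by apply/idP/idP; rewrite inE.
Qed.

Lemma profile_cvg u : 0 < u < h -> k n u * (u ^+ d.-1 * m u) @[n --> \oo] --> u ^+ d.-1 * m u `^ q.
Proof.
move=> uh; have /andP[u0 _] := uh; have mu0 : 0 <= m u by apply: mean_ge0 => //; exact: ltW.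
have <- : m u `^ (q - 1) * (u ^+ d.-1 * m u) = u ^+ d.-1 * m u `^ q.
  rewrite mulrCA powR_mulr_ge0 ?subrK// gt_eqF//; exact: lt_le_trans q1.
apply: cvgMr_tmp; apply: cvg_near_cst.
have [n0 _ hn0] : \forall n \near \oo, m u `^ (q - 1) < n%:R by exact: nbhs_infty_gtr.
exists n0 => // n /= n0n; rewrite /profile in_itv/= uh min_r//.
have /ltW := hn0 n n0n; move=> /le_trans; apply; by rewrite ler_nat.
Qed.

Lemma profile_unit n u : q = 1 -> k n u <= 1.
Proof.
move=> ->; rewrite /profile; case: ifP => // _.
by rewrite subrr powRr0 ge_min lexx orbT.
Qed.

(** Since [(q - 1) * (r - 1) = 1], without the cut-off this would be an
    equality. *)
Lemma profile_power n u r : 0 < r -> r^-1 + q^-1 = 1 -> k n u `^ r <= k n u * m u.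
Proof.
move=> r0 rq; rewrite /profile; case: ifP => [|_]; last first.
  by rewrite powR0 ?gt_eqF// mul0r.
rewrite in_itv/= => /andP[u0 _]; have mu0 : 0 <= m u by apply: mean_ge0 => //; exact: ltW.
set y := Num.min _ _.
have y0 : 0 <= y by rewrite le_min powR_ge0 andbT.
have q0 : 0 < q by exact: lt_le_trans q1.
have rq1 : (q - 1) * (r - 1) = 1.
  have : (r^-1 + q^-1) * (r * q) = r * q by rewrite rq mul1r.
  have -> : (r^-1 + q^-1) * (r * q) = q + r by field; rewrite !gt_eqF.
  nra.
have r1 : 0 <= r - 1.
  rewrite subr_ge0 leNgt; apply/negP => r1.
  have : (q - 1) * (r - 1) <= 0 by rewrite mulr_ge0_le0// ?subr_ge0// subr_le0 ltW.
  by rewrite rq1 leNgt ltr01.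
have -> : y `^ r = y * y `^ (r - 1).
  by rewrite mulrC powR_mulr_ge0 ?subrK// gt_eqF.
rewrite ler_wpM2l//.
apply: le_trans (_ : (m u `^ (q - 1)) `^ (r - 1) <= _); last by rewrite -powRrM rq1 powRr1.
by apply: ge0_ler_powR => //; rewrite ?nnegrE ?powR_ge0// ge_min lexx orbT.
Qed.

End Profile.

Section LowerBound.
Context {R : realType} (d : nat) (hd : (1 < d)%N) (K C : set 'rV[R]_d).
Context (hK : convex_body K) (hC : open_fg_cone C).
Local Notation V := 'rV[R]_d.
Local Notation N := (gauge_norm K).
Local Notation mu := (@lebesgue_measure R).
Local Notation vol := (@vol R d).
Local Notation Bor := (Bor R d).
Local Notation R1 := (measurableTypeR R).
Context (m0 : (0 < vol (K `&` C))%E).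
Context (w wB : R -> R) (Zw : set R) (mwB : measurable_fun setT (wB : R1 -> R)).
Context (wB0 : forall r, 0 <= wB r).
Context (mZw : measurable (Zw : set R1)) (Zw0 : mu Zw = 0%E).
Context (wBE : forall r, 0 < r -> ~ Zw r -> wB r = w r).
Context (tfin : forall u, 0 < u -> tail d wB u \is a fin_num).
Context (moment : (\int[mu]_(r in `]0%R, 1%R[) (wB r * r ^+ d)%:E < +oo)%E).
Context (h : R) (h0 : 0 < h) (p : \bar R) (q : R) (pq : conjugate p q) (q1 : 1 <= q).
Context (Nn : R) (Nn0 : 0 <= Nn).
Context (hN : ((2 * d%:R)%:E * vol (K `&` C) * tail d wB h = Nn%:E)%E).

Let hd0 : (0 < d)%N. Proof. exact: ltnW. Qed.
Local Notation m := (mean d wB h).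
Local Notation k := (profile d wB h q).
Local Notation J n := (gain d wB h (k n)).

Let mk n : measurable_fun setT (k n : R1 -> R). Proof. exact: measurable_profile. Qed.
Let k0 n r : 0 <= k n r. Proof. exact: profile_ge0. Qed.
Let kM n r : k n r <= n.+1%:R. Proof. exact: profile_le. Qed.
Let kh n r : ~ (0 < r < h) -> k n r = 0. Proof. exact: profile_out. Qed.

(** The value of the operator at the vertex is a real number and bounds the
    gain, although the integral of [mean ^ q] may diverge. *)
Lemma gain_fin n : J n \is a fin_num.
Proof.
have := radial_value0_gain hd hK hC mwB wB0 tfin moment h0 (mk n) (k0 n) (kM n) (@kh n) ler01.
have [v vE] : exists v, vol (K `&` C) = v%:E.
  by exists (fine (vol (K `&` C))); rewrite fineK// leb_body_cone_fin.
have [t tE] : exists t, tail d wB h = t%:E by exists (fine (tail d wB h)); rewrite fineK// tfin.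
have v0 : 0 < v by rewrite -lte_fin -vE.
have : (0 <= J n)%E by apply: gain_ge0 => //; exact: k0.
rewrite vE tE mul1e.
case: (J n) => [g|_|//] //=.
by rewrite -EFinM addye// gt0_muley// lte_fin mulr_gt0// ltr0n.
Qed.

(** The r-th power of the profile is at most [k * mean], whose integral in
    polar coordinates is the gain; the constant normalizes it. *)
Lemma profile_unit_bound n r v j : 0 < r -> r^-1 + q^-1 = 1 ->
    vol (K `&` C) = v%:E -> J n = j%:E ->
  unit_bound C r%:E (fun x => (d%:R * v * j) `^ (- r^-1) * k n (N x)).
Proof.
move=> r0 rq vE jE; set c := (_ `^ _).
have c0 : 0 <= c by exact: powR_ge0.
have v0 : 0 < v by rewrite -lte_fin -vE.
have j0 : 0 <= j by rewrite -lee_fin -jE; apply: gain_ge0 => //; exact: k0.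
have mF : measurable_fun setT ((fun u => ((c * k n u) `^ r)%:E) : R1 -> \bar R).
  apply/measurable_EFinP; apply: (measurableT_comp (measurable_powR _)).
  by apply: measurable_funM => //; exact: mk.
have F0 u : (0 <= ((c * k n u) `^ r)%:E)%E by rewrite lee_fin powR_ge0.
rewrite /= (radial hd0 hK hC mF F0).
apply: (@le_trans _ _ (d%:R%:E * vol (K `&` C) * ((c `^ r)%:E * J n))%E); last first.
  rewrite vE jE -!EFinM lee_fin.
  have -> : d%:R * v * (c `^ r * j) = c `^ r * (d%:R * v * j) by ring.
  rewrite /c -powRrM mulNr mulVf ?gt_eqF// powR_inv1 ?mulr_ge0 ?(ltW v0)//.
  have [->|D0] := eqVneq (d%:R * v * j) 0; first by rewrite mulr0 ler01.
  by rewrite mulVf.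
apply: lee_wpmul2l; first by rewrite mule_ge0// lee_fin.
have mI : measurable (`]0, h[%classic : set R1) by exact: measurable_itv.
have mm : measurable_fun (`]0, h[%classic : set R1) (m : R1 -> R).
  by apply: measurable_mean => // u; rewrite /= !in_itv/= andbT => /andP[].
have mk' : measurable_fun (`]0, h[%classic : set R1) (k n : R1 -> R).
  by apply: measurable_funS (mk n).
have mX : measurable_fun (`]0, h[%classic : set R1) ((fun u => u ^+ d.-1) : R1 -> R).
  exact: measurable_funX.
have mg : measurable_fun (`]0, h[%classic : set R1)
    ((fun u => (k n u * (u ^+ d.-1 * m u))%:E) : R1 -> \bar R).
  apply/measurable_EFinP; apply: measurable_funM => //; apply: measurable_funM => //.
rewrite /gain -(ge0_integralZl mu mI mg); last 2 first.
- move=> u; rewrite /= in_itv/= => /andP[u0 _].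
  by rewrite lee_fin mulr_ge0 ?k0// mulr_ge0 ?exprn_ge0 ?mean_ge0// ltW.
- by rewrite lee_fin powR_ge0.
rewrite (_ : \int[mu]_(u in `]0%R, +oo[) _ =
    \int[mu]_(u in `]0%R, h[) (((c * k n u) `^ r)%:E * (u ^+ d.-1)%:E))%E; last first.
  rewrite integral_mkcond [RHS]integral_mkcond; apply: eq_integral => u _; rewrite !patchE.
  case: ifPn => [/set_mem|/negP un].
    rewrite /= in_itv/= andbT => u0; case: ifPn => // /negP hu.
    rewrite kh ?mulr0 ?powR0 ?gt_eqF ?mul0e// => uh; apply: hu.
    by rewrite inE/= in_itv.
  rewrite memNset// /= in_itv/= => /andP[u0 _]; apply: un.
  by rewrite inE/= in_itv/= u0.
apply: ge0_le_integral => //.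
- by move=> u; rewrite /= in_itv/= => /andP[u0 _]; rewrite mule_ge0// lee_fin exprn_ge0// ltW.
- apply: emeasurable_funM; first exact: measurable_funS mF.
  by apply/measurable_EFinP; exact: measurable_funX.
- by apply: emeasurable_funM.
move=> u; rewrite /= in_itv/= => /andP[u0 _].
rewrite -!EFinM lee_fin powRM ?k0// -mulrA ler_wpM2l ?powR_ge0//.
rewrite mulrCA [leLHS]mulrC ler_wpM2l ?exprn_ge0 ?(ltW u0)//.
exact: profile_power.
Qed.

Lemma deviation_profile S n : approximants C Nn S ->
  ((d%:R%:E * vol (K `&` C) * J n) `^ q^-1 <= deviation C (D_Kw K C w) S (WK K p C))%E.
Proof.
move=> hS.
have key c : 0 <= c -> unit_bound C p (fun x => c * k n (N x)) ->
    (c%:E * (d%:R%:E * vol (K `&` C)) * J n <= deviation C (D_Kw K C w) S (WK K p C))%E.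
  move=> c0 ub; apply: (deviation_gain hd hK hC m0 mwB wB0 mZw Zw0 wBE tfin moment h0 Nn0 hN
    (mk n) (k0 n) (kM n) (@kh n) c0 hS (gain_fin n)).
  exact: (radial_fun_WK hd hK hC m0 (mk n) (k0 n) (kM n) h0 (@kh n) c0 pq ub).
have [v vE] : exists v, vol (K `&` C) = v%:E.
  by exists (fine (vol (K `&` C))); rewrite fineK// leb_body_cone_fin.
have [j jE] : exists j, J n = j%:E by exists (fine (J n)); rewrite fineK// gain_fin.
have v0 : 0 < v by rewrite -lte_fin -vE.
have j0 : 0 <= j by rewrite -lee_fin -jE; apply: gain_ge0 => //; exact: k0.
(* For p = +oo, q = 1 and the profile is bounded by 1 without
   normalization. *)
case: (p) pq key => [r [r0 _ rq]|q_1|//] key.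
  have := key _ (powR_ge0 _ _) (profile_unit_bound r0 rq vE jE).
  apply: le_trans; rewrite vE jE -!EFinM lee_fin -[leRHS]mulrA.
  rewrite powR_mulr_ge0 ?mulr_ge0 ?(ltW v0)//.
    by rewrite -rq addrA addNr add0r.
  by rewrite -rq addrA addNr add0r invr_neq0// gt_eqF// (lt_le_trans _ q1).
have := key 1 ler01 (fun x => _); rewrite mul1e => /(_ _)/(le_trans _); apply.
  rewrite vE jE -!EFinM/= q_1 invr1 powRr1//.
  by rewrite !mulr_ge0// ltW.
by move=> x; rewrite mul1r profile_unit.
Qed.

(** The bounds of [deviation_profile] pass to the limit [n --> +oo] by Fatou's
    lemma, which also covers the case where the integral diverges. *)
Lemma deviation_lower_bound S : approximants C Nn S ->
  ((d%:R%:E * vol (K `&` C) *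
    \int[mu]_(u in `]0%R, h[) (u ^+ d.-1 * m u `^ q)%:E) `^ q^-1 <=
   deviation C (D_Kw K C w) S (WK K p C))%E.
Proof.
move=> hS; have q0 : 0 < q by exact: lt_le_trans q1.
have := fun n => deviation_profile n hS.
case: (deviation _ _ _ _) => [s| |] hs; last 2 first.
- by rewrite leey.
- by have := hs 0%N; rewrite leeNy_eq => /eqP hoo; have := poweR_ge0 (d%:R%:E * vol (K `&` C) * J 0) q^-1; rewrite hoo.
have [v vE] : exists v, vol (K `&` C) = v%:E.
  by exists (fine (vol (K `&` C))); rewrite fineK// leb_body_cone_fin.
have v0 : 0 < v by rewrite -lte_fin -vE.
have D0 : 0 < d%:R * v by rewrite mulr_gt0// ltr0n.
have s0 : 0 <= s by rewrite -lee_fin; apply: le_trans (hs 0%N); exact: poweR_ge0.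
rewrite vE in hs *.
have hJ n : (J n <= (s `^ q / (d%:R * v))%:E)%E.
  have [j jE] : exists j, J n = j%:E by exists (fine (J n)); rewrite fineK// gain_fin.
  have j0 : 0 <= j by rewrite -lee_fin -jE; apply: gain_ge0 => //; exact: k0.
  have := hs n; rewrite jE -!EFinM !lee_fin ler_pdivlMr// mulrC => hj.
  have Dj : 0 <= j * (d%:R * v) by rewrite mulr_ge0// ltW.
  have -> : j * (d%:R * v) = ((j * (d%:R * v)) `^ q^-1) `^ q.
    by rewrite -powRrM mulVf ?gt_eqF// powRr1.
  by apply: ge0_ler_powR => //; rewrite ?nnegrE ?powR_ge0// ltW.
have mI : measurable (`]0, h[%classic : set R1) by exact: measurable_itv.
have mm : measurable_fun (`]0, h[%classic : set R1) (m : R1 -> R).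
  by apply: measurable_mean => // u; rewrite /= !in_itv/= andbT => /andP[].
have hI : (\int[mu]_(u in `]0%R, h[) (u ^+ d.-1 * m u `^ q)%:E <= (s `^ q / (d%:R * v))%:E)%E.
  apply: (@fatou_le _ R1 R mu _ (fun n u => (k n u * (u ^+ d.-1 * m u))%:E)) => //.
  - move=> n; apply/measurable_EFinP; apply: measurable_funM.
      exact: measurable_funS (mk n).
    by apply: measurable_funM => //; exact: measurable_funX.
  - move=> n u; rewrite /= in_itv/= => /andP[u0 _].
    by rewrite lee_fin mulr_ge0 ?k0// mulr_ge0 ?exprn_ge0 ?mean_ge0// ltW.
  - move=> u; rewrite /= in_itv/= => uh.
    by apply: cvg_EFin; [exact: nearW|exact: profile_cvg].
apply: (@le_trans _ _ ((d%:R%:E * v%:E * (s `^ q / (d%:R * v))%:E) `^ q^-1)%E).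
  apply: poweR_le; first by rewrite invr_ge0 ltW.
    rewrite mule_ge0//; first by rewrite mule_ge0// lee_fin// ltW.
    by apply: integral_ge0 => u; rewrite /= in_itv/= => /andP[u0 _];
      rewrite lee_fin mulr_ge0 ?exprn_ge0 ?powR_ge0// ltW.
  by apply: lee_wpmul2l => //; rewrite -EFinM lee_fin ltW.
rewrite -!EFinM/= lee_fin mulrC mulfVK ?gt_eqF// -powRrM mulfV ?gt_eqF// powRr1//.
Qed.

End LowerBound.

(** * The truncated operator *)

Section UpperBound.
Context {R : realType} (d : nat) (hd : (1 < d)%N) (K C : set 'rV[R]_d).
Context (hK : convex_body K) (hC : open_fg_cone C).
Local Notation V := 'rV[R]_d.
Local Notation N := (gauge_norm K).
Local Notation mu := (@lebesgue_measure R).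
Local Notation vol := (@vol R d).
Local Notation Bor := (Bor R d).
Local Notation R1 := (measurableTypeR R).
Context (m0 : (0 < vol (K `&` C))%E).
Context (w wB : R -> R) (Zw : set R) (mwB : measurable_fun setT (wB : R1 -> R)).
Context (wB0 : forall r, 0 <= wB r).
Context (mZw : measurable (Zw : set R1)) (Zw0 : mu Zw = 0%E).
Context (wBE : forall r, 0 < r -> ~ Zw r -> wB r = w r).
Context (tfin : forall u, 0 < u -> tail d wB u \is a fin_num).
Context (h : R) (h0 : 0 < h) (p : \bar R) (q : R) (pq : conjugate p q) (q1 : 1 <= q).
Context (Nn : R) (hN : ((2 * d%:R)%:E * vol (K `&` C) * tail d wB h = Nn%:E)%E).

Let hd0 : (0 < d)%N. Proof. exact: ltnW. Qed.
Let q0 : 0 < q. Proof. exact: lt_le_trans q1. Qed.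
Local Notation E := (C `\` dilate h K).

(** Polar coordinates; the averaged weight of the weight cut at [h] vanishes
    beyond [h]. *)
Lemma ker_norm_mean : (ker_norm K C q (cut h wB) =
  (d%:R%:E * vol (K `&` C) *
   \int[mu]_(u in `]0%R, h[) (u ^+ d.-1 * mean d wB h u `^ q)%:E) `^ q^-1)%E.
Proof.
rewrite /ker_norm; congr (_ `^ _)%E.
pose F (r : R) : \bar R :=
  ((((Num.max 0 r ^+ d.-1) `^ (- 1)) * fine (tail d (cut h wB) r)) `^ q)%:E.
have mF : measurable_fun setT (F : R1 -> \bar R).
  apply/measurable_EFinP; apply: (measurableT_comp (measurable_powR _)).
  apply: measurable_funM; last first.
    by apply: measurableT_comp => //; exact: measurable_tail_cut.
  by apply: (measurableT_comp (measurable_powR _)); exact: measurable_maxX.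
have F0 r : (0 <= F r)%E by rewrite lee_fin powR_ge0.
transitivity (\int[vol]_(t in C) F (N t))%E.
  apply: eq_integral => t _; rewrite /F /ker max_r ?gauge_ge0//.
  by rewrite powR_inv1// exprn_ge0// gauge_ge0.
rewrite (radial hd0 hK hC mF F0); congr (_ * _)%E.
rewrite integral_mkcond [RHS]integral_mkcond; apply: eq_integral => u _; rewrite !patchE.
case: ifPn => [/set_mem|/negP un].
  rewrite /= in_itv/= andbT => u0; rewrite /F max_r ?(ltW u0)//.
  rewrite powR_inv1 ?exprn_ge0 ?(ltW u0)// -/(mean d wB h u).
  case: ifPn => [_|/negP hu]; first by rewrite mulrC EFinM.
  rewrite /mean tail_cut_ge/= ?mulr0 ?powR0 ?gt_eqF ?mul0e//.
  by rewrite leNgt; apply/negP => uh; apply: hu; rewrite inE/= in_itv/= u0.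
rewrite memNset// /= in_itv/= => /andP[u0 _]; apply: un.
by rewrite inE/= in_itv/= u0.
Qed.

Lemma measurable_truncation : measurable (E : set Bor).
Proof.
rewrite (_ : E = C `&` [set t | `[h, +oo[%classic (N t)]); last first.
  by apply/seteqP; split => t /= [Ct]; rewrite (dilate_gauge hK _ h0) in_itv/= andbT leNgt => /negP.
apply: measurableI; first exact: measurable_cone.
by rewrite -[X in measurable X]setTI; apply: (measurable_gauge hK).
Qed.

(** The norm of the truncated operator is at most twice this mass: the choice
    of [h] makes it at most N. *)
Lemma truncation_mass : (\int[vol]_t (\1_E t * wB (N t))%:E = (Nn / 2)%:E)%E.
Proof.
pose F (r : R) : \bar R := (wB r * \1_(`[h, +oo[ : set R1) r)%:E.
have mF : measurable_fun setT (F : R1 -> \bar R).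
  by apply/measurable_EFinP; apply: measurable_funM => //; exact: measurable_indic.
have F0 r : (0 <= F r)%E by rewrite lee_fin mulr_ge0// indicE.
transitivity (\int[vol]_(t in C) F (N t))%E.
  rewrite [RHS]integral_mkcond; apply: eq_integral => t _; rewrite patchE /F !indicE.
  have [Ct|nC] := pselect (C t); last by rewrite !memNset ?mul0r// => -[].
  rewrite (mem_set Ct); congr (_%:E); rewrite mulrC; congr (_ * (nat_of_bool _)%:R).
  apply/idP/idP; rewrite !inE/= in_itv/= andbT leNgt.
    by move=> [_ /(dilate_gauge hK _ h0)/negP].
  by move=> /negP hh; split => // /(dilate_gauge hK _ h0).
rewrite (radial hd0 hK hC mF F0).
rewrite (_ : \int[mu]_(r in `]0%R, +oo[) _ = tail d wB h)%E.
  have [v vE] : exists v, vol (K `&` C) = v%:E.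
    by exists (fine (vol (K `&` C))); rewrite fineK// leb_body_cone_fin.
  have [t tE] : exists t, tail d wB h = t%:E by exists (fine (tail d wB h)); rewrite fineK// tfin.
  have e : 2 * d%:R * v * t = Nn by apply: EFin_inj; rewrite -hN vE tE.
  rewrite vE tE; transitivity (d%:R * v * t)%:E; first by [].
  by congr (_%:E); rewrite -e; field.
have mH : measurable_fun setT ((fun r => (wB r * Num.max 0 r ^+ d.-1)%:E) : R1 -> \bar R).
  by apply/measurable_EFinP; apply: measurable_funM => //; exact: measurable_maxX.
rewrite /tail (integral_itv_obnd_cbnd (measurable_funS measurableT (@subsetT _ _) mH)).
rewrite integral_mkcond [RHS]integral_mkcond; apply: eq_integral => r _; rewrite !patchE /F indicE.
have [hr|hr] := boolP (r \in `[h, +oo[%classic).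
  move: hr; rewrite inE/= in_itv/= andbT => hr; have r0 := lt_le_trans h0 hr.
  by rewrite mem_set/= ?in_itv/= ?r0// mulr1 max_r ?(ltW r0)// EFinM.
by rewrite mulr0 mul0e if_same.
Qed.

Lemma truncation_approximant : approximants C Nn (D_Kwh K C w h).
Proof.
have := trunc_op_approximant hd hK hC m0 mwB wB0 mZw Zw0 wBE measurable_truncation
  (@subDsetl _ _ _) truncation_mass.
by rewrite mulrC mulfVK.
Qed.

(** What the truncation removes is the integral over the dilate of the body,
    which [class_increment_le] bounds for the weight cut at [h]. The truncated
    integral is absolutely convergent; the removed one is known to be so only
    if the bound is finite. *)
Lemma truncation_error (f : V -> R) (x : V) : WK K p C f -> C x ->
  (`|D_Kw K C w f x - D_Kwh K C w h f x|%:E <= ker_norm K C q (cut h wB))%E.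
Proof.
move=> fW Cx; have [[fL cf _] _] := fW; have mC := measurable_cone hC.
have [f1 [Zf [mf1 f1c mZf Zf0 f1E]]] := Linfty_version hC m0 fL.
set c := fine _ in f1c.
have [mF mG eG] := operator_version hd hK hC mwB mZw Zw0 wBE measurable_truncation
  (@subDsetl _ _ _) mf1 mZf Zf0 f1E Cx.
have [_ mH eH] := operator_version hd hK hC mwB mZw Zw0 wBE mC (@subset_refl _ _) mf1 mZf Zf0 f1E Cx.
pose G (t : V) := \1_E t * (wB (N t) * (f x - f1 (x + t))).
pose H (t : V) := \1_C t * (cut h wB (N t) * (f x - f1 (x + t))).
have GH t : \1_C t * (wB (N t) * (f x - f1 (x + t))) = G t + H t.
  rewrite /G /H !indicE; have [Ct|nC] := pselect (C t); last first.
    by rewrite !memNset ?mul0r ?addr0// => -[].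
  rewrite (mem_set Ct) !mul1r; have [Nh|Nh] := ltP (N t) h.
    by rewrite memNset ?mul0r ?add0r ?cut_lt// => -[_]; apply; apply/(dilate_gauge hK _ h0).
  rewrite mem_set ?mul1r ?cut_ge ?mul0r ?addr0//; split => //.
  by move=> /(dilate_gauge hK _ h0); rewrite ltNge Nh.
have mHH : measurable_fun setT (H : Bor -> R).
  rewrite (_ : H = fun t => \1_C t * (wB (N t) * (f x - f1 (x + t))) - G t).
    exact: measurable_funB.
  by apply/funext => t; rewrite GH addrC addKr.
have oC := cone_open hC.
have mfB : measurable_fun (C : set Bor) (f : Bor -> R) by exact: open_continuous_Bor.
have absH : (\int[vol]_t `|(H t)%:E| <= ker_norm K C q (cut h wB))%E.
  have := class_increment_le hd hK hC m0 pq q0 fW Cx (measurable_cut mwB h) (cut_ge0 wB0 h)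
    (fun u u0 => tail_cut_fin h mwB wB0 tfin u0).
  apply: le_trans; rewrite [leRHS]integral_mkcond.
  pose f2 : V -> R := f \_ C.
  have mf2 : measurable_fun setT (f2 : Bor -> R) by exact: ((measurable_restrictT _ mC).1 mfB).
  pose H2 (t : V) := \1_C t * (cut h wB (N t) * (f x - f2 (x + t))).
  have mH2 : measurable_fun setT (H2 : Bor -> R).
    apply: measurable_funM; first exact: measurable_indic.
    apply: measurable_funM; first exact: measurableT_comp (measurable_cut mwB h) (measurable_gauge hK).
    apply: measurable_funB => //.
    rewrite (_ : (fun t => _) = (fun t : Bor => f2 ((t : V) + x))).
      exact: measurableT_comp mf2 (measurable_shift x).
    by apply/funext => t; rewrite addrC.
  rewrite (_ : patch _ _ _ = fun t => `|(H2 t)%:E|%E); last first.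
    apply/funext => t; rewrite patchE /H2 indicE; case: ifPn => [/set_mem Ct|_]; last by rewrite mul0r abse0.
    rewrite mul1r abse_EFin normrM (ger0_norm (cut_ge0 wB0 _ _)) /f2 patchE mem_set//.
    exact: (cone_add hC).
  rewrite (ge0_ae_eq_integral measurableT (f := fun t : Bor => `|(H t)%:E|%E)
     (g := fun t : Bor => `|(H2 t)%:E|%E))//.
  - by apply: measurableT_comp => //; exact/measurable_EFinP.
  - by apply: measurableT_comp => //; exact/measurable_EFinP.
  have mT := measurable_translate x mZf.
  exists [set t | Zf (t + x)]; split => //; first exact: vol_translate.
  move=> t ht; apply: contrapT => nZ; apply: ht => _.
  rewrite /H /H2 !indicE; have [Ct|nC] := pselect (C t); last by rewrite memNset// !mul0r.
  have Cxt : C (x + t) by exact: (cone_add hC).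
  rewrite /f2 patchE (mem_set Cxt) f1E// => ?; apply: nZ; by rewrite /= addrC.
case: ltgtP (leey (ker_norm K C q (cut h wB))) => [kf _|//|kf _]; last by rewrite kf leey.
have iH : vol.-integrable setT (fun t => (H t)%:E).
  by apply/integrableP; split; [exact/measurable_EFinP|exact: le_lt_trans absH kf].
have iG : vol.-integrable setT (fun t => (G t)%:E).
  have i1 := average_integrable (measurable_trunc hK mwB measurable_truncation)
    (trunc_ge0 K wB0 E) truncation_mass x mf1 f1c.
  have ik := kernel_integrable (measurable_trunc hK mwB measurable_truncation)
    (trunc_ge0 K wB0 E) truncation_mass.
  have i3 : vol.-integrable setT (fun t => ((f x)%:E * (trunc K wB E t)%:E)%E) by exact: integrableZl.
  rewrite (_ : (fun t => _) = (fun t => ((f x)%:E * (trunc K wB E t)%:E - (trunc K wB E t * f1 (x + t)%R)%:E)%E)).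
    exact: integrableB.
  by apply/funext => t; rewrite -EFinM -EFinB /trunc /G; congr (_%:E); ring.
have -> : D_Kw K C w f x - D_Kwh K C w h f x = \int[vol]_t H t.
  have -> : D_Kw K C w f x = \int[vol]_t G t + \int[vol]_t H t.
    rewrite /D_Kw /Rintegral eH -fineD ?(integrable_fin_num measurableT)//.
    rewrite -(integralD measurableT iG iH); congr (fine _); apply: eq_integral => t _.
    by rewrite GH EFinD.
  by rewrite /D_Kwh /Rintegral eG addrC addKr.
rewrite -abse_EFin /Rintegral fineK ?(integrable_fin_num measurableT)//.
apply: le_trans (le_abse_integral vol measurableT _) absH.
exact/measurable_EFinP.
Qed.

Lemma deviation_truncation :
  (deviation C (D_Kw K C w) (D_Kwh K C w h) (WK K p C) <= ker_norm K C q (cut h wB))%E.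
Proof.
apply: ge_ereal_sup => _ [f fW <-].
have k0 : (0 <= ker_norm K C q (cut h wB))%E by exact: poweR_ge0.
have := truncation_error fW.
case: (ker_norm _ _ _ _) k0 => [s|_ _|//]; last by rewrite leey.
rewrite lee_fin => s0 hs; apply/(Linfty_normP m0) => //.
by apply: aeW => x Cx; rewrite -lee_fin; exact: hs.
Qed.

End UpperBound.

(** * The best approximation *)

Lemma conjugate_exponent (R : realType) (d : nat) (p : \bar R) (q : R) : (0 < d)%N ->
  (d%:R%:E < p)%E -> (p^-1 + q%:E^-1 = 1)%E -> conjugate p q /\ 1 <= q.
Proof.
move=> d0; have d1 : 1 <= d%:R :> R by rewrite ler1n.
case: p => [r||]; rewrite ?lte_fin// => hr.
  have r1 : 1 < r by exact: le_lt_trans hr.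
  have r0 : 0 < r by exact: lt_trans r1.
  have ri : r^-1 < 1 by rewrite invf_lt1.
  rewrite inver gt_eqF// inver; case: ifPn => q0; first by rewrite addey.
  rewrite -EFinD => -[e].
  have qi : 0 < q^-1 by lra.
  have q00 : 0 < q by rewrite -invr_gt0.
  split => //; rewrite -(invrK q) -[leLHS]invr1 lef_pV2 ?posrE// ?invr_gt0//.
  have : 0 < r^-1 by rewrite invr_gt0.
  lra.
rewrite invey add0e inver; case: ifPn => q0; first by [].
by move=> -[e]; have -> : q = 1 by rewrite -(invrK q) e invr1.
Qed.

Theorem theorem1 (R : realType) (d : nat) (p : \bar R) (q : R)
    (C K : set 'rV[R]_d) (w : R -> R) (N h : R)
    (hd : (2 <= d)%N) (hp : (d%:R%:E < p)%E) (hpq : (p^-1 + q%:E^-1 = 1)%E)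
    (hC : open_fg_cone C) (hw : forall t, 0 < t -> 0 <= w t)
    (hK : convex_body K)
    (hKw : (polytope K /\ Wq d q 1 w) \/ Wq_star d q 1 w)
    (hw1 : weight_space d 1 `]1, +oo[ w)
    (hN0 : 0 < N) (hN : (N%:E < op_norm C (Linfp p C) (D_Kw K C w))%E)
    (hh0 : 0 < h)
    (hh : ((2 * d%:R)%:E * leb (K `&` C) *
           \int[completed_lebesgue_measure]_(t in `]h, +oo[)
             (w t * t ^+ d.-1)%:E = N%:E)%E) :
  E_N C N (D_Kw K C w) (WK K p C) =
    ((d%:R%:E * leb (K `&` C)) `^ q^-1 * weight_norm d q `]0%R, h[ (g_wh d w h))%E
  /\ approximants C N (D_Kwh K C w h)
  /\ deviation C (D_Kw K C w) (D_Kwh K C w h) (WK K p C) =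
     E_N C N (D_Kw K C w) (WK K p C).
Proof.
have hd0 : (0 < d)%N by exact: ltnW.
have [pq q1] := conjugate_exponent hd0 hp hpq.
have m0 : (0 < vol (K `&` C))%E.
  rewrite lt0e measure_ge0 andbT; apply/eqP => v0; move: hh.
  by rewrite -volE v0 mule0 mul0e => -[N0]; move: hN0; rewrite -N0 ltxx.
have hKw' : Wq d q 1 w \/ Wq_star d q 1 w by case: hKw => [[_]|]; [left|right].
have [wB [Z [bw tfin moment]]] := weight_data hd0 q1 hw hKw' hw1.
have [mwB wB0 mZ Z0 wE] := bw.
have wBE r : 0 < r -> ~ Z r -> wB r = w r by move=> r0; apply: wE; rewrite /= in_itv/= r0.
have hN' : ((2 * d%:R)%:E * vol (K `&` C) * tail d wB h = N%:E)%E.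
  rewrite -hh volE; congr (_ * _)%E.
  have r0 r : `]h, +oo[%classic r -> 0 < r by rewrite /= in_itv/= andbT; exact: lt_trans.
  apply/esym; apply: (ge0_integral_leb1_mod (F := fun t => w t * t ^+ d.-1) (measurable_itv _) mZ Z0).
  - apply: measurable_funM; first exact: measurable_funS mwB.
    by apply: measurable_funS (measurable_maxX d.-1).
  - by move=> r /r0 rp nZ; rewrite wBE// max_r// ltW.
  - by move=> r /r0 rp; rewrite mulr_ge0 ?hw// exprn_ge0// ltW.
  - by move=> r _; rewrite mulr_ge0// maxX_ge0.
have wn : ((d%:R%:E * leb (K `&` C)) `^ q^-1 * weight_norm d q `]0%R, h[ (g_wh d w h) =
    (d%:R%:E * vol (K `&` C) * \int[lebesgue_measure]_(u in `]0%R, h[)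
       (u ^+ d.-1 * mean d wB h u `^ q)%:E) `^ q^-1)%E.
  have bwh : borel_weight `]0, h[ w wB Z.
    by apply: borel_weightS bw => r /=; rewrite !in_itv/= andbT => /andP[].
  rewrite (weight_norm_meanE d bwh) => [|r /andP[r0 _]]; last exact: hw.
  rewrite -volE; apply/esym; apply: poweRM; first by rewrite mule_ge0// lee_fin.
  by apply: integral_ge0 => u; rewrite /= in_itv/= => /andP[u0 _];
    rewrite lee_fin mulr_ge0 ?exprn_ge0 ?powR_ge0// ltW.
have hA : approximants C N (D_Kwh K C w h).
  exact: (truncation_approximant hd hK hC m0 mwB wB0 mZ Z0 wBE tfin hh0 hN').
have up := deviation_truncation hd hK hC m0 mwB wB0 mZ Z0 wBE tfin hh0 pq q1 hN'.
rewrite (ker_norm_mean hd hK hC mwB wB0 h q1) -wn in up.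
have lo S : approximants C N S -> ((d%:R%:E * leb (K `&` C)) `^ q^-1 *
    weight_norm d q `]0%R, h[ (g_wh d w h) <= deviation C (D_Kw K C w) S (WK K p C))%E.
  move=> hS; rewrite wn.
  exact: (deviation_lower_bound hd hK hC m0 mwB wB0 mZ Z0 wBE tfin moment hh0 pq q1 (ltW hN0) hN' hS).
have EN : E_N C N (D_Kw K C w) (WK K p C) =
    ((d%:R%:E * leb (K `&` C)) `^ q^-1 * weight_norm d q `]0%R, h[ (g_wh d w h))%E.
  apply/eqP; rewrite eq_le; apply/andP; split.
    by apply: le_trans up; apply: ereal_inf_lbound; exists (D_Kwh K C w h).
  by apply: le_ereal_inf_tmp => _ [S hS <-]; exact: lo.
split => //; split => //; rewrite EN.
by apply/eqP; rewrite eq_le up lo.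
Qed.
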